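(* Let $(M,g,J)$ be a Hermitian manifold of real dimension $2n$ with $\mathcal V$-spinor bundle $\mathcal VM=\mathcal S^{\downarrow}M\otimes\mathcal S^{\uparrow}M$, endowed with its Hermitian metric $\check h$ and covariant derivative $D^{\mathcal C}$. Then: (i) The bundle $\mathcal VM$ is a Chern-Dirac bundle with respect to both operations $\cdot_L$ and $\cdot_R$. (ii) There exists an isometry $\varsigma:\Lambda^{\bullet}(T^{*\mathbb C}M)\to\mathcal VM$ such that $D^{\mathcal C}_X\circ\varsigma=\varsigma\circ D^{\mathcal C}_X$ for every vector field $X$ on $M$.
   Context: **Hermitian manifolds.** $(M,g,J)$ is a Hermitian manifold of real dimension $2n$ ($J$ integrable, $g$ a $J$-invariant Riemannian metric), $\omega=g(J\cdot,\cdot)$; $g$ is extended complex bilinearly to $T^{\mathbb C}M=T^{10}M\oplus T^{01}M$. $D^{\mathcal C}$ is the Chern connection: the unique connection with $D^{\mathcal C}g=0$, $D^{\mathcal C}J=0$ whose torsion $T(X,Y)=D^{\mathcal C}_XY-D^{\mathcal C}_YX-[X,Y]$ satisfies $T(JX,Y)=T(X,JY)$; it acts on complex forms in the standard way. $U_{g,J}(M)$ is the principal $\mathrm U_n$-bundle of unitary frames, i.e. $g$-orthonormal frames $(e_1,\dots,e_{2n})$ with $Je_{2j-1}=e_{2j}$. $\Lambda^\bullet(T^{*\mathbb C}M)$ has the Hermitian metric induced by $g$. **Clifford conventions and Chern-Dirac bundles.** $\mathcal C\ell^{\mathbb C}M$ is the bundle of complex Clifford algebras of $(TM,g)$ with $v\cdot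 w+w\cdot v=-2g(v,w)$, endowed with the covariant derivative induced by $D^{\mathcal C}$. Covectors are identified with vectors through $g$, and exterior forms with Clifford elements through $v\cdot w=v\wedge w-v\lrcorner w$ ($v$ a vector, $w$ a form). A Chern-Dirac bundle over $(M,g,J)$ is a complex vector bundle $E\to M$ with a Hermitian metric $h$, a covariant derivative $D$ preserving $h$, and a structure of complex left $\mathcal C\ell^{\mathbb C}M$-module $c:\mathcal C\ell^{\mathbb C}M\to\mathfrak{gl}(E)$ such that $h(c(v)\sigma_1,\sigma_2)+h(\sigma_1,c(\bar v)\sigma_2)=0$ for all $v\in T^{\mathbb C}M$, $\sigma_1,\sigma_2\in E$ (over the same point), and $D_X(c(w)\sigma)=c(D^{\mathcal C}_Xw)\sigma+c(w)D_X\sigma$ for all vector fields $X$ and sections $w$ of $\mathcal C\ell^{\mathbb C}M$, $\sigma$ of $E$. **Spinor bundles.** $\mathcal S_{2n}$ is the complex spin module of dimension $2^n$; $\mathrm{Spin}^{\mathbb C}_{2n}=\mathrm{Spin}_{2n}\times_{\mathbb Z_2}S^1$ acts on it by $\kappa_{2n}([g,z])=z\,\kappa_{2n}(g)$, where $\kappa_{2n}(g)$ is the spin representation. Let $F_\pm:\mathrm U_n\to\mathrm{Spin}^{\mathbb C}_{2n}$ be the unique homomorphic lifts of $A\mapsto(A,\det(A)^{\pm1})\in\mathrm{SO}_{2n}\times S^1$ along the double covering $[g,z]\mapsto(\tau_{2n}(g),z^2)$, with $\tau_{2n}:\mathrm{Spin}_{2n}\to\mathrm{SO}_{2n}$ the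 standard covering. The canonical and anticanonical spinor bundles are $\mathcal S^{\uparrow}M=U_{g,J}(M)\times_{\kappa_{2n}\circ F_+}\mathcal S_{2n}$ and $\mathcal S^{\downarrow}M=U_{g,J}(M)\times_{\kappa_{2n}\circ F_-}\mathcal S_{2n}$, with fibrewise Clifford multiplication and the covariant derivatives, both denoted $D^{\mathcal C}$, induced by the Chern connection on $U_{g,J}(M)$. For $\mathcal S=\mathcal S^{\uparrow}$ or $\mathcal S^{\downarrow}$, $\mathcal S^kM$ ($0\le k\le n$) is the subbundle on which Clifford multiplication by $\omega$ equals $(2k-n)i$. The line bundles $\mathcal S^{\uparrow0}M$ and $\mathcal S^{\downarrow n}M$ are trivial. One fixes nowhere vanishing global sections $\psi^o$ of $\mathcal S^{\uparrow0}M$ and $\varphi^o$ of $\mathcal S^{\downarrow n}M$, and Hermitian metrics $h^{\uparrow}$, $h^{\downarrow}$ on $\mathcal S^{\uparrow}M$, $\mathcal S^{\downarrow}M$ which are invariant under Clifford multiplication by (unit) tangent vectors and satisfy $h^{\uparrow}(\psi^o,\psi^o)=1=h^{\downarrow}(\varphi^o,\varphi^o)$. **$\mathcal V$-spinors.** $\mathcal VM=\mathcal S^{\downarrow}M\otimes\mathcal S^{\uparrow}M$, with Hermitian metric $\check h=h^{\downarrow}\otimes h^{\uparrow}$, the tensor product covariant derivative $D^{\mathcal C}$ and the bigradation $\mathcal V^{p,q}M=\mathcal S^{\downarrow\,n-p}M\otimes\mathcal S^{\uparrow\,q}M$, $0\le p,q\le n$. The operations $\cdot_L,\cdot_R:\mathcal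 C\ell^{\mathbb C}M\otimes\mathcal VM\to\mathcal VM$ are the unique $\mathbb C$-linear ones such that, for every $w\in\mathcal C\ell^{\mathbb C}_xM$ and every homogeneous decomposable $\varphi\otimes\psi\in\mathcal V^{p,q}_xM$, $x\in M$, $$w\cdot_L(\varphi\otimes\psi)=(w\cdot\varphi)\otimes\psi,\qquad w\cdot_R(\varphi\otimes\psi)=(-1)^p\,\varphi\otimes(w\cdot\psi).$$
   Formalization: The sections ψ^o and φ^o are assumed parallel (otherwise D^C need not preserve the metric), and the sign (-1)^p in w·_R applies only to the odd part of w (otherwise 1 would act as -1 on V^{1,q} and ·_R would not be a module structure). *)

(* Defs.v *)
From HB Require Import structures.
From mathcomp Require Import all_boot all_order all_algebra.
From mathcomp Require Import all_classical all_reals all_analysis.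
From mathcomp Require Import complex.
Set Implicit Arguments.
Unset Strict Implicit.
Unset Printing Implicit Defensive.
Import Order.TTheory GRing.Theory Num.Theory numFieldNormedType.Exports.
Local Open Scope classical_set_scope.
Local Open Scope ring_scope.
Local Open Scope complex_scope.

(******************************************************************************)
(* Smooth manifolds                                                           *)
(******************************************************************************)

Fixpoint Ck (R : realType) (V W : normedModType R) (U : set V) (k : nat)
    (f : V -> W) : Prop :=
  match k with
  | 0 => forall x, U x -> {for x, continuous f}
  | k'.+1 => (forall x, U x -> differentiable f x) /\
             (forall v, Ck U k' (fun x => 'D_v f x))
  end.

Definition smooth_on (R : realType) (V W : normedModType R) (U : set V)
  (f : V -> W) : Prop := forall k, Ck U k f.

Record chart (R : realType) (m : nat) (M : Type) := Chart {
  cdom : set M;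
  cmap : M -> 'rV[R]_m;
  cinv : 'rV[R]_m -> M }.

Record is_chart (R : realType) (m : nat) (M : topologicalType)
    (c : chart R m M) : Prop := {
  cdom_open : open (cdom c);
  cimg_open : open (cmap c @` cdom c);
  cmapK : forall x, cdom c x -> cinv c (cmap c x) = x;
  cmap_cont : forall x, cdom c x -> {for x, continuous (cmap c)};
  cinv_cont : forall p, (cmap c @` cdom c) p -> {for p, continuous (cinv c)} }.

Record manifold (R : realType) (m : nat) := Manifold {
  msort :> topologicalType;
  atlas : set (chart R m msort);
  chart_at : msort -> chart R m msort;
  atlas_chart : forall c, atlas c -> is_chart c;
  chart_at_atlas : forall x, atlas (chart_at x);
  chart_at_dom : forall x, cdom (chart_at x) x;
  transition_smooth : forall c c', atlas c -> atlas c' ->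
    smooth_on (cmap c @` (cdom c `&` cdom c')) (cmap c' \o cinv c);
  manifold_hausdorff : hausdorff_space msort;
  manifold_second_countable : @second_countable msort }.

(* f is smooth on a neighbourhood of x. *)
Definition smooth_at (R : realType) (m : nat) (M : manifold R m)
    (W : normedModType R) (x : M) (f : M -> W) : Prop :=
  let c := chart_at x in
  exists U : set 'rV[R]_m, [/\ open U, U (cmap c x), U `<=` cmap c @` cdom c &
    smooth_on U (f \o cinv c)].

(* A tangent vector at x is a coherent family of coordinate vectors, one for  *)
(* each chart of the atlas around x.                                          *)
Section Tangent.
Context {R : realType} {m : nat} (M : manifold R m).

Definition tangent_axiom (x : M) (v : chart R m M -> 'rV[R]_m) : Prop :=
  (forall c c', atlas c -> atlas c' -> cdom c x -> cdom c' x ->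
     v c' = 'd (cmap c' \o cinv c) (cmap c x) (v c)) /\
  (forall c, ~ (atlas c /\ cdom c x) -> v c = 0).

Definition tangent_pred (x : M) : {pred chart R m M -> 'rV[R]_m} :=
  fun v => `[< tangent_axiom x v >].

Lemma tangent_submod (x : M) : submod_closed (tangent_pred x).
Proof.
split=> [|a u v /asboolP[u1 u2] /asboolP[v1 v2]]; apply/asboolP; split=> //.
- by move=> c c' _ _ _ _; rewrite [RHS]linear0.
- by move=> c c' h1 h2 h3 h4; rewrite [RHS]linearP -u1// -v1.
- by move=> c h; change (a *: u c + v c = 0); rewrite u2// v2// scaler0 addr0.
Qed.

HB.instance Definition _ (x : M) :=
  GRing.isSubmodClosed.Build R (chart R m M -> 'rV[R]_m) (tangent_pred x)
    (tangent_submod x).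

Record tangent (x : M) := Tangent {
  coords :> chart R m M -> 'rV[R]_m;
  coordsP : coords \in tangent_pred x }.

HB.instance Definition _ (x : M) := [isSub for @coords x].
HB.instance Definition _ (x : M) := [Choice of tangent x by <:].
HB.instance Definition _ (x : M) :=
  [SubChoice_isSubLmodule of tangent x by <:].

Definition vfield := forall x : M, tangent x.

End Tangent.

(******************************************************************************)
(* Derivatives of functions along tangent vectors, vector fields              *)
(******************************************************************************)
Section Calculus.
Context {R : realType} {m : nat} (M : manifold R m).
Implicit Types (x : M) (X Y : vfield M).

Definition csmooth_at x (f : M -> R[i]) : Prop :=
  smooth_at x (fun y => complex.Re (f y)) /\
  smooth_at x (fun y => complex.Im (f y)).

(* Only used for finite-dimensional V, where it amounts to the smoothness of  *)
(* the coordinates of f.                                                      *)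
Definition vsmooth_at (V : lmodType R[i]) x (f : M -> V) : Prop :=
  forall l : {scalar V}, csmooth_at x (fun y => l (f y)).

Definition der x (v : tangent x) (f : M -> R) : R :=
  let c := chart_at x in 'd (f \o cinv c) (cmap c x) (v c).

Definition cder x (v : tangent x) (f : M -> R[i]) : R[i] :=
  der v (fun y => complex.Re (f y)) +i* der v (fun y => complex.Im (f y)).

Definition vf_smooth_at x X : Prop :=
  smooth_at x (fun y => X y (chart_at x)).

(* Lie bracket: the only tangent vector with the given action on functions.   *)
Definition lie X Y x : tangent x :=
  xget 0 [set Z : tangent x | forall f : M -> R, smooth_at x f ->
    der Z f = der (X x) (fun y => der (Y y) f)
              - der (Y x) (fun y => der (X y) f)].

End Calculus.

(******************************************************************************)
(* Hermitian manifolds and the Chern connection                               *)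
(******************************************************************************)

Record hermitian_structure (R : realType) (n : nat) (M : manifold R n.*2) :=
    HermitianStructure {
  metric : forall x : M, tangent x -> tangent x -> R;
  cplx : forall x : M, tangent x -> tangent x;
  metricC : forall x (u v : tangent x), metric u v = metric v u;
  metricPl : forall x a (u v w : tangent x),
    metric (a *: u + v) w = a * metric u w + metric v w;
  metric_gt0 : forall x (v : tangent x), v != 0 -> 0 < metric v v;
  metric_smooth : forall x (X Y : vfield M),
    vf_smooth_at x X -> vf_smooth_at x Y ->
    smooth_at x (fun y => metric (X y) (Y y));
  cplxP : forall x a (u v : tangent x),
    cplx (a *: u + v) = a *: cplx u + cplx v;
  cplxK : forall x (v : tangent x), cplx (cplx v) = - v;
  cplx_smooth : forall x (X : vfield M),
    vf_smooth_at x X -> vf_smooth_at x (fun y => cplx (X y));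
  cplx_metric : forall x (u v : tangent x),
    metric (cplx u) (cplx v) = metric u v;
  (* integrability: the Nijenhuis tensor vanishes *)
  cplx_integrable : forall x (X Y : vfield M),
    vf_smooth_at x X -> vf_smooth_at x Y ->
    let JX y := cplx (X y) in
    let JY y := cplx (Y y) in
    lie JX JY x - cplx (lie JX Y x) - cplx (lie X JY x) - lie X Y x = 0 }.

Section Chern.
Context {R : realType} {n : nat} {M : manifold R n.*2}.
Context (H : hermitian_structure M).
Implicit Types (x : M) (X Y Z : vfield M).

(* Covariant derivatives are taken as operators on germs of sections: D v Y   *)
(* is defined for v tangent at x and Y smooth near x, and depends only on the *)
(* germ of Y at x. Values at non-smooth sections are unconstrained.           *)
Definition conn := forall x, tangent x -> vfield M -> tangent x.

Record is_connection (D : conn) : Prop := {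
  conn_linear : forall x a (u v : tangent x) Y, vf_smooth_at x Y ->
    D x (a *: u + v) Y = a *: D x u Y + D x v Y;
  connD : forall x (v : tangent x) Y Z, vf_smooth_at x Y -> vf_smooth_at x Z ->
    D x v (fun y => Y y + Z y) = D x v Y + D x v Z;
  conn_leibniz : forall x (v : tangent x) (f : M -> R) Y,
    smooth_at x f -> vf_smooth_at x Y ->
    D x v (fun y => f y *: Y y) = der v f *: Y x + f x *: D x v Y;
  conn_local : forall x (v : tangent x) Y Z,
    vf_smooth_at x Y -> vf_smooth_at x Z ->
    (\forall y \near x, Y y = Z y) -> D x v Y = D x v Z;
  conn_smooth : forall x X Y, vf_smooth_at x X -> vf_smooth_at x Y ->
    vf_smooth_at x (fun y => D y (X y) Y) }.

Definition torsion (D : conn) X Y x : tangent x :=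
  D x (X x) Y - D x (Y x) X - lie X Y x.

Record is_chern (D : conn) : Prop := {
  chern_connection : is_connection D;
  chern_metric : forall x (v : tangent x) Y Z,
    vf_smooth_at x Y -> vf_smooth_at x Z ->
    der v (fun y => metric H (Y y) (Z y)) =
      metric H (D x v Y) (Z x) + metric H (Y x) (D x v Z);
  chern_cplx : forall x (v : tangent x) Y, vf_smooth_at x Y ->
    D x v (fun y => cplx H (Y y)) = cplx H (D x v Y);
  chern_torsion : forall x X Y, vf_smooth_at x X -> vf_smooth_at x Y ->
    torsion D (fun y => cplx H (X y)) Y x =
    torsion D X (fun y => cplx H (Y y)) x }.

End Chern.

(******************************************************************************)
(* Complex vector bundles                                                     *)
(******************************************************************************)

(* sec_smooth x s means that the section s is smooth on a neighbourhood of x; *)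
(* that the fibres form a smooth vector bundle is is_vbundle below.           *)
Record bundle (R : realType) (m : nat) (M : manifold R m) := Bundle {
  fib :> M -> lmodType R[i];
  sec_smooth : forall x : M, (forall y, fib y) -> Prop }.

Section Bundles.
Context {R : realType} {m : nat} {M : manifold R m} (E : bundle M).
Implicit Types (x : M) (s t : forall y, E y).

(* Around each point there is a local frame in terms of which the smooth      *)
(* sections are the combinations with smooth coefficients.                    *)
Definition is_vbundle : Prop :=
  exists r : nat, forall x, exists b : 'I_r -> forall y, E y,
    \forall y \near x,
      (forall e : E y, exists! c : {ffun 'I_r -> R[i]},
         e = \sum_i c i *: b i y) /\
      (forall s, sec_smooth y s <->
         exists c : 'I_r -> M -> R[i],
           (forall i, csmooth_at y (c i)) /\
           (\forall z \near y, s z = \sum_i c i z *: b i z)).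

(* Hermitian metrics are linear in the first argument. *)
Record is_hmetric (h : forall x, E x -> E x -> R[i]) : Prop := {
  hmetricPl : forall x a (u v w : E x),
    h x (a *: u + v) w = a * h x u w + h x v w;
  hmetricC : forall x (u v : E x), h x u v = (h x v u)^*;
  hmetric_gt0 : forall x (u : E x), u != 0 -> 0 < h x u u;
  hmetric_smooth : forall x s t, sec_smooth x s -> sec_smooth x t ->
    csmooth_at x (fun y => h y (s y) (t y)) }.

Definition cov := forall x, tangent x -> (forall y, E y) -> E x.

Record is_cov (D : cov) : Prop := {
  cov_linear : forall x a (u v : tangent x) s, sec_smooth x s ->
    D x (a *: u + v) s = a%:C *: D x u s + D x v s;
  covD : forall x (v : tangent x) s t, sec_smooth x s -> sec_smooth x t ->
    D x v (fun y => s y + t y) = D x v s + D x v t;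
  cov_leibniz : forall x (v : tangent x) (f : M -> R[i]) s,
    csmooth_at x f -> sec_smooth x s ->
    D x v (fun y => f y *: s y) = cder v f *: s x + f x *: D x v s;
  cov_local : forall x (v : tangent x) s t, sec_smooth x s -> sec_smooth x t ->
    (\forall y \near x, s y = t y) -> D x v s = D x v t;
  cov_smooth : forall x (X : vfield M) s, vf_smooth_at x X -> sec_smooth x s ->
    sec_smooth x (fun y => D y (X y) s) }.

Definition preserves (D : cov) (h : forall x, E x -> E x -> R[i]) : Prop :=
  forall x (v : tangent x) s t, sec_smooth x s -> sec_smooth x t ->
    cder v (fun y => h y (s y) (t y)) =
      h x (D x v s) (t x) + h x (s x) (D x v t).

End Bundles.

(******************************************************************************)
(* Complex differential forms                                                 *)
(******************************************************************************)

(* A complex exterior form at x (of mixed degree) is a function on finite     *)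
(* lists of tangent vectors; its restriction to lists of length k, which is   *)
(* multilinear and alternating, is its component of degree k (zero when k     *)
(* exceeds the dimension).                                                    *)
Section Forms.
Context {R : realType} {m : nat} {M : manifold R m}.
Implicit Types (x : M).

Definition form_axiom x (al : seq (tangent x) -> R[i]) : Prop :=
  (forall (l1 l2 : seq (tangent x)) a u v,
     al (l1 ++ (a *: u + v) :: l2) =
       a%:C * al (l1 ++ u :: l2) + al (l1 ++ v :: l2)) /\
  (forall (l1 l2 l3 : seq (tangent x)) u, al (l1 ++ u :: l2 ++ u :: l3) = 0).

Definition form_pred x : {pred seq (tangent x) -> R[i]} :=
  fun al => `[< form_axiom al >].

Lemma form_submod x :
  @submod_closed R[i] (seq (tangent x) -> R[i]^o) (form_pred (x := x)).
Proof.
split=> [|c al be /asboolP[a1 a2] /asboolP[b1 b2]]; apply/asboolP; split.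
- by move=> *; rewrite /= mulr0 addr0.
- by [].
- move=> l1 l2 a u v.
  change (c * al (l1 ++ (a *: u + v) :: l2) + be (l1 ++ (a *: u + v) :: l2) =
    a%:C * (c * al (l1 ++ u :: l2) + be (l1 ++ u :: l2)) +
    (c * al (l1 ++ v :: l2) + be (l1 ++ v :: l2))).
  by rewrite a1 b1 !mulrDr addrACA mulrCA.
- move=> l1 l2 l3 u.
  change (c * al (l1 ++ u :: l2 ++ u :: l3) + be (l1 ++ u :: l2 ++ u :: l3) = 0).
  by rewrite a2 b2 mulr0 addr0.
Qed.

HB.instance Definition _ x :=
  GRing.isSubmodClosed.Build R[i] (seq (tangent x) -> R[i]^o)
    (form_pred (x := x)) (form_submod x).

Record extform x := ExtForm {
  form_fun :> seq (tangent x) -> R[i]^o;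
  formP : form_fun \in form_pred (x := x) }.

HB.instance Definition _ x := [isSub for @form_fun x].
HB.instance Definition _ x := [Choice of extform x by <:].
HB.instance Definition _ x := [SubChoice_isSubLmodule of extform x by <:].

Definition at_pt (x : M) (Us : seq (vfield M)) : seq (tangent x) :=
  [seq U x | U <- Us].

Definition all_smooth_at x (Us : seq (vfield M)) : Prop :=
  forall i, (i < size Us)%N -> vf_smooth_at x (nth (fun=> 0) Us i).

Definition extformB : bundle M := Bundle
  (fib := fun x => extform x : lmodType R[i])
  (fun x al => forall Us, all_smooth_at x Us ->
     csmooth_at x (fun y => al y (at_pt y Us))).

Definition form_cov (D : forall x, tangent x -> vfield M -> tangent x)
    : cov extformB :=
  fun x v al => xget (0 : extform x) [set be : extform x |
    forall Us, all_smooth_at x Us ->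
      be (at_pt x Us) = cder v (fun y => al y (at_pt y Us))
        - \sum_(i < size Us)
            al x (set_nth 0 (at_pt x Us) i (D x v (nth (fun=> 0) Us i)))].

End Forms.
Arguments extformB {R m} M.

(******************************************************************************)
(* Complex Clifford algebras, spin groups and spin modules                    *)
(******************************************************************************)

Definition dotv (R : realType) (N : nat) (v w : 'rV[R]_N) : R :=
  (v *m w^T) 0 0.

Definition clifford_map (R : realType) (N : nat) (A : algType R[i])
    (f : 'rV[R]_N -> A) : Prop :=
  (forall a u v, f (a *: u + v) = a%:C *: f u + f v) /\
  (forall v w, f v * f w + f w * f v = (- (2 * dotv v w))%:C%:A).

(* The complex Clifford algebra of euclidean R^N, by its universal property.  *)
Record clifford (R : realType) (N : nat) := Clifford {
  cl_alg :> algType R[i];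
  cl_vec : 'rV[R]_N -> cl_alg;
  cl_vecP : clifford_map cl_vec;
  cl_univ : forall (A : algType R[i]) (f : 'rV[R]_N -> A), clifford_map f ->
    exists F : {lrmorphism cl_alg -> A}, (forall v, F (cl_vec v) = f v) /\
      forall F' : {lrmorphism cl_alg -> A},
        (forall v, F' (cl_vec v) = f v) -> F' =1 F }.

Section Spin.
Context {R : realType} {n : nat} (Cl : clifford R n.*2).

(* For orthogonal Q, the algebra automorphism of Cl extending v |-> Q v       *)
(* (row vectors).                                                             *)
Definition cl_lift (Q : 'M[R]_n.*2) : {lrmorphism Cl -> Cl} :=
  match pselect (exists F : {lrmorphism Cl -> Cl},
                   forall v, F (cl_vec Cl v) = cl_vec Cl (v *m Q^T)) with
  | left exF => sval (cid exF)
  | right _ => idfun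
  end.

(* Parity of Clifford elements: b = true for odd ones. *)
Definition cl_parity (b : bool) (w : Cl) : Prop :=
  cl_lift (- 1%:M) w = (-1) ^+ b *: w.

Definition spin (g : Cl) : Prop :=
  exists s : seq 'rV[R]_n.*2, [/\ ~~ odd (size s),
    (forall i, (i < size s)%N -> dotv s`_i s`_i = 1) &
    g = \prod_(v <- s) cl_vec Cl v].

(* The covering Spin -> SO, g v g^-1 = Q v. *)
Definition spin_covers (g : Cl) (Q : 'M[R]_n.*2) : Prop :=
  forall v, g * cl_vec Cl v = cl_vec Cl (v *m Q^T) * g.

Lemma half_ord_subproof (a : 'I_n.*2) : (a./2 < n)%N.
Proof. by rewrite ltn_half_double. Qed.

Definition half_ord (a : 'I_n.*2) : 'I_n := Ordinal (half_ord_subproof a).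

(* U_n in SO_2n: with 0-based indices, the j-th complex coordinate direction  *)
(* and its product by the imaginary unit are the real basis vectors of index  *)
(* 2j and 2j+1.                                                               *)
Definition realify (A : 'M[R[i]]_n) : 'M[R]_n.*2 :=
  \matrix_(a, b)
    let z := A (half_ord a) (half_ord b) in
    match odd a, odd b with
    | false, false | true, true => complex.Re z
    | true, false => complex.Im z
    | false, true => - complex.Im z
    end.

(* Elements of Spin^C are represented by pairs (g, z), up to simultaneous     *)
(* change of sign. The boolean selects between F_+ (true) and F_- (false).    *)
Definition is_spinc_lift (b : bool) (F : 'M[R[i]]_n -> Cl * R[i]) : Prop :=
  (forall A, A \is unitarymx ->
     [/\ spin (F A).1, `|(F A).2| = 1, spin_covers (F A).1 (realify A) &
         (F A).2 ^+ 2 = if b then \det A else (\det A)^-1]) /\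
  (forall A B, A \is unitarymx -> B \is unitarymx ->
     let g := (F A).1 * (F B).1 in
     let z := (F A).2 * (F B).2 in
     F (A *m B) = (g, z) \/ F (A *m B) = (- g, - z)).

(* The spin module is C^(2^n) with a structure of Cl-module: such a structure *)
(* is unique up to isomorphism.                                               *)
Definition spin_module := {lrmorphism Cl -> 'M[R[i]]_(2 ^ n)}.

End Spin.

(******************************************************************************)
(* Vector bundles associated with the unitary frame bundle                    *)
(******************************************************************************)

Record urep (R : realType) (n : nat) := URep {
  uspace : lmodType R[i];
  uact : 'M[R[i]]_n -> {linear uspace -> uspace} }.

Section Associated.
Context {R : realType} {n : nat} {M : manifold R n.*2}.
Context (H : hermitian_structure M).
Implicit Types (x : M) (V : urep R n).

Definition frame x := 'I_n.*2 -> tangent x.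

Definition uframe x (e : frame x) : Prop :=
  (forall a b, metric H (e a) (e b) = (a == b)%:R) /\
  (forall a b : 'I_n.*2, ~~ odd a -> b = a.+1 :> nat -> cplx H (e a) = e b).

Definition frame_act x (e : frame x) (A : 'M[R[i]]_n) : frame x :=
  fun b => \sum_a realify A a b *: e a.

(* The fibre at x of the bundle associated with V: the class [e, t] is        *)
(* represented by the equivariant function on the unitary frames at x with    *)
(* value t at e, extended by 0 to the other frames.                           *)
Definition assoc_axiom V x (s : frame x -> uspace V) : Prop :=
  (forall e, ~ uframe e -> s e = 0) /\
  (forall e A, uframe e -> A \is unitarymx ->
     uact V A (s (frame_act e A)) = s e).

Definition assoc_pred V x : {pred frame x -> uspace V} :=
  fun s => `[< assoc_axiom s >].

Lemma assoc_submod V x : submod_closed (@assoc_pred V x).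
Proof.
split=> [|c s t /asboolP[s1 s2] /asboolP[t1 t2]]; apply/asboolP; split.
- by [].
- by move=> e A _ _; rewrite /= linear0.
- move=> e he; change (c *: s e + t e = 0).
  by rewrite s1// t1// scaler0 addr0.
- move=> e A he hA.
  change (uact V A (c *: s (frame_act e A) + t (frame_act e A)) =
    c *: s e + t e).
  by rewrite linearP s2// t2.
Qed.

HB.instance Definition _ V x :=
  GRing.isSubmodClosed.Build R[i] (frame x -> uspace V)
    (@assoc_pred V x) (assoc_submod V x).

Record assoc V x := Assoc {
  assoc_fun :> frame x -> uspace V;
  assocP : assoc_fun \in @assoc_pred V x }.

HB.instance Definition _ V x := [isSub for @assoc_fun V x].
HB.instance Definition _ V x := [Choice of assoc V x by <:].
HB.instance Definition _ V x := [SubChoice_isSubLmodule of assoc V x by <:].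

(* The element of the fibre with values s at the unitary frames (0 if s is    *)
(* not equivariant, which never happens below).                               *)
Definition mk_assoc V x (s : frame x -> uspace V) : assoc V x :=
  insubd (0 : assoc V x) (fun e => if `[< uframe e >] then s e else 0).

Definition local_frame := 'I_n.*2 -> vfield M.

Definition frame_at (e : local_frame) x : frame x := fun a => e a x.

Definition uframe_near x (e : local_frame) : Prop :=
  (forall a, vf_smooth_at x (e a)) /\ \forall y \near x, uframe (frame_at e y).

Definition assocB V : bundle M := Bundle
  (fib := fun x => assoc V x : lmodType R[i])
  (fun x s => forall e, uframe_near x e ->
     vsmooth_at x (fun y => s y (frame_at e y))).

(* Covariant derivative induced by the connection D on the frame bundle: the  *)
(* derivative of the equivariant function s along the horizontal lift of v.   *)
(* That lift at the frame e x is the image of v under the differential of any *)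
(* local section e of the frame bundle which is parallel at x.                *)
Definition assoc_cov (D : conn (M := M)) V : cov (assocB V) :=
  fun x v s => xget (0 : assoc V x) [set t : assoc V x |
    forall e, uframe_near x e -> (forall u a, D x u (e a) = 0) ->
    forall l : {scalar uspace V},
      l (t (frame_at e x)) = cder v (fun y => l (s y (frame_at e y)))].

End Associated.
Arguments assocB {R n M} H V.
Arguments assoc_cov {R n M} H D V.
Arguments mk_assoc {R n M} H V [x] s.

(******************************************************************************)
(* Clifford bundle and Chern-Dirac bundles                                    *)
(******************************************************************************)
Section ChernDirac.
Context {R : realType} {n : nat} {M : manifold R n.*2}.
Context (H : hermitian_structure M).
Context (D : conn (M := M)) (Cl : clifford R n.*2).
Implicit Types (x : M).

Definition cl_rep : urep R n := URep (fun A => cl_lift Cl (realify A)).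

Definition clB : bundle M := assocB H cl_rep.

Definition cl_one x : clB x := mk_assoc H cl_rep (fun _ : frame x => (1 : Cl)).

Definition cl_mul x (w w' : clB x) : clB x :=
  mk_assoc H cl_rep (fun e => (w e : Cl) * w' e).

Definition cl_tangent x (v : tangent x) : clB x :=
  mk_assoc H cl_rep (fun e => cl_vec Cl (\row_a metric H v (e a))).

(* e_a1 . ... . e_ak for A = {a1 < ... < ak} *)
Definition cl_blade (A : {set 'I_n.*2}) : Cl :=
  \prod_(a <- enum A) cl_vec Cl (delta_mx 0 a).

(* In an orthonormal frame the identification of forms with Clifford elements *)
(* sends e_a1 /\ ... /\ e_ak (a1 < ... < ak) to e_a1 . ... . e_ak.            *)
Definition cl_form x (al : seq (tangent x) -> R[i]) : clB x :=
  mk_assoc H cl_rep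
    (fun e => \sum_(A : {set 'I_n.*2}) al [seq e a | a <- enum A] *: cl_blade A).

Definition kahler_form x (l : seq (tangent x)) : R[i] :=
  if l is [:: u; v] then (metric H (cplx H u) v)%:C else 0.

Definition cl_bundle_parity x (b : bool) (w : clB x) : Prop :=
  forall e : frame x, uframe H e -> cl_parity b (w e : Cl).

Record is_chern_dirac (E : bundle M) (h : forall x, E x -> E x -> R[i])
    (DE : cov E) (c : forall x, clB x -> E x -> E x) : Prop := {
  cd_vbundle : is_vbundle E;
  cd_hmetric : is_hmetric h;
  cd_cov : is_cov DE;
  cd_preserves : preserves DE h;
  (* left module structure *)
  cd_linl : forall x a (w w' : clB x) (s : E x),
    c x (a *: w + w') s = a *: c x w s + c x w' s;
  cd_linr : forall x a (w : clB x) (s t : E x),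
    c x w (a *: s + t) = a *: c x w s + c x w t;
  cd_one : forall x (s : E x), c x (cl_one x) s = s;
  cd_mul : forall x (w w' : clB x) (s : E x),
    c x (cl_mul w w') s = c x w (c x w' s);
  cd_smooth : forall x (w : forall y, clB y) (s : forall y, E y),
    sec_smooth x w -> sec_smooth x s -> sec_smooth x (fun y => c y (w y) (s y));
  (* the complex tangent vector u + i u' and its conjugate u - i u' *)
  cd_skew : forall x (u u' : tangent x) (s t : E x),
    h x (c x (cl_tangent u + (0 +i* 1) *: cl_tangent u') s) t +
    h x s (c x (cl_tangent u - (0 +i* 1) *: cl_tangent u') t) = 0;
  cd_leibniz : forall x (v : tangent x) (w : forall y, clB y)
      (s : forall y, E y), sec_smooth x w -> sec_smooth x s ->
    DE x v (fun y => c y (w y) (s y)) =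
      c x (assoc_cov H D cl_rep x v w) (s x) + c x (w x) (DE x v s) }.

End ChernDirac.

(******************************************************************************)
(* Spinor bundles and V-spinors                                               *)
(******************************************************************************)
Section Spinors.
Context {R : realType} {n : nat} {M : manifold R n.*2}.
Context (H : hermitian_structure M).
Context (D : conn (M := M)) (Cl : clifford R n.*2) (kappa : spin_module Cl).
Implicit Types (x : M) (F : 'M[R[i]]_n -> Cl * R[i]).

Local Notation S := 'cV[R[i]]_(2 ^ n).

Definition spinc_mx F (A : 'M[R[i]]_n) : 'M[R[i]]_(2 ^ n) :=
  (F A).2 *: kappa (F A).1.

Definition spinor_rep F : urep R n :=
  URep (fun A => mulmx (spinc_mx F A) : {linear S -> S}).

Definition spinorB F : bundle M := assocB H (spinor_rep F).

Definition spinor_cov F : cov (spinorB F) := assoc_cov H D (spinor_rep F).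

Definition cl_spinor F x (w : clB H Cl x) (s : spinorB F x) : spinorB F x :=
  mk_assoc H (spinor_rep F) (fun e => kappa (w e) *m s e).

Definition spinor_grade F (k : nat) x (s : spinorB F x) : Prop :=
  cl_spinor (cl_form H Cl (kahler_form H (x := x))) s =
  (((2 * k)%:R - n%:R) * (0 +i* 1)) *: s.

(* A Hermitian metric invariant under unit tangent vectors, normalised on a   *)
(* nowhere vanishing section s0 of the trivial line bundle of degree k. The   *)
(* section s0 is parallel, as the constant sections of the trivial bundle     *)
(* are: normalising on f s0 instead would divide h by |f|^2, and the metric   *)
(* would no longer be preserved by the covariant derivative.                  *)
Record is_spinor_metric F (k : nat) (s0 : forall x, spinorB F x)
    (h : forall x, spinorB F x -> spinorB F x -> R[i]) : Prop := {
  s0_smooth : forall x, sec_smooth x s0;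
  s0_grade : forall x, spinor_grade k (s0 x);
  s0_neq0 : forall x, s0 x != 0;
  s0_parallel : forall x (v : tangent x), spinor_cov v s0 = 0;
  sm_hmetric : is_hmetric h;
  sm_invariant : forall x (v : tangent x) (s t : spinorB F x),
    metric H v v = 1 ->
    h x (cl_spinor (cl_tangent H Cl v) s) (cl_spinor (cl_tangent H Cl v) t) =
    h x s t;
  sm_norm : forall x, h x (s0 x) (s0 x) = 1 }.

(* VM: the tensor product of column vectors s, t is the matrix s t^T, and     *)
(* P (x) Q acts by T |-> P T Q^T.                                             *)
Context (Fp Fm : 'M[R[i]]_n -> Cl * R[i]).

Definition vspinor_act (A : 'M[R[i]]_n) :
    {linear 'M[R[i]]_(2 ^ n) -> 'M[R[i]]_(2 ^ n)} :=
  mulmxr (spinc_mx Fp A)^T \o mulmx (spinc_mx Fm A).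

Definition vspinor_rep : urep R n := URep vspinor_act.

Definition vspinorB : bundle M := assocB H vspinor_rep.

Definition vten x (s : spinorB Fm x) (t : spinorB Fp x) : vspinorB x :=
  mk_assoc H vspinor_rep (fun e => (s e : S) *m (t e : S)^T).

(* The operations below are the extensions of their values on decomposable    *)
(* elements: they are computed on arbitrary decompositions as sums of         *)
(* (homogeneous) decomposables.                                               *)

Definition vspinor_metric (hdn : forall x, spinorB Fm x -> spinorB Fm x -> R[i])
    (hup : forall x, spinorB Fp x -> spinorB Fp x -> R[i])
    x (t t' : vspinorB x) : R[i] :=
  xget 0 [set c : R[i] | forall r r'
    (f : 'I_r -> spinorB Fm x) (p : 'I_r -> spinorB Fp x)
    (f' : 'I_r' -> spinorB Fm x) (p' : 'I_r' -> spinorB Fp x),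
    t = \sum_i vten (f i) (p i) -> t' = \sum_j vten (f' j) (p' j) ->
    c = \sum_i \sum_j hdn x (f i) (f' j) * hup x (p i) (p' j)].

Definition vspinor_cov : cov vspinorB :=
  fun x v t => xget (0 : vspinorB x) [set u : vspinorB x | forall r
    (f : 'I_r -> forall y, spinorB Fm y) (p : 'I_r -> forall y, spinorB Fp y),
    (forall i, sec_smooth x (f i)) -> (forall i, sec_smooth x (p i)) ->
    (\forall y \near x, t y = \sum_i vten (f i y) (p i y)) ->
    u = \sum_i (vten (spinor_cov v (f i)) (p i x) +
                vten (f i x) (spinor_cov v (p i)))].

(* The bigradation: s (x) t is homogeneous of bidegree (p, q). *)
Definition vhom (p q : nat) x (s : spinorB Fm x) (t : spinorB Fp x) : Prop :=
  [/\ (p <= n)%N, (q <= n)%N, spinor_grade (n - p) s & spinor_grade q t].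

Definition opL x (w : clB H Cl x) (t : vspinorB x) : vspinorB x :=
  xget (0 : vspinorB x) [set u : vspinorB x | forall r (p q : 'I_r -> nat)
    (f : 'I_r -> spinorB Fm x) (g : 'I_r -> spinorB Fp x),
    (forall i, vhom (p i) (q i) (f i) (g i)) ->
    t = \sum_i vten (f i) (g i) ->
    u = \sum_i vten (cl_spinor w (f i)) (g i)].

(* The sign (-1)^p is applied to the odd part of w. In particular w ._R (s    *)
(* (x) t) = (-1)^p s (x) (w . t) for w odd, e.g. a tangent vector, and ._R is *)
(* the module structure that these operators generate; without restriction to *)
(* odd w the formula does not define a module structure (1 would act as -1 on *)
(* elements of odd degree p).                                                 *)
Definition opR x (w : clB H Cl x) (t : vspinorB x) : vspinorB x :=
  xget (0 : vspinorB x) [set u : vspinorB x |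
    forall (w0 w1 : clB H Cl x) r (p q : 'I_r -> nat)
    (f : 'I_r -> spinorB Fm x) (g : 'I_r -> spinorB Fp x),
    cl_bundle_parity false w0 -> cl_bundle_parity true w1 -> w = w0 + w1 ->
    (forall i, vhom (p i) (q i) (f i) (g i)) ->
    t = \sum_i vten (f i) (g i) ->
    u = \sum_i (vten (f i) (cl_spinor w0 (g i)) +
                (-1) ^+ p i *: vten (f i) (cl_spinor w1 (g i)))].

End Spinors.

(* The Hermitian metric on forms induced by g: the e^a1 /\ ... /\ e^ak        *)
(* (a1 < ... < ak) are orthonormal for each orthonormal frame e.              *)
Definition form_inner (R : realType) (n : nat) (M : manifold R n.*2) (x : M)
    (e : frame x) (al be : extform x) : R[i] :=
  \sum_(A : {set 'I_n.*2})
    al [seq e a | a <- enum A] * (be [seq e a | a <- enum A])^*.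

(* Main.v *)
Require Import Defs.
From HB Require Import structures.
From mathcomp Require Import all_boot all_order all_algebra.
From mathcomp Require Import all_classical all_reals all_analysis.
From mathcomp Require Import complex ring perm.
Set Implicit Arguments.
Unset Strict Implicit.
Unset Printing Implicit Defensive.
Import Order.TTheory GRing.Theory Num.Theory numFieldNormedType.Exports.
Local Open Scope classical_set_scope.
Local Open Scope ring_scope.
Local Open Scope complex_scope.

(* Choose a matrix T with kappa(v) T = T kappa(v)^T for all vectors v. The     *)
(* lifts F_- and F_+ are dual through T: rho_-(A) T rho_+(A)^T = T, at first  *)
(* up to a sign, which is multiplicative in A and hence trivial, as every     *)
(* unitary matrix is a square. So w |-> T kappa(w)^T identifies VM with the   *)
(* Clifford bundle, that is with the bundle of forms, compatibly with the     *)
(* covariant derivatives, which are all computed as derivatives of components *)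
(* in a unitary frame that is parallel at the given point.                    *)
(* The metric on VM is invariant under unit vectors acting on either factor,  *)
(* hence the images of the blades are orthogonal and have the same length.    *)
(* Thus it is the metric of forms times a positive function c, which has      *)
(* derivative zero because phi0 (x) psi0 is parallel of norm 1; dividing by   *)
(* the square root of c gives the isometry.                                   *)
(* The sign (-1)^p in ._R is the action on the first factor of the chirality  *)
(* element chi, whose square is 1, so that ._R is the operation               *)
(* t |-> t kappa(w0)^T + chi t kappa(w1)^T for the even and odd parts w0, w1. *)

(** * Smooth functions and derivations *)

(** Algebraically, everything rests on two isomorphisms. First, [kappa] identifies the Clifford
    algebra with all matrices of order 2^n ([kappa_invK], [kappaK]), so [w |-> T kappa(w)^T], with
    [T] from [charge_conjugation], identifies it with the tensor square of the spin module. Second,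
    antisymmetrisation identifies forms with Clifford elements. Both are equivariant under U_n: the
    first because the two lifts are dual through [T] ([spinc_mx_dual], [vspinor_act_charge]), the
    second by [quantization_equivariant]. Hence they pass to the associated bundles. Differentially,
    each point has a unitary frame that is parallel at that point ([parallel_uframe_exists]). In it
    the covariant derivatives of Clifford sections, spinors, V-spinors and forms are the derivatives
    of their components ([assoc_covE], [vspinor_covE], [form_cov_frame]). So an operation given by
    one constant bilinear formula in all unitary frames obeys the Leibniz rule
    ([chern_dirac_of_bilinear]), and a constant linear identification commutes with the derivatives.
    The lifts [Fp] and [Fm] are only given algebraically; their smoothness along families of unitary
    matrices is extracted from the nowhere vanishing smooth sections ([spinc_smooth], [spinc_der0]).
    For the metric, invariance under unit vectors forces the images of the blades to be orthogonal
    of equal length ([beta_blade], [vmetric_xi]), so only a positive function remains to be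
    normalised away, and its derivative vanishes ([cder_norm_factor]). Clifford multiplication by
    vectors is skew because a unit vector acts as an isometry of square -1. For [._R] the sign
    (-1)^p is harmless, since components of different degree are orthogonal
    ([spinor_grade_orthogonal]), and it comes from the involution [chirality], which makes [._R] a
    module structure ([right_opM]). *)

Section NearDiff.
Context {R : realType} {V W : normedModType R}.
Implicit Types (f g : V -> W) (x : V).

(** The first-order expansion of [f] at [x] is also one of [g], and an expansion determines the
    differential. Needed because functions read in different charts agree only near a point. *)
Lemma near_eq_is_diff f g x : {near x, f =1 g} -> differentiable f x ->
  differentiable g x /\ 'd g x = 'd f x :> (V -> W).
Proof.
move=> fg df.
have fgx : f x = g x by exact: nbhs_singleton fg.
have eg : g \o shift x = cst (g x) + 'd f x +o_ 0 id.
  apply/eqaddoP => e e0; have /eqaddoP/(_ e e0) := diff_locally df.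
  have : \forall y \near 0, f (y + x) = g (y + x).
    by move: fg; rewrite (near_shift 0 x); apply: filterS => y /=; rewrite subr0.
  by apply: filterS2 => y /= fgy; rewrite !fctE /= fgy fgx.
have dgE := diff_unique (diff_continuous df) eg.
split=> //; apply/diff_locallyP; rewrite dgE; split=> //.
exact: diff_continuous df.
Qed.

Lemma near_eq_differentiable f g x : {near x, f =1 g} ->
  differentiable f x -> differentiable g x.
Proof. by move=> fg /(near_eq_is_diff fg)[]. Qed.

Lemma near_eq_diff f g x : {near x, f =1 g} -> differentiable f x ->
  'd g x = 'd f x :> (V -> W).
Proof. by move=> fg /(near_eq_is_diff fg)[]. Qed.

Lemma near_eq_diffE f g x v : {near x, f =1 g} -> differentiable f x ->
  'd g x v = 'd f x v.
Proof. by move=> fg df; rewrite (near_eq_diff fg df). Qed.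

(** On an open set pointwise equality is equality near each point, hence passes to directional
    derivatives. This is how explicit formulas for derivatives enter the inductions on [k] below. *)
Lemma Ck_open_ext (U : set V) k f g : open U -> (forall x, U x -> f x = g x) ->
  Ck U k f -> Ck U k g.
Proof.
move=> oU; elim: k f g => [|k IH] f g fg.
  move=> cf x Ux; have fgn : {near x, f =1 g}.
    by apply: filterS fg _; exact: open_nbhs_nbhs.
  have := cf x Ux; rewrite /prop_for /continuous_at (fg x Ux) => cfx.
  by apply: cvg_trans cfx; apply: near_eq_cvg; apply: filterS fgn => y ->.
move=> [df Df]; have fgn x : U x -> {near x, f =1 g}.
  by move=> Ux; apply: filterS fg _; exact: open_nbhs_nbhs.
split=> [x Ux|v]; first exact: near_eq_differentiable (fgn x Ux) (df x Ux).
apply: IH (Df v) => x Ux; exact/near_eq_derive/fgn.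
Qed.

Lemma Ck_subset (U U' : set V) k f : U' `<=` U -> Ck U k f -> Ck U' k f.
Proof.
move=> sU; elim: k f => [|k IH] f; first by move=> cf x /sU; exact: cf.
by move=> [df Df]; split=> [x /sU|v]; [exact: df|exact: IH (Df v)].
Qed.

Lemma CkW (U : set V) k f : Ck U k.+1 f -> Ck U k f.
Proof.
elim: k f => [|k IH] f.
  by move=> [df _] x Ux; exact: differentiable_continuous (df x Ux).
by move=> [df Df]; split=> // v; exact: IH (Df v).
Qed.

Lemma Ck_cst (U : set V) k (a : W) : Ck U k (fun=> a).
Proof.
elim: k a => [|k IH] a; first by move=> x _; exact: cst_continuous.
split=> [x _|v]; first exact: differentiable_cst.
have -> : (fun x => 'D_v (fun=> a) x) = fun=> 0 :> W.
  by apply/funext => x; exact: derive_cst.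
exact: IH.
Qed.

Lemma CkD (U : set V) k f g : open U -> Ck U k f -> Ck U k g ->
  Ck U k (fun x => f x + g x).
Proof.
move=> oU; elim: k f g => [|k IH] f g.
  by move=> cf cg x Ux; exact: (continuousD (cf x Ux) (cg x Ux)).
move=> [df Df] [dg Dg]; split=> [x Ux|v].
  by exact: (differentiableD (df x Ux) (dg x Ux)).
apply: Ck_open_ext oU _ (IH _ _ (Df v) (Dg v)) => x Ux.
by rewrite -deriveD//; apply: diff_derivable; [exact: df|exact: dg].
Qed.

Lemma Ck_sum (U : set V) k (I : Type) (r : seq I) (P : pred I) (f : I -> V -> W) :
  open U -> (forall i, P i -> Ck U k (f i)) ->
  Ck U k (fun x => \sum_(i <- r | P i) f i x).
Proof.
move=> oU Cf; elim: r => [|i r IH].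
  by apply: Ck_open_ext oU _ (Ck_cst U k 0) => x _; rewrite big_nil.
case: (boolP (P i)) => Pi.
  by apply: Ck_open_ext oU _ (CkD oU (Cf i Pi) IH) => x _; rewrite big_cons Pi.
by apply: Ck_open_ext oU _ IH => x _; rewrite big_cons (negPf Pi).
Qed.

Lemma smooth_onP (U : set V) f : smooth_on U f <->
  (forall x, U x -> differentiable f x) /\
  forall v, smooth_on U (fun x => 'D_v f x).
Proof.
split=> [sf|[df Df] [|k]].
- split=> [x Ux|v k]; first by have [+ _] := sf 1%N; apply.
  by have [_] := sf k.+1; apply.
- by move=> x Ux; apply: differentiable_continuous; exact: df.
- by split=> // v; exact: Df.
Qed.

Lemma smooth_on_diff (U : set V) f x : smooth_on U f -> U x ->
  differentiable f x.
Proof. by move=> /smooth_onP[+ _]; apply. Qed.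

End NearDiff.

Lemma diff_compE (R : realType) (U V W : normedModType R) (f : U -> V)
    (g : V -> W) x u : differentiable f x -> differentiable g (f x) ->
  'd (g \o f) x u = 'd g (f x) ('d f x u).
Proof. by move=> df dg; rewrite diff_comp. Qed.

Section ScalarCk.
Context {R : realType} {V : normedModType R}.
Implicit Types (f g : V -> R) (U : set V).

Lemma CkM U k f g : open U -> Ck U k f -> Ck U k g ->
  Ck U k (fun x => f x * g x).
Proof.
move=> oU; elim: k f g => [|k IH] f g Cf Cg.
  by move=> x Ux; exact: (continuousM (Cf x Ux) (Cg x Ux)).
have [[df Df] [dg Dg]] := (Cf, Cg); split=> [x Ux|v].
  by exact: (differentiableM (df x Ux) (dg x Ux)).
have C := CkD oU (IH _ _ (CkW Cf) (Dg v)) (IH _ _ (CkW Cg) (Df v)).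
apply: Ck_open_ext oU _ C => x Ux.
by rewrite deriveM//; apply: diff_derivable; [exact: df|exact: dg].
Qed.

(** The derivative is a polynomial in the function itself and the derivative of [f], so that
    [Ck_invsqrt] closes by induction on [k]. The inverse square root serves to normalise vectors in
    Gram-Schmidt, to invert complex functions and to rescale the final isometry. *)
Lemma is_diff_invsqrt f x : differentiable f x -> 0 < f x ->
  differentiable (fun y => (Num.sqrt (f y))^-1) x /\ forall v,
  'D_v (fun y => (Num.sqrt (f y))^-1) x =
    - 2^-1 * ((Num.sqrt (f x))^-1 * ((Num.sqrt (f x))^-1 *
       ((Num.sqrt (f x))^-1 * 'D_v f x))).
Proof.
move=> df fx0.
have s0 : Num.sqrt (f x) != 0 by rewrite gt_eqF// sqrtr_gt0.
have ds : differentiable (@Num.sqrt R) (f x).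
  by apply/derivable1_diffP; have [] := is_derive1_sqrt fx0.
have dsf : differentiable (Num.sqrt \o f) x by exact: differentiable_comp.
have dV := differentiableV dsf s0.
split=> // v; rewrite deriveE// (diffV dsf s0) /= /GRing.scale_fun /=.
rewrite diff_comp//=.
rewrite deriv1E; last exact/derivable1_diffP.
rewrite /= derive1E derive_sqrt// deriveE//.
set s := Num.sqrt (f x); set t := 'd f x v.
have -> : s ^- 2 = s^-1 * s^-1 by rewrite expr2 invfM.
rewrite /GRing.scale /= invfM; set u := s^-1; ring.
Qed.

Lemma Ck_invsqrt U k f : open U -> (forall x, U x -> 0 < f x) -> Ck U k f ->
  Ck U k (fun x => (Num.sqrt (f x))^-1).
Proof.
move=> oU f0; elim: k => [|k IH] Cf.
  move=> x Ux; apply: continuousV; first by rewrite gt_eqF// sqrtr_gt0 f0.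
  by apply: continuous_comp (Cf x Ux) _; exact: sqrt_continuous.
have [df Df] := Cf; split=> [x Ux|v].
  by have [] := is_diff_invsqrt (df x Ux) (f0 x Ux).
have C := IH (CkW Cf).
have CC := CkM oU (Ck_cst U k (- 2^-1 : R))
   (CkM oU C (CkM oU C (CkM oU C (Df v)))).
apply: Ck_open_ext oU _ CC => x Ux.
by have [_ ->] := is_diff_invsqrt (df x Ux) (f0 x Ux).
Qed.

Context {m : nat}.
Implicit Type h : V -> 'rV[R]_m.

Lemma differentiable_rowP h x :
  (forall i, differentiable (fun y => h y 0 i) x) -> differentiable h x.
Proof.
move=> dh; have -> : h = \sum_i (fun y => h y 0 i *: (delta_mx 0 i : 'rV[R]_m)).
  by apply/funext => y; rewrite {1}[h y]row_sum_delta fct_sumE.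
by apply: differentiable_sum => i; apply: differentiableZl; exact: dh.
Qed.

Lemma differentiable_row h x i : differentiable h x ->
  differentiable (fun y => h y 0 i) x.
Proof.
move=> dh; apply: (differentiable_comp (g := fun N : 'rV[R]_m => N 0 i)) dh _.
exact: differentiable_coord.
Qed.

Lemma derive_row h x v i : differentiable h x ->
  'D_v h x 0 i = 'D_v (fun y => h y 0 i) x.
Proof. by move=> dh; rewrite derive_mx ?mxE//; exact: diff_derivable. Qed.

Lemma Ck_rowP U k h : open U -> (forall i, Ck U k (fun y => h y 0 i)) <-> Ck U k h.
Proof.
move=> oU; elim: k h => [|k IH] h.
  split=> Ch.
    apply: (@Ck_open_ext _ _ _ U 0 (fun y => \sum_i h y 0 i *: (delta_mx 0 i : 'rV[R]_m))) => //.
      by move=> x _; rewrite -row_sum_delta.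
    apply: Ck_sum => // i _ x Ux; exact: (continuousZr_tmp (Ch i x Ux)).
  move=> i x Ux.
  exact: (continuous_comp (Ch x Ux) (@coord_continuous _ _ _ 0 i _)).
split=> [Ch|[dh Dh] i].
  have dh x : U x -> differentiable h x.
    by move=> Ux; apply: differentiable_rowP => i; have [+ _] := Ch i; apply.
  split=> // v; apply/IH => i; have [_ /(_ v)] := Ch i.
  by apply: Ck_open_ext oU _ => x Ux; rewrite derive_row//; exact: dh.
split=> [x Ux|v]; first by apply: differentiable_row; exact: dh.
have /IH/(_ i) := Dh v; apply: Ck_open_ext oU _ => x Ux.
by rewrite derive_row//; exact: dh.
Qed.

End ScalarCk.

Section Composition.
Context {R : realType} {V : normedModType R} {p : nat}.

Lemma derive_comp_row (g : V -> 'rV[R]_p) (f : 'rV[R]_p -> R) x v :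
  differentiable g x -> differentiable f (g x) ->
  'D_v (f \o g) x = \sum_i 'D_v (fun y => g y 0 i) x * 'D_(delta_mx 0 i) f (g x).
Proof.
move=> dg df; rewrite deriveE; last exact: differentiable_comp.
rewrite diff_comp//= [X in 'd f _ X]row_sum_delta linear_sum.
by apply: eq_bigr => i _; rewrite linearZ /= -derive_row// !deriveE.
Qed.

(** In coordinates the derivative of the composite is a sum of products: a derivative of [g], one
    order less smooth by assumption, times a partial derivative of [f] composed with [g], covered by
    induction. *)
Lemma Ck_comp (U : set V) (U' : set 'rV[R]_p) k (g : V -> 'rV[R]_p)
    (f : 'rV[R]_p -> R) : open U -> (forall x, U x -> U' (g x)) ->
  Ck U k g -> Ck U' k f -> Ck U k (f \o g).
Proof.
move=> oU gU; elim: k f => [|k IH] f.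
  by move=> Cg Cf x Ux; exact: continuous_comp (Cg x Ux) (Cf _ (gU x Ux)).
move=> Cg Cf; have [[dg Dg] [df Df]] := (Cg, Cf); split=> [x Ux|v].
  by apply: differentiable_comp; [exact: dg|exact/df/gU].
have C : Ck U k (fun x => \sum_i 'D_v (fun y => g y 0 i) x *
    ('D_(delta_mx 0 i) f \o g) x).
  apply: Ck_sum => // i _; apply: CkM => //.
    by have /(Ck_rowP k.+1 g oU)/(_ i)[_] := Cg; apply.
  exact: IH (CkW Cg) (Df _).
apply: Ck_open_ext oU _ C => x Ux.
by rewrite derive_comp_row//; [exact: dg|exact/df/gU].
Qed.

Lemma smooth_on_coord (U : set 'rV[R]_p) i : open U ->
  smooth_on U (fun u : 'rV[R]_p => u 0 i).
Proof.
move=> oU; apply/smooth_onP; split=> [x _|v k]; first exact: differentiable_coord.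
apply: Ck_open_ext oU _ (Ck_cst U k (v 0 i)) => x _.
rewrite deriveE; last exact: differentiable_coord.
have [f cf fE] : exists2 f : {linear 'rV[R]_p -> R}, continuous f &
    (fun u : 'rV[R]_p => u 0 i) = f.
  have li : linear (fun u : 'rV[R]_p => u 0 i) by move=> a u w; rewrite !mxE.
  pose L := GRing.isLinear.Build _ _ _ _ _ li.
  pose f : {linear _ -> _} := HB.pack (fun u : 'rV[R]_p => u 0 i) L.
  by exists f => //; exact: coord_continuous.
by rewrite fE diff_lin// -fE.
Qed.

Lemma smooth_on_row (U : set V) (g : V -> 'rV[R]_p) : open U ->
  (forall i, smooth_on U (fun y => g y 0 i)) <-> smooth_on U g.
Proof.
move=> oU; split=> [sg k|sg i k]; first by apply/Ck_rowP => // i; exact: sg.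
by have /(Ck_rowP k g oU) := sg k; apply.
Qed.

End Composition.

(** * Smooth functions and vector fields in charts *)

Section Charts.
Context {R : realType} {m : nat} {M : manifold R m}.
Implicit Types (x y : M) (c : chart R m M).

Lemma chartK c y : atlas c -> cdom c y -> cinv c (cmap c y) = y.
Proof. by move=> ac; exact: (cmapK (atlas_chart ac)). Qed.

Lemma chart_nbhs c x (P : M -> Prop) : atlas c -> cdom c x ->
  (\forall y \near x, P y) <-> (\forall p \near cmap c x, P (cinv c p)).
Proof.
move=> /atlas_chart ac cx; split=> nP.
  have := cinv_cont ac (ex_intro2 _ _ x cx erefl).
  by rewrite /prop_for /continuous_at cmapK// => /(_ _ nP).
have nc : \forall y \near x, cdom c y.
  by apply: open_nbhs_nbhs; split=> //; exact: cdom_open ac.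
have nP' : \forall y \near x, P (cinv c (cmap c y)).
  by have := cmap_cont ac cx; rewrite /prop_for /continuous_at => /(_ _ nP).
near=> y; rewrite -(cmapK ac (x := y)); first by near: y.
by near: y.
Unshelve. all: by end_near. Qed.

Lemma near_cdom c x : atlas c -> cdom c x -> \forall y \near x, cdom c y.
Proof.
move=> /atlas_chart ac cx.
by apply: open_nbhs_nbhs; split=> //; exact: cdom_open ac.
Qed.

Lemma near_cmap c x (U : set 'rV[R]_m) : atlas c -> cdom c x -> open U ->
  U (cmap c x) -> \forall y \near x, U (cmap c y).
Proof.
move=> /atlas_chart ac cx oU Ux; have := cmap_cont ac cx.
by rewrite /prop_for /continuous_at; apply; exact: open_nbhs_nbhs.
Qed.

Lemma cmap_image c p : atlas c -> (cmap c @` cdom c) p ->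
  cdom c (cinv c p) /\ cmap c (cinv c p) = p.
Proof. by move=> /atlas_chart ac [y cy <-]; rewrite cmapK. Qed.

Lemma open_cmap c (A : set M) : atlas c -> open A -> open (cmap c @` (cdom c `&` A)).
Proof.
move=> ac oA; rewrite openE => _ [y [cy Ay] <-].
have nA : \forall z \near y, (cdom c `&` A) z.
  apply: filterI; first exact: near_cdom.
  exact: open_nbhs_nbhs.
have := (chart_nbhs (cdom c `&` A) ac cy).1 nA.
rewrite /interior; have : \forall p \near cmap c y, (cmap c @` cdom c) p.
  apply: open_nbhs_nbhs; split; first exact: (cimg_open (atlas_chart ac)).
  by exists y.
apply: filterS2 => p /(cmap_image ac)[cp pE] cAp.
by exists (cinv c p).
Qed.

(** [smooth_at] refers to [chart_at x], which varies with [x] without any continuity. Statements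
    about all points near [x] are therefore proved in one fixed chart [c] and translated back by
    [smooth_in_at]. *)
Definition smooth_in (W : normedModType R) c x (f : M -> W) : Prop :=
  exists U : set 'rV[R]_m, [/\ open U, U (cmap c x), U `<=` cmap c @` cdom c &
    smooth_on U (f \o cinv c)].

Definition transition c c' := cmap c' \o cinv c.

Lemma overlap_open c c' : atlas c -> atlas c' ->
  open (cmap c @` (cdom c `&` cdom c')).
Proof. by move=> ac /atlas_chart ac'; apply: open_cmap => //; exact: cdom_open. Qed.

(** On the common domain, [f] read in [c'] is [f] read in [c] after the transition map; [A]
    restricts this domain to where smoothness of [f] is known. *)
Lemma smooth_in_change c c' x (f : M -> R) : atlas c -> atlas c' ->
  cdom c x -> cdom c' x -> smooth_in c x f -> smooth_in c' x f.
Proof.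
move=> ac ac' cx cx' [U [oU Ux Uc sf]].
pose A := cdom c `&` cdom c' `&` (cmap c @^-1` U).
have oA : open (cdom c `&` A).
  rewrite openE => y [cy [[_ cy'] Uy]]; rewrite /interior.
  have n1 := near_cdom ac cy; have n2 := near_cdom ac' cy'.
  have n3 := near_cmap ac cy oU Uy.
  by near=> z; split; [|split; [split|]]; near: z.
exists (cmap c' @` (cdom c' `&` (cdom c `&` A))); split.
- exact: open_cmap.
- by exists x.
- by move=> _ [y [cy _] <-]; exists y.
move=> k; set U' := cmap c' @` _.
have oU' : open U' by exact: open_cmap.
have gU p : U' p -> U (transition c' c p).
  by move=> [y [cy [_ [_ Uy]]] <-]; rewrite /transition /= chartK.
have Cg : Ck U' k (transition c' c).
  apply: Ck_subset (transition_smooth ac' ac k) => _ [y [cy [cy' _]] <-].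
  by exists y.
apply: Ck_open_ext oU' _ (Ck_comp oU' gU Cg (sf k)) => p [y [cy [cy' _]] <-].
by rewrite /transition /= !chartK.
Unshelve. all: by end_near. Qed.

Lemma chart_atP x : atlas (chart_at x) /\ cdom (chart_at x) x.
Proof. by split; [exact: chart_at_atlas|exact: chart_at_dom]. Qed.

Lemma smooth_in_at c x (f : M -> R) : atlas c -> cdom c x ->
  smooth_in c x f <-> smooth_at x f.
Proof.
move=> ac cx; have [ax xx] := chart_atP x.
by split=> sf; [exact: smooth_in_change sf|exact: (smooth_in_change (c := chart_at x))].
Qed.

Lemma smooth_at_near x (f : M -> R) : smooth_at x f ->
  \forall y \near x, smooth_at y f.
Proof.
move=> [U [oU Ux Uc sf]]; have [ax xx] := chart_atP x.
have n1 := near_cdom ax xx; have n2 := near_cmap ax xx oU Ux.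
near=> y; apply/(smooth_in_at _ ax); first by near: y.
by exists U; split=> //; near: y.
Unshelve. all: by end_near. Qed.

Section Generic.
Context {W : normedModType R}.
Implicit Types f g : M -> W.

Lemma smooth_in_ext c x f g : atlas c -> cdom c x -> {near x, f =1 g} ->
  smooth_in c x f -> smooth_in c x g.
Proof.
move=> ac cx; rewrite {1}/prop_near1 nbhsE => -[A [oA Ax] fg] [U [oU Ux Uc sf]].
have oI : open (U `&` cmap c @` (cdom c `&` A)).
  by apply: openI => //; exact: open_cmap.
exists (U `&` cmap c @` (cdom c `&` A)); split=> //.
- by split=> //; exists x.
- by move=> p [Up _]; exact: Uc.
move=> k; apply: Ck_open_ext oI _ (Ck_subset _ (sf k)) => [p|p []//].
move=> [_ [y [cy Ay] <-]] /=; rewrite chartK//.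
exact: fg.
Qed.

Lemma smooth_at_ext x f g : {near x, f =1 g} -> smooth_at x f -> smooth_at x g.
Proof. by have [ax xx] := chart_atP x; exact: smooth_in_ext. Qed.

Lemma smooth_at_cst x (a : W) : smooth_at x (fun=> a).
Proof.
have [ax xx] := chart_atP x.
exists (cmap (chart_at x) @` cdom (chart_at x)); split=> //.
- exact: cimg_open (atlas_chart ax).
- by move=> k; exact: Ck_cst.
Qed.

Lemma smooth_at2 (W1 W2 W3 : normedModType R) x (f1 : M -> W1) (f2 : M -> W2)
    (g : M -> W3) :
  (forall U k, open U -> Ck U k (f1 \o cinv (chart_at x)) ->
    Ck U k (f2 \o cinv (chart_at x)) -> Ck U k (g \o cinv (chart_at x))) ->
  smooth_at x f1 -> smooth_at x f2 -> smooth_at x g.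
Proof.
move=> op [U [oU Ux Uc sf]] [U' [oU' Ux' Uc' sf']]; exists (U `&` U'); split=> //.
- exact: openI.
- by move=> p [Up _]; exact: Uc.
move=> k; apply: op; first exact: openI.
  by apply: Ck_subset (sf k) => p [].
by apply: Ck_subset (sf' k) => p [].
Qed.

Lemma smooth_atD x f g : smooth_at x f -> smooth_at x g ->
  smooth_at x (fun y => f y + g y).
Proof. by apply: smooth_at2 => U k oU Cf Cg; exact: (CkD oU Cf Cg). Qed.

Lemma smooth_at_sum x (I : Type) (r : seq I) (P : pred I) (f : I -> M -> W) :
  (forall i, P i -> smooth_at x (f i)) ->
  smooth_at x (fun y => \sum_(i <- r | P i) f i y).
Proof.
move=> sf; elim: r => [|i r IH].
  by apply: smooth_at_ext (smooth_at_cst x 0); apply: nearW => y; rewrite big_nil.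
case: (boolP (P i)) => Pi.
  apply: smooth_at_ext (smooth_atD (sf i Pi) IH).
  by apply: nearW => y; rewrite big_cons Pi.
by apply: smooth_at_ext IH; apply: nearW => y; rewrite big_cons (negPf Pi).
Qed.

End Generic.

Implicit Types f g : M -> R.

Lemma smooth_atM x f g : smooth_at x f -> smooth_at x g ->
  smooth_at x (fun y => f y * g y).
Proof. by apply: smooth_at2 => U k oU Cf Cg; exact: (CkM oU Cf Cg). Qed.

Lemma smooth_atN x f : smooth_at x f -> smooth_at x (fun y => - f y).
Proof.
move=> sf; apply: smooth_at_ext (smooth_atM (smooth_at_cst x (-1 : R)) sf).
by apply: nearW => y; rewrite mulN1r.
Qed.

Lemma smooth_atB x f g : smooth_at x f -> smooth_at x g ->
  smooth_at x (fun y => f y - g y).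
Proof. by move=> sf sg; apply: smooth_atD => //; exact: smooth_atN. Qed.

Lemma smooth_at_continuous x f : smooth_at x f -> {for x, continuous f}.
Proof.
move=> [U [oU Ux Uc sf]]; have [ax xx] := chart_atP x.
have cc : {for x, continuous (cmap (chart_at x))} by apply: (cmap_cont (atlas_chart ax)).
have cf := continuous_comp cc (differentiable_continuous (smooth_on_diff sf Ux)).
have fE : {near x, (f \o cinv (chart_at x)) \o cmap (chart_at x) =1 f}.
  by apply: filterS (near_cdom ax xx) => y cy /=; rewrite chartK.
rewrite /prop_for /continuous_at -(nbhs_singleton fE).
apply: cvg_trans cf; apply: near_eq_cvg.
by apply: filterS fE => y.
Qed.

Lemma smooth_at_gt0 x f : smooth_at x f -> 0 < f x -> \forall y \near x, 0 < f y.
Proof.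
move=> /smooth_at_continuous cf f0; apply: (cf [set z | 0 < z]).
by apply: open_nbhs_nbhs; split=> //; exact: open_gt.
Qed.

Lemma smooth_at_invsqrt x f : smooth_at x f -> 0 < f x ->
  smooth_at x (fun y => (Num.sqrt (f y))^-1).
Proof.
move=> [U [oU Ux Uc sf]] f0; have [ax xx] := chart_atP x.
have nf : \forall p \near cmap (chart_at x) x, 0 < f (cinv (chart_at x) p).
  apply/(chart_nbhs (fun y => 0 < f y) ax xx); apply: smooth_at_gt0 => //; by exists U.
move: nf; rewrite {1}/prop_near1 nbhsE => -[A [oA Ax] fA].
exists (U `&` A); split=> //; first exact: openI.
  by move=> p [Up _]; exact: Uc.
move=> k; apply: (@Ck_invsqrt _ _ _ _ (f \o cinv (chart_at x))).
- exact: openI.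
- by move=> p [_ /fA].
by apply: Ck_subset (sf k) => p [].
Qed.

Context {p : nat}.
Implicit Types h : M -> 'rV[R]_p.

Lemma smooth_at_row x h : smooth_at x h <-> forall i, smooth_at x (fun y => h y 0 i).
Proof.
split=> [[U [oU Ux Uc sf]] i|sh].
  by exists U; split=> //; exact: ((smooth_on_row (h \o cinv (chart_at x)) oU).2 sf i).
pose f i y := h y 0 i *: (delta_mx 0 i : 'rV[R]_p).
apply: (@smooth_at_ext _ _ (fun y => \sum_i f i y)).
  by apply: nearW => y; rewrite -row_sum_delta.
apply: smooth_at_sum => i _; have [U [oU Ux Uc sf]] := sh i.
exists U; split=> //; apply/(smooth_on_row _ oU) => j k.
apply: Ck_open_ext oU _ (CkM oU (sf k) (Ck_cst U k ((delta_mx 0 i : 'rV[R]_p) 0 j))).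
by move=> q _; rewrite /f /= !mxE.
Qed.

End Charts.

Section Derivation.
Context {R : realType} {m : nat} {M : manifold R m}.
Implicit Types (x y : M) (f g : M -> R).

Lemma smooth_at_diff x f : smooth_at x f ->
  differentiable (f \o cinv (chart_at x)) (cmap (chart_at x) x).
Proof. by move=> [U [oU Ux Uc sf]]; exact: smooth_on_diff sf Ux. Qed.

Lemma der_ext x (v : tangent x) f g : smooth_at x f -> {near x, f =1 g} ->
  der v f = der v g.
Proof.
move=> /smooth_at_diff sf fg; have [ax xx] := chart_atP x.
have fg' : {near cmap (chart_at x) x, f \o cinv (chart_at x) =1
    g \o cinv (chart_at x)} := (chart_nbhs (fun y => f y = g y) ax xx).1 fg.
exact: (congr1 (fun h : 'rV[R]_m -> R => h (v (chart_at x)))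
  (esym (near_eq_diff fg' sf))).
Qed.

Lemma der_cst x (v : tangent x) a : der v (fun=> a) = 0.
Proof. by rewrite /der (diff_cst (a : R)). Qed.

Lemma derD x (v : tangent x) f g : smooth_at x f -> smooth_at x g ->
  der v (fun y => f y + g y) = der v f + der v g.
Proof.
move=> /smooth_at_diff sf /smooth_at_diff sg.
exact: (congr1 (fun h : 'rV[R]_m -> R => h (v (chart_at x))) (diffD sf sg)).
Qed.

Lemma derM x (v : tangent x) f g : smooth_at x f -> smooth_at x g ->
  der v (fun y => f y * g y) = der v f * g x + f x * der v g.
Proof.
move=> /smooth_at_diff sf /smooth_at_diff sg.
have := congr1 (fun h : 'rV[R]_m -> R => h (v (chart_at x))) (diffM sf sg).
have [ax xx] := chart_atP x; move=> e; rewrite addrC [der v f * _]mulrC.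
move: e; rewrite /= (chartK ax xx); exact: id.
Qed.

Lemma derZ x (v : tangent x) a f : smooth_at x f ->
  der v (fun y => a * f y) = a * der v f.
Proof.
by move=> sf; rewrite derM// ?der_cst ?mul0r ?add0r//; exact: smooth_at_cst.
Qed.

Lemma derN x (v : tangent x) f : smooth_at x f ->
  der v (fun y => - f y) = - der v f.
Proof.
move=> /smooth_at_diff sf.
exact: (congr1 (fun h : 'rV[R]_m -> R => h (v (chart_at x))) (diffN sf)).
Qed.

Lemma derB x (v : tangent x) f g : smooth_at x f -> smooth_at x g ->
  der v (fun y => f y - g y) = der v f - der v g.
Proof. by move=> sf sg; rewrite derD ?derN//; exact: smooth_atN. Qed.

Lemma der_sum x (v : tangent x) (I : Type) (r : seq I) (P : pred I)
    (f : I -> M -> R) : (forall i, P i -> smooth_at x (f i)) ->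
  der v (fun y => \sum_(i <- r | P i) f i y) = \sum_(i <- r | P i) der v (f i).
Proof.
move=> sf; elim: r => [|i r IH].
  rewrite [RHS]big_nil -[RHS](der_cst v 0); congr (der v _).
  by apply/funext => y; rewrite big_nil.
rewrite big_cons; case: ifP => Pi; rewrite -IH.
  rewrite -derD; [|exact: sf|exact: smooth_at_sum].
  by congr (der v _); apply/funext => y; rewrite big_cons Pi.
by congr (der v _); apply/funext => y; rewrite big_cons Pi.
Qed.

Lemma der_linear x a (u v : tangent x) f :
  der (a *: u + v) f = a * der u f + der v f.
Proof. by rewrite /der [LHS](linearP ('d _ _)). Qed.

Lemma der_invsqrt0 x (v : tangent x) f : smooth_at x f -> 0 < f x ->
  der v f = 0 -> der v (fun y => (Num.sqrt (f y))^-1) = 0.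
Proof.
move=> /smooth_at_diff sf f0; have [ax xx] := chart_atP x; rewrite /der => df0.
have f0' : 0 < (f \o cinv (chart_at x)) (cmap (chart_at x) x).
  by rewrite /= chartK.
have [d1 dE] := is_diff_invsqrt sf f0'.
by rewrite -[LHS](deriveE _ d1) dE deriveE// df0 !mulr0.
Qed.

Lemma smooth_at_cmap x i : smooth_at x (fun y => cmap (chart_at x) y 0 i).
Proof.
have [ax xx] := chart_atP x; have oI := cimg_open (atlas_chart ax).
exists (cmap (chart_at x) @` cdom (chart_at x)); split=> //.
move=> k; apply: Ck_open_ext oI _ (smooth_on_coord i oI k) => p.
by move=> /(cmap_image ax)[_ /= ->].
Qed.

Lemma der_cmap x (v : tangent x) i :
  der v (fun y => cmap (chart_at x) y 0 i) = v (chart_at x) 0 i.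
Proof.
have [ax xx] := chart_atP x; rewrite /der.
set p := cmap (chart_at x) x.
have fE : {near p, (fun u : 'rV[R]_m => u 0 i) =1
    (fun y => cmap (chart_at x) y 0 i) \o cinv (chart_at x)}.
  have : \forall q \near p, (cmap (chart_at x) @` cdom (chart_at x)) q.
    apply: open_nbhs_nbhs; split; first exact: (cimg_open (atlas_chart ax)).
    by exists x.
  by apply: filterS => q /(cmap_image ax)[_ /= ->].
rewrite (near_eq_diff fE); last exact: differentiable_coord.
rewrite -deriveE; last exact: differentiable_coord.
rewrite -(derive_row (h := id))//.
by rewrite derive_id.
Qed.

End Derivation.

Section TangentCoordinates.
Context {R : realType} {m : nat} {M : manifold R m}.
Implicit Types (x y : M) (c : chart R m M).

Lemma coordsD x (u v : tangent x) c : (u + v) c = u c + v c.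
Proof. by []. Qed.

Lemma coordsZ x a (u : tangent x) c : (a *: u) c = a *: u c.
Proof. by []. Qed.

Lemma coords0 x c : (0 : tangent x) c = 0.
Proof. by []. Qed.

Lemma coords_sum x I (r : seq I) (P : pred I) (f : I -> tangent x) c :
  (\sum_(i <- r | P i) f i) c = \sum_(i <- r | P i) f i c.
Proof. exact: (big_morph (fun v : tangent x => v c) (fun u v => coordsD u v c) (coords0 x c)). Qed.

Lemma coords_change x (v : tangent x) c c' : atlas c -> atlas c' ->
  cdom c x -> cdom c' x ->
  v c' = 'd (transition c c') (cmap c x) (v c).
Proof. by move=> *; have /asboolP[+ _] := coordsP v; apply. Qed.

Lemma tangent_inj x c (u v : tangent x) : atlas c -> cdom c x ->
  u c = v c -> u = v.
Proof.
move=> ac cx uv; apply: val_inj; apply/funext => c' /=.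
have [[ac' cx']|nc'] := pselect (atlas c' /\ cdom c' x).
  by rewrite (coords_change u ac ac')// (coords_change v ac ac')// uv.
have /asboolP[_ /(_ _ nc') ->] := coordsP u.
by have /asboolP[_ /(_ _ nc') ->] := coordsP v.
Qed.

Lemma transitionE c c' x : atlas c -> cdom c x ->
  transition c c' (cmap c x) = cmap c' x.
Proof. by move=> ac cx; rewrite /transition /= (chartK ac cx). Qed.

Lemma transition_diff c c' x : atlas c -> atlas c' -> cdom c x -> cdom c' x ->
  differentiable (transition c c') (cmap c x).
Proof.
move=> ac ac' cx cx'; apply: (smooth_on_diff (transition_smooth ac ac')).
by exists x.
Qed.

(** A coordinate vector in one chart spreads to a coherent family over the atlas; coherence is the
    chain rule for transition maps. *)
Lemma tangent_subproof x c (u : 'rV[R]_m) : atlas c -> cdom c x ->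
  (fun c' => if `[< atlas c' /\ cdom c' x >]
     then 'd (transition c c') (cmap c x) u else 0) \in tangent_pred x.
Proof.
move=> ac cx; apply/asboolP; split=> [c1 c2 a1 a2 x1 x2|c1 nc1]; last first.
  by case: asboolP.
do 2 (case: asboolP => [_|[]//]).
have d1 := transition_diff ac a1 cx x1.
have d2 : differentiable (transition c1 c2) (transition c c1 (cmap c x)).
  by rewrite (transitionE _ ac cx); exact: transition_diff.
have e : {near cmap c x, transition c1 c2 \o transition c c1 =1 transition c c2}.
  apply/(chart_nbhs (fun y => transition c1 c2 (cmap c1 y) = cmap c2 y) ac cx).
  by apply: filterS (near_cdom a1 x1) => y cy; rewrite /transition /= chartK.
rewrite [LHS](near_eq_diffE u e); last exact: differentiable_comp.
rewrite [LHS](diff_compE u d1 d2) (transitionE _ ac cx).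
exact: erefl.
Qed.

(** The default 0 makes this total, so that [cfield] below is a vector field on the whole of [M],
    with constant coordinates on the domain of [c]. *)
Definition mk_tangent x c (u : 'rV[R]_m) : tangent x :=
  match pselect (atlas c /\ cdom c x) with
  | left h => Tangent (tangent_subproof u h.1 h.2)
  | right _ => 0
  end.

Lemma mk_tangentK x c u : atlas c -> cdom c x -> mk_tangent x c u c = u.
Proof.
move=> ac cx; rewrite /mk_tangent; case: pselect => [h|[]//] /=.
case: asboolP => [_|[]//].
have e : {near cmap c x, id =1 transition c c}.
  have : \forall p \near cmap c x, (cmap c @` cdom c) p.
    by apply: open_nbhs_nbhs; split; first exact: cimg_open (atlas_chart ac).
  by apply: filterS => p /(cmap_image ac)[_]; rewrite /transition /= => ->.
by rewrite [LHS](near_eq_diffE u e)// -deriveE// derive_id.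
Qed.

(** Coordinates change by the Jacobian of the transition map, whose entries are smooth functions of
    the point. *)
Lemma vf_smooth_change c c' x (X : vfield M) : atlas c -> atlas c' ->
  cdom c x -> cdom c' x ->
  smooth_at x (fun y => X y c) -> smooth_at x (fun y => X y c').
Proof.
move=> ac ac' cx cx' sX; apply/smooth_at_row => i.
have oU := overlap_open ac ac'; set U := cmap c @` _ in oU.
have sT : smooth_on U (fun p => transition c c' p 0 i).
  apply: (smooth_on_row (transition c c') oU).2.
  exact: transition_smooth.
have sD j : smooth_at x (fun y => 'D_(delta_mx 0 j)
    (fun p => transition c c' p 0 i) (cmap c y)).
  apply/(smooth_in_at _ ac cx); exists U; split=> //.
  - by exists x.
  - by move=> _ [y [cy _] <-]; exists y.
  have /smooth_onP[_ /(_ (delta_mx 0 j)) sD] := sT.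
  move=> k; apply: Ck_open_ext oU _ (sD k) => _ [y [cy _] <-] /=.
  by rewrite (chartK ac cy).
have E : {near x, (fun y => \sum_j X y c 0 j * 'D_(delta_mx 0 j)
    (fun p => transition c c' p 0 i) (cmap c y)) =1 fun y => X y c' 0 i}.
  have n1 := near_cdom ac cx; have n2 := near_cdom ac' cx'.
  near=> y; have cy : cdom c y by near: y.
  have cy' : cdom c' y by near: y.
  have dt := transition_diff ac ac' cy cy'.
  rewrite (coords_change (X y) ac ac')// -deriveE// derive_row//.
  rewrite deriveE; last exact: differentiable_row.
  rewrite [X y c in RHS]row_sum_delta linear_sum.
  apply: eq_bigr => j _; rewrite linearZ /= deriveE//.
  exact: differentiable_row.
apply: smooth_at_ext E _; apply: smooth_at_sum => j _; apply: smooth_atM => //.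
by move: j; apply/smooth_at_row.
Unshelve. all: by end_near. Qed.

Lemma vf_smooth_in c x (X : vfield M) : atlas c -> cdom c x ->
  smooth_at x (fun y => X y c) <-> vf_smooth_at x X.
Proof.
by move=> ac cx; have [ax xx] := chart_atP x; split; exact: vf_smooth_change.
Qed.

Lemma vf_smooth_near x (X : vfield M) : vf_smooth_at x X ->
  \forall y \near x, vf_smooth_at y X.
Proof.
move=> sX; have [ax xx] := chart_atP x; have n1 := near_cdom ax xx.
have n2 : \forall y \near x, forall i, smooth_at y (fun z => X z (chart_at x) 0 i).
  apply: filter_forall => i; apply: smooth_at_near.
  by move: i; apply/smooth_at_row.
near=> y; apply/(vf_smooth_in _ ax); first by near: y.
by apply/smooth_at_row; near: y.
Unshelve. all: by end_near. Qed.

Lemma vf_smoothD x (X Y : vfield M) : vf_smooth_at x X -> vf_smooth_at x Y ->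
  vf_smooth_at x (fun y => X y + Y y).
Proof. by move=> sX sY; exact: smooth_atD. Qed.

Lemma vf_smoothZ x (f : M -> R) (X : vfield M) : smooth_at x f ->
  vf_smooth_at x X -> vf_smooth_at x (fun y => f y *: X y).
Proof.
move=> sf /smooth_at_row sX; apply/smooth_at_row => i.
apply: smooth_at_ext (smooth_atM sf (sX i)); apply: nearW => y.
by rewrite coordsZ mxE.
Qed.

Lemma vf_smooth0 x : vf_smooth_at x (fun=> 0).
Proof. exact: smooth_at_cst. Qed.

Lemma vf_smooth_sum x I (r : seq I) (P : pred I) (X : I -> vfield M) :
  (forall i, P i -> vf_smooth_at x (X i)) ->
  vf_smooth_at x (fun y => \sum_(i <- r | P i) X i y).
Proof.
move=> sX; apply: (@smooth_at_ext _ _ _ _ _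
  (fun y => \sum_(i <- r | P i) X i y (chart_at x))).
  by apply: nearW => y; rewrite coords_sum.
by apply: smooth_at_sum => i /sX.
Qed.

Definition cfield c (u : 'rV[R]_m) : vfield M := fun y => mk_tangent y c u.

Lemma cfield_smooth c u x : atlas c -> cdom c x -> vf_smooth_at x (cfield c u).
Proof.
move=> ac cx; apply/(vf_smooth_in _ ac cx).
apply: smooth_at_ext (smooth_at_cst x u).
by apply: filterS (near_cdom ac cx) => y cy; rewrite /cfield mk_tangentK.
Qed.

Lemma cfield_sum c x (v : tangent x) : atlas c -> cdom c x ->
  v = \sum_i v c 0 i *: cfield c (delta_mx 0 i) x.
Proof.
move=> ac cx; apply: (tangent_inj ac cx); rewrite coords_sum.
rewrite [LHS]row_sum_delta; apply: eq_bigr => i _.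
by rewrite coordsZ /cfield mk_tangentK.
Qed.

(** At each [y] the derivative is computed in [chart_at y]; near [x] the chain rule rewrites it as
    the sum of the components of [X] times partial derivatives of [f], all in the single chart
    [chart_at x]. *)
Lemma der_near x (X : vfield M) (f : M -> R) : vf_smooth_at x X ->
  smooth_at x f -> smooth_at x (fun y => der (X y) f).
Proof.
move=> sX sf; have [ax xx] := chart_atP x; set c := chart_at x in ax xx.
have /(smooth_in_at f ax xx)[U [oU Ux Uc sfU]] := sf.
have sD j : smooth_at x (fun y => 'D_(delta_mx 0 j) (f \o cinv c) (cmap c y)).
  apply/(smooth_in_at _ ax xx); exists U; split=> //.
  have /smooth_onP[_ /(_ (delta_mx 0 j)) sD] := sfU.
  move=> k; apply: Ck_open_ext oU _ (sD k) => p Up /=.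
  by have [_ ->] := cmap_image ax (Uc p Up).
have E : {near x, (fun y => \sum_j X y c 0 j * 'D_(delta_mx 0 j)
    (f \o cinv c) (cmap c y)) =1 fun y => der (X y) f}.
  have n1 := near_cdom ax xx; have n2 := near_cmap ax xx oU Ux.
  near=> y; have cy : cdom c y by near: y.
  have Uy : U (cmap c y) by near: y.
  have [ay yy] := chart_atP y; rewrite /der.
  have df := smooth_on_diff sfU Uy.
  have dt := transition_diff ay ax yy cy.
  have df' : differentiable (f \o cinv c) (transition (chart_at y) c (cmap (chart_at y) y)).
    by rewrite (transitionE _ ay yy).
  have e : {near cmap (chart_at y) y, (f \o cinv c) \o transition (chart_at y) c =1
      f \o cinv (chart_at y)}.
    apply/(chart_nbhs (fun z => f (cinv c (cmap c z)) = f z) ay yy).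
    by apply: filterS (near_cdom ax cy) => z cz; rewrite (chartK ax cz).
  rewrite [RHS](near_eq_diffE _ e); last exact: differentiable_comp.
  rewrite [RHS](diff_compE _ dt df') -(coords_change (X y) ay ax)// (transitionE _ ay yy).
  rewrite [X y c in RHS]row_sum_delta linear_sum.
  by apply: eq_bigr => j _; rewrite linearZ /= deriveE.
apply: smooth_at_ext E _; apply: smooth_at_sum => j _; apply: smooth_atM => //.
by move: j; apply/smooth_at_row.
Unshelve. all: by end_near. Qed.

End TangentCoordinates.

(** * Complex-valued and vector-valued functions *)

Section ComplexParts.
Context {R : realType}.
Implicit Types z w : R[i].

Lemma complex_ext z w : complex.Re z = complex.Re w ->
  complex.Im z = complex.Im w -> z = w.
Proof. by case: z w => a b [c d] /= -> ->. Qed.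

Lemma cReD z w : complex.Re (z + w) = complex.Re z + complex.Re w.
Proof. by case: z w => a b []. Qed.

Lemma cImD z w : complex.Im (z + w) = complex.Im z + complex.Im w.
Proof. by case: z w => a b []. Qed.

Lemma cReM z w :
  complex.Re (z * w) = complex.Re z * complex.Re w - complex.Im z * complex.Im w.
Proof. by case: z w => a b []. Qed.

Lemma cImM z w :
  complex.Im (z * w) = complex.Re z * complex.Im w + complex.Im z * complex.Re w.
Proof. by case: z w => a b []. Qed.

Lemma cReJ z : complex.Re z^* = complex.Re z.
Proof. by case: z. Qed.

Lemma cImJ z : complex.Im z^* = - complex.Im z.
Proof. by case: z. Qed.

End ComplexParts.

Section ComplexFunctions.
Context {R : realType} {m : nat} {M : manifold R m}.
Implicit Types (x y : M) (f g : M -> R[i]).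

Lemma csmooth_ext x f g : {near x, f =1 g} -> csmooth_at x f -> csmooth_at x g.
Proof.
by move=> fg [sr si]; split; [apply: smooth_at_ext sr|apply: smooth_at_ext si];
   apply: filterS fg => y ->.
Qed.

Lemma csmooth_cst x (a : R[i]) : csmooth_at x (fun=> a).
Proof. by split; exact: smooth_at_cst. Qed.

Lemma csmooth_real x (f : M -> R) : smooth_at x f -> csmooth_at x (fun y => (f y)%:C).
Proof. by move=> sf; split=> //=; exact: smooth_at_cst. Qed.

Lemma csmoothD x f g : csmooth_at x f -> csmooth_at x g ->
  csmooth_at x (fun y => f y + g y).
Proof.
by move=> [fr fi] [gr gi]; split; [apply: smooth_at_ext (smooth_atD fr gr)|
  apply: smooth_at_ext (smooth_atD fi gi)]; apply: nearW => y; case: (f y) (g y) => ? ? [].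
Qed.

Lemma csmoothM x f g : csmooth_at x f -> csmooth_at x g ->
  csmooth_at x (fun y => f y * g y).
Proof.
move=> [fr fi] [gr gi]; split.
  apply: smooth_at_ext (smooth_atB (smooth_atM fr gr) (smooth_atM fi gi)).
  by apply: nearW => y; case: (f y) (g y) => ? ? [].
apply: smooth_at_ext (smooth_atD (smooth_atM fr gi) (smooth_atM fi gr)).
by apply: nearW => y; case: (f y) (g y) => ? ? [].
Qed.

Lemma csmoothZ x a f : csmooth_at x f -> csmooth_at x (fun y => a * f y).
Proof. by move=> sf; apply: csmoothM => //; exact: csmooth_cst. Qed.

Lemma csmooth_conj x f : csmooth_at x f -> csmooth_at x (fun y => (f y)^*).
Proof.
move=> [fr fi]; split; first by apply: smooth_at_ext fr; apply: nearW => y; case: (f y).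
by apply: smooth_at_ext (smooth_atN fi); apply: nearW => y; case: (f y).
Qed.

Lemma csmooth_sum x (I : Type) (r : seq I) (P : pred I) (f : I -> M -> R[i]) :
  (forall i, P i -> csmooth_at x (f i)) ->
  csmooth_at x (fun y => \sum_(i <- r | P i) f i y).
Proof.
move=> sf; elim: r => [|i r IH].
  by apply: csmooth_ext (csmooth_cst x 0); apply: nearW => y; rewrite big_nil.
case: (boolP (P i)) => Pi.
  apply: csmooth_ext (csmoothD (sf i Pi) IH).
  by apply: nearW => y; rewrite big_cons Pi.
by apply: csmooth_ext IH; apply: nearW => y; rewrite big_cons (negPf Pi).
Qed.

Lemma csmooth_prod x (I : Type) (r : seq I) (P : pred I) (f : I -> M -> R[i]) :
  (forall i, P i -> csmooth_at x (f i)) ->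
  csmooth_at x (fun y => \prod_(i <- r | P i) f i y).
Proof.
move=> sf; elim: r => [|i r IH].
  by apply: csmooth_ext (csmooth_cst x 1); apply: nearW => y; rewrite big_nil.
case: (boolP (P i)) => Pi.
  apply: csmooth_ext (csmoothM (sf i Pi) IH).
  by apply: nearW => y; rewrite big_cons Pi.
by apply: csmooth_ext IH; apply: nearW => y; rewrite big_cons (negPf Pi).
Qed.

Lemma csmooth_near x f : csmooth_at x f -> \forall y \near x, csmooth_at y f.
Proof. by move=> [/smooth_at_near fr /smooth_at_near fi]; exact: filterS2 fr fi. Qed.

Lemma complex_sqr_gt0 (z : R[i]) : z != 0 ->
  0 < complex.Re z * complex.Re z + complex.Im z * complex.Im z.
Proof.
case: z => a b; rewrite eq_complex /= negb_and => /orP[a0|b0].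
  by rewrite ltr_pwDl// -expr2 ?sqr_ge0// exprn_even_gt0//=.
by rewrite ltr_wpDl// -expr2 ?sqr_ge0// exprn_even_gt0//=.
Qed.

Lemma csmooth_neq0 x f : csmooth_at x f -> f x != 0 -> \forall y \near x, f y != 0.
Proof.
move=> [fr fi] f0; have s := smooth_atD (smooth_atM fr fr) (smooth_atM fi fi).
apply: filterS (smooth_at_gt0 s (complex_sqr_gt0 f0)) => y.
by apply: contraTneq => ->; rewrite /= !mulr0 addr0 ltxx.
Qed.

(** The inverse is the conjugate divided by the squared modulus, whose reciprocal is the square of
    its inverse square root. *)
Lemma csmoothV x f : csmooth_at x f -> f x != 0 -> csmooth_at x (fun y => (f y)^-1).
Proof.
move=> sf f0; have [fr fi] := sf.
have s := smooth_atD (smooth_atM fr fr) (smooth_atM fi fi).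
have si := smooth_at_invsqrt s (complex_sqr_gt0 f0).
apply: csmooth_ext (csmoothM (csmooth_real (smooth_atM si si)) (csmooth_conj sf)).
apply: filterS (csmooth_neq0 sf f0) => y fy0 /=.
have gt := complex_sqr_gt0 fy0; set N := _ + _ in gt *.
have -> : (Num.sqrt N)^-1 * (Num.sqrt N)^-1 = N^-1.
  by rewrite -invfM -expr2 sqr_sqrtr// ltW.
have NE : N%:C = f y * (f y)^*.
  rewrite /N; case: (f y) => a b /=; apply/eqP; rewrite eq_complex /=.
  by rewrite mulrN opprK eqxx /= mulrN mulrC addNr.
apply: (mulfI fy0); rewrite mulfV// mulrCA -NE.
by rewrite -rmorphM /= mulVf ?gt_eqF.
Qed.

Lemma cder_ext x (v : tangent x) f g : csmooth_at x f -> {near x, f =1 g} ->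
  cder v f = cder v g.
Proof.
move=> [sr si] fg; apply: complex_ext; rewrite /cder.
  by apply: (der_ext v sr); apply: filterS fg => y ->.
by apply: (der_ext v si); apply: filterS fg => y ->.
Qed.

Lemma eq_cder x (v : tangent x) f g : f =1 g -> cder v f = cder v g.
Proof. by move=> /funext ->. Qed.

Lemma cder_cst x (v : tangent x) a : cder v (fun=> a) = 0.
Proof. by rewrite /cder !der_cst. Qed.

Lemma cder_real x (v : tangent x) (f : M -> R) :
  cder v (fun y => (f y)%:C) = (der v f)%:C.
Proof. by rewrite /cder /= der_cst. Qed.

Lemma cderD x (v : tangent x) f g : csmooth_at x f -> csmooth_at x g ->
  cder v (fun y => f y + g y) = cder v f + cder v g.
Proof.
move=> [fr fi] [gr gi]; apply: complex_ext; rewrite (cReD, cImD).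
  rewrite -[RHS](derD v fr gr); congr (der v _).
  by apply/funext => y; rewrite cReD.
rewrite -[RHS](derD v fi gi); congr (der v _).
by apply/funext => y; rewrite cImD.
Qed.

Lemma cderM x (v : tangent x) f g : csmooth_at x f -> csmooth_at x g ->
  cder v (fun y => f y * g y) = cder v f * g x + f x * cder v g.
Proof.
move=> [fr fi] [gr gi]; apply: complex_ext; rewrite (cReD, cImD).
  transitivity (der v (fun y => complex.Re (f y) * complex.Re (g y) -
                    complex.Im (f y) * complex.Im (g y))).
    by congr (der v _); apply/funext => y; rewrite cReM.
  rewrite (derB v (smooth_atM fr gr) (smooth_atM fi gi)) !cReM.
  rewrite (derM v fr gr) (derM v fi gi) /cder /=.
  by rewrite opprD addrACA.
transitivity (der v (fun y => complex.Re (f y) * complex.Im (g y) +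
                    complex.Im (f y) * complex.Re (g y))).
  by congr (der v _); apply/funext => y; rewrite cImM.
rewrite (derD v (smooth_atM fr gi) (smooth_atM fi gr)) !cImM.
rewrite (derM v fr gi) (derM v fi gr) /cder /=.
by rewrite addrACA.
Qed.

Lemma cderZ x (v : tangent x) a f : csmooth_at x f ->
  cder v (fun y => a * f y) = a * cder v f.
Proof.
by move=> sf; rewrite cderM// ?cder_cst ?mul0r ?add0r//; exact: csmooth_cst.
Qed.

Lemma cder_sum x (v : tangent x) (I : Type) (r : seq I) (P : pred I)
    (f : I -> M -> R[i]) : (forall i, P i -> csmooth_at x (f i)) ->
  cder v (fun y => \sum_(i <- r | P i) f i y) = \sum_(i <- r | P i) cder v (f i).
Proof.
move=> sf; elim: r => [|i r IH].
  rewrite [RHS]big_nil -[RHS](cder_cst v 0); congr (cder v _).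
  by apply/funext => y; rewrite big_nil.
rewrite [RHS]big_cons; case: ifP => Pi; rewrite -IH.
  rewrite -cderD; [|exact: sf|exact: csmooth_sum].
  by congr (cder v _); apply/funext => y; rewrite big_cons Pi.
by congr (cder v _); apply/funext => y; rewrite big_cons Pi.
Qed.

Lemma cder_conj x (v : tangent x) f : csmooth_at x f ->
  cder v (fun y => (f y)^*) = (cder v f)^*.
Proof.
move=> [fr fi]; apply: complex_ext; rewrite (cReJ, cImJ).
  by congr (der v _); apply/funext => y; rewrite cReJ.
rewrite -[RHS](derN v fi); congr (der v _).
by apply/funext => y; rewrite cImJ.
Qed.

Lemma cder_linear x a (u v : tangent x) f :
  cder (a *: u + v) f = a%:C * cder u f + cder v f.
Proof.
apply: complex_ext; rewrite (cReD, cImD) (cReM, cImM) /cder /= der_linear.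
  by rewrite mul0r subr0.
by rewrite mul0r addr0.
Qed.

Lemma cder_near x (X : vfield M) f : vf_smooth_at x X -> csmooth_at x f ->
  csmooth_at x (fun y => cder (X y) f).
Proof. by move=> sX [fr fi]; split; exact: der_near. Qed.

Lemma cder_prod0 x (v : tangent x) (I : Type) (r : seq I) (P : pred I)
    (f : I -> M -> R[i]) : (forall i, P i -> csmooth_at x (f i)) ->
  (forall i, P i -> cder v (f i) = 0) ->
  cder v (fun y => \prod_(i <- r | P i) f i y) = 0.
Proof.
move=> sf df; elim: r => [|i r IH].
  rewrite -[RHS](cder_cst v 1); congr (cder v _).
  by apply/funext => y; rewrite big_nil.
case: (boolP (P i)) => Pi; last first.
  by rewrite -[RHS]IH; congr (cder v _); apply/funext => y; rewrite big_cons (negPf Pi).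
transitivity (cder v (fun y => f i y * \prod_(j <- r | P j) f j y)).
  by congr (cder v _); apply/funext => y; rewrite big_cons Pi.
rewrite cderM; [|exact: sf|exact: csmooth_prod].
by rewrite IH df// mul0r mulr0 addr0.
Qed.

End ComplexFunctions.

Section FiniteDimensional.
Context {R : realType}.
Local Notation C := R[i].

(* A finite family spanning V, with the coordinate functionals of a          *)
(* decomposition: this is all that the calculus of V-valued maps needs.      *)
Record findim (V : lmodType C) := Findim {
  fd_idx : finType;
  fd_vec : fd_idx -> V;
  fd_dual : fd_idx -> {scalar V};
  fd_sum : forall v, v = \sum_i fd_dual i v *: fd_vec i }.

Arguments fd_vec [V] f i.
Arguments fd_dual [V] f i.

Lemma scalar_exists (V : lmodType C) (f : V -> C) : scalar f ->
  exists l : {scalar V}, l =1 f.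
Proof.
move=> sf; pose L := GRing.isLinear.Build C V C _ f sf.
pose F : {scalar V} := HB.pack f L.
by exists F.
Qed.

Lemma mx_entry_scalar p q (i : 'I_p) (j : 'I_q) :
  scalar (fun A : 'M[C]_(p, q) => A i j).
Proof. by move=> a A B; rewrite !mxE. Qed.

Definition mx_entry p q (i : 'I_p) (j : 'I_q) : {scalar 'M[C]_(p, q)} :=
  sval (cid (scalar_exists (mx_entry_scalar i j))).

Lemma mx_entryE p q (i : 'I_p) (j : 'I_q) (A : 'M[C]_(p, q)) : mx_entry i j A = A i j.
Proof. by rewrite /mx_entry; case: cid. Qed.

Lemma mx_findim_sum p q (v : 'M[C]_(p, q)) :
  v = \sum_(i : 'I_p * 'I_q) mx_entry i.1 i.2 v *: delta_mx i.1 i.2.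
Proof.
rewrite {1}[v]matrix_sum_delta pair_bigA /=.
by apply: eq_bigr => i _; rewrite mx_entryE.
Qed.

Definition mx_findim p q : findim 'M[C]_(p, q) := Findim (@mx_findim_sum p q).

Section Calculus.
Context {m : nat} {M : manifold R m} {V : lmodType C} (b : findim V).
Implicit Types (x : M) (f g : M -> V).

Lemma scalar_ext (u v : V) : (forall l : {scalar V}, l u = l v) -> u = v.
Proof.
move=> uv; rewrite (fd_sum b u) (fd_sum b v).
by apply: eq_bigr => i _; rewrite uv.
Qed.

Lemma scalar_fd (l : {scalar V}) (u : V) :
  l u = \sum_i fd_dual b i u * l (fd_vec b i).
Proof. by rewrite {1}(fd_sum b u) linear_sum; apply: eq_bigr => i _; rewrite linearZ. Qed.

Lemma vsmooth_fd x f : (forall i, csmooth_at x (fun y => fd_dual b i (f y))) ->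
  vsmooth_at x f.
Proof.
move=> sf l; apply: (@csmooth_ext _ _ _ _
    (fun y => \sum_i fd_dual b i (f y) * l (fd_vec b i))).
  by apply: nearW => y; rewrite [RHS]scalar_fd.
by apply: csmooth_sum => i _; apply: csmoothM => //; exact: csmooth_cst.
Qed.

(** [V] carries no topology: maps into it are differentiated through linear forms. For smooth [f],
    [vderP] shows that the result does not depend on the chosen family. *)
Definition vder x (v : tangent x) f : V :=
  \sum_i cder v (fun y => fd_dual b i (f y)) *: fd_vec b i.

Lemma vderP x (v : tangent x) f (l : {scalar V}) : vsmooth_at x f ->
  l (vder v f) = cder v (fun y => l (f y)).
Proof.
move=> sf; rewrite /vder linear_sum /=.
transitivity (cder v (fun y => \sum_i fd_dual b i (f y) * l (fd_vec b i))).
  rewrite cder_sum => [|i _]; last exact: (csmoothM (sf _) (csmooth_cst _ _)).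
  apply: eq_bigr => i _; rewrite linearZ /=.
  by rewrite (cderM v (sf _) (csmooth_cst _ _)) cder_cst mulr0 addr0.
by apply: eq_cder => y; rewrite [RHS]scalar_fd.
Qed.

End Calculus.

Section Operations.
Context {m : nat} {M : manifold R m}.
Implicit Types x : M.

Lemma vsmooth_ext (V : lmodType C) x (f g : M -> V) : {near x, f =1 g} ->
  vsmooth_at x f -> vsmooth_at x g.
Proof. by move=> fg sf l; apply: csmooth_ext (sf l); apply: filterS fg => y ->. Qed.

Lemma vsmooth_cst (V : lmodType C) x (a : V) : vsmooth_at x (fun=> a).
Proof. by move=> l; exact: csmooth_cst. Qed.

Lemma vsmooth_near (V : lmodType C) (b : findim V) x (f : M -> V) :
  vsmooth_at x f -> \forall y \near x, vsmooth_at y f.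
Proof.
move=> sf; have : \forall y \near x, forall i, csmooth_at y (fun z => fd_dual b i (f z)).
  by apply: filter_forall => i; exact: csmooth_near.
by apply: filterS => y; exact: vsmooth_fd.
Qed.

Lemma vder_ext (V : lmodType C) (b : findim V) x (v : tangent x) (f g : M -> V) :
  vsmooth_at x f -> {near x, f =1 g} -> vder b v f = vder b v g.
Proof.
move=> sf fg; rewrite /vder; apply: eq_bigr => i _.
rewrite (@cder_ext _ _ _ x v _ (fun y => fd_dual b i (g y)) (sf _))//.
by apply: filterS fg => y ->.
Qed.

Lemma vder_cst (V : lmodType C) (b : findim V) x (v : tangent x) (a : V) :
  vder b v (fun=> a) = 0.
Proof. by rewrite /vder big1// => i _; rewrite cder_cst scale0r. Qed.

Lemma vder_near (V : lmodType C) (b : findim V) x (X : vfield M) (f : M -> V) :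
  vf_smooth_at x X -> vsmooth_at x f -> vsmooth_at x (fun y => vder b (X y) f).
Proof.
move=> sX sf l; have nf := vsmooth_near b sf.
apply: (csmooth_ext _ (cder_near sX (sf l))).
by apply: filterS nf => y sfy; rewrite vderP.
Qed.

Lemma vder_linear (V : lmodType C) (b : findim V) x a (u v : tangent x) (f : M -> V) :
  vder b (a *: u + v) f = a%:C *: vder b u f + vder b v f.
Proof.
rewrite /vder scaler_sumr -big_split; apply: eq_bigr => i _ /=.
by rewrite cder_linear scalerDl scalerA.
Qed.

Section Bilinear.
Context {V1 V2 V3 : lmodType C} (b1 : findim V1) (b2 : findim V2) (b3 : findim V3).
Context (B : V1 -> V2 -> V3).
Hypothesis Bl : forall w, linear (B^~ w).
Hypothesis Br : forall v, linear (B v).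

(** Reduces a bilinear map to finitely many products of scalar functions. Smoothness and the Leibniz
    rule for matrix products, module actions and tensor products come from it. *)
Lemma bilin_scalar (l : {scalar V3}) v w : l (B v w) =
  \sum_i \sum_j (fd_dual b1 i v * fd_dual b2 j w) * l (B (fd_vec b1 i) (fd_vec b2 j)).
Proof.
pose Lw := GRing.isLinear.Build C V1 V3 _ (B^~ w) (Bl w).
pose F : {linear V1 -> V3} := HB.pack (B^~ w) Lw.
rewrite {1}(fd_sum b1 v) -[B _ w]/(F _) !linear_sum; apply: eq_bigr => i _.
rewrite !linearZ /=.
transitivity (fd_dual b1 i v *
    \sum_j fd_dual b2 j w * l (B (fd_vec b1 i) (fd_vec b2 j))); last first.
  by rewrite mulr_sumr; apply: eq_bigr => j _; rewrite mulrA.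
congr (_ * _).
pose Lv := GRing.isLinear.Build C V2 V3 _ (B (fd_vec b1 i)) (Br _).
pose G : {linear V2 -> V3} := HB.pack (B (fd_vec b1 i)) Lv.
rewrite {1}(fd_sum b2 w) -[B _ _]/(G _) !linear_sum; apply: eq_bigr => j _.
by rewrite !linearZ.
Qed.

Lemma vsmooth_bilin x (f : M -> V1) (g : M -> V2) : vsmooth_at x f ->
  vsmooth_at x g -> vsmooth_at x (fun y => B (f y) (g y)).
Proof.
move=> sf sg l; apply: (@csmooth_ext _ _ _ _ (fun y => \sum_i \sum_j
   (fd_dual b1 i (f y) * fd_dual b2 j (g y)) * l (B (fd_vec b1 i) (fd_vec b2 j)))).
  by apply: nearW => y; rewrite [RHS]bilin_scalar.
apply: csmooth_sum => i _; apply: csmooth_sum => j _.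
by apply: csmoothM; [apply: csmoothM; [exact: sf|exact: sg]|exact: csmooth_cst].
Qed.

Lemma vder_bilin x (v : tangent x) (f : M -> V1) (g : M -> V2) :
  vsmooth_at x f -> vsmooth_at x g ->
  vder b3 v (fun y => B (f y) (g y)) =
    B (vder b1 v f) (g x) + B (f x) (vder b2 v g).
Proof.
move=> sf sg; apply: (scalar_ext b3) => l.
rewrite vderP; last exact: vsmooth_bilin.
rewrite linearD /= !bilin_scalar.
transitivity (cder v (fun y => \sum_i \sum_j
   (fd_dual b1 i (f y) * fd_dual b2 j (g y)) * l (B (fd_vec b1 i) (fd_vec b2 j)))).
  by apply: eq_cder => y; rewrite [LHS]bilin_scalar.
have sij i j : csmooth_at x (fun y => fd_dual b1 i (f y) * fd_dual b2 j (g y)).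
  by apply: csmoothM; [exact: sf|exact: sg].
have sij' i j : csmooth_at x (fun y => (fd_dual b1 i (f y) * fd_dual b2 j (g y)) *
    l (B (fd_vec b1 i) (fd_vec b2 j))).
  by apply: csmoothM => //; exact: csmooth_cst.
rewrite cder_sum => [|i _]; last by apply: csmooth_sum => j _; exact: sij'.
rewrite -big_split; apply: eq_bigr => i _; rewrite cder_sum => [|j _]; last exact: sij'.
rewrite -big_split; apply: eq_bigr => j _ /=.
rewrite cderM//; last exact: csmooth_cst.
rewrite cder_cst mulr0 addr0 cderM; [|exact: sf|exact: sg].
by rewrite mulrDl !vderP.
Qed.

End Bilinear.

Lemma vsmooth_lin (V W : lmodType C) (L : V -> W) x (f : M -> V) : linear L ->
  vsmooth_at x f -> vsmooth_at x (fun y => L (f y)).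
Proof.
move=> lL sf l; have [l' l'E] : exists l' : {scalar V}, l' =1 l \o L.
  by apply: scalar_exists => a u v; rewrite /= lL linearP.
by apply: csmooth_ext (sf l'); apply: nearW => y; rewrite l'E.
Qed.

Lemma vder_lin (V W : lmodType C) (b : findim V) (b' : findim W) (L : V -> W) x
    (v : tangent x) (f : M -> V) : linear L -> vsmooth_at x f ->
  vder b' v (fun y => L (f y)) = L (vder b v f).
Proof.
move=> lL sf; apply: (scalar_ext b') => l; rewrite vderP; last exact: vsmooth_lin.
have [l' l'E] : exists l' : {scalar V}, l' =1 l \o L.
  by apply: scalar_exists => a u w; rewrite /= lL linearP.
rewrite -[RHS](l'E) (vderP _ v l' sf).
by apply: eq_cder => y; rewrite l'E.
Qed.

Lemma vsmoothD (V : lmodType C) x (f g : M -> V) : vsmooth_at x f ->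
  vsmooth_at x g -> vsmooth_at x (fun y => f y + g y).
Proof.
move=> sf sg l; apply: csmooth_ext (csmoothD (sf l) (sg l)).
by apply: nearW => y; rewrite linearD.
Qed.

Lemma vderD (V : lmodType C) (b : findim V) x (v : tangent x) (f g : M -> V) :
  vsmooth_at x f -> vsmooth_at x g ->
  vder b v (fun y => f y + g y) = vder b v f + vder b v g.
Proof.
move=> sf sg; apply: (scalar_ext b) => l; rewrite vderP; last exact: vsmoothD.
rewrite (linearD l) (vderP _ v l sf) (vderP _ v l sg) -(cderD v (sf l) (sg l)).
by apply: eq_cder => y; rewrite linearD.
Qed.

Lemma vsmooth_sum (V : lmodType C) x (I : Type) (r : seq I) (P : pred I)
    (f : I -> M -> V) : (forall i, P i -> vsmooth_at x (f i)) ->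
  vsmooth_at x (fun y => \sum_(i <- r | P i) f i y).
Proof.
move=> sf l; apply: (@csmooth_ext _ _ _ _ (fun y => \sum_(i <- r | P i) l (f i y))).
  by apply: nearW => y; rewrite linear_sum.
by apply: csmooth_sum => i Pi; exact: sf.
Qed.

Lemma vder_sum (V : lmodType C) (b : findim V) x (v : tangent x) (I : Type) (r : seq I)
    (P : pred I) (f : I -> M -> V) : (forall i, P i -> vsmooth_at x (f i)) ->
  vder b v (fun y => \sum_(i <- r | P i) f i y) = \sum_(i <- r | P i) vder b v (f i).
Proof.
move=> sf; apply: (scalar_ext b) => l; rewrite vderP; last exact: vsmooth_sum.
rewrite linear_sum /=; transitivity (cder v (fun y => \sum_(i <- r | P i) l (f i y))).
  by apply: eq_cder => y; rewrite linear_sum.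
rewrite cder_sum => [|i Pi]; last exact: sf.
by apply: eq_bigr => i Pi; rewrite vderP//; exact: sf.
Qed.

Lemma vsmoothZ (V : lmodType C) x (k : M -> C) (f : M -> V) : csmooth_at x k ->
  vsmooth_at x f -> vsmooth_at x (fun y => k y *: f y).
Proof.
move=> sk sf l; apply: csmooth_ext (csmoothM sk (sf l)).
by apply: nearW => y; rewrite linearZ.
Qed.

Lemma vderZ (V : lmodType C) (b : findim V) x (v : tangent x) (k : M -> C) (f : M -> V) :
  csmooth_at x k -> vsmooth_at x f ->
  vder b v (fun y => k y *: f y) = cder v k *: f x + k x *: vder b v f.
Proof.
move=> sk sf; apply: (scalar_ext b) => l; rewrite vderP; last exact: vsmoothZ.
rewrite linearD !linearZ /= (vderP _ v l sf) -(cderM v sk (sf l)).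
by apply: eq_cder => y; rewrite linearZ.
Qed.

Lemma vsmooth_mxP p q x (f : M -> 'M[C]_(p, q)) : vsmooth_at x f <->
  forall i j, csmooth_at x (fun y => f y i j).
Proof.
split=> [sf i j|sf].
  by apply: csmooth_ext (sf (mx_entry i j)); apply: nearW => y; rewrite mx_entryE.
apply: (vsmooth_fd (b := mx_findim p q)) => -[i j] /=.
by apply: csmooth_ext (sf i j); apply: nearW => y; rewrite mx_entryE.
Qed.

Lemma vder_mxE p q x (v : tangent x) (f : M -> 'M[C]_(p, q)) i j :
  vsmooth_at x f -> vder (mx_findim p q) v f i j = cder v (fun y => f y i j).
Proof.
move=> sf; rewrite -mx_entryE (vderP _ v _ sf).
by apply: eq_cder => y; rewrite mx_entryE.
Qed.

End Operations.

End FiniteDimensional.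

Arguments fd_vec {R V} f i.
Arguments fd_dual {R V} f i.

(** * Parallel unitary frames *)

Section Realify.
Context {R : realType} {n : nat}.
Implicit Types (A B : 'M[R[i]]_n) (j k : 'I_n).

Lemma even_ord_subproof j : (j.*2 < n.*2)%N.
Proof. by rewrite ltn_double. Qed.

Lemma odd_ord_subproof j : (j.*2.+1 < n.*2)%N.
Proof. by rewrite ltn_Sdouble. Qed.

Definition even_ord j : 'I_n.*2 := Ordinal (even_ord_subproof j).
Definition odd_ord j : 'I_n.*2 := Ordinal (odd_ord_subproof j).

Lemma half_even_ord j : half_ord (even_ord j) = j.
Proof. by apply: val_inj; rewrite /= doubleK. Qed.

Lemma half_odd_ord j : half_ord (odd_ord j) = j.
Proof. by apply: val_inj; rewrite /= uphalf_double. Qed.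

Lemma odd_even_ord j : odd (even_ord j) = false.
Proof. by rewrite /= odd_double. Qed.

Lemma odd_odd_ord j : odd (odd_ord j) = true.
Proof. by rewrite /= odd_double. Qed.

Lemma ord_parity (a : 'I_n.*2) :
  a = if odd a then odd_ord (half_ord a) else even_ord (half_ord a).
Proof.
apply: val_inj; have := odd_double_half a; case: (odd a) => /= {1}<-; first by [].
by rewrite add0n.
Qed.

Lemma ord_parity_ind (P : 'I_n.*2 -> Prop) :
  (forall j, P (even_ord j)) -> (forall j, P (odd_ord j)) -> forall a, P a.
Proof. by move=> Pe Po a; rewrite (ord_parity a); case: (odd a). Qed.

Lemma even_ord_inj : injective even_ord.
Proof. by move=> j k /(congr1 (@half_ord n)); rewrite !half_even_ord. Qed.

Lemma odd_ord_inj : injective odd_ord.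
Proof. by move=> j k /(congr1 (@half_ord n)); rewrite !half_odd_ord. Qed.

Lemma eq_even_odd j k : (even_ord j == odd_ord k) = false.
Proof.
by apply/eqP => /(congr1 (fun a : 'I_n.*2 => odd a)); rewrite odd_even_ord odd_odd_ord.
Qed.

Lemma big_parity (T : Type) (idx : T) (op : Monoid.com_law idx) (F : 'I_n.*2 -> T) :
  \big[op/idx]_a F a = \big[op/idx]_j op (F (even_ord j)) (F (odd_ord j)).
Proof.
rewrite (bigID (fun a : 'I_n.*2 => ~~ odd a)) /= big_split /=; congr (op _ _).
  rewrite (reindex_onto even_ord (@half_ord n)) /=.
    by apply: eq_bigl => j; rewrite odd_double half_even_ord eqxx.
  by move=> a oa; rewrite [RHS]ord_parity (negPf oa).
rewrite (reindex_onto odd_ord (@half_ord n)) /=.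
  by apply: eq_bigl => j; rewrite odd_double /= half_odd_ord eqxx.
by move=> a; rewrite negbK => oa; rewrite [RHS]ord_parity oa.
Qed.

Lemma sum_parity (T : nmodType) (F : 'I_n.*2 -> T) :
  \sum_a F a = \sum_j (F (even_ord j) + F (odd_ord j)).
Proof. exact: big_parity. Qed.

Lemma realify_ee A j k : realify A (even_ord j) (even_ord k) = complex.Re (A j k).
Proof. by rewrite mxE !odd_even_ord !half_even_ord. Qed.
Lemma realify_oe A j k : realify A (odd_ord j) (even_ord k) = complex.Im (A j k).
Proof. by rewrite mxE odd_odd_ord odd_even_ord half_even_ord half_odd_ord. Qed.
Lemma realify_eo A j k : realify A (even_ord j) (odd_ord k) = - complex.Im (A j k).
Proof. by rewrite mxE odd_odd_ord odd_even_ord half_even_ord half_odd_ord. Qed.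
Lemma realify_oo A j k : realify A (odd_ord j) (odd_ord k) = complex.Re (A j k).
Proof. by rewrite mxE !odd_odd_ord !half_odd_ord. Qed.

Definition realifyE := (realify_ee, realify_oe, realify_eo, realify_oo).

Lemma realify_inj : injective (@realify R n).
Proof.
move=> A B /matrixP AB; apply/matrixP => j k; apply: complex_ext.
  by rewrite -!realify_ee AB.
by rewrite -!realify_oe AB.
Qed.

Lemma Re_sum (I : Type) (r : seq I) (P : pred I) (F : I -> R[i]) :
  complex.Re (\sum_(i <- r | P i) F i) = \sum_(i <- r | P i) complex.Re (F i).
Proof. by apply: big_morph => [z w|//]; rewrite cReD. Qed.

Lemma Im_sum (I : Type) (r : seq I) (P : pred I) (F : I -> R[i]) :
  complex.Im (\sum_(i <- r | P i) F i) = \sum_(i <- r | P i) complex.Im (F i).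
Proof. by apply: big_morph => [z w|//]; rewrite cImD. Qed.

Lemma realifyM A B : realify (A *m B) = realify A *m realify B.
Proof.
apply/matrixP => a b; elim/ord_parity_ind: a => j; elim/ord_parity_ind: b => k;
  rewrite [RHS]mxE (big_parity +%R) realifyE mxE ?Re_sum ?Im_sum ?raddf_sum -?sumrN;
  apply: eq_bigr => l _; rewrite /= !realifyE ?cReM ?cImM.
- by rewrite mulNr.
- by rewrite opprD mulrN mulNr.
- by rewrite addrC.
- by rewrite mulrN addrC.
Qed.

Lemma realify1 : realify (1%:M : 'M[R[i]]_n) = 1%:M.
Proof.
apply/matrixP => a b; elim/ord_parity_ind: a => j; elim/ord_parity_ind: b => k;
  rewrite realifyE !mxE.
- by rewrite (inj_eq even_ord_inj); case: (j == k).
- by rewrite eq_even_odd; case: (j == k); rewrite /= oppr0.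
- by rewrite [odd_ord j == _]eq_sym eq_even_odd; case: (j == k).
- by rewrite (inj_eq odd_ord_inj); case: (j == k).
Qed.

Definition adjmx A : 'M[R[i]]_n := \matrix_(j, k) (A k j)^*.

Lemma unitary_adjP A : A \is unitarymx <-> A *m adjmx A = 1%:M.
Proof.
have -> : adjmx A = map_mx Num.conj A^T.
  by apply/matrixP => j k; rewrite !mxE; apply: complex_ext; case: (A k j).
by split=> [/unitarymxP|?]; last apply/unitarymxP.
Qed.

Lemma realify_adj A : realify (adjmx A) = (realify A)^T.
Proof.
apply/matrixP => a b; elim/ord_parity_ind: a => j; elim/ord_parity_ind: b => k;
  rewrite [RHS]mxE !realifyE !mxE ?cReJ ?cImJ ?opprK//.
Qed.

(** [realify] is injective, multiplicative and turns adjoints into transposes, so unitarity can be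
    read off the real scalar products of frame vectors. *)
Lemma unitary_realify A : A \is unitarymx <-> realify A *m (realify A)^T = 1%:M.
Proof.
rewrite -realify_adj -realifyM -realify1; split; first by move/unitary_adjP => ->.
by move/realify_inj => ?; apply/unitary_adjP.
Qed.

Lemma unitary1 : (1%:M : 'M[R[i]]_n) \is unitarymx.
Proof. by apply/unitary_realify; rewrite realify1 trmx1 mulmx1. Qed.

Lemma unitary_adjK A : A \is unitarymx -> adjmx A *m A = 1%:M.
Proof. by move/unitary_adjP/mulmx1C. Qed.

Lemma unitary_adj A : A \is unitarymx -> adjmx A \is unitarymx.
Proof.
move=> uA; apply/unitary_realify; rewrite realify_adj trmxK.
by rewrite -realify_adj -realifyM unitary_adjK// realify1.
Qed.

End Realify.

Section MetricAlgebra.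
Context {R : realType} {n : nat} {M : manifold R n.*2}.
Context (H : hermitian_structure M).
Implicit Types (x : M).

Lemma metricDl x (u v w : tangent x) :
  metric H (u + v) w = metric H u w + metric H v w.
Proof. by rewrite -[u]scale1r metricPl mul1r scale1r. Qed.

Lemma metric0l x (w : tangent x) : metric H 0 w = 0.
Proof. by have := metricDl 0 0 w; rewrite addr0 => /eqP; rewrite addrC -subr_eq subrr => /eqP<-. Qed.

Lemma metricZl x a (u w : tangent x) : metric H (a *: u) w = a * metric H u w.
Proof. by rewrite -[a *: u]addr0 metricPl metric0l addr0. Qed.

Lemma metricNl x (u w : tangent x) : metric H (- u) w = - metric H u w.
Proof. by rewrite -scaleN1r metricZl mulN1r. Qed.

Lemma metric_suml x I (r : seq I) (P : pred I) (F : I -> tangent x) w :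
  metric H (\sum_(i <- r | P i) F i) w = \sum_(i <- r | P i) metric H (F i) w.
Proof. exact: (big_morph (fun u => metric H u w) (fun u v => metricDl u v w) (metric0l w)). Qed.

Lemma metricDr x (u v w : tangent x) :
  metric H w (u + v) = metric H w u + metric H w v.
Proof. by rewrite !(metricC H w) metricDl. Qed.

Lemma metricZr x a (u w : tangent x) : metric H w (a *: u) = a * metric H w u.
Proof. by rewrite !(metricC H w) metricZl. Qed.

Lemma metricNr x (u w : tangent x) : metric H w (- u) = - metric H w u.
Proof. by rewrite !(metricC H w) metricNl. Qed.

Lemma metric0r x (w : tangent x) : metric H w 0 = 0.
Proof. by rewrite metricC metric0l. Qed.

Lemma metric_sumr x I (r : seq I) (P : pred I) (F : I -> tangent x) w :
  metric H w (\sum_(i <- r | P i) F i) = \sum_(i <- r | P i) metric H w (F i).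
Proof. by rewrite metricC metric_suml; apply: eq_bigr => i _; rewrite metricC. Qed.

Lemma cplx_skew x (u v : tangent x) : metric H (cplx H u) v = - metric H u (cplx H v).
Proof. by rewrite -(cplx_metric H u) cplxK metricNr opprK. Qed.

Lemma cplx_orth x (u : tangent x) : metric H (cplx H u) u = 0.
Proof.
apply/eqP; have := cplx_skew u u; rewrite [in RHS]metricC => /eqP.
by rewrite -addr_eq0 -mulr2n mulrn_eq0 /=.
Qed.

Lemma span_tangent x k (e : 'I_k -> tangent x) (c := chart_at x)
    (E := \matrix_(a < k) (e a c)) :
  (forall v : tangent x, (v c <= E)%MS -> exists u : 'rV_k, v = \sum_a u 0 a *: e a).
Proof.
move=> v /submxP[u vE]; exists u; have [ax xx] := chart_atP x.
apply: (tangent_inj ax xx); rewrite coords_sum vE mulmx_sum_row.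
by apply: eq_bigr => a _; rewrite rowK coordsZ.
Qed.

(** Orthonormality makes the rows of the coordinate matrix of [e] independent; the matrix is square,
    so the frame spans the tangent space. *)
Lemma orthonormal_expand x (e : 'I_n.*2 -> tangent x) :
  (forall a b, metric H (e a) (e b) = (a == b)%:R) ->
  forall v, v = \sum_a metric H v (e a) *: e a.
Proof.
move=> oe v; set c := chart_at x; set E := \matrix_(a < n.*2) (e a c).
have [ax xx] := chart_atP x.
have coef (u : 'rV_n.*2) b : metric H (\sum_a u 0 a *: e a) (e b) = u 0 b.
  rewrite metric_suml (bigD1 b)//= metricZl oe eqxx mulr1 big1 ?addr0// => a ab.
  by rewrite metricZl oe (negPf ab) mulr0.
have fE : row_free E.
  apply/row_freeP; exists (pinvmx E); apply/eqP; rewrite -subr_eq0; apply/eqP.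
  have k0 (u : 'rV_n.*2) : u *m E = 0 -> u = 0.
    move=> u0; have e0 : \sum_a u 0 a *: e a = 0.
      apply: (tangent_inj ax xx); rewrite coords_sum coords0 -[RHS]u0 mulmx_sum_row.
      by apply: eq_bigr => a _; rewrite rowK coordsZ.
    by apply/rowP => b; rewrite -coef e0 metric0l mxE.
  apply/row_matrixP => a; rewrite row0; apply: k0.
  by rewrite -row_mul mulmxBl mulmxKpV// mul1mx subrr row0.
have [u uE] : exists u : 'rV_n.*2, v = \sum_a u 0 a *: e a.
  apply: span_tangent; apply: submx_full; rewrite row_full_unit -row_free_unit.
  exact: fE.
by rewrite {1}uE; apply: eq_bigr => a _; rewrite {1}uE coef.
Qed.

Lemma exists_not_spanned x k (e : 'I_k -> tangent x) : (k < n.*2)%N ->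
  exists f : tangent x, forall u : 'rV[R]_k, f != \sum_a u 0 a *: e a.
Proof.
move=> kn; set c := chart_at x; set E := \matrix_(a < k) (e a c).
have [ax xx] := chart_atP x.
have /row_subPn[i ni] : ~~ (1%:M <= E)%MS.
  apply/negP => /mxrankS; rewrite mxrank1 => /leq_trans/(_ (rank_leq_row E)).
  by rewrite leqNgt kn.
exists (mk_tangent x c (row i 1%:M)) => u; apply/eqP => fE; move/negP: ni; apply.
have := mk_tangentK (row i 1%:M) ax xx; rewrite fE coords_sum => <-.
apply: summx_sub => a _; rewrite coordsZ; apply: scalemx_sub.
by rewrite -(rowK (fun a => e a c)) row_sub.
Qed.

End MetricAlgebra.

Section ParallelFrames.
Context {R : realType} {n : nat} {M : manifold R n.*2}.
Context (H : hermitian_structure M) (D : conn (M := M)) (hD : is_chern H D).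
Implicit Types (x : M) (X Y : vfield M).

Let cD : is_connection D := chern_connection hD.

Lemma conn0 x (v : tangent x) : D v (fun=> 0) = 0.
Proof.
have s0 : vf_smooth_at x (fun=> 0 : tangent _) := vf_smooth0 x.
have := connD cD v s0 s0; have -> : (fun y : M => 0 + 0 : tangent y) = (fun=> 0).
  by apply: functional_extensionality_dep => y; rewrite addr0.
by move=> /eqP; rewrite addrC -subr_eq subrr => /eqP<-.
Qed.

Lemma conn_sum x (v : tangent x) (I : Type) (r : seq I) (X : I -> vfield M) :
  (forall i, vf_smooth_at x (X i)) ->
  D v (fun y => \sum_(i <- r) X i y) = \sum_(i <- r) D v (X i).
Proof.
move=> sX; elim: r => [|i r IH].
  rewrite big_nil -[RHS](conn0 v); congr (D v _).
  by apply: functional_extensionality_dep => y; rewrite big_nil.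
rewrite big_cons -IH -(connD cD v (sX i)); last exact: vf_smooth_sum.
by congr (D v _); apply: functional_extensionality_dep => y; rewrite big_cons.
Qed.

Definition parallel_at x X := forall u : tangent x, D u X = 0.

Lemma conn_linear_sum x (I : Type) (r : seq I) (k : I -> R) (u : I -> tangent x) X :
  vf_smooth_at x X ->
  D (\sum_(i <- r) k i *: u i) X = \sum_(i <- r) k i *: D (u i) X.
Proof.
move=> sX; elim: r => [|i r IH]; last by rewrite !big_cons (conn_linear cD)// IH.
rewrite !big_nil; have := conn_linear cD 1 0 0 sX.
by rewrite scale1r addr0 scale1r => /eqP; rewrite addrC -subr_eq subrr => /eqP<-.
Qed.

(* The coefficients of the extension are affine in the coordinates of a      *)
(* chart, with linear part given by the Christoffel symbols.                  *)
Lemma parallel_extension x (f : tangent x) :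
  exists X, [/\ vf_smooth_at x X, X x = f & parallel_at x X].
Proof.
have [ax xx] := chart_atP x; set c := chart_at x in ax xx.
pose E i := cfield (M := M) c (delta_mx 0 i).
have sE i : vf_smooth_at x (E i) by exact: cfield_smooth.
pose G k j i := D (E k x) (E j) c 0 i.
pose h i y := f c 0 i - \sum_j f c 0 j * \sum_k G k j i * (cmap c y 0 k - cmap c x 0 k).
have st k : smooth_at x (fun y => cmap c y 0 k - cmap c x 0 k).
  by apply: smooth_atB; [exact: smooth_at_cmap|exact: smooth_at_cst].
have sG j i : smooth_at x (fun y => \sum_k G k j i * (cmap c y 0 k - cmap c x 0 k)).
  by apply: smooth_at_sum => k _; exact: (smooth_atM (smooth_at_cst _ _) (st k)).
have sh i : smooth_at x (h i).
  apply: smooth_atB; first exact: smooth_at_cst.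
  by apply: smooth_at_sum => j _; exact: (smooth_atM (smooth_at_cst _ _) (sG j i)).
have hx i : h i x = f c 0 i.
  rewrite /h big1 ?subr0// => j _; rewrite big1 ?mulr0// => k _.
  by rewrite subrr mulr0.
have dh (u : tangent x) i : der u (h i) = - \sum_j f c 0 j * \sum_k G k j i * u c 0 k.
  rewrite /h derB; [|exact: smooth_at_cst|]; last first.
    by apply: smooth_at_sum => j _; exact: (smooth_atM (smooth_at_cst _ _) (sG j i)).
  rewrite der_cst sub0r der_sum; last first.
    by move=> j _; exact: (smooth_atM (smooth_at_cst _ _) (sG j i)).
  congr (- _); apply: eq_bigr => j _; rewrite (derZ _ _ (sG j i)); congr (_ * _).
  rewrite der_sum; last by move=> k _; exact: (smooth_atM (smooth_at_cst _ _) (st k)).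
  apply: eq_bigr => k _; rewrite (derZ _ _ (st k)); congr (_ * _).
  rewrite (derB _ (smooth_at_cmap x k) (smooth_at_cst x _)) der_cst subr0.
  exact: der_cmap.
exists (fun y => \sum_i h i y *: E i y); split.
- by apply: vf_smooth_sum => i _; exact: vf_smoothZ.
- rewrite [RHS](cfield_sum f ax xx); apply: eq_bigr => i _.
  by rewrite hx.
move=> u; rewrite conn_sum => [|i]; last exact: vf_smoothZ.
transitivity (\sum_i (der u (h i) *: E i x + h i x *: D u (E i))).
  by apply: eq_bigr => i _; exact: (conn_leibniz cD).
apply: (tangent_inj ax xx); rewrite coords_sum coords0; apply/rowP => l.
rewrite summxE mxE.
transitivity (\sum_i der u (h i) * (E i x c 0 l) + \sum_i f c 0 i * (D u (E i) c 0 l)).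
  rewrite -big_split; apply: eq_bigr => i _.
  by rewrite coordsD !coordsZ !mxE hx.
have Ex i : E i x c 0 l = (l == i)%:R by rewrite /E /cfield mk_tangentK// mxE eqxx.
have DE i : D u (E i) c 0 l = \sum_k G k i l * u c 0 k.
  rewrite {1}(cfield_sum u ax xx) (conn_linear_sum _ _ _ (sE i)) coords_sum summxE.
  by apply: eq_bigr => k _; rewrite coordsZ mxE mulrC.
have -> : \sum_i der u (h i) * E i x c 0 l = der u (h l).
  rewrite -[RHS]mulr1 (bigD1 l isT) /= Ex eqxx [X in _ + X]big1 ?addr0// => i li.
  by rewrite Ex eq_sym (negPf li) mulr0.
rewrite dh addrC; apply/eqP; rewrite subr_eq0; apply/eqP.
by apply: eq_bigr => i _; rewrite DE.
Qed.

Lemma der_metric0 x (u : tangent x) X Y : vf_smooth_at x X -> vf_smooth_at x Y ->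
  parallel_at x X -> parallel_at x Y ->
  der u (fun y => metric H (X y) (Y y)) = 0.
Proof.
by move=> sX sY pX pY; rewrite (chern_metric hD)// pX pY metric0l metric0r addr0.
Qed.

Lemma parallelZ x (f : M -> R) X : smooth_at x f -> vf_smooth_at x X ->
  (forall u : tangent x, der u f = 0) -> parallel_at x X ->
  parallel_at x (fun y => f y *: X y).
Proof.
by move=> sf sX df pX u; rewrite (conn_leibniz cD)// df pX scale0r scaler0 addr0.
Qed.

Lemma parallelD x X Y : vf_smooth_at x X -> vf_smooth_at x Y ->
  parallel_at x X -> parallel_at x Y -> parallel_at x (fun y => X y + Y y).
Proof. by move=> sX sY pX pY u; rewrite (connD cD)// pX pY addr0. Qed.

Lemma parallel_sum x (I : Type) (r : seq I) (X : I -> vfield M) :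
  (forall i, vf_smooth_at x (X i)) -> (forall i, parallel_at x (X i)) ->
  parallel_at x (fun y => \sum_(i <- r) X i y).
Proof. by move=> sX pX u; rewrite conn_sum// big1// => i _; exact: pX. Qed.

(** Scalar products of fields parallel at [x] have derivative zero at [x], and so do the
    Gram-Schmidt coefficients built from them. Hence orthonormalisation keeps fields parallel at
    [x]. *)
Lemma gram_schmidt_step x k (e : 'I_k -> vfield M) : (k < n.*2)%N ->
  (forall a, vf_smooth_at x (e a)) -> (forall a, parallel_at x (e a)) ->
  (\forall y \near x, forall a b, metric H (e a y) (e b y) = (a == b)%:R) ->
  exists X, [/\ vf_smooth_at x X, parallel_at x X &
    \forall y \near x, metric H (X y) (X y) = 1 /\
      forall a, metric H (X y) (e a y) = 0].
Proof.
move=> kn se pe oe; have oex := nbhs_singleton oe.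
have [f nf] := exists_not_spanned (fun a => e a x) kn.
have [F [sF Fx pF]] := parallel_extension f.
have sg a : smooth_at x (fun y => - metric H (F y) (e a y)).
  by apply: smooth_atN; exact: metric_smooth.
have sT a : vf_smooth_at x (fun y => - metric H (F y) (e a y) *: e a y).
  exact: vf_smoothZ.
have pT a : parallel_at x (fun y => - metric H (F y) (e a y) *: e a y).
  apply: parallelZ => // u; rewrite derN; last exact: metric_smooth.
  by rewrite der_metric0// oppr0.
pose F' : vfield M := fun y => F y + \sum_a - metric H (F y) (e a y) *: e a y.
have sS : vf_smooth_at x (fun y => \sum_a - metric H (F y) (e a y) *: e a y).
  by apply: vf_smooth_sum => a _; exact: sT.
have sF' : vf_smooth_at x F' by exact: vf_smoothD.
have pF' : parallel_at x F' by apply: parallelD => //; exact: parallel_sum.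
(* [f] lies outside the span of the [e a x], so its orthogonal part does not vanish at [x]. *)
have N0 : 0 < metric H (F' x) (F' x).
  apply: metric_gt0; rewrite /F' Fx.
  have := nf (\row_a metric H f (e a x)); apply: contra => /eqP/eqP.
  rewrite addr_eq0 => /eqP fE; apply/eqP; rewrite [LHS]fE -sumrN.
  by apply: eq_bigr => a _; rewrite mxE scaleNr opprK.
have sN : smooth_at x (fun y => metric H (F' y) (F' y)) by exact: metric_smooth.
have sI := smooth_at_invsqrt sN N0.
exists (fun y => (Num.sqrt (metric H (F' y) (F' y)))^-1 *: F' y); split.
- exact: vf_smoothZ.
- by apply: parallelZ => // u; apply: der_invsqrt0 => //; exact: der_metric0.
have nN := smooth_at_gt0 sN N0.
near=> y; split.
  rewrite metricZl metricZr mulrA -invfM -expr2 sqr_sqrtr ?mulVf//.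
    by rewrite gt_eqF//; near: y.
  by apply: ltW; near: y.
move=> a; rewrite metricZl; set q := _^-1.
rewrite /F' metricDl metric_suml (bigD1 a isT) /=.
have oey : forall a b, metric H (e a y) (e b y) = (a == b)%:R by near: y.
rewrite metricZl oey eqxx mulr1 big1 ?addr0 ?addrN ?mulr0// => b ba.
by rewrite metricZl oey (negPf ba) mulr0.
Unshelve. all: by end_near. Qed.

Lemma cplx0 x : cplx H (0 : tangent x) = 0.
Proof.
have := cplxP H 1 (0 : tangent x) 0; rewrite !scale1r addr0 => /eqP.
by rewrite addrC -subr_eq subrr => /eqP<-.
Qed.

Lemma cplx_parallel x X : vf_smooth_at x X -> parallel_at x X ->
  parallel_at x (fun y => cplx H (X y)).
Proof.
by move=> sX pX u; rewrite (chern_cplx hD)// pX cplx0.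
Qed.

(** The frame is parallel at the single point [x] only, which is possible whatever the curvature. It
    is built one complex line at a time: [JX] is parallel at [x] since the connection preserves [J],
    and it is orthogonal to [X] and to the earlier [J]-stable planes. *)
Lemma parallel_uframe_exists x :
  exists e : local_frame (M := M), uframe_near H x e /\ forall u a, D (x := x) u (e a) = 0.
Proof.
suff: forall k, (k <= n)%N -> exists e : nat -> vfield M,
    [/\ forall a, vf_smooth_at x (e a), forall a, parallel_at x (e a),
      (forall j y, cplx H (e j.*2 y) = e j.*2.+1 y) &
      \forall y \near x, forall a b, (a < k.*2)%N -> (b < k.*2)%N ->
        metric H (e a y) (e b y) = (a == b)%:R].
  move=> /(_ n (leqnn n))[e [se pe Je oe]]; exists (fun a : 'I_n.*2 => e a).
  split; last by move=> u a; exact: pe.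
  split; first by move=> a; exact: se.
  apply: filterS oe => y oe; split=> a b; first by rewrite oe.
  move=> oa; rewrite /frame_at => ->; rewrite -[in LHS](odd_double_half a).
  by rewrite (negPf oa) add0n Je -[in RHS](odd_double_half a) (negPf oa).
elim=> [|k IH] kn.
  (* Fields not yet constructed are 0. As [J] fixes 0, the relation between even and odd indices can
     be required for all [j] at every stage. *)
  exists (fun _ y => 0); split=> [a|a u|j y|].
  - exact: vf_smooth0.
  - exact: conn0.
  - exact: cplx0.
  - exact: nearW.
have [e [se pe Je oe]] := IH (ltnW kn).
have [X [sX pX oX]] : exists X, [/\ vf_smooth_at x X, parallel_at x X &
    \forall y \near x, metric H (X y) (X y) = 1 /\
      forall a : 'I_k.*2, metric H (X y) (e a y) = 0].
  apply: (gram_schmidt_step (e := fun a : 'I_k.*2 => e a)) => //.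
    by rewrite ltn_double.
  by apply: filterS oe => y oe a b; rewrite oe.
pose JX : vfield M := fun y => cplx H (X y).
have sJX : vf_smooth_at x JX by exact: cplx_smooth.
have pJX : parallel_at x JX by exact: cplx_parallel.
exists (fun a => if a == k.*2 then X else if a == k.*2.+1 then JX else e a); split.
- by move=> a; case: ifP => // _; case: ifP.
- by move=> a; case: ifP => // _; case: ifP.
- move=> j y; rewrite (inj_eq double_inj) eqSS (inj_eq double_inj).
  have [->|jk] := eqVneq j k.
    by rewrite -[X in X == k.*2]addn1 -[X in _ == X]addn0 eqn_add2l.
  rewrite [j.*2 == _]negbTE; last by apply/eqP => /(congr1 odd); rewrite /= !odd_double.
  rewrite [j.*2.+1 == _]negbTE; last by apply/eqP => /(congr1 odd); rewrite /= !odd_double.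
  exact: Je.
near=> y.
have oey : forall a b, (a < k.*2)%N -> (b < k.*2)%N ->
  metric H (e a y) (e b y) = (a == b)%:R by near: y.
have [XX Xe] : metric H (X y) (X y) = 1 /\
  forall a : 'I_k.*2, metric H (X y) (e a y) = 0 by near: y.
have Xe' a : (a < k.*2)%N -> metric H (X y) (e a y) = 0.
  by move=> ak; exact: (Xe (Ordinal ak)).
have JXe a : (a < k.*2)%N -> metric H (JX y) (e a y) = 0.
  move=> ak; rewrite -(odd_double_half a); case: (boolP (odd a)) => oa.
    rewrite add1n -Je cplx_metric Xe'//.
    by apply: leq_ltn_trans ak; rewrite -{2}(odd_double_half a) leq_addl.
  rewrite add0n /JX cplx_skew Je Xe' ?oppr0//.
  rewrite -[a./2.*2.+1]add1n; move: ak; rewrite -{1}(odd_double_half a) (negPf oa) add0n.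
  by rewrite !ltn_double add1n ltn_Sdouble.
have XJX : metric H (X y) (JX y) = 0 by rewrite metricC cplx_orth.
have JXJX : metric H (JX y) (JX y) = 1 by rewrite cplx_metric.
have lt2 a : (a < k.+1.*2)%N -> a != k.*2 -> a != k.*2.+1 -> (a < k.*2)%N.
  by rewrite doubleS !ltnS => h1 h2 h3; rewrite ltn_neqAle h2 -ltnS ltn_neqAle h3.
have neS : (k.*2.+1 == k.*2) = false by rewrite gtn_eqF.
move=> a b ak bk /=.
have [aE|ak2] := eqVneq a k.*2; have [bE|bk2] := eqVneq b k.*2.
- by rewrite XX aE bE eqxx.
- have [bE|bk3] := eqVneq b k.*2.+1; first by rewrite XJX aE bE eq_sym neS.
  by rewrite Xe' ?lt2// aE eq_sym (negPf bk2).
- have [aE|ak3] := eqVneq a k.*2.+1; first by rewrite metricC XJX aE bE neS.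
  by rewrite metricC Xe' ?lt2// bE (negPf ak2).
have [aE|ak3] := eqVneq a k.*2.+1; have [bE|bk3] := eqVneq b k.*2.+1.
- by rewrite JXJX aE bE eqxx.
- by rewrite JXe ?lt2// aE eq_sym (negPf bk3).
- by rewrite metricC JXe ?lt2// bE (negPf ak3).
by rewrite oey ?lt2.
Unshelve. all: by end_near. Qed.

End ParallelFrames.

(** * Associated bundles *)

Section FrameTransitions.
Context {R : realType} {n : nat} {M : manifold R n.*2}.
Context (H : hermitian_structure M).
Implicit Types (x : M) (A B : 'M[R[i]]_n).

(** The matrix [A] with [frame_act e A = e'] (see [trans_act]). Column [k] lists the complex
    coordinates of the vector of [e'] of index [2k]; those of odd index follow by applying [J]. *)
Definition trans x (e e' : frame x) : 'M[R[i]]_n :=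
  \matrix_(j, k) (metric H (e' (even_ord k)) (e (even_ord j)) +i*
                  metric H (e' (even_ord k)) (e (odd_ord j))).

Lemma uframe_odd x (e : frame x) j : uframe H e ->
  e (odd_ord j) = cplx H (e (even_ord j)).
Proof. by move=> [_ Je]; rewrite (Je _ (odd_ord j))// odd_even_ord. Qed.

Lemma realify_trans x (e e' : frame x) a b : uframe H e -> uframe H e' ->
  realify (trans e e') a b = metric H (e' b) (e a).
Proof.
move=> ue ue'; elim/(@ord_parity_ind n): a => j; elim/(@ord_parity_ind n): b => k;
  rewrite realifyE mxE//=; rewrite !(uframe_odd _ ue) !(uframe_odd _ ue').
  by rewrite cplx_skew.
by rewrite cplx_metric.
Qed.

Lemma trans_act x (e e' : frame x) : uframe H e -> uframe H e' ->
  frame_act e (trans e e') = e'.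
Proof.
move=> ue ue'; apply/funext => b; have [oe _] := ue.
rewrite [RHS](orthonormal_expand oe); apply: eq_bigr => a _.
by rewrite realify_trans.
Qed.

Lemma trans_unitary x (e e' : frame x) : uframe H e -> uframe H e' ->
  trans e e' \is unitarymx.
Proof.
move=> ue ue'; apply/unitary_realify; apply: mulmx1C; apply/matrixP => a b.
rewrite mxE [RHS]mxE; have [oe _] := ue; have [oe' _] := ue'.
rewrite -oe' {1}(orthonormal_expand oe (e' a)) metric_suml.
by apply: eq_bigr => c _; rewrite [_^T a c]mxE !realify_trans// metricZl (metricC H (e c)).
Qed.

Lemma metric_frame_act x (e : frame x) A a c : uframe H e ->
  metric H (frame_act e A a) (e c) = realify A c a.
Proof.
move=> [oe _]; rewrite /frame_act metric_suml (bigD1 c)//= metricZl oe eqxx mulr1.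
by rewrite big1 ?addr0// => b bc; rewrite metricZl oe (negPf bc) mulr0.
Qed.

Lemma frame_act_inj x (e : frame x) A B : uframe H e ->
  frame_act e A = frame_act e B -> A = B.
Proof.
move=> ue AB; apply: realify_inj; apply/matrixP => a b.
by rewrite -!(metric_frame_act _ _ _ ue) AB.
Qed.

Lemma frame_act1 x (e : frame x) : frame_act e 1%:M = e.
Proof.
apply/funext => b; rewrite /frame_act realify1 (bigD1 b)//= mxE eqxx scale1r.
by rewrite big1 ?addr0// => a ab; rewrite mxE (negPf ab) scale0r.
Qed.

Lemma frame_actM x (e : frame x) A B :
  frame_act (frame_act e A) B = frame_act e (A *m B).
Proof.
apply/funext => b; rewrite /frame_act realifyM.
under eq_bigr do rewrite scaler_sumr.
rewrite exchange_big; apply: eq_bigr => c _; rewrite mxE scaler_suml.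
by apply: eq_bigr => a _; rewrite scalerA mulrC.
Qed.

Lemma frame_act_uframe x (e : frame x) A : uframe H e -> A \is unitarymx ->
  uframe H (frame_act e A).
Proof.
move=> ue /unitary_realify/mulmx1C uA; have [oe Je] := ue; split=> [a b|a b].
  transitivity (((realify A)^T *m realify A) a b); last by rewrite uA mxE.
  rewrite {2}/frame_act metric_sumr mxE; apply: eq_bigr => c _.
  by rewrite metricZr metric_frame_act// [_^T a c]mxE mulrC.
have JS I (r : seq I) (F : I -> tangent x) :
    cplx H (\sum_(i <- r) F i) = \sum_(i <- r) cplx H (F i).
  apply: (big_morph (fun v : tangent x => cplx H v) _ (cplx0 H x)) => u v.
  by have := cplxP H 1 u v; rewrite !scale1r.
have JZ k (v : tangent x) : cplx H (k *: v) = k *: cplx H v.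
  by have := cplxP H k v 0; rewrite cplx0 !addr0.
elim/(@ord_parity_ind n): a => j; last by rewrite odd_odd_ord.
move=> _ bE; have -> : b = odd_ord j by apply: val_inj.
rewrite /frame_act JS !sum_parity; apply: eq_bigr => k _.
rewrite !realifyE !JZ -(uframe_odd _ ue) addrC; congr (_ + _).
have -> : cplx H (e (odd_ord k)) = - e (even_ord k) by rewrite uframe_odd// cplxK.
by rewrite scalerN scaleNr.
Qed.

Lemma trans_frame_act x (e : frame x) A : uframe H e -> A \is unitarymx ->
  trans e (frame_act e A) = A.
Proof.
move=> ue uA; apply: (frame_act_inj ue).
by rewrite trans_act//; exact: frame_act_uframe.
Qed.

Lemma trans_id x (e : frame x) : uframe H e -> trans e e = 1%:M.
Proof. by move=> ue; rewrite -{2}(frame_act1 e) trans_frame_act//; exact: unitary1. Qed.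

Lemma trans_mul x (e e' e'' : frame x) : uframe H e -> uframe H e' ->
  uframe H e'' -> trans e e' *m trans e' e'' = trans e e''.
Proof.
move=> ue ue' ue''; apply: (frame_act_inj ue).
by rewrite -frame_actM !trans_act.
Qed.

Lemma uframe_near_near x (e : local_frame (M := M)) : uframe_near H x e ->
  \forall y \near x, uframe_near H y e.
Proof.
move=> [se ue]; have n1 : \forall y \near x, forall a, vf_smooth_at y (e a).
  by apply: filter_forall => a; exact: vf_smooth_near.
have n2 := near_join ue.
near=> y; split; near: y; [exact: n1|exact: n2].
Unshelve. all: by end_near. Qed.

Lemma uframe_near_at x (e : local_frame (M := M)) : uframe_near H x e ->
  uframe H (frame_at e x).
Proof. by move=> [_ /nbhs_singleton]. Qed.

Lemma trans_smooth x (e e' : local_frame (M := M)) j k : uframe_near H x e ->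
  uframe_near H x e' ->
  csmooth_at x (fun y => trans (frame_at e y) (frame_at e' y) j k).
Proof.
move=> [se _] [se' _]; split.
  apply: smooth_at_ext (metric_smooth H (se' (even_ord k)) (se (even_ord j))).
  by apply: nearW => y; rewrite mxE.
apply: smooth_at_ext (metric_smooth H (se' (even_ord k)) (se (odd_ord j))).
by apply: nearW => y; rewrite mxE.
Qed.

Lemma trans_unitary_near x (e e' : local_frame (M := M)) : uframe_near H x e ->
  uframe_near H x e' ->
  \forall y \near x, trans (frame_at e y) (frame_at e' y) \is unitarymx.
Proof. by move=> [_ ue] [_ ue']; apply: filterS2 ue ue' => y; exact: trans_unitary. Qed.

(** As [e] is parallel at [x], metric compatibility leaves only the term with the derivative of
    [e']. Between two frames parallel at [x] the transition matrix thus has derivative zero. *)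
Lemma cder_trans x (D : conn (M := M)) (hD : is_chern H D) (v : tangent x)
    (e e' : local_frame (M := M)) j k :
  uframe_near H x e -> uframe_near H x e' -> (forall u a, D x u (e a) = 0) ->
  cder v (fun y => trans (frame_at e y) (frame_at e' y) j k) =
    metric H (D x v (e' (even_ord k))) (e (even_ord j) x) +i*
    metric H (D x v (e' (even_ord k))) (e (odd_ord j) x).
Proof.
move=> [se _] [se' _] pe; rewrite /cder; congr (_ +i* _).
  rewrite -[RHS]addr0 -(metric0r H (e' (even_ord k) x)) -(pe v (even_ord j)).
  rewrite -(chern_metric hD v (se' _) (se _)); congr (der v _); apply/funext => y.
  by rewrite mxE.
rewrite -[RHS]addr0 -(metric0r H (e' (even_ord k) x)) -(pe v (odd_ord j)).
rewrite -(chern_metric hD v (se' _) (se _)); congr (der v _); apply/funext => y.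
by rewrite mxE.
Qed.

End FrameTransitions.

Section AssociatedBundles.
Context {R : realType} {n : nat} {M : manifold R n.*2}.
Context (H : hermitian_structure M) (D : conn (M := M)) (hD : is_chern H D).
Context (V : urep R n) (b : findim (uspace V)).
Implicit Types (x : M) (A B : 'M[R[i]]_n).

(* Replaces the smoothness of the representation as a map on the Lie group    *)
(* U_n: it is only ever composed with families of unitary matrices.           *)
Record smooth_urep : Prop := {
  urep1 : forall t, uact V 1%:M t = t;
  urepM : forall A B t, A \is unitarymx -> B \is unitarymx ->
    uact V (A *m B) t = uact V A (uact V B t);
  urep_smooth : forall x (A : M -> 'M[R[i]]_n),
    (forall j k, csmooth_at x (fun y => A y j k)) ->
    (\forall y \near x, A y \is unitarymx) ->
    forall t, vsmooth_at x (fun y => uact V (A y) t);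
  urep_der0 : forall x (v : tangent x) (A : M -> 'M[R[i]]_n),
    (forall j k, csmooth_at x (fun y => A y j k)) ->
    (\forall y \near x, A y \is unitarymx) ->
    (forall j k, cder v (fun y => A y j k) = 0) ->
    forall t, vder b v (fun y => uact V (A y) t) = 0 }.

Hypothesis sV : smooth_urep.

Lemma mk_assocE x (s : frame x -> uspace V) (e : frame x) :
  (forall e' A, uframe H e' -> A \is unitarymx ->
     uact V A (s (frame_act e' A)) = s e') ->
  uframe H e -> mk_assoc H V s e = s e.
Proof.
move=> es ue; rewrite /mk_assoc insubdK; first by case: asboolP.
apply/asboolP; split=> [e' ne|e' A ue' uA]; first by case: asboolP.
case: asboolP => [_|[]]; last exact: frame_act_uframe.
by case: asboolP => // _; exact: es.
Qed.

Lemma assoc_act x (s : assoc H V x) (e : frame x) A : uframe H e ->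
  A \is unitarymx -> uact V A (s (frame_act e A)) = s e.
Proof. by have /asboolP[_] := assocP s; apply. Qed.

Lemma assoc_trans x (s : assoc H V x) (e e' : frame x) : uframe H e ->
  uframe H e' -> s e = uact V (trans H e e') (s e').
Proof.
move=> ue ue'; rewrite -{2}(trans_act ue ue') assoc_act//.
exact: trans_unitary.
Qed.

Lemma assoc_ext x (e : frame x) (s t : assoc H V x) : uframe H e ->
  s e = t e -> s = t.
Proof.
move=> ue st; apply: val_inj; apply/funext => e' /=.
have [ue'|nu] := pselect (uframe H e').
  by rewrite (assoc_trans s ue' ue) st -assoc_trans.
by have /asboolP[-> //] := assocP s; have /asboolP[-> //] := assocP t.
Qed.

Lemma assocD x (s t : assoc H V x) e : (s + t) e = s e + t e.
Proof. by []. Qed.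

Lemma assocZ x a (s : assoc H V x) e : (a *: s) e = a *: s e.
Proof. by []. Qed.

Lemma assoc0 x e : (0 : assoc H V x) e = 0.
Proof. by []. Qed.

Lemma assoc_sum x I (r : seq I) (P : pred I) (F : I -> assoc H V x) e :
  (\sum_(i <- r | P i) F i) e = \sum_(i <- r | P i) F i e.
Proof.
exact: (big_morph (fun s : assoc H V x => s e) (fun s t => assocD s t e) (assoc0 e)).
Qed.

(** The inverse of evaluation at [e]: it identifies the representation space with the fibre. *)
Definition at_frame x (e : frame x) (t : uspace V) : assoc H V x :=
  mk_assoc H V (fun e' => uact V (trans H e' e) t).

Lemma at_frameE x (e e' : frame x) t : uframe H e -> uframe H e' ->
  at_frame e t e' = uact V (trans H e' e) t.
Proof.
move=> ue ue'; rewrite /at_frame mk_assocE// => e1 A ue1 uA.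
have ue2 := frame_act_uframe ue1 uA.
rewrite -(urepM sV _ uA (trans_unitary ue2 ue)).
by rewrite -{1}(trans_frame_act ue1 uA) trans_mul.
Qed.

Lemma at_frame_id x (e : frame x) t : uframe H e -> at_frame e t e = t.
Proof. by move=> ue; rewrite at_frameE// trans_id// (urep1 sV). Qed.

Lemma uact_expand A t : uact V A t = \sum_i fd_dual b i t *: uact V A (fd_vec b i).
Proof. by rewrite {1}(fd_sum b t) linear_sum; apply: eq_bigr => i _; rewrite linearZ. Qed.

Lemma uact_smooth x (A : M -> 'M[R[i]]_n) (t : M -> uspace V) :
  (forall j k, csmooth_at x (fun y => A y j k)) ->
  (\forall y \near x, A y \is unitarymx) -> vsmooth_at x t ->
  vsmooth_at x (fun y => uact V (A y) (t y)).
Proof.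
move=> sA uA st; apply: (@vsmooth_ext _ _ _ _ _
    (fun y => \sum_i fd_dual b i (t y) *: uact V (A y) (fd_vec b i))).
  by apply: nearW => y; rewrite [RHS]uact_expand.
by apply: vsmooth_sum => i _; apply: vsmoothZ; [exact: st|exact: urep_smooth].
Qed.

Lemma vder_uact x (v : tangent x) (A : M -> 'M[R[i]]_n) (t : M -> uspace V) :
  (forall j k, csmooth_at x (fun y => A y j k)) ->
  (\forall y \near x, A y \is unitarymx) -> vsmooth_at x t ->
  vder b v (fun y => uact V (A y) (t y)) =
    uact V (A x) (vder b v t) + vder b v (fun y => uact V (A y) (t x)).
Proof.
move=> sA uA st; have sAb i := urep_smooth sV sA uA (fd_vec b i).
have E (s : M -> uspace V) : (fun y => uact V (A y) (s y)) =
    (fun y => \sum_i fd_dual b i (s y) *: uact V (A y) (fd_vec b i)).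
  by apply/funext => y; rewrite [LHS]uact_expand.
rewrite E vder_sum => [|i _]; last exact: (vsmoothZ (st _) (sAb i)).
rewrite (E (fun=> t x)) vder_sum => [|i _]; last first.
  exact: (vsmoothZ (csmooth_cst x _) (sAb i)).
rewrite {1}/vder linear_sum -big_split; apply: eq_bigr => i _.
transitivity (cder v (fun y => fd_dual b i (t y)) *: uact V (A x) (fd_vec b i) +
   fd_dual b i (t x) *: vder b v (fun y => uact V (A y) (fd_vec b i))).
  exact: (vderZ b v (st (fd_dual b i)) (sAb i)).
congr (_ + _); first by rewrite linearZ.
symmetry; apply: (etrans (vderZ b v (csmooth_cst x (fd_dual b i (t x))) (sAb i))).
by rewrite cder_cst scale0r add0r.
Qed.

Lemma vder_uact0 x (v : tangent x) (A : M -> 'M[R[i]]_n) (t : M -> uspace V) :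
  (forall j k, csmooth_at x (fun y => A y j k)) ->
  (\forall y \near x, A y \is unitarymx) ->
  (forall j k, cder v (fun y => A y j k) = 0) -> vsmooth_at x t ->
  vder b v (fun y => uact V (A y) (t y)) = uact V (A x) (vder b v t).
Proof. by move=> sA uA dA st; rewrite vder_uact// (urep_der0 sV)// addr0. Qed.

(** One local frame suffices, since transition matrices between local unitary frames are smooth. *)
Lemma assoc_smoothP x (e : local_frame (M := M)) (s : forall y, assocB H V y) :
  uframe_near H x e ->
  sec_smooth x s <-> vsmooth_at x (fun y => s y (frame_at e y)).
Proof.
move=> ue; split=> [|se e' ue']; first exact.
have := uact_smooth (fun j k => trans_smooth j k ue' ue)
  (trans_unitary_near ue' ue) se.
apply: vsmooth_ext; have [[_ n1] [_ n2]] := (ue, ue').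
by apply: filterS2 n1 n2 => y uy uy'; rewrite -assoc_trans.
Qed.

Lemma assoc_smooth_near x (s : forall y, assocB H V y) : sec_smooth x s ->
  \forall y \near x, sec_smooth y s.
Proof.
move=> ss; have [e [ue _]] := parallel_uframe_exists hD x.
have := vsmooth_near b (ss e ue); have := uframe_near_near ue.
by apply: filterS2 => y uy sy; apply/(assoc_smoothP _ uy).
Qed.

Lemma at_frame_smooth x (e : local_frame (M := M)) (t : M -> uspace V) :
  uframe_near H x e -> vsmooth_at x t ->
  sec_smooth x (fun y => at_frame (frame_at e y) (t y) : assocB H V y).
Proof.
move=> ue st; apply/(assoc_smoothP _ ue); apply: vsmooth_ext st.
by have [_] := ue; apply: filterS => y uy; rewrite at_frame_id.
Qed.

(** The condition defining [assoc_cov] ranges over all frames parallel at [x]. The element whose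
    value at [e] is the derivative of the components satisfies it, because transition matrices
    between such frames act with derivative zero; and the condition, applied to [e], determines the
    element. *)
Lemma assoc_covE x (v : tangent x) (e : local_frame (M := M))
    (s : forall y, assocB H V y) :
  sec_smooth x s -> uframe_near H x e -> (forall u a, D (x := x) u (e a) = 0) ->
  (assoc_cov H D V x v s : assoc H V x) (frame_at e x) =
    vder b v (fun y => s y (frame_at e y)).
Proof.
move=> ss ue pe; apply: (scalar_ext b) => l; rewrite (vderP _ _ _ (ss e ue)).
rewrite /assoc_cov; set P := [set t | _].
suff : P (xget 0 P) by apply.
apply: (@xgetPex _ 0); exists (at_frame (frame_at e x)
  (vder b v (fun y => s y (frame_at e y)))) => e' ue' pe' l'.
rewrite at_frameE; [|exact: uframe_near_at|exact: uframe_near_at].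
have d0 j k : cder v (fun y => trans H (frame_at e' y) (frame_at e y) j k) = 0.
  by rewrite (cder_trans hD)// pe !metric0l.
have sA j k := trans_smooth j k ue' ue.
rewrite -(vder_uact0 sA (trans_unitary_near ue' ue) d0 (ss e ue)).
rewrite (vderP _ _ _ (uact_smooth sA (trans_unitary_near ue' ue) (ss e ue))).
apply: cder_ext.
  exact: (uact_smooth sA (trans_unitary_near ue' ue) (ss e ue) l').
have [[_ n1] [_ n2]] := (ue, ue').
by apply: filterS2 n1 n2 => y uy uy'; rewrite -assoc_trans.
Qed.

End AssociatedBundles.

(** * Clifford algebras and spin modules *)

(** The universal property takes values in nonzero algebras. That [2 ^ n] is positive has to be
    proved, so the matrix algebra receives this structure under a name of its own. *)
Definition spin_end (R : realType) n := 'M[R[i]]_(2 ^ n).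

Section SpinEndAlgebra.
Context (R : realType) (n : nat).

HB.instance Definition _ := GRing.PzRing.on (spin_end R n).
HB.instance Definition _ := GRing.Lmodule.on (spin_end R n).

Lemma spin_end_nonzero1 : 1 != 0 :> spin_end R n.
Proof.
have h : (0 < 2 ^ n)%N by rewrite expn_gt0.
apply/eqP => /matrixP/(_ (Ordinal h) (Ordinal h))/eqP.
by rewrite !mxE eqxx oner_eq0.
Qed.

HB.instance Definition _ :=
  GRing.PzSemiRing_isNonZero.Build (spin_end R n) spin_end_nonzero1.
HB.instance Definition _ :=
  GRing.LSemiModule_isLSemiAlgebra.Build R[i] (spin_end R n) (@scalemxAl _ _ _ _).
HB.instance Definition _ := GRing.LSemiAlgebra_isSemiAlgebra.Build R[i]
  (spin_end R n) (fun k => @scalemxAr _ _ _ _ k).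

End SpinEndAlgebra.

Section PermInvariance.

(** Adjacent transpositions generate the permutations. The relation will be equality for symmetric
    functions of a word, and equality up to sign for products of generators and for values of
    forms. *)
Lemma swap_perm_rel (T : eqType) (X : Type) (f : seq T -> X) (r : X -> X -> Prop) :
  (forall u, r u u) -> (forall u v w, r u v -> r v w -> r u w) ->
  (forall l1 x y l2, r (f (l1 ++ x :: y :: l2)) (f (l1 ++ y :: x :: l2))) ->
  forall l l', perm_eq l l' -> r (f l) (f l').
Proof.
move=> rr rt sw l l'; suff: forall l1 l l', perm_eq l l' -> r (f (l1 ++ l)) (f (l1 ++ l')).
  by move=> h; exact: (h [::]).

move=> {l l'} l1 l; elim: l l1 => [|x l IH] l1 l' p.
  by have /esym/size0nil -> := perm_size p.
have xl' : x \in l' by rewrite -(perm_mem p) mem_head.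
case/splitPr: xl' p => p1 p2 p.
have mv : forall q1 q2, r (f (q1 ++ x :: p1 ++ q2)) (f (q1 ++ p1 ++ x :: q2)).
  elim: p1 {p} => [|y p1 IHp] q1 q2; first exact: rr.
  apply: rt (sw q1 x y _) _.
  by have := IHp (rcons q1 y) q2; rewrite !cat_rcons.
apply: rt (mv l1 p2); rewrite -!cat_rcons; apply: IH.
rewrite -(perm_cons x); apply: perm_trans p _.
by rewrite -[x :: p2]cat1s perm_catCA.
Qed.

Lemma swap_perm_eq (T : eqType) (X : Type) (f : seq T -> X) :
  (forall l1 x y l2, f (l1 ++ x :: y :: l2) = f (l1 ++ y :: x :: l2)) ->
  forall l l', perm_eq l l' -> f l = f l'.
Proof. by move=> sw; apply: (swap_perm_rel (r := eq)) => // u v w ->. Qed.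

End PermInvariance.

Section CliffordWords.
Context {R : realType} {N : nat} (Cl : clifford R N).
Local Notation C := R[i].
Implicit Types (v w : 'rV[R]_N) (a b : 'I_N) (l : seq 'I_N).

Definition cl_gen a : Cl := cl_vec Cl (delta_mx 0 a).

Definition cl_word l : Cl := \prod_(a <- l) cl_gen a.

Lemma cl_vecD v w : cl_vec Cl (v + w) = cl_vec Cl v + cl_vec Cl w.
Proof. by have := (cl_vecP Cl).1 1 v w; rewrite !scale1r. Qed.

Lemma cl_vec0 : cl_vec Cl 0 = 0.
Proof. by have := cl_vecD 0 0; rewrite addr0 => /eqP; rewrite addrC -subr_eq subrr => /eqP<-. Qed.

Lemma cl_vecZ (k : R) v : cl_vec Cl (k *: v) = k%:C *: cl_vec Cl v.
Proof. by have := (cl_vecP Cl).1 k v 0; rewrite cl_vec0 !addr0. Qed.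

Lemma cl_vec_sum I (r : seq I) (F : I -> 'rV[R]_N) :
  cl_vec Cl (\sum_(i <- r) F i) = \sum_(i <- r) cl_vec Cl (F i).
Proof. exact: (big_morph _ cl_vecD cl_vec0). Qed.

Lemma cl_vecE v : cl_vec Cl v = \sum_a (v 0 a)%:C *: cl_gen a.
Proof.
rewrite {1}[v]row_sum_delta cl_vec_sum; apply: eq_bigr => a _.
by rewrite cl_vecZ.
Qed.

Lemma dotv_delta a b : dotv (delta_mx 0 a) (delta_mx 0 b) = (a == b)%:R :> R.
Proof.
rewrite /dotv trmx_delta mul_delta_mx_cond.
by case: (a == b); rewrite ?mulr1n ?mulr0n mxE.
Qed.

Lemma cl_genC a b : a != b -> cl_gen a * cl_gen b = - (cl_gen b * cl_gen a).
Proof.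
move=> ab; apply/eqP; rewrite -addr_eq0 (cl_vecP Cl).2 dotv_delta (negPf ab).
by rewrite mulr0 oppr0 scale0r.
Qed.

Lemma cl_vec_sqr v : dotv v v = 1 -> cl_vec Cl v * cl_vec Cl v = -1.
Proof.
move=> v1; have := (cl_vecP Cl).2 v v; rewrite v1 mulr1 -!mulr2n.
have -> : (- (2 : R))%:C%:A = (-1 : Cl) *+ 2.
  by rewrite rmorphN rmorph_nat scaleNr scaler_nat mulNrn.
move=> e; have two0 : (2 : C) != 0 by rewrite pnatr_eq0.
by apply: (scalerI two0); rewrite !scaler_nat.
Qed.

Lemma cl_gen_sqr a : cl_gen a * cl_gen a = -1.
Proof. by apply: cl_vec_sqr; rewrite dotv_delta eqxx. Qed.

Lemma cl_word_cat l l' : cl_word (l ++ l') = cl_word l * cl_word l'.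
Proof. by rewrite /cl_word big_cat. Qed.

Lemma cl_word_cons a l : cl_word (a :: l) = cl_gen a * cl_word l.
Proof. by rewrite /cl_word big_cons. Qed.

Lemma cl_word_nil : cl_word [::] = 1.
Proof. by rewrite /cl_word big_nil. Qed.

Lemma cl_gen_word a l :
  cl_gen a * cl_word l = (-1) ^+ count (predC1 a) l *: (cl_word l * cl_gen a).
Proof.
elim: l => [|b l IH]; first by rewrite cl_word_nil mulr1 mul1r scale1r.
rewrite !cl_word_cons /=; have [->|ab] := eqVneq b a.
  by rewrite add0n -!mulrA IH -scalerAr.
rewrite -mulrA [LHS]mulrA cl_genC 1?eq_sym// mulNr -[in LHS]mulrA IH -scalerAr.
by rewrite exprD expr1 mulN1r scaleNr.
Qed.

Lemma cl_word_rev l : cl_word l * cl_word (rev l) = (-1) ^+ size l.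
Proof.
elim: l => [|a l IH]; first by rewrite /rev /= cl_word_nil mulr1.
rewrite cl_word_cons rev_cons -cats1 cl_word_cat cl_word_cons cl_word_nil mulr1 /=.
rewrite mulrA -(mulrA (cl_gen a)) IH exprS commr_sign -mulrA cl_gen_sqr.
by rewrite mulrN1 mulN1r.
Qed.

Definition eq_up_to_sign (u w : Cl) := u = w \/ u = - w.

Lemma eq_up_to_sign_trans (u v w : Cl) :
  eq_up_to_sign u v -> eq_up_to_sign v w -> eq_up_to_sign u w.
Proof. by case=> -> [] ->; rewrite /eq_up_to_sign ?opprK; tauto. Qed.

Lemma cl_word_perm l l' : perm_eq l l' -> eq_up_to_sign (cl_word l) (cl_word l').
Proof.
apply: swap_perm_rel => [u|u v w|l1 a b l2]; [by left|exact: eq_up_to_sign_trans|].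
rewrite !cl_word_cat !cl_word_cons !mulrA -!(mulrA (cl_word l1)).
have [->|ab] := eqVneq a b; [by left|right].
by rewrite cl_genC// mulNr mulrN.
Qed.

(** Sorting a word costs a sign, and a repeated generator squares to -1. *)
Lemma cl_word_blade l : exists s (A : {set 'I_N}), cl_word l = s *: cl_word (enum A).
Proof.
elim: l => [|a l [s [A IH]]].
  by exists 1, finset.set0; rewrite enum_set0 scale1r.
rewrite cl_word_cons IH -scalerAr -cl_word_cons.
have [aA|aA] := boolP (a \in A).
  have : perm_eq (enum A) (a :: enum (A :\ a)).
    apply: uniq_perm; rewrite /= ?enum_uniq ?mem_enum ?setD11//.
    by move=> b; rewrite inE !mem_enum in_setD1; case: eqVneq => // ->.
  move/cl_word_perm; rewrite !cl_word_cons => -[]->; rewrite ?mulrN mulrA cl_gen_sqr mulN1r.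
    by exists (- s), (A :\ a); rewrite scalerN scaleNr.
  by exists s, (A :\ a); rewrite opprK.
have : perm_eq (a :: enum A) (enum (a |: A)).
  apply: uniq_perm; rewrite /= ?enum_uniq ?mem_enum ?aA//.
  by move=> b; rewrite inE !mem_enum in_setU1.
by move/cl_word_perm => -[]->; [exists s|exists (- s)]; exists (a |: A);
   rewrite // scalerN scaleNr.
Qed.

End CliffordWords.

(** * The Clifford algebra as the matrix algebra of the spin module *)

Section SpinModule.
Context {R : realType} {n : nat} (Cl : clifford R n.*2) (kappa : spin_module Cl).
Local Notation C := R[i].
Local Notation Mat := 'M[R[i]]_(2 ^ n).
Local Notation N := n.*2.
Implicit Types (v : 'rV[R]_N) (w : Cl) (a : 'I_N) (l : seq 'I_N) (A B : {set 'I_N}).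

Lemma kappaM w w' : kappa (w * w') = kappa w *m kappa w'.
Proof. exact: rmorphM. Qed.
Lemma kappaD w w' : kappa (w + w') = kappa w + kappa w'.
Proof. exact: rmorphD. Qed.
Lemma kappaN w : kappa (- w) = - kappa w.
Proof. exact: rmorphN. Qed.
Lemma kappaZ k w : kappa (k *: w) = k *: kappa w.
Proof. exact: linearZ. Qed.
Lemma kappa1 : kappa 1 = 1%:M.
Proof. exact: rmorph1. Qed.
Lemma kappa0 : kappa 0 = 0.
Proof. exact: rmorph0. Qed.
Lemma kappa_sum I (r : seq I) (P : pred I) (F : I -> Cl) :
  kappa (\sum_(i <- r | P i) F i) = \sum_(i <- r | P i) kappa (F i).
Proof. exact: rmorph_sum. Qed.

(** Here the generator [a] anticommutes with the word, so conjugation by it changes the sign of the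
    matrix but not its trace. *)
Lemma trace_word0 l a : odd (count (predC1 a) l) -> \tr (kappa (cl_word Cl l)) = 0.
Proof.
move=> od; set K := kappa _; set G := kappa (cl_gen Cl a).
have GK : G *m K = - (K *m G).
  by rewrite -!kappaM cl_gen_word -signr_odd od expr1 scaleN1r kappaN.
have GG : G *m G = - 1%:M by rewrite -kappaM cl_gen_sqr kappaN kappa1.
have : \tr K = - \tr K.
  rewrite -{1}[K]mulmx1 -[X in _ *m X]opprK -GG mulmxN mulmxA raddfN /=.
  by rewrite mxtrace_mulC mulmxA GK mulNmx -mulmxA GG mulmxN mulmx1 opprK.
by move=> /eqP; rewrite -addr_eq0 -mulr2n mulrn_eq0 /= => /eqP.
Qed.

Lemma count_predC1_uniq (T : eqType) (a : T) (l : seq T) : uniq l ->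
  (count (predC1 a) l + (a \in l))%N = size l.
Proof. by move=> ul; rewrite -(count_uniq_mem a ul) addnC (count_predC (pred1 a)). Qed.

Definition blade A : Cl := cl_word Cl (enum A).
Definition blade_inv A : Cl := (-1) ^+ #|A| *: cl_word Cl (rev (enum A)).

Lemma blade_invK A : blade_inv A * blade A = 1.
Proof.
rewrite /blade_inv /blade -{2}(revK (enum A)) -scalerAl cl_word_rev size_rev -cardE.
rewrite -(signr_odd C) -(signr_odd Cl).
by case: (odd _); rewrite ?expr1 ?scaleN1r ?opprK ?scale1r.
Qed.

(* Some generator commutes with exactly one of two distinct blades. *)
Lemma blade_separate A B : A != B ->
  exists a, odd (count (predC1 a) (rev (enum A) ++ enum B)).
Proof.
move=> AB; have cnt a : (count (predC1 a) (rev (enum A) ++ enum B) + (a \in A) + (a \in B) =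
    #|A| + #|B|)%N.
  rewrite count_cat count_rev -addnA addnACA !cardE.
  by rewrite -(mem_enum A) -(mem_enum B) !count_predC1_uniq ?enum_uniq.
suff [a aAB] : exists a, odd (#|A| + #|B|) (+) (a \in A) (+) (a \in B).
  by exists a; move: aAB; rewrite -(cnt a) !oddD !oddb; case: odd; case: (a \in A); case: (a \in B).
have [ev|od] := boolP (odd (#|A| + #|B|)); last first.
  apply/existsP; apply: contraNT AB; rewrite negb_exists => /forallP h.
  by apply/eqP/setP => a; have := h a; case: (a \in A); case: (a \in B).
apply/existsP; apply: contraLR ev; rewrite negb_exists => /forallP h.
have -> : B = ~: A.
  by apply/setP => a; rewrite inE; have := h a; case: (a \in A); case: (a \in B).
by rewrite cardsC card_ord odd_double.
Qed.

(** For distinct blades the product of one with the inverse of the other anticommutes with some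
    generator. This orthogonality yields linear independence and, in [blade_coef], the
    coordinates. *)
Lemma trace_blade A B :
  \tr (kappa (blade_inv A) *m kappa (blade B)) = (2 ^ n)%:R * (A == B)%:R.
Proof.
have [<-|AB] := eqVneq A B.
  by rewrite -kappaM blade_invK kappa1 mxtrace1 mulr1.
rewrite mulr0 -kappaM /blade_inv /blade -scalerAl -cl_word_cat kappaZ linearZ /=.
by have [a od] := blade_separate AB; rewrite (trace_word0 od) mulr0.
Qed.

Lemma pow2_neq0 : ((2 ^ n)%:R : C) != 0.
Proof. by rewrite pnatr_eq0 -lt0n expn_gt0. Qed.

Lemma blade_coef (x : {set 'I_N} -> C) A :
  \tr (kappa (blade_inv A) *m \sum_B x B *: kappa (blade B)) / (2 ^ n)%:R = x A.
Proof.
rewrite mulmx_sumr raddf_sum /= (bigD1 A)//= big1 => [|B BA]; last first.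
  by rewrite -scalemxAr linearZ /= trace_blade eq_sym (negPf BA) !mulr0.
by rewrite addr0 -scalemxAr linearZ /= trace_blade eqxx mulr1 mulfK ?pow2_neq0.
Qed.

(** The blades are independent, and their number, 2 to the power 2n, is the dimension of the space
    of matrices. *)
Lemma blade_span (X : Mat) : exists x, X = \sum_B x B *: kappa (blade B).
Proof.
pose X_ (i : 'I_#|{set 'I_N}|) : Mat := kappa (blade (enum_val i)).
pose t := [tuple X_ i | i < #|{set 'I_N}|].
have re (y : 'I_#|{set 'I_N}| -> C) :
    \sum_i y i *: t`_i = \sum_B y (enum_rank B) *: kappa (blade B).
  symmetry; rewrite (reindex_onto (@enum_val {set 'I_N} _) (fun B => enum_rank B)) /=.
    rewrite (eq_bigl xpredT) => [|i]; last by rewrite enum_valK eqxx.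
    by apply: eq_bigr => i _; rewrite enum_valK nth_mktuple.
  by move=> B _; rewrite enum_rankK.
have ft : free t.
  apply/freeP => k k0 i; have := blade_coef (fun B => k (enum_rank B)) (enum_val i).
  by rewrite -re k0 mulmx0 raddf0 mul0r enum_valK.
have : X \in <<t>>%VS.
  suff -> : <<t>>%VS = fullv by rewrite memvf.
  apply/eqP; rewrite eqEdim subvf /= dimvf /dim /=.
  move: ft; rewrite /free => /eqP->; rewrite size_tuple.
  have -> : #|{: {set 'I_N}}| = (2 ^ N)%N.
    have := card_powerset [set: 'I_N]%SET; rewrite cardsT card_ord => <-.
    by apply: eq_card => A; rewrite !inE finset.subsetT.
  by rewrite -expnD addnn.
move/coord_span => ->; exists (fun B => coord t (enum_rank B) X).
exact: (re (fun i => coord t i X)).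
Qed.

Definition kappa_inv (X : Mat) : Cl :=
  \sum_A (\tr (kappa (blade_inv A) *m X) / (2 ^ n)%:R) *: blade A.

Lemma kappa_invK X : kappa (kappa_inv X) = X.
Proof.
have [x ->] := blade_span X; rewrite /kappa_inv kappa_sum.
by apply: eq_bigr => A _; rewrite blade_coef kappaZ.
Qed.

Lemma kappa_inv_linear : linear kappa_inv.
Proof.
move=> k X Y; rewrite /kappa_inv scaler_sumr -big_split; apply: eq_bigr => A _ /=.
by rewrite mulmxDr -scalemxAr linearP /= mulrDl scalerDl scalerA mulrA.
Qed.

Lemma kappa_inv0 : kappa_inv 0 = 0.
Proof. by rewrite /kappa_inv big1// => A _; rewrite mulmx0 raddf0 mul0r scale0r. Qed.

Lemma kappa_invZ k X : kappa_inv (k *: X) = k *: kappa_inv X.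
Proof. by have := kappa_inv_linear k X 0; rewrite kappa_inv0 !addr0. Qed.

Lemma kappa_inv_sum I (r : seq I) (P : pred I) (F : I -> Mat) :
  kappa_inv (\sum_(i <- r | P i) F i) = \sum_(i <- r | P i) kappa_inv (F i).
Proof.
apply: (big_morph kappa_inv _ kappa_inv0) => X Y.
by have := kappa_inv_linear 1 X Y; rewrite !scale1r.
Qed.

Lemma kappa_inv_blade A : kappa_inv (kappa (blade A)) = blade A.
Proof.
rewrite /kappa_inv (bigD1 A)//= trace_blade eqxx mulr1 mulfV ?pow2_neq0// scale1r.
by rewrite big1 ?addr0// => B BA; rewrite trace_blade (negPf BA) mulr0 mul0r scale0r.
Qed.

Lemma kappa_inv_word l : kappa_inv (kappa (cl_word Cl l)) = cl_word Cl l.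
Proof.
have [s [A ->]] := cl_word_blade Cl l; rewrite kappaZ -/(blade A).
by rewrite kappa_invZ kappa_inv_blade.
Qed.

(* The composite of kappa with its candidate inverse is an algebra            *)
(* endomorphism fixing the vectors, hence the identity by uniqueness in the   *)
(* universal property.                                                        *)
Lemma kappaK w : kappa_inv (kappa w) = w.
Proof.
pose f x := kappa_inv (kappa x).
have fZ : linear f by move=> k x y; rewrite /f kappaD kappaZ kappa_inv_linear.
have f1 : f 1 = 1 by rewrite /f -(cl_word_nil Cl) kappa_inv_word.
have fM : {morph f : x y / x * y}.
  move=> x y; rewrite /f; have [X XE] := blade_span (kappa x).
  have [Y YE] := blade_span (kappa y); rewrite kappaM XE YE.
  rewrite mulmx_suml !kappa_inv_sum mulr_suml; apply: eq_bigr => A _.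
  rewrite mulmx_sumr kappa_inv_sum mulr_sumr; apply: eq_bigr => B _.
  rewrite -scalemxAl -scalemxAr !kappa_invZ !kappa_inv_blade -kappaM.
  by rewrite /blade -cl_word_cat kappa_inv_word cl_word_cat -scalerAl -scalerAr.
pose L := GRing.isLinear.Build C Cl Cl _ f fZ.
pose Mo := GRing.isMonoidMorphism.Build Cl Cl f (conj f1 fM).
pose F : {lrmorphism Cl -> Cl} := HB.pack f L Mo.
have [G [_ uG]] := @cl_univ _ _ Cl _ _ (cl_vecP Cl).
have FE v : F (cl_vec Cl v) = cl_vec Cl v.
  rewrite cl_vecE linear_sum; apply: eq_bigr => a _; rewrite linearZ; congr (_ *: _).
  rewrite -[RHS](mulr1) -(cl_word_nil Cl) -cl_word_cons -kappa_inv_word.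
  by rewrite cl_word_cons cl_word_nil mulr1.
by rewrite -[LHS]/(F w) (uG F FE) -(uG (idfun : {lrmorphism Cl -> Cl})).
Qed.

End SpinModule.

Section CliffordTools.
Context {R : realType} {n : nat} (Cl : clifford R n.*2) (kappa : spin_module Cl).
Local Notation C := R[i].
Local Notation Mat := 'M[R[i]]_(2 ^ n).
Local Notation N := n.*2.
Implicit Types (v : 'rV[R]_N) (w : Cl) (a : 'I_N) (l : seq 'I_N) (Q : 'M[R]_N).

Lemma kappa_inj : injective kappa.
Proof. exact: can_inj (kappaK kappa). Qed.

Lemma kappa_inv1 : kappa_inv kappa 1%:M = 1.
Proof. by rewrite -(kappa1 kappa) kappaK. Qed.

Lemma kappa_invM (X Y : Mat) :
  kappa_inv kappa (X *m Y) = kappa_inv kappa X * kappa_inv kappa Y.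
Proof. by apply: kappa_inj; rewrite kappaM !kappa_invK. Qed.

Lemma blade_expand w : w = \sum_A
  (\tr (kappa (blade_inv Cl A) *m kappa w) / (2 ^ n)%:R) *: blade Cl A.
Proof. by rewrite -{1}(kappaK kappa w). Qed.

Lemma cl_word_ext (V : lmodType C) (f g : Cl -> V) : linear f -> linear g ->
  (forall l, f (cl_word Cl l) = g (cl_word Cl l)) -> f =1 g.
Proof.
move=> lf lg fg w.
pose Lf := GRing.isLinear.Build C Cl V _ f lf; pose F : {linear Cl -> V} := HB.pack f Lf.
pose Lg := GRing.isLinear.Build C Cl V _ g lg; pose G : {linear Cl -> V} := HB.pack g Lg.
rewrite -[LHS]/(F w) -[RHS]/(G w) (blade_expand w) !linear_sum.
by apply: eq_bigr => A _; rewrite !linearZ; congr (_ *: _); exact: fg.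
Qed.

(** Orthogonality of [Q] makes [v |-> Q v] a Clifford map, so the universal property provides the
    extension and excludes the default branch of [cl_lift]. *)
Lemma cl_lift_vec Q v : Q^T *m Q = 1%:M ->
  cl_lift Cl Q (cl_vec Cl v) = cl_vec Cl (v *m Q^T).
Proof.
move=> oQ; rewrite /cl_lift; case: pselect => [ex|nex]; last first.
  case: nex; have [|F [FE _]] := @cl_univ _ _ Cl Cl (fun v => cl_vec Cl (v *m Q^T)).
    split=> [k u w|u w]; first by rewrite mulmxDl -scalemxAl (cl_vecP Cl).1.
    rewrite (cl_vecP Cl).2 /dotv trmx_mul trmxK.
    by rewrite -mulmxA (mulmxA Q^T) oQ mul1mx.
  by exists F.
exact: svalP (cid ex) v.
Qed.

Lemma cl_lift_gen Q a : Q^T *m Q = 1%:M ->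
  cl_lift Cl Q (cl_gen Cl a) = \sum_b (Q b a)%:C *: cl_gen Cl b.
Proof.
move=> oQ; rewrite /cl_gen cl_lift_vec// cl_vecE; apply: eq_bigr => b _.
by rewrite -rowE !mxE.
Qed.

Lemma cl_lift_word Q l : cl_lift Cl Q (cl_word Cl l) =
  \prod_(a <- l) cl_lift Cl Q (cl_gen Cl a).
Proof. exact: rmorph_prod. Qed.

Lemma cl_intertwine Q (X : Mat) : Q^T *m Q = 1%:M ->
  (forall v, X *m kappa (cl_vec Cl v) = kappa (cl_vec Cl (v *m Q^T)) *m X) ->
  forall w, X *m kappa w = kappa (cl_lift Cl Q w) *m X.
Proof.
move=> oQ XE; apply: cl_word_ext => [k x y|k x y|l].
- by rewrite kappaD kappaZ mulmxDr -scalemxAr.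
- by rewrite linearP kappaD kappaZ mulmxDl -scalemxAl.
rewrite cl_lift_word; elim: l => [|a l IH].
  by rewrite cl_word_nil big_nil kappa1 mulmx1 mul1mx.
rewrite cl_word_cons big_cons !kappaM mulmxA [X *m _]XE -mulmxA IH mulmxA.
by rewrite cl_lift_vec.
Qed.

(** [kappa] is onto, so [X] commutes with every matrix, in particular with the matrix units. *)
Lemma mx_central (X : Mat) : (forall w, X *m kappa w = kappa w *m X) ->
  exists c, X = c%:M.
Proof.
move=> XE; have cX Y : X *m Y = Y *m X by rewrite -(kappa_invK kappa Y) XE.
have h : (0 < 2 ^ n)%N by rewrite expn_gt0.
pose i0 := Ordinal h; exists (X i0 i0); apply/matrixP => i j; rewrite mxE.
have /matrixP/(_ i i0) := cX (delta_mx j i0).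
rewrite !mxE (bigD1 j)//= mxE !eqxx mulr1 big1 => [|k kj]; last first.
  by rewrite mxE (negPf kj) mulr0.
rewrite addr0 (bigD1 i0)//= mxE eqxx andbT big1 => [|k kj]; last first.
  by rewrite mxE (negPf kj) andbF mul0r.
by move=> ->; rewrite addr0 mulr_natl.
Qed.

(** The Clifford relation is symmetric in its two vectors, so it survives the reversal of products
    by transposition. *)
Lemma transpose_hom : exists F : {lrmorphism Cl -> spin_end R n},
  forall v, F (cl_vec Cl v) = (kappa (cl_vec Cl v))^T.
Proof.
have [|F [FE _]] := @cl_univ _ _ Cl (spin_end R n) (fun v => (kappa (cl_vec Cl v))^T).
  split=> [k u v|v w].
    by rewrite (cl_vecP Cl).1 kappaD kappaZ linearP.
  rewrite -[LHS]/(_ *m _ + _ *m _) -!trmx_mul -linearD /= -!kappaM -kappaD.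
  rewrite addrC (cl_vecP Cl).2 kappaZ kappa1 linearZ /= trmx1.
  by [].
by exists F.
Qed.

(* The intertwiner between a module and its transpose is found as in the      *)
(* Skolem-Noether theorem: its columns are the images of a vector of the      *)
(* range of phi(E_00) under phi(E_i0).                                        *)
Lemma charge_conjugation : exists T : Mat, T \in unitmx /\
  forall v, kappa (cl_vec Cl v) *m T = T *m (kappa (cl_vec Cl v))^T.
Proof.
have [F FE] := transpose_hom.
pose phi (X : Mat) : Mat := F (kappa_inv kappa X).
have phiM X Y : phi (X *m Y) = phi X *m phi Y.
  by rewrite /phi kappa_invM rmorphM.
have phi1 : phi 1%:M = 1%:M by rewrite /phi kappa_inv1 rmorph1.
have phiP k X Y : phi (k *: X + Y) = k *: phi X + phi Y.
  by rewrite /phi kappa_inv_linear linearP.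
have phi0 : phi 0 = 0 by rewrite /phi kappa_inv0 linear0.
have phi_sum I (r : seq I) (G : I -> Mat) :
    phi (\sum_(i <- r) G i) = \sum_(i <- r) phi (G i).
  by apply: (big_morph phi _ phi0) => X Y; have := phiP 1 X Y; rewrite !scale1r.
have phiZ k X : phi (k *: X) = k *: phi X by have := phiP k X 0; rewrite phi0 !addr0.
have h : (0 < 2 ^ n)%N by rewrite expn_gt0.
pose i0 := Ordinal h.
(* A matrix unit generates the whole algebra as a two-sided ideal, so [phi] cannot kill it without
   killing 1. *)
have P0 : phi (delta_mx i0 i0) != 0.
  apply/eqP => p0; have p0' i j : phi (delta_mx i j) = 0.
    have -> : delta_mx i j = delta_mx i i0 *m delta_mx i0 i0 *m delta_mx i0 j :> Mat.
      by rewrite !mul_delta_mx.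
    by rewrite !phiM p0 mulmx0 mul0mx.
  have : phi 1%:M = 0.
    rewrite [1%:M]matrix_sum_delta phi_sum big1// => i _.
    by rewrite phi_sum big1 => [//|j _]; rewrite phiZ p0' scaler0.
  by rewrite phi1 => /matrixP/(_ i0 i0)/eqP; rewrite !mxE eqxx oner_eq0.
have [j0 u0] : exists j, col j (phi (delta_mx i0 i0)) != 0.
  apply/existsP; apply: contraNT P0; rewrite negb_exists => /forallP z.
  apply/eqP/matrixP => i j; rewrite mxE; have /negPn/eqP/colP/(_ i) := z j.
  by rewrite !mxE.
set u := col j0 _ in u0.
pose S : Mat := \matrix_(k, i) (phi (delta_mx i i0) *m u) k 0.
have Scol i : S *m delta_mx i 0 = phi (delta_mx i i0) *m u :> 'cV_(2 ^ n).
  by apply/colP => k; rewrite -colE !mxE.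
have SE X : phi X *m S = S *m X.
  have colS i : phi X *m S *m delta_mx i 0 = S *m X *m delta_mx i 0 :> 'cV_(2 ^ n).
    rewrite -!mulmxA Scol mulmxA -phiM.
    have -> : X *m delta_mx i i0 = \sum_k X k i *: delta_mx k i0.
      apply/matrixP => k j; rewrite summxE mxE (bigD1 i isT) /= mxE eqxx /=.
      rewrite [X in _ + X]big1 ?addr0 => [|l li]; last by rewrite mxE (negPf li) mulr0.
      rewrite (bigD1 k isT) /= !mxE eqxx [X in _ = _ + X]big1 ?addr0// => l lk.
      by rewrite !mxE eq_sym (negPf lk) mulr0.
    have -> : X *m delta_mx i 0 = \sum_k X k i *: delta_mx k 0 :> 'cV_(2 ^ n).
      apply/colP => k; rewrite summxE -colE mxE (bigD1 k isT) /= !mxE !eqxx mulr1.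
      rewrite big1 ?addr0// => l lk; by rewrite !mxE eq_sym (negPf lk) mulr0.
    rewrite phi_sum mulmx_suml mulmx_sumr; apply: eq_bigr => k _.
    by rewrite phiZ -scalemxAl -scalemxAr Scol.
  apply/matrixP => k i; have /colP/(_ k) := colS i.
  by rewrite -!colE ![(col _ _) _ _]mxE.
(* The kernel of [S] is stable under all matrices, by [SE]. If it contained a nonzero vector it
   would contain the basis vector of index [i0], whose image under [S] is [u]. *)
have Su : S \in unitmx.
  rewrite -unitmx_tr unitmxE unitfE; apply/det0P => -[x x0 xS].
  have Sx : S *m x^T = 0 by apply: trmx_inj; rewrite trmx_mul trmxK trmx0.
  have SX (X : Mat) : S *m X *m x^T = 0 by rewrite -SE -mulmxA Sx mulmx0.
  have [j xj] : exists j, x 0 j != 0.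
    apply/existsP; apply: contraNT x0; rewrite negb_exists => /forallP z.
    by apply/eqP/rowP => j; have /negPn/eqP := z j; rewrite mxE.
  case/negP: u0; apply/eqP.
  have := SX ((x 0 j)^-1 *: delta_mx i0 j).
  have -> : S *m ((x 0 j)^-1 *: delta_mx i0 j) *m x^T = S *m delta_mx i0 0 :> 'cV_(2 ^ n).
    rewrite -mulmxA; congr (_ *m _); rewrite -scalemxAl; apply/colP => k.
    rewrite !mxE (bigD1 j isT) /= !mxE eqxx andbT big1 => [|l lj]; last first.
      by rewrite !mxE (negPf lj) andbF mul0r.
    by rewrite addr0 mulrCA mulVf// mulr1.
  by rewrite Scol /u colE mulmxA -phiM mul_delta_mx.
exists (invmx S); split; first by rewrite unitmx_inv.
move=> v; have := SE (kappa (cl_vec Cl v)); rewrite /phi kappaK FE => E.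
apply: (can_inj (mulmxK Su)); rewrite (mulmxKV Su) -mulmxA E mulmxA (mulVmx Su).
by rewrite mul1mx.
Qed.

End CliffordTools.

Section UnitarySquareRoot.
Context {R : realType} {n : nat}.
Implicit Types A B : 'M[R[i]]_n.

Lemma unitary_diag_sqrt (d : 'rV[R[i]]_n) : diag_mx d \is unitarymx ->
  diag_mx (map_mx sqrtC d) \is unitarymx.
Proof.
move/unitary_adjP => ud; apply/unitary_adjP.
have adjE (u : 'rV[R[i]]_n) : adjmx (diag_mx u) = diag_mx (\row_j (u 0 j)^*).
  apply/matrixP => j k; rewrite !mxE eq_sym.
  by case: eqVneq => [->|_]; rewrite ?mulr1n ?mulr0n ?rmorph0.
have dE j : d 0 j * (d 0 j)^* = 1.
  by move/matrixP/(_ j j): ud; rewrite adjE mulmx_diag !mxE eqxx !mulr1n.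
rewrite adjE mulmx_diag -diag_const_mx; congr diag_mx; apply/rowP => j.
rewrite !mxE; set r := sqrtC _; have rr : r ^+ 2 = d 0 j by rewrite sqrtCK.
have r2 : (r * r^*) ^+ 2 = 1.
  rewrite exprMn rr -(dE j); congr (_ * _); rewrite -rr.
  by rewrite [in RHS]expr2 rmorphM -expr2.
have r0 : 0 <= r * r^* by exact: mul_conjC_ge0.
by apply/eqP; rewrite -(eqrXn2 (n := 2))// ?ler01// r2 expr1n.
Qed.

(** By the spectral theorem, taking roots of the eigenvalues. This plays the part of the
    connectedness of U_n: a multiplicative sign on unitary matrices is trivial, being trivial on
    squares. *)
Lemma unitary_sqrt A : A \is unitarymx ->
  exists B, B \is unitarymx /\ A = B *m B.
Proof.
move=> uA; have nA : A \is normalmx.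
  apply/normalmxP; have -> : map_mx Num.conj A^T = adjmx A.
    by apply/matrixP => j k; rewrite !mxE.
  by rewrite unitary_adjK//; apply/unitary_adjP.
have /orthomx_spectralP AE := nA; set P := spectralmx A in AE.
set d := spectral_diag A in AE.
have uP : P \is unitarymx by exact: spectral_unitarymx.
have Pu : P \in unitmx by exact: unitarymx_unit.
have PV : invmx P = adjmx P.
  by rewrite -[RHS]mulmx1 -(mulmxV Pu) mulmxA unitary_adjK// mul1mx.
have ud : diag_mx d \is unitarymx.
  have -> : diag_mx d = P *m A *m adjmx P.
    by rewrite AE -PV !mulmxA mulmxV// mul1mx mulmxK.
  exact: mul_unitarymx (mul_unitarymx uP uA) (unitary_adj uP).
exists (invmx P *m diag_mx (map_mx sqrtC d) *m P); split.
  rewrite PV; exact: mul_unitarymx (mul_unitarymx (unitary_adj uP) (unitary_diag_sqrt ud)) uP.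
rewrite -!mulmxA (mulmxA P) mulmxV// mul1mx (mulmxA (diag_mx _)) mulmx_diag.
rewrite {1}AE -mulmxA; congr (_ *m (diag_mx _ *m _)); apply/rowP => j.
by rewrite !mxE -expr2 sqrtCK.
Qed.

End UnitarySquareRoot.

(** * The representations of the unitary group on spinors *)

Section SpinRepresentation.
Context {R : realType} {n : nat} (Cl : clifford R n.*2) (kappa : spin_module Cl).
Local Notation C := R[i].
Local Notation Mat := 'M[R[i]]_(2 ^ n).
Implicit Types (A B : 'M[R[i]]_n) (g w : Cl).
Context (T : Mat) (uT : T \in unitmx)
  (hT : forall v, kappa (cl_vec Cl v) *m T = T *m (kappa (cl_vec Cl v))^T).

Lemma unitary_realify_tr A : A \is unitarymx -> (realify A)^T *m realify A = 1%:M.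
Proof. by move/unitary_realify/mulmx1C. Qed.

(** By [hT] a unit vector with matrix [X] satisfies [X *m T *m X^T = X *m X *m T = - T], and an
    element of Spin is a product of an even number of unit vectors. *)
Lemma spin_charge g : spin g -> kappa g *m T *m (kappa g)^T = T.
Proof.
move=> [s [ev s1 ->]]; suff : forall s : seq 'rV[R]_n.*2,
    (forall i, (i < size s)%N -> dotv s`_i s`_i = 1) ->
    let X := kappa (\prod_(v <- s) cl_vec Cl v) in
    X *m T *m X^T = (-1) ^+ size s *: T.
  by move=> /(_ s s1) /= ->; rewrite -signr_odd (negPf ev) scale1r.
move=> {ev s1 g s}; elim=> [|v s IH] s1 X.
  by rewrite /X big_nil kappa1 mul1mx trmx1 mulmx1 scale1r.
have vv : kappa (cl_vec Cl v) *m kappa (cl_vec Cl v) = - 1%:M.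
  by rewrite -kappaM cl_vec_sqr ?kappaN ?kappa1//; exact: (s1 0%N).
rewrite /X big_cons kappaM; set Y := kappa (\prod_(_ <- _) _).
rewrite trmx_mul mulmxA -(mulmxA _ Y) -(mulmxA _ _ Y^T) IH; last first.
  by move=> i; exact: (s1 i.+1).
rewrite -scalemxAr -scalemxAl -mulmxA -hT mulmxA vv mulNmx mul1mx scalerN.
by rewrite exprS mulN1r scaleNr.
Qed.

Lemma spin_unit g : spin g -> kappa g \in unitmx.
Proof.
move=> /spin_charge E; have : kappa g *m (T *m (kappa g)^T *m invmx T) = 1%:M.
  by rewrite !mulmxA E mulmxV.
by move/mulmx1_unit => -[].
Qed.

Section Lift.
Context (b : bool) (F : 'M[C]_n -> Cl * C) (hF : is_spinc_lift b F).
Local Notation rho := (spinc_mx kappa F).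

(** The representatives [(g, z)] and [(- g, - z)] act in the same way, so the lift up to a common
    sign becomes a true representation. *)
Lemma spinc_mxM A B : A \is unitarymx -> B \is unitarymx ->
  rho (A *m B) = rho A *m rho B.
Proof.
move=> uA uB; have := hF.2 A B uA uB; rewrite /spinc_mx => /= -[]-> /=.
  by rewrite kappaM -scalemxAl -scalemxAr scalerA.
by rewrite kappaN kappaM scalerN scaleNr opprK -scalemxAl -scalemxAr scalerA.
Qed.

Lemma spinc_neq0 A : A \is unitarymx -> (F A).2 != 0.
Proof.
by move=> uA; have [_ + _ _] := hF.1 A uA; rewrite -normr_eq0 => ->; exact: oner_neq0.
Qed.

Lemma spinc_mx_unit A : A \is unitarymx -> rho A \in unitmx.
Proof.
move=> uA; have [sg _ _ _] := hF.1 A uA; rewrite /spinc_mx unitmxZ ?spin_unit//.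
by rewrite unitfE spinc_neq0.
Qed.

Lemma spinc_mx1 : rho 1%:M = 1%:M.
Proof.
have u1 := @unitary1 R n; have := spinc_mxM u1 u1; rewrite mulmx1 => E.
have U := spinc_mx_unit u1.
by rewrite -[LHS](mulKmx U) -E mulVmx.
Qed.

Lemma spin_covers_kappa A w : A \is unitarymx ->
  kappa (F A).1 *m kappa w = kappa (cl_lift Cl (realify A) w) *m kappa (F A).1.
Proof.
move=> uA; have [_ _ cv _] := hF.1 A uA; move: w; apply: cl_intertwine.
  exact: unitary_realify_tr.
by move=> v; rewrite -!kappaM cv.
Qed.

Lemma spinc_mx_kappa A w : A \is unitarymx ->
  rho A *m kappa w = kappa (cl_lift Cl (realify A) w) *m rho A.
Proof.
by move=> uA; rewrite /spinc_mx -scalemxAl spin_covers_kappa// scalemxAr.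
Qed.

Lemma spinc_mx_charge A : A \is unitarymx ->
  rho A *m T *m (rho A)^T = (if b then \det A else (\det A)^-1) *: T.
Proof.
move=> uA; have [sg _ _ zz] := hF.1 A uA; rewrite /spinc_mx linearZ /= -zz.
by rewrite -!scalemxAl -scalemxAr scalerA spin_charge.
Qed.

End Lift.

Context (Fp Fm : 'M[C]_n -> Cl * C).
Context (hFp : is_spinc_lift true Fp) (hFm : is_spinc_lift false Fm).

(* The two lifts are dual to each other up to a sign, which is multiplicative *)
(* and therefore trivial, every unitary matrix being a square.                *)
Lemma spinc_mx_dual_sign A : A \is unitarymx -> exists e : C, e ^+ 2 = 1 /\
  spinc_mx kappa Fm A *m T *m (spinc_mx kappa Fp A)^T = e *: T.
Proof.
move=> uA; have [sp _ cp zp] := hFp.1 A uA; have [sm _ cm zm] := hFm.1 A uA.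
set gp := kappa (Fp A).1; set gm := kappa (Fm A).1.
have up : gp \in unitmx by exact: spin_unit.
(* Both spin elements cover the same rotation, so their quotient commutes with the Clifford algebra
   and is a scalar; [spin_charge] then gives [c ^+ 2 = 1]. *)
have [c cE] : exists c, gm *m invmx gp = c%:M.
  apply: (mx_central (kappa := kappa)) => w.
  have lw : kappa w *m gp = gp *m (invmx gp *m kappa w *m gp).
    by rewrite -(mulmxA (invmx gp)) mulKVmx.
  set w' := kappa_inv kappa (invmx gp *m kappa w *m gp).
  have w'E : kappa w' = invmx gp *m kappa w *m gp by rewrite kappa_invK.
  have lE : kappa w = kappa (cl_lift Cl (realify A) w').
    apply: (can_inj (mulmxK up)); rewrite lw -w'E.
    exact: (spin_covers_kappa hFp).
  rewrite lE -mulmxA; have -> : invmx gp *m kappa (cl_lift Cl (realify A) w') =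
      kappa w' *m invmx gp.
    apply: (can_inj (mulmxK up)); rewrite (mulmxKV up) -mulmxA.
    by rewrite -(spin_covers_kappa hFp w' uA) (mulKmx up).
  by rewrite mulmxA (spin_covers_kappa hFm)// mulmxA.
have gE : gm = c *: gp.
  by rewrite -[LHS](mulmxKV up) cE mul_scalar_mx.
have T0 : T != 0.
  apply: contra_neq (@spin_end_nonzero1 R n) => T0.
  by rewrite -[LHS](mulmxV uT) {1}T0 mul0mx.
have c2 : c ^+ 2 = 1.
  have := spin_charge sm; rewrite -/gm gE linearZ /= -!scalemxAl -scalemxAr scalerA.
  rewrite spin_charge// => E.
  have : (c ^+ 2 - 1) *: T = 0 by rewrite scalerBl scale1r expr2 E subrr.
  by move=> /eqP; rewrite scaler_eq0 (negPf T0) orbF subr_eq0 => /eqP.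
(* The squares of the two phases are inverse to each other, being the determinant and its inverse,
   so their product squares to 1. *)
exists ((Fm A).2 * (Fp A).2 * c); split.
  rewrite !exprMn c2 mulr1 zp zm mulVf//.
  by rewrite -unitfE -unitmxE; exact: unitarymx_unit.
rewrite /spinc_mx -/gp -/gm gE scalerA [X in _ *m X]linearZ /=.
rewrite -scalemxAr -!scalemxAl scalerA spin_charge//; congr (_ *: _).
by rewrite mulrCA mulrA.
Qed.

Lemma spinc_mx_dual A : A \is unitarymx ->
  spinc_mx kappa Fm A *m T *m (spinc_mx kappa Fp A)^T = T.
Proof.
move=> uA; have [B [uB ->]] := unitary_sqrt uA.
have [e [e2 eE]] := spinc_mx_dual_sign uB.
rewrite (spinc_mxM hFp)// (spinc_mxM hFm)// trmx_mul !mulmxA.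
rewrite -(mulmxA (spinc_mx kappa Fm B)) -(mulmxA (spinc_mx kappa Fm B)).
by rewrite eE -scalemxAr -scalemxAl eE scalerA -expr2 e2 scale1r.
Qed.

End SpinRepresentation.

(** * Smooth dependence of the representations on unitary matrices *)

Section CliffordFamilies.
Context {R : realType} {n : nat} {M : manifold R n.*2}.
Context (Cl : clifford R n.*2) (kappa : spin_module Cl).
Local Notation C := R[i].
Local Notation Mat := 'M[R[i]]_(2 ^ n).
Local Notation N := n.*2.
Local Notation fM := (@mx_findim R (2 ^ n) (2 ^ n)).
Implicit Types (x : M) (A : M -> 'M[C]_n) (w : Cl) (l : seq 'I_N).

Lemma realify_smooth x A a b : (forall j k, csmooth_at x (fun y => A y j k)) ->
  smooth_at x (fun y => realify (A y) a b).
Proof.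
move=> sA; elim/(@ord_parity_ind n): a => j; elim/(@ord_parity_ind n): b => k.
- by have [s _] := sA j k; apply: smooth_at_ext s; apply: nearW => y; rewrite realifyE.
- have [_ s] := sA j k; apply: smooth_at_ext (smooth_atN s).
  by apply: nearW => y; rewrite realifyE.
- by have [_ s] := sA j k; apply: smooth_at_ext s; apply: nearW => y; rewrite realifyE.
- by have [s _] := sA j k; apply: smooth_at_ext s; apply: nearW => y; rewrite realifyE.
Qed.

Lemma der_realify0 x (v : tangent x) A a b : (forall j k, csmooth_at x (fun y => A y j k)) ->
  (forall j k, cder v (fun y => A y j k) = 0) ->
  der v (fun y => realify (A y) a b) = 0.
Proof.
move=> sA dA; elim/(@ord_parity_ind n): a => j; elim/(@ord_parity_ind n): b => k.
- have -> : (fun y => realify (A y) (even_ord j) (even_ord k)) =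
    (fun y => complex.Re (A y j k)) by apply/funext => y; rewrite realifyE.
  by have := congr1 (@complex.Re R) (dA j k).
- have -> : (fun y => realify (A y) (even_ord j) (odd_ord k)) =
    (fun y => - complex.Im (A y j k)) by apply/funext => y; rewrite realifyE.
  rewrite derN; last by have [] := sA j k.
  by have /= -> := congr1 (@complex.Im R) (dA j k); rewrite oppr0.
- have -> : (fun y => realify (A y) (odd_ord j) (even_ord k)) =
    (fun y => complex.Im (A y j k)) by apply/funext => y; rewrite realifyE.
  by have := congr1 (@complex.Im R) (dA j k).
- have -> : (fun y => realify (A y) (odd_ord j) (odd_ord k)) =
    (fun y => complex.Re (A y j k)) by apply/funext => y; rewrite realifyE.
  by have := congr1 (@complex.Re R) (dA j k).
Qed.

(** Polynomial in the entries of [Q], and defined for all [Q], orthogonal or not. Where the matrices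
    are unitary, the products [lift_word] compute [cl_lift] on words ([lift_word_near]), so that the
    latter can be differentiated. *)
Definition lift_gen (Q : M -> 'M[R]_N) a y : Mat :=
  \sum_b (Q y b a)%:C *: kappa (cl_gen Cl b).

Definition lift_word (Q : M -> 'M[R]_N) l y : Mat := \big[mulmx/1%:M]_(a <- l) lift_gen Q a y.

Lemma mulmx_bilin_l p q r (B : 'M[C]_(q, r)) : linear (fun X : 'M[C]_(p, q) => X *m B).
Proof. by move=> k X Y; rewrite mulmxDl scalemxAl. Qed.

Lemma mulmx_bilin_r p q r (B : 'M[C]_(p, q)) : linear (fun X : 'M[C]_(q, r) => B *m X).
Proof. by move=> k X Y; rewrite mulmxDr scalemxAr. Qed.

Section Family.
Context (x : M) (Q : M -> 'M[R]_N).
Hypothesis sQ : forall a b, smooth_at x (fun y => Q y a b).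

Lemma gen_smooth a : vsmooth_at x (lift_gen Q a).
Proof.
apply: vsmooth_sum => b _; apply: vsmoothZ; first exact: csmooth_real.
exact: vsmooth_cst.
Qed.

Lemma vder_gen (v : tangent x) a : vder fM v (lift_gen Q a) =
  \sum_b (der v (fun y => Q y b a))%:C *: kappa (cl_gen Cl b).
Proof.
have sg b : csmooth_at x (fun y => (Q y b a)%:C) by exact: csmooth_real.
rewrite /lift_gen vder_sum => [|b _]; last exact: (vsmoothZ (sg b) (vsmooth_cst _ _)).
apply: eq_bigr => b _; rewrite (vderZ fM v (sg b) (vsmooth_cst x (kappa (cl_gen Cl b)))).
by rewrite vder_cst scaler0 addr0 cder_real.
Qed.

Lemma word_cons a l y : lift_word Q (a :: l) y = lift_gen Q a y *m lift_word Q l y.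
Proof. by rewrite /lift_word big_cons. Qed.

Lemma word_smooth l : vsmooth_at x (lift_word Q l).
Proof.
elim: l => [|a l IH].
  apply: vsmooth_ext (vsmooth_cst x (1%:M : Mat)).
  by apply: nearW => y; rewrite /lift_word big_nil.
apply: (vsmooth_ext (f := fun y => lift_gen Q a y *m lift_word Q l y)).
  by apply: nearW => y; rewrite word_cons.
by apply: (vsmooth_bilin fM fM (@mulmx_bilin_l _ _ _) (@mulmx_bilin_r _ _ _));
  [exact: gen_smooth|].
Qed.

Lemma vder_word_cons (v : tangent x) a l : vder fM v (lift_word Q (a :: l)) =
  vder fM v (lift_gen Q a) *m lift_word Q l x + lift_gen Q a x *m vder fM v (lift_word Q l).
Proof.
have -> : lift_word Q (a :: l) = (fun y => lift_gen Q a y *m lift_word Q l y).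
  by apply/funext => y; rewrite word_cons.
exact: (vder_bilin fM fM fM (@mulmx_bilin_l _ _ _) (@mulmx_bilin_r _ _ _) v
  (gen_smooth a) (word_smooth l)).
Qed.

Lemma vder_word_nil (v : tangent x) : vder fM v (lift_word Q [::]) = 0.
Proof.
rewrite -(vder_cst fM v (1%:M : Mat)); congr (vder _ v _).
by apply/funext => y; rewrite /lift_word big_nil.
Qed.

Lemma vder_word0 (v : tangent x) l : (forall a b, der v (fun y => Q y a b) = 0) ->
  vder fM v (lift_word Q l) = 0.
Proof.
move=> dQ; elim: l => [|a l IH]; first exact: vder_word_nil.
rewrite vder_word_cons IH mulmx0 addr0 vder_gen big1 ?mul0mx// => b _.
by rewrite dQ scale0r.
Qed.

Lemma gen1 a : Q x = 1%:M -> lift_gen Q a x = kappa (cl_gen Cl a).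
Proof.
move=> Q1; rewrite /lift_gen Q1 (bigD1 a isT) /= mxE eqxx scale1r big1 ?addr0// => b ba.
by rewrite mxE (negPf ba) scale0r.
Qed.

Lemma word1 l : Q x = 1%:M -> lift_word Q l x = kappa (cl_word Cl l).
Proof.
move=> Q1; elim: l => [|a l IH]; first by rewrite /lift_word big_nil cl_word_nil kappa1.
by rewrite word_cons cl_word_cons kappaM gen1// IH.
Qed.

End Family.

(** The differential at the identity: linear in the derivatives of the entries of [Q], with
    coefficients [P] independent of the point. This uniformity is what makes the connection on
    V-spinors smooth later on. *)
Lemma vder_word1 l : exists P : 'I_N -> 'I_N -> Mat,
  forall x (v : tangent x) (Q : M -> 'M[R]_N),
    (forall a b, smooth_at x (fun y => Q y a b)) -> Q x = 1%:M ->
    vder fM v (lift_word Q l) = \sum_a \sum_b (der v (fun y => Q y a b))%:C *: P a b.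
Proof.
elim: l => [|c l [P IH]].
  exists (fun _ _ => 0) => x v Q sQ Q1; rewrite vder_word_nil big1// => a _.
  by rewrite big1// => b _; rewrite scaler0.
exists (fun a b => (b == c)%:R *: (kappa (cl_gen Cl a) *m kappa (cl_word Cl l)) +
   kappa (cl_gen Cl c) *m P a b) => x v Q sQ Q1.
rewrite vder_word_cons// vder_gen// IH// gen1// word1// mulmx_suml mulmx_sumr -big_split.
apply: eq_bigr => a _ /=; rewrite mulmx_sumr (bigD1 c isT) /=.
rewrite [in RHS](bigD1 c isT) /= eqxx scale1r scalerDr -addrA -scalemxAl -scalemxAr.
congr (_ + (_ + _)); apply: eq_bigr => b bc.
by rewrite (negPf bc) scale0r add0r scalemxAr.
Qed.

Lemma lift_word_near x A l : (\forall y \near x, A y \is unitarymx) ->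
  \forall y \near x, lift_word (fun y => realify (A y)) l y =
    kappa (cl_lift Cl (realify (A y)) (cl_word Cl l)).
Proof.
apply: filterS => y uA; rewrite cl_lift_word.
elim: l => [|a l IH]; first by rewrite /lift_word !big_nil kappa1.
rewrite word_cons big_cons kappaM IH; congr (_ *m _).
rewrite cl_lift_gen; last exact: unitary_realify_tr.
by rewrite kappa_sum; apply: eq_bigr => b _; rewrite kappaZ.
Qed.

Lemma kappa_lift_blades Q w : kappa (cl_lift Cl Q w) = \sum_(B : {set 'I_N})
  (\tr (kappa (blade_inv Cl B) *m kappa w) / (2 ^ n)%:R) *:
    kappa (cl_lift Cl Q (blade Cl B)).
Proof.
rewrite {1}(blade_expand kappa w) linear_sum kappa_sum.
by apply: eq_bigr => B _; rewrite linearZ kappaZ.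
Qed.

Lemma lift_smooth x A w : (forall j k, csmooth_at x (fun y => A y j k)) ->
  (\forall y \near x, A y \is unitarymx) ->
  vsmooth_at x (fun y => kappa (cl_lift Cl (realify (A y)) w)).
Proof.
move=> sA uA; apply: (vsmooth_ext (f := fun y => \sum_(B : {set 'I_N})
  (\tr (kappa (blade_inv Cl B) *m kappa w) / (2 ^ n)%:R) *:
    kappa (cl_lift Cl (realify (A y)) (blade Cl B)))).
  by apply: nearW => y; rewrite [RHS]kappa_lift_blades.
apply: vsmooth_sum => B _; apply: vsmoothZ; first exact: csmooth_cst.
apply: (vsmooth_ext (lift_word_near (enum B) uA)).
by apply: word_smooth => a b; exact: realify_smooth.
Qed.

Lemma vder_lift x (v : tangent x) A w : (forall j k, csmooth_at x (fun y => A y j k)) ->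
  (\forall y \near x, A y \is unitarymx) ->
  vder fM v (fun y => kappa (cl_lift Cl (realify (A y)) w)) = \sum_(B : {set 'I_N})
  (\tr (kappa (blade_inv Cl B) *m kappa w) / (2 ^ n)%:R) *:
    vder fM v (lift_word (fun y => realify (A y)) (enum B)).
Proof.
move=> sA uA.
have sw (B : {set 'I_N}) : vsmooth_at x (lift_word (fun y => realify (A y)) (enum B)).
  by apply: word_smooth => a b; exact: realify_smooth.
have sl (B : {set 'I_N}) := lift_smooth (blade Cl B) sA uA.
have -> : (fun y => kappa (cl_lift Cl (realify (A y)) w)) = fun y => \sum_(B : {set 'I_N})
  (\tr (kappa (blade_inv Cl B) *m kappa w) / (2 ^ n)%:R) *:
    kappa (cl_lift Cl (realify (A y)) (blade Cl B)).
  by apply/funext => y; rewrite [LHS]kappa_lift_blades.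
rewrite vder_sum => [|B _]; last exact: (vsmoothZ (csmooth_cst x _) (sl B)).
apply: eq_bigr => B _; rewrite (vderZ fM v (csmooth_cst x _) (sl B)).
rewrite cder_cst scale0r add0r; congr (_ *: _).
exact: (esym (vder_ext fM v (sw B) (lift_word_near (enum B) uA))).
Qed.

Lemma vder_lift0 x (v : tangent x) A w : (forall j k, csmooth_at x (fun y => A y j k)) ->
  (\forall y \near x, A y \is unitarymx) ->
  (forall j k, cder v (fun y => A y j k) = 0) ->
  vder fM v (fun y => kappa (cl_lift Cl (realify (A y)) w)) = 0.
Proof.
move=> sA uA dA; rewrite vder_lift// big1// => B _; rewrite vder_word0 ?scaler0//.
  by move=> a b; exact: realify_smooth.
by move=> a b; exact: der_realify0.
Qed.

Lemma vder_lift1 w : exists P : 'I_N -> 'I_N -> Mat,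
  forall x (v : tangent x) A, (forall j k, csmooth_at x (fun y => A y j k)) ->
    (\forall y \near x, A y \is unitarymx) -> A x = 1%:M ->
    vder fM v (fun y => kappa (cl_lift Cl (realify (A y)) w)) =
    \sum_a \sum_b (der v (fun y => realify (A y) a b))%:C *: P a b.
Proof.
pose P_ (B : {set 'I_N}) := sval (cid (vder_word1 (enum B))).
exists (fun a b => \sum_(B : {set 'I_N})
  (\tr (kappa (blade_inv Cl B) *m kappa w) / (2 ^ n)%:R) *: P_ B a b) => x v A sA uA A1.
rewrite vder_lift//.
transitivity (\sum_(B : {set 'I_N}) \sum_a \sum_b
  (\tr (kappa (blade_inv Cl B) *m kappa w) / (2 ^ n)%:R) *:
     ((der v (fun y => realify (A y) a b))%:C *: P_ B a b)).
  apply: eq_bigr => B _; rewrite (svalP (cid (vder_word1 (enum B))) x v)//.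
  - by rewrite scaler_sumr; apply: eq_bigr => a _; rewrite scaler_sumr.
  - by move=> a b; exact: realify_smooth.
  - by rewrite A1 realify1.
rewrite exchange_big; apply: eq_bigr => a _; rewrite exchange_big; apply: eq_bigr => b _.
by rewrite scaler_sumr; apply: eq_bigr => B _; rewrite !scalerA mulrC.
Qed.

End CliffordFamilies.

Section DeterminantFamilies.
Context {R : realType} {m : nat} {M : manifold R m} {n : nat}.
Implicit Types (x : M) (A : M -> 'M[R[i]]_n).

Lemma csmooth_det x A : (forall j k, csmooth_at x (fun y => A y j k)) ->
  csmooth_at x (fun y => \det (A y)).
Proof.
move=> sA; rewrite /determinant; apply: csmooth_sum => s _.
apply: csmoothM; first exact: csmooth_cst.
by apply: csmooth_prod => i _; exact: sA.
Qed.

Lemma cder_det0 x (v : tangent x) A : (forall j k, csmooth_at x (fun y => A y j k)) ->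
  (forall j k, cder v (fun y => A y j k) = 0) -> cder v (fun y => \det (A y)) = 0.
Proof.
move=> sA dA; rewrite /determinant.
have sP (s : 'S_n) : csmooth_at x (fun y => \prod_i A y i (s i)).
  by apply: csmooth_prod => i _; exact: sA.
rewrite cder_sum => [|s _]; last exact: (csmoothM (csmooth_cst x _) (sP s)).
rewrite big1// => s _; rewrite (cderZ v _ (sP s)) cder_prod0 ?mulr0//.
Qed.

Lemma cderV0 x (v : tangent x) (f : M -> R[i]) : csmooth_at x f -> f x != 0 ->
  cder v f = 0 -> cder v (fun y => (f y)^-1) = 0.
Proof.
move=> sf f0 df; have sV := csmoothV sf f0.
have : cder v (fun y => f y * (f y)^-1) = 0.
  rewrite -(cder_cst v 1); apply: cder_ext; first exact: csmoothM.
  by apply: filterS (csmooth_neq0 sf f0) => y fy; rewrite mulfV.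
rewrite (cderM v sf sV) df mul0r add0r => /eqP.
by rewrite mulf_eq0 (negPf f0) => /eqP.
Qed.

End DeterminantFamilies.

Section SmoothRepresentations.
Context {R : realType} {n : nat} {M : manifold R n.*2}.
Context (H : hermitian_structure M) (D : conn (M := M)) (hD : is_chern H D).
Context (Cl : clifford R n.*2) (kappa : spin_module Cl).
Local Notation C := R[i].
Local Notation Mat := 'M[R[i]]_(2 ^ n).
Local Notation N := n.*2.
Local Notation fM := (@mx_findim R (2 ^ n) (2 ^ n)).
Implicit Types (x : M) (A : M -> 'M[C]_n) (w : Cl).

Lemma cl_dual_exists (B : {set 'I_N}) : exists l : {scalar Cl},
  forall w, l w = \tr (kappa (blade_inv Cl B) *m kappa w) / (2 ^ n)%:R.
Proof.
apply: (@scalar_exists R Cl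
  (fun w => \tr (kappa (blade_inv Cl B) *m kappa w) / (2 ^ n)%:R)) => k u w.
rewrite kappaD (kappaZ kappa k u) mulmxDr -scalemxAr.
by rewrite mxtraceD mxtraceZ mulrDl mulrA.
Qed.

Definition cl_dual (B : {set 'I_N}) : {scalar Cl} := sval (cid (cl_dual_exists B)).

Lemma cl_dualE B w : cl_dual B w = \tr (kappa (blade_inv Cl B) *m kappa w) / (2 ^ n)%:R.
Proof. by rewrite /cl_dual; case: cid. Qed.

Lemma cl_findim_sum w : w = \sum_B cl_dual B w *: blade Cl B.
Proof. by rewrite {1}(blade_expand kappa w); apply: eq_bigr => B _; rewrite cl_dualE. Qed.

Definition cl_findim : findim Cl := Findim cl_findim_sum.

Lemma kappa_linear : linear kappa.
Proof. by move=> k u w; rewrite kappaD kappaZ. Qed.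

Lemma cl_vsmoothP x (f : M -> Cl) : vsmooth_at x f <-> vsmooth_at x (fun y => kappa (f y)).
Proof.
split=> sf; first exact: vsmooth_lin kappa_linear sf.
apply: vsmooth_ext (vsmooth_lin (kappa_inv_linear kappa) sf).
by apply: nearW => y; rewrite kappaK.
Qed.

Lemma cl_vderE x (v : tangent x) (f : M -> Cl) : vsmooth_at x f ->
  kappa (vder cl_findim v f) = vder fM v (fun y => kappa (f y)).
Proof. by move=> sf; rewrite (vder_lin cl_findim fM v kappa_linear sf). Qed.

Lemma cl_liftM (Q Q' : 'M[R]_N) w : Q^T *m Q = 1%:M -> Q'^T *m Q' = 1%:M ->
  cl_lift Cl (Q *m Q') w = cl_lift Cl Q (cl_lift Cl Q' w).
Proof.
move=> oQ oQ'; have oQQ : (Q *m Q')^T *m (Q *m Q') = 1%:M.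
  by rewrite trmx_mul -mulmxA (mulmxA Q^T) oQ mul1mx.
move: w; apply: (cl_word_ext kappa) => [k u w|k u w|l]; rewrite ?linearP//.
rewrite !cl_lift_word rmorph_prod; apply: eq_bigr => a _.
rewrite /cl_gen (cl_lift_vec _ _ oQQ) (cl_lift_vec _ _ oQ') trmx_mul mulmxA.
exact: esym (cl_lift_vec _ _ oQ).
Qed.

Lemma cl_lift1 w : cl_lift Cl 1%:M w = w.
Proof.
move: w; apply: (cl_word_ext kappa) => [k u w|//|l]; first by rewrite linearP.
rewrite cl_lift_word; apply: eq_bigr => a _.
by rewrite /cl_gen cl_lift_vec trmx1 mulmx1.
Qed.

Lemma cl_smooth_urep : smooth_urep (M := M) (V := cl_rep Cl) cl_findim.
Proof.
split=> [t|A B t uA uB|x A sA uA t|x v A sA uA dA t] /=.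
- by rewrite realify1 cl_lift1.
- by rewrite realifyM cl_liftM//; exact: unitary_realify_tr.
- exact/cl_vsmoothP/lift_smooth.
apply: (kappa_inj (kappa := kappa)); rewrite cl_vderE.
  by rewrite kappa0 vder_lift0.
exact/cl_vsmoothP/lift_smooth.
Qed.

Context (T : Mat) (uT : T \in unitmx)
  (hT : forall v, kappa (cl_vec Cl v) *m T = T *m (kappa (cl_vec Cl v))^T).

Section Spinor.
Context (b : bool) (F : 'M[C]_n -> Cl * C) (hF : is_spinc_lift b F).
Local Notation rho := (spinc_mx kappa F).

(** The conditions on [F] at a single matrix fix [rho] only up to sign, and no continuity is
    assumed. Products of two entries do not see the sign: they are entries of [rho E rho^T] for a
    matrix unit [E], which [cl_lift] and the determinant express smoothly. *)
Lemma spinc_pair (A0 : 'M[C]_n) (i j k l : 'I_(2 ^ n)) : A0 \is unitarymx ->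
  rho A0 i j * rho A0 k l = (if b then \det A0 else (\det A0)^-1) *
    (kappa (cl_lift Cl (realify A0)
       (kappa_inv kappa (delta_mx j l *m invmx T))) *m T) i k.
Proof.
move=> uA; set w := kappa_inv kappa _.
transitivity ((rho A0 *m delta_mx j l *m (rho A0)^T) i k).
  rewrite !mxE (bigD1 l isT) /= !mxE (bigD1 j isT) /= !mxE !eqxx mulr1.
  rewrite [X in _ = (_ + X) * _ + _]big1 ?addr0 => [|q qj]; last first.
    by rewrite !mxE (negPf qj) mulr0.
  rewrite [X in _ = _ + X]big1 ?addr0// => q ql; rewrite !mxE big1 ?mul0r// => p _.
  by rewrite !mxE (negPf ql) andbF mulr0.
have -> : delta_mx j l = kappa w *m T by rewrite kappa_invK mulmxKV.
rewrite mulmxA (spinc_mx_kappa kappa hF w uA) -!mulmxA (mulmxA (rho A0)).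
by rewrite (spinc_mx_charge hT hF uA) -scalemxAr mxE.
Qed.

Section Sections.
Context (psi0 : forall x : M, spinorB H kappa F x).
Hypothesis psi_smooth : forall x, sec_smooth x psi0.
Hypothesis psi_neq0 : forall x, psi0 x != 0.

Section Family.
Context (x : M) (A : M -> 'M[C]_n).
Hypothesis sA : forall j k, csmooth_at x (fun y => A y j k).
Hypothesis uA : \forall y \near x, A y \is unitarymx.

Let e0 := sval (cid (parallel_uframe_exists hD x)).
Let ue0 : uframe_near H x e0 := (svalP (cid (parallel_uframe_exists hD x))).1.

Let e1 : local_frame (M := M) := fun a y => frame_act (frame_at e0 y) (A y) a.

Lemma frame_act_near : uframe_near H x e1.
Proof.
have [se ue] := ue0; split=> [a|].
  apply: vf_smooth_sum => c _; exact: (vf_smoothZ (realify_smooth c a sA) (se c)).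
by apply: filterS2 ue uA => y uy uAy; exact: frame_act_uframe.
Qed.

Let u0 y := psi0 y (frame_at e0 y).
Let u1 y := psi0 y (frame_at e1 y).

Lemma spinc_frame_section : \forall y \near x, rho (A y) *m u1 y = u0 y.
Proof.
have [_ ue] := ue0; apply: filterS2 ue uA => y uy uAy.
exact: (assoc_act (V := spinor_rep kappa F) (psi0 y) uy uAy).
Qed.

Let pair i j k l y := (if b then \det (A y) else (\det (A y))^-1) *
    (kappa (cl_lift Cl (realify (A y))
       (kappa_inv kappa (delta_mx j l *m invmx T))) *m T) i k.

Lemma unitary_det_neq0 (B : 'M[C]_n) : B \is unitarymx -> \det B != 0.
Proof. by move=> uB; rewrite -unitfE -unitmxE; exact: unitarymx_unit. Qed.

Let cdet_smooth : csmooth_at x (fun y => if b then \det (A y) else (\det (A y))^-1).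
Proof.
case: b; first exact: csmooth_det.
apply: csmoothV; first exact: csmooth_det.
exact: unitary_det_neq0 (nbhs_singleton uA).
Qed.

Let lift_entry_smooth w i k : csmooth_at x (fun y =>
  (kappa (cl_lift Cl (realify (A y)) w) *m T) i k).
Proof.
have := vsmooth_lin (@mulmx_bilin_l R _ _ _ T) (lift_smooth kappa w sA uA).
by move/vsmooth_mxP; apply.
Qed.

Let pair_smooth i j k l : csmooth_at x (pair i j k l).
Proof. exact: csmoothM cdet_smooth (lift_entry_smooth _ _ _). Qed.

(** The smooth section [psi0] settles the sign: its components satisfy [u0 = rho u1] in the frames
    [e0] and [e1]. Multiplying an entry of [rho] by a nonzero component of [u0] gives a sum of
    products of two entries of [rho] times components of [u1], all smooth. *)
Lemma spinc_smooth i j : csmooth_at x (fun y => rho (A y) i j).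
Proof.
have su0 := psi_smooth (e := e0) ue0; have su1 := psi_smooth frame_act_near.
have [k u0k] : exists k, u0 x k 0 != 0.
  apply/existsP; have := psi_neq0 x; apply: contraNT; rewrite negb_exists => /forallP z.
  apply/eqP; apply: (assoc_ext (e := frame_at e0 x)); first exact: uframe_near_at ue0.
  apply/colP => k; have /negPn/eqP E := z k.
  by apply: etrans E _; rewrite -[RHS]/((0 : 'cV[C]_(2 ^ n)) k 0) mxE.
have su0k : csmooth_at x (fun y => u0 y k 0) by have /vsmooth_mxP := su0; apply.
have su1l l : csmooth_at x (fun y => u1 y l 0) by have /vsmooth_mxP := su1; apply.
have sS : csmooth_at x (fun y => \sum_l pair i j k l y * u1 y l 0).
  by apply: csmooth_sum => l _; exact: (csmoothM (pair_smooth _ _ _ _) (su1l l)).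
apply: csmooth_ext (csmoothM sS (csmoothV su0k u0k)).
apply: filterS3 spinc_frame_section uA (csmooth_neq0 su0k u0k) => y E uAy u0y.
apply: (can_inj (mulfK u0y)); rewrite mulfVK// -E [X in _ = _ * X]mxE mulr_sumr.
by apply: eq_bigr => l _; rewrite mulrA spinc_pair.
Qed.

(** Products of two entries have derivative zero. Apply this to the square of a nonzero entry, then
    to the product of that entry with any other. *)
Lemma spinc_der0 (v : tangent x) i j : (forall j k, cder v (fun y => A y j k) = 0) ->
  cder v (fun y => rho (A y) i j) = 0.
Proof.
move=> dA; have uAx := nbhs_singleton uA.
have dpair i1 j1 k1 l1 : cder v (pair i1 j1 k1 l1) = 0.
  have sl := lift_smooth kappa (kappa_inv kappa (delta_mx j1 l1 *m invmx T)) sA uA.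
  have dl : cder v (fun y => (kappa (cl_lift Cl (realify (A y))
       (kappa_inv kappa (delta_mx j1 l1 *m invmx T))) *m T) i1 k1) = 0.
    rewrite -(vder_mxE v i1 k1 (vsmooth_lin (@mulmx_bilin_l R _ _ _ T) sl)).
    rewrite (vder_lin fM fM v (@mulmx_bilin_l R _ _ _ T) sl).
    by rewrite (vder_lift0 kappa _ sA uA dA) mul0mx mxE.
  have dd : cder v (fun y => if b then \det (A y) else (\det (A y))^-1) = 0.
    case: b; first exact: cder_det0.
    apply: cderV0; [exact: csmooth_det|exact: unitary_det_neq0|exact: cder_det0].
  by rewrite /pair (cderM v cdet_smooth (lift_entry_smooth _ _ _)) dd dl mul0r mulr0 addr0.
have dprod i1 j1 k1 l1 : cder v (fun y => rho (A y) i1 j1) * rho (A x) k1 l1 +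
    rho (A x) i1 j1 * cder v (fun y => rho (A y) k1 l1) = 0.
  rewrite -(cderM v (spinc_smooth i1 j1) (spinc_smooth k1 l1)) -[RHS](dpair i1 j1 k1 l1).
  apply: cder_ext; first exact: csmoothM (spinc_smooth i1 j1) (spinc_smooth k1 l1).
  by apply: filterS uA => y uAy; rewrite spinc_pair.
have [i1 [j1 r0]] : exists i1 j1, rho (A x) i1 j1 != 0.
  apply: contrapT => z; have : rho (A x) = 0.
    apply/matrixP => i1 j1; rewrite [RHS]mxE; apply/eqP/negPn/negP => r0.
    by apply: z; exists i1, j1.
  move=> r0; have := spinc_mx_unit uT hT hF uAx; rewrite r0.
  move=> /mulmxV; rewrite mul0mx => E; have := @spin_end_nonzero1 R n.
  by rewrite -[1]E eqxx.
have d1 : cder v (fun y => rho (A y) i1 j1) = 0.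
  have := dprod i1 j1 i1 j1; rewrite mulrC -mulr2n => /eqP.
  by rewrite mulrn_eq0 /= mulf_eq0 (negPf r0) => /eqP.
have := dprod i1 j1 i j; rewrite d1 mul0r add0r => /eqP.
by rewrite mulf_eq0 (negPf r0) => /eqP.
Qed.

End Family.

Lemma spinor_smooth_urep :
  smooth_urep (M := M) (V := spinor_rep kappa F) (mx_findim (2 ^ n) 1).
Proof.
split=> [t|A B t uA uB|x A sA uA t|x v A sA uA dA t] /=.
- by rewrite (spinc_mx1 uT hT hF) mul1mx.
- by rewrite (spinc_mxM kappa hF) // mulmxA.
- have sr : vsmooth_at x (fun y => rho (A y)).
    by apply/vsmooth_mxP => i j; exact: spinc_smooth.
  exact: (vsmooth_lin (@mulmx_bilin_l R _ _ _ t) sr).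
have sr : vsmooth_at x (fun y => rho (A y)).
  by apply/vsmooth_mxP => i j; exact: spinc_smooth.
rewrite (vder_lin fM (mx_findim (2 ^ n) 1) v (@mulmx_bilin_l R _ _ _ t) sr).
have -> : vder fM v (fun y => rho (A y)) = 0.
  by apply/matrixP => i j; rewrite vder_mxE// mxE spinc_der0.
by rewrite mul0mx.
Qed.

End Sections.
End Spinor.

Context (Fp Fm : 'M[C]_n -> Cl * C).
Context (hFp : is_spinc_lift true Fp) (hFm : is_spinc_lift false Fm).

(* w |-> T kappa(w)^T identifies V-spinors with Clifford elements, on which   *)
(* the two spin representations together act as U_n does through SO_2n.       *)
Lemma vspinor_act_charge (A0 : 'M[C]_n) w : A0 \is unitarymx ->
  vspinor_act kappa Fp Fm A0 (T *m (kappa w)^T) =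
    T *m (kappa (cl_lift Cl (realify A0) w))^T.
Proof.
move=> uA; rewrite /vspinor_act /= /mulmxr.
have -> : spinc_mx kappa Fm A0 *m (T *m (kappa w)^T) *m (spinc_mx kappa Fp A0)^T =
    spinc_mx kappa Fm A0 *m T *m (spinc_mx kappa Fp A0 *m kappa w)^T.
  by rewrite trmx_mul !mulmxA.
rewrite (spinc_mx_kappa kappa hFp w uA) trmx_mul mulmxA.
by rewrite (spinc_mx_dual uT hT hFp hFm uA).
Qed.

(** The inverse of the identification [w |-> T kappa(w)^T]. *)
Definition vspinor_symbol (t : Mat) : Cl := kappa_inv kappa (invmx T *m t)^T.

Lemma vspinor_symbolK t : T *m (kappa (vspinor_symbol t))^T = t.
Proof. by rewrite kappa_invK trmxK mulKVmx. Qed.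

Lemma charge_tr_linear : linear (fun X : Mat => T *m X^T).
Proof. by move=> k X Y; rewrite linearP /= mulmxDr -scalemxAr. Qed.

Lemma vspinor_actE (A0 : 'M[C]_n) t : A0 \is unitarymx ->
  vspinor_act kappa Fp Fm A0 t =
    T *m (kappa (cl_lift Cl (realify A0) (vspinor_symbol t)))^T.
Proof. by move=> uA; rewrite -{1}(vspinor_symbolK t) vspinor_act_charge. Qed.

(** Under the identification with Clifford elements the action becomes [cl_lift], in which the signs
    of the two lifts no longer appear. *)
Lemma vspinor_smooth_urep :
  smooth_urep (M := M) (V := vspinor_rep kappa Fp Fm) fM.
Proof.
split=> [t|A B t uA uB|x A sA uA t|x v A sA uA dA t].
- rewrite [LHS]vspinor_actE ?unitary1// realify1 cl_lift1.
  exact: vspinor_symbolK.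
- rewrite -[uact _ B t]/(vspinor_act kappa Fp Fm B t) [X in uact _ A X]vspinor_actE//.
  rewrite -[RHS]/(vspinor_act kappa Fp Fm A _) [RHS]vspinor_act_charge//.
  rewrite [LHS]vspinor_actE ?mul_unitarymx// realifyM cl_liftM//; exact: unitary_realify_tr.
- apply: (vsmooth_ext _ (vsmooth_lin charge_tr_linear
    (lift_smooth kappa (vspinor_symbol t) sA uA))).
  by apply: filterS uA => y uAy; rewrite [RHS]vspinor_actE.
have sl := lift_smooth kappa (vspinor_symbol t) sA uA.
rewrite -(vder_ext fM v (vsmooth_lin charge_tr_linear sl)); last first.
  by apply: filterS uA => y uAy; rewrite [RHS]vspinor_actE.
rewrite (vder_lin fM fM v charge_tr_linear sl) (vder_lift0 kappa _ sA uA dA).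
by rewrite trmx0 mulmx0.
Qed.

Lemma vspinor_der1 t : exists P : 'I_N -> 'I_N -> Mat,
  forall x (v : tangent x) A, (forall j k, csmooth_at x (fun y => A y j k)) ->
    (\forall y \near x, A y \is unitarymx) -> A x = 1%:M ->
    vder fM v (fun y => vspinor_act kappa Fp Fm (A y) t) =
    \sum_a \sum_b (der v (fun y => realify (A y) a b))%:C *: P a b.
Proof.
have [P PE] := vder_lift1 (M := M) kappa (vspinor_symbol t).
exists (fun a b => T *m (P a b)^T) => x v A sA uA A1.
have sl := lift_smooth kappa (vspinor_symbol t) sA uA.
rewrite -(vder_ext fM v (vsmooth_lin charge_tr_linear sl)); last first.
  by apply: filterS uA => y uAy; rewrite vspinor_actE.
rewrite (vder_lin fM fM v charge_tr_linear sl) (PE x v A sA uA A1).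
rewrite linear_sum /= mulmx_sumr; apply: eq_bigr => a _.
rewrite linear_sum /= mulmx_sumr; apply: eq_bigr => c _.
by rewrite linearZ /= -scalemxAr.
Qed.

End SmoothRepresentations.

(** * The grading of the spin module and the chirality element *)

Section CommutingComplexStructures.
Context {R : realType} {p : nat}.
Local Notation C := R[i].
Local Notation Mat := 'M[R[i]]_p.
Local Notation ci := (0 +i* 1 : C).

Lemma ci_sqr : ci * ci = -1.
Proof. by apply: complex_ext; rewrite /= ?mulr0 ?mul0r ?mulr1 ?sub0r ?addr0 ?oppr0. Qed.

Definition grade_value (m k : nat) : C := ((2 * k)%:R - m%:R) * ci.

Lemma grade_value_inj m : injective (grade_value m).
Proof.
have ci0 : ci != 0 by rewrite eq_complex /= oner_eq0 andbF.
move=> k l /(mulIf ci0)/addIr/eqP.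
by rewrite eqr_nat eqn_pmul2l// => /eqP.
Qed.

(* Spectral projections of the sum of the K j, built one K at a time from     *)
(* those of each K j on its eigenvalues i and -i.                             *)
Lemma commuting_grading (J : eqType) (K : J -> Mat) (s : seq J) :
  (forall i j, K i *m K j = K j *m K i) -> (forall j, K j *m K j = - 1%:M) ->
  exists E : nat -> Mat,
  [/\ \sum_(k < (size s).+1) E k = 1%:M,
      (forall k, (size s < k)%N -> E k = 0),
      (forall k, (\sum_(j <- s) K j) *m E k = grade_value (size s) k *: E k),
      (forall k, (\big[mulmx/1%:M]_(j <- s) ((- ci) *: K j)) *m E k =
         (-1) ^+ (size s + k) *: E k) &
      forall X, (forall j, j \in s -> X *m K j = K j *m X) ->
        forall k, X *m E k = E k *m X].
Proof.
move=> KC KK; elim: s => [|j s [E [E1 E0 ES EG EC]]].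
  exists (fun k => if k == 0%N then 1%:M else 0); split=> [|k|k|k|X _ k] /=.
  - by rewrite big_ord_recl big_ord0 addr0.
  - by case: k.
  - rewrite big_nil mul0mx; case: k => [|k] /=; last by rewrite scaler0.
    by rewrite /grade_value muln0 subrr mul0r scale0r.
  - by rewrite big_nil mul1mx; case: k => [|k] /=; rewrite ?scaler0// scale1r.
  - by case: ifP; rewrite ?mulmx1 ?mul1mx ?mulmx0 ?mul0mx.
(* [pp] and [pm] are the projections on the eigenspaces of [K j] for [i] and [-i]. *)
pose pp : Mat := 2^-1 *: (1%:M - ci *: K j).
pose pm : Mat := 2^-1 *: (1%:M + ci *: K j).
have ppm : pp + pm = 1%:M.
  by rewrite -scalerDr addrCA subrK -mulr2n -[1%:M *+ 2]scaler_nat scalerA mulVf ?scale1r//.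
have Kpp : K j *m pp = ci *: pp.
  rewrite -scalemxAr scalerA mulrC -scalerA; congr (_ *: _).
  rewrite mulmxBr mulmx1 -scalemxAr KK scalerN opprK scalerBr scalerA ci_sqr.
  by rewrite scaleN1r opprK addrC scalemx1.
have Kpm : K j *m pm = (- ci) *: pm.
  rewrite -scalemxAr scalerA mulrC -scalerA; congr (_ *: _).
  rewrite mulmxDr mulmx1 -scalemxAr KK scalerN scalerDr scalerA mulNr ci_sqr.
  by rewrite opprK scale1r scaleNr addrC scalemx1.
have EK k : K j *m E k = E k *m K j by apply: EC => i _; exact: KC.
(* The degree counts the structures that act as [i]: it rises by one on the [i]-eigenspace of [K j]
   and stays on the other. *)
pose E' k := (if k is k'.+1 then E k' *m pp else 0) + E k *m pm.
have KE k Y : K j *m (E k *m Y) = E k *m (K j *m Y) by rewrite !mulmxA EK.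
exists E'; split=> [|k ks|k|k|X XC k] /=.
- rewrite big_split /= big_ord_recl add0r.
  rewrite -mulmx_suml E1 mul1mx big_ord_recr /= E0// mul0mx addr0.
  by rewrite -mulmx_suml E1 mul1mx.
- rewrite /E' (E0 k); last by apply: ltn_trans ks.
  by rewrite mul0mx addr0; case: k ks => // k ks; rewrite E0 ?mul0mx.
- rewrite big_cons mulmxDl /E' !mulmxDr !mulmxA !ES -!scalemxAl.
  rewrite -!mulmxA !KE !Kpm -!scalemxAr.
  case: k => [|k].
    rewrite !mulmx0 !add0r -scalerDl; congr (_ *: _).
    rewrite /grade_value /= muln0 -natr1; set a := (0%:R : C); set c := (size s)%:R.
    by rewrite /a; ring.
  rewrite !mulmxA ES -scalemxAl -!mulmxA KE Kpp -scalemxAr.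
  rewrite addrACA -!scalerDl scalerDr; congr (_ *: _ + _ *: _).
    by rewrite /grade_value mulnS natrD -(natr1 (size s)); ring.
  by rewrite /grade_value mulnS natrD -(natr1 (size s)); ring.
- rewrite big_cons /E' mulmxDr; set G := \big[mulmx/_]_(_ <- _) _.
  have GX k' Y : (- ci *: K j) *m G *m (E k' *m Y) =
      (-1) ^+ (size s + k') *: (E k' *m ((- ci) *: (K j *m Y))).
    rewrite -mulmxA; have -> : G *m (E k' *m Y) = (-1) ^+ (size s + k') *: (E k' *m Y).
      by rewrite mulmxA EG scalemxAl.
    by rewrite -scalemxAr -scalemxAl KE -[in RHS]scalemxAr.
  have GEm k' : (- ci *: K j) *m G *m (E k' *m pm) =
      (-1) ^+ (size s + k').+1 *: (E k' *m pm).
    by rewrite GX Kpm scalerA mulrNN ci_sqr scaleN1r mulmxN scalerN exprS mulN1r scaleNr.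
  have GEp k' : (- ci *: K j) *m G *m (E k' *m pp) =
      (-1) ^+ (size s + k') *: (E k' *m pp).
    by rewrite GX Kpp scalerA mulNr ci_sqr opprK scale1r.
  rewrite GEm addSn; case: k => [|k]; first by rewrite !mulmx0 !add0r.
  rewrite GEp scalerDr addnS; congr (_ *: _ + _).
  by rewrite !exprS !mulN1r opprK.
- have XE l : X *m E l = E l *m X.
    by apply: EC => i si; apply: XC; rewrite inE si orbT.
  have XK : X *m K j = K j *m X by apply: XC; rewrite mem_head.
  have Xpp : X *m pp = pp *m X.
    by rewrite -scalemxAr -scalemxAl mulmxBr mulmxBl mulmx1 mul1mx -scalemxAr -scalemxAl XK.
  have Xpm : X *m pm = pm *m X.
    by rewrite -scalemxAr -scalemxAl mulmxDr mulmxDl mulmx1 mul1mx -scalemxAr -scalemxAl XK.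
  rewrite /E' mulmxDr mulmxDl mulmxA XE -mulmxA Xpm mulmxA.
  case: k => [|k]; first by rewrite mulmx0 mul0mx.
  by rewrite mulmxA XE -mulmxA Xpp mulmxA.
Qed.

End CommutingComplexStructures.

Section Grading.
Context {R : realType} {n : nat} (Cl : clifford R n.*2) (kappa : spin_module Cl).
Local Notation C := R[i].
Local Notation Mat := 'M[R[i]]_(2 ^ n).
Local Notation N := n.*2.
Local Notation ci := (0 +i* 1 : C).

Definition plane_elt (j : 'I_n) : Cl := cl_gen Cl (even_ord j) * cl_gen Cl (odd_ord j).

Definition omega_elt : Cl := \sum_j plane_elt j.

Definition plane_word (s : seq 'I_n) : seq 'I_N :=
  flatten [seq [:: even_ord j; odd_ord j] | j <- s].

(** The normalised volume element, that is the product of the [- i K_j] over the complex planes.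
    Each factor is 1 where [K_j] acts as [i] and -1 where it acts as [-i], so on degree [k] the
    product is (-1)^(n-k). *)
Definition chirality : Mat := (- ci) ^+ n *: kappa (cl_word Cl (plane_word (index_enum 'I_n))).

Lemma plane_elt_sqr j : plane_elt j * plane_elt j = -1.
Proof.
rewrite /plane_elt -mulrA (mulrA (cl_gen _ (odd_ord j))).
rewrite (cl_genC Cl (a := odd_ord j)); last by rewrite eq_sym eq_even_odd.
rewrite mulNr mulrN mulrA (mulrA (cl_gen _ _) (cl_gen _ _)) cl_gen_sqr mulN1r mulNr opprK.
exact: cl_gen_sqr.
Qed.

Lemma plane_eltC j k : plane_elt j * plane_elt k = plane_elt k * plane_elt j.
Proof.
have [->//|jk] := eqVneq j k.
have cl a b : a != b -> forall w, cl_gen Cl a * (cl_gen Cl b * w) =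
    - (cl_gen Cl b * (cl_gen Cl a * w)).
  by move=> ab w; rewrite !mulrA cl_genC// mulNr.
have ee : even_ord j != even_ord k by rewrite (inj_eq even_ord_inj).
have oo : odd_ord j != odd_ord k by rewrite (inj_eq odd_ord_inj).
have eo : even_ord j != odd_ord k by rewrite eq_even_odd.
have oe : odd_ord j != even_ord k by rewrite eq_sym eq_even_odd.
rewrite /plane_elt -!mulrA (cl _ _ oe) (cl_genC _ oo) !mulrN opprK.
by rewrite (cl _ _ ee) (cl _ _ eo) !mulrN opprK.
Qed.

Lemma spinor_grading : exists E : nat -> Mat,
  [/\ \sum_(k < n.+1) E k = 1%:M,
      (forall k, kappa omega_elt *m E k = @grade_value R n k *: E k),
      (forall k, chirality *m E k = (-1) ^+ (n + k) *: E k) &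
      (forall k, kappa omega_elt *m E k = E k *m kappa omega_elt)].
Proof.
pose K j := kappa (plane_elt j).
have [|j|E [E1 _ ES EG EC]] := @commuting_grading R _ _ K (index_enum 'I_n).
- by move=> j k; rewrite /K -!kappaM plane_eltC.
- by rewrite /K -kappaM plane_elt_sqr kappaN kappa1.
have sz : size (index_enum 'I_n) = n.
  by rewrite -[index_enum _]enumT size_enum_ord.
rewrite sz in E1 ES EG.
have SE : kappa omega_elt = \sum_j K j by rewrite kappa_sum.
exists E; split=> // [k|k|k].
- by rewrite SE ES.
- rewrite -EG /chirality; congr (_ *m _).
  have G (s : seq 'I_n) : \big[mulmx/1%:M]_(j <- s) ((- ci) *: K j) =
      (- ci) ^+ size s *: kappa (cl_word Cl (plane_word s)).
    elim: s => [|j s IH]; first by rewrite big_nil /plane_word /= cl_word_nil kappa1 scale1r.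
    rewrite big_cons IH /plane_word /= !cl_word_cons mulrA kappaM -/(plane_elt j).
    by rewrite -scalemxAl -scalemxAr scalerA exprS.
  by rewrite G sz.
apply: EC => j _; rewrite SE mulmx_suml mulmx_sumr; apply: eq_bigr => l _.
by rewrite /K -!kappaM plane_eltC.
Qed.

(** Distinct projections [E l] belong to distinct eigenvalues of [omega_elt], so they kill an
    eigenvector except for [l = k]. *)
Lemma chirality_eigen k (f : 'cV[C]_(2 ^ n)) :
  kappa omega_elt *m f = @grade_value R n k *: f ->
  chirality *m f = (-1) ^+ (n + k) *: f.
Proof.
have [E [E1 ES EG EC]] := spinor_grading; move=> fk.
have Ef l : l != k -> E l *m f = 0.
  move=> lk; have : (@grade_value R n l - @grade_value R n k) *: (E l *m f) = 0.
    rewrite scalerBl; apply/eqP; rewrite subr_eq0; apply/eqP.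
    by rewrite scalemxAl -ES EC -mulmxA fk scalemxAr.
  move=> /eqP; rewrite scaler_eq0 subr_eq0 => /orP[/eqP/grade_value_inj e|/eqP//].
  by rewrite e eqxx in lk.
rewrite -{1}[f]mul1mx -E1 mulmx_suml mulmx_sumr -[in RHS](mul1mx f) -E1 mulmx_suml scaler_sumr.
apply: eq_bigr => l _; rewrite mulmxA EG -scalemxAl.
by have [->//|lk] := eqVneq (l : nat) k; rewrite Ef// !scaler0.
Qed.

Lemma chirality_sqr : chirality *m chirality = 1%:M.
Proof.
have [E [E1 _ EG _]] := spinor_grading.
rewrite -[LHS]mulmx1 -E1 mulmx_sumr; apply: eq_bigr => k _.
rewrite -mulmxA EG -scalemxAr EG scalerA -exprD addnn -signr_odd odd_double scale1r.
by [].
Qed.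

End Grading.

(** * Exterior forms *)

Section ExteriorForms.
Context {R : realType} {n : nat} {M : manifold R n.*2}.
Context (H : hermitian_structure M) (x : M).
Local Notation C := R[i].
Local Notation N := n.*2.
Implicit Types (A B : {set 'I_N}) (u v : tangent x) (l : seq (tangent x)) (al be : extform x) (e : frame x).

Definition multilinear_on_lists (phi : seq (tangent x) -> C) :=
  forall l1 l2 a u v, phi (l1 ++ (a *: u + v) :: l2) =
    a%:C * phi (l1 ++ u :: l2) + phi (l1 ++ v :: l2).

Lemma form_multilinear al : multilinear_on_lists al.
Proof. by have /asboolP[] := formP al. Qed.

Lemma form_alternating al l1 l2 l3 u : al (l1 ++ u :: l2 ++ u :: l3) = 0.
Proof. by have /asboolP[_] := formP al; apply. Qed.

Lemma multilinear0 phi l1 l2 : multilinear_on_lists phi -> phi (l1 ++ 0 :: l2) = 0.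
Proof.
move=> mp; have := mp l1 l2 1 0 0; rewrite scale1r addr0 mul1r => /eqP.
by rewrite addrC -subr_eq subrr => /eqP<-.
Qed.

Lemma multilinear_sum phi l1 l2 (I : Type) (r : seq I) (k : I -> R) (w : I -> tangent x) :
  multilinear_on_lists phi ->
  phi (l1 ++ (\sum_(i <- r) k i *: w i) :: l2) =
    \sum_(i <- r) (k i)%:C * phi (l1 ++ w i :: l2).
Proof.
move=> mp; elim: r => [|i r IH]; first by rewrite !big_nil multilinear0.
by rewrite !big_cons mp IH.
Qed.

Lemma form_swap al l1 l2 u v : al (l1 ++ u :: v :: l2) = - al (l1 ++ v :: u :: l2).
Proof.
have mp := form_multilinear al.
have D (l3 l4 : seq (tangent x)) (a b : tangent x) :
    al (l3 ++ (a + b) :: l4) = al (l3 ++ a :: l4) + al (l3 ++ b :: l4).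
  by have := mp l3 l4 1 a b; rewrite scale1r mul1r.
have := form_alternating al l1 [::] l2 (u + v); rewrite /= D.
have := D (rcons l1 u) l2 u v; rewrite !cat_rcons => ->.
have := D (rcons l1 v) l2 u v; rewrite !cat_rcons => ->.
rewrite (form_alternating al l1 [::] l2 u) (form_alternating al l1 [::] l2 v).
by rewrite add0r addr0 => /eqP; rewrite addr_eq0 => /eqP.
Qed.

Lemma form_word_perm al e (s t : seq 'I_N) : perm_eq s t ->
  al [seq e a | a <- s] = al [seq e a | a <- t] \/
  al [seq e a | a <- s] = - al [seq e a | a <- t].
Proof.
apply: (swap_perm_rel (f := fun s => (al [seq e a | a <- s] : C))
  (r := fun z w => z = w \/ z = - w)) => [z|z w q|l1 a b l2]; first by left.
  by move=> [->|->] [->|->]; rewrite ?opprK; tauto.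
by right; rewrite !map_cat /= form_swap.
Qed.

Lemma form_word_nonuniq al e (s : seq 'I_N) : ~~ uniq s ->
  al [seq e a | a <- s] = 0.
Proof.
move=> nu; suff [s1 [a [s2 [s3 ->]]]] : exists s1 a s2 s3, s = s1 ++ a :: s2 ++ a :: s3.
  by rewrite !map_cat /= map_cat /= form_alternating.
elim: s nu => //= a s IH; rewrite negb_and negbK => /orP[as_|/IH[s1 [b [s2 [s3 ->]]]]].
  by case/splitPr: as_ => s2 s3; exists [::], a, s2, s3.
by exists (a :: s1), b, s2, s3.
Qed.

(** Multilinearity reduces the arguments to frame vectors; lists with a repetition give 0, and the
    others can be sorted at the cost of a sign. *)
Lemma form_frame_ext e al be : uframe H e ->
  (forall A : {set 'I_N}, al [seq e a | a <- enum A] = be [seq e a | a <- enum A]) ->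
  al = be.
Proof.
move=> [oe _] ab; apply/subr0_eq; set ga := al - be.
have gaE l : ga l = al l - be l by [].
have ga0 (s : seq 'I_N) : ga [seq e a | a <- s] = 0.
  have [us|/form_word_nonuniq -> //] := boolP (uniq s).
  have p : perm_eq s (enum [set a in s]%SET).
    by apply: uniq_perm; rewrite ?enum_uniq// => a; rewrite mem_enum inE.
  by have [->|->] := form_word_perm ga e p; rewrite gaE ab subrr ?oppr0.
suff gl l : ga l = 0 by apply: val_inj; apply/funext => l; exact: gl.
(* [s] collects the indices of the arguments already expanded in the frame. *)
suff : forall s, ga ([seq e a | a <- s] ++ l) = 0 by move/(_ [::]).
elim: l => [|v l IH] s; first by rewrite cats0.
rewrite (orthonormal_expand oe v) (multilinear_sum _ _ _ _ _ (form_multilinear ga)) big1//.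
move=> a _; have := IH (rcons s a); rewrite map_rcons cat_rcons => ->.
by rewrite mulr0.
Qed.

(** The wedge product, in increasing order, of the coframe elements with index in [A]. *)
Definition det_form_fun e (A : {set 'I_N}) l : C :=
  if size l == #|A| then
    \det (\matrix_(i < #|A|, j < #|A|) (metric H l`_i (e (enum_val j)))%:C)
  else 0.

Lemma det_form_axiom e A : form_axiom (det_form_fun e A).
Proof.
split=> [l1 l2 a u v|l1 l2 l3 u]; rewrite /det_form_fun.
  rewrite !size_cat /=; case: eqP => sz; last by rewrite mulr0 addr0.
  have i0 : (size l1 < #|A|)%N by rewrite -sz addnS ltnS leq_addr.
  have ne (w w' : tangent x) (k : nat) : k != size l1 ->
      (l1 ++ w :: l2)`_k = (l1 ++ w' :: l2)`_k.
    by rewrite !nth_cat; case: ltngtP => // lk _; rewrite -(subnSK lk).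
  have eq (w : tangent x) : (l1 ++ w :: l2)`_(size l1) = w.
    by rewrite nth_cat ltnn subnn.
  rewrite -[X in _ = _ + X]mul1r.
  apply: (determinant_multilinear (i0 := Ordinal i0)).
  - by apply/rowP => j; rewrite !mxE /= !eq metricPl mul1r -rmorphM -rmorphD.
  - by apply/matrixP => i j; rewrite !mxE (ne u (a *: u + v))// eq_sym (neq_lift (Ordinal i0)).
  - by apply/matrixP => i j; rewrite !mxE (ne v (a *: u + v))// eq_sym (neq_lift (Ordinal i0)).
case: eqP => // sz.
have s1 : (size l1 < #|A|)%N by rewrite -sz size_cat /= addnS ltnS leq_addr.
have s2 : (size l1 + (size l2).+1 < #|A|)%N.
  by rewrite -sz size_cat /= size_cat /= ltn_add2l ltnS addnS ltnS leq_addr.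
apply: (determinant_alternate (i1 := Ordinal s1) (i2 := Ordinal s2)).
  by rewrite -val_eqE /= -{1}[size l1]addn0 eqn_add2l.
move=> j; rewrite !mxE /= nth_cat ltnn subnn /= nth_cat ltnNge leq_addr /=.
by rewrite addKn /= nth_cat ltnn subnn.
Qed.

Definition det_form e A : extform x := ExtForm (asboolT (det_form_axiom e A)).

Lemma det_form_frame e A B : uframe H e ->
  det_form e A [seq e a | a <- enum B] = (A == B)%:R.
Proof.
move=> [oe _]; rewrite /= /det_form_fun size_map -cardE.
have nthB (b0 : 'I_N) i : (i < #|B|)%N ->
    [seq e a | a <- enum B]`_i = e (nth b0 (enum B) i).
  by move=> iB; rewrite (nth_map b0)// -cardE.
have [<-|AB] := eqVneq A B.
  rewrite eqxx -[RHS](det1 C #|A|); congr (\det _); apply/matrixP => i j.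
  rewrite !mxE (nth_map (enum_val j)) -?cardE// -enum_val_nth oe.
  by rewrite (inj_eq enum_val_inj); case: (i == j).
case: eqP => // cAB.
have [b bB bA] : exists2 b, b \in B & b \notin A.
  apply/subsetPn; apply: contra AB => BA.
  by rewrite eq_sym eqEcard BA cAB leqnn.
have ib : (index b (enum B) < #|A|)%N by rewrite -cAB cardE index_mem mem_enum.
rewrite (expand_det_row _ (Ordinal ib)) big1// => j _; rewrite !mxE /=.
rewrite (nth_map b) ?index_mem ?mem_enum// nth_index ?mem_enum// oe.
have -> : (b == enum_val j) = false.
  by apply/eqP => bE; rewrite bE enum_valP in bA.
by rewrite mul0r.
Qed.

Lemma form_sumE (I : Type) (r : seq I) (k : I -> C) (F : I -> extform x) l :
  (\sum_(i <- r) k i *: F i) l = \sum_(i <- r) k i * F i l.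
Proof.
elim: r => [|i r IH]; first by rewrite !big_nil.
by rewrite !big_cons -IH.
Qed.

Lemma form_expand e al : uframe H e ->
  al = \sum_(A : {set 'I_N}) al [seq e a | a <- enum A] *: det_form e A.
Proof.
move=> ue; apply: (form_frame_ext ue) => B; rewrite form_sumE (bigD1 B isT) /=.
rewrite [det_form_fun _ _ _](det_form_frame B B ue) eqxx mulr1 big1 ?addr0// => A AB.
by rewrite [det_form_fun _ _ _](det_form_frame A B ue) (negPf AB) mulr0.
Qed.

Section CliffordForm.
Context (Cl : clifford R N).

(** The sum of [phi(e_a1, ..., e_ak) e_a1 ... e_ak] over all words of length [k], repetitions
    included. Unlike the sum over increasing words, it contracts each slot separately, which makes
    its independence of the frame visible. *)
Fixpoint clifford_sum e k (phi : seq (tangent x) -> C) : Cl :=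
  if k is k'.+1 then
    \sum_a cl_gen Cl a * clifford_sum e k' (fun l => phi (e a :: l))
  else phi [::] *: 1.

Lemma clifford_sum_linear e k (I : Type) (r : seq I) (z : I -> C)
    (phi : I -> seq (tangent x) -> C) :
  clifford_sum e k (fun l => \sum_(i <- r) z i * phi i l) =
    \sum_(i <- r) z i *: clifford_sum e k (phi i).
Proof.
elim: k phi => [|k IH] phi /=.
  by rewrite scaler_suml; apply: eq_bigr => i _; rewrite scalerA.
transitivity (\sum_a \sum_(i <- r) z i *: (cl_gen Cl a *
    clifford_sum e k (fun l => phi i (e a :: l)))).
  apply: eq_bigr => a _; rewrite (IH (fun i l => phi i (e a :: l))) mulr_sumr.
  by apply: eq_bigr => i _; rewrite scalerAr.
by rewrite exchange_big; apply: eq_bigr => i _; rewrite scaler_sumr.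
Qed.

(** In each slot the rotation of the frame vector and that of the generator cancel, as the rows of
    an orthogonal matrix are orthonormal. *)
Lemma clifford_sum_equivariant e k phi (A : 'M[C]_n) : A \is unitarymx ->
  multilinear_on_lists phi ->
  cl_lift Cl (realify A) (clifford_sum (frame_act e A) k phi) = clifford_sum e k phi.
Proof.
move=> uA; elim: k phi => [|k IH] phi mp /=; first by rewrite linearZ /= rmorph1.
have oQ := unitary_realify_tr uA.
have mpu u : multilinear_on_lists (fun l => phi (u :: l)).
  by move=> l1 l2 a v w; exact: (mp (u :: l1)).
transitivity (\sum_a \sum_c \sum_d ((realify A c a)%:C * (realify A d a)%:C) *:
    (cl_gen Cl c * clifford_sum e k (fun l => phi (e d :: l)))).
  rewrite linear_sum; apply: eq_bigr => a _; rewrite rmorphM /= IH//.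
  rewrite cl_lift_gen// mulr_suml; apply: eq_bigr => c _.
  have -> : (fun l => phi (frame_act e A a :: l)) =
      (fun l => \sum_d (realify A d a)%:C * phi (e d :: l)).
    by apply/funext => l; exact: (multilinear_sum [::] l _ _ _ mp).
  rewrite clifford_sum_linear mulr_sumr; apply: eq_bigr => d _.
  by rewrite -scalerAl -scalerAr scalerA.
rewrite exchange_big; apply: eq_bigr => c _ /=; rewrite exchange_big /=.
have QQ d : \sum_a ((realify A c a)%:C * (realify A d a)%:C) = ((c == d)%:R : C).
  have /matrixP/(_ c d) := (unitary_realify A).1 uA; rewrite !mxE => /(congr1 (real_complex R)).
  rewrite rmorph_sum /= => E; transitivity ((c == d)%:R%:C : C); last by case: (c == d).
  by rewrite -E; apply: eq_bigr => a _; rewrite [_^T a d]mxE rmorphM.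
rewrite (bigD1 c isT) /= -scaler_suml QQ eqxx scale1r big1 ?addr0// => d dc.
by rewrite -scaler_suml QQ eq_sym (negPf dc) scale0r.
Qed.

Fixpoint words_sum k (g : seq 'I_N -> Cl) : Cl :=
  if k is k'.+1 then \sum_a words_sum k' (fun s => g (a :: s)) else g [::].

(** A set of size [k] is listed by [k!] words without repetition, on which [g] takes the same value.
    In the induction the first letter [a] is split off: the remaining letters form a set avoiding
    [a], and each set of size [k.+1] arises from [k.+1] choices of [a]. *)
Lemma words_sum_sets k (g : seq 'I_N -> Cl) :
  (forall s1 a b s2, g (s1 ++ a :: b :: s2) = g (s1 ++ b :: a :: s2)) ->
  (forall s, ~~ uniq s -> g s = 0) ->
  words_sum k g = k`!%:R *: \sum_(A : {set 'I_N} | #|A| == k) g (enum A).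
Proof.
elim: k g => [|k IH] g sw nu /=.
  rewrite scale1r (bigD1 finset.set0) ?cards0//= enum_set0 big1 ?addr0// => A.
  by rewrite cards_eq0 => /andP[->].
transitivity (\sum_a k`!%:R *: \sum_(A : {set 'I_N} | (#|A| == k.+1) && (a \in A)) g (enum A)).
  apply: eq_bigr => a _; rewrite IH => [|l1 c d l2|s ns].
  - congr (_ *: _); rewrite (bigID (fun A : {set 'I_N} => a \in A)) /= big1 ?add0r => [|A].
      rewrite [RHS](reindex_onto (fun A => a |: A) (fun A => A :\ a)) /=; last first.
        by move=> A /andP[_ aA]; rewrite finset.setD1K.
      rewrite [LHS](eq_bigl (fun A : {set 'I_N} =>
        ((#|a |: A| == k.+1) && (a \in a |: A)) && ((a |: A) :\ a == A))); last first.
        move=> A; rewrite setU11 andbT cardsU1.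
        case: (boolP (a \in A)) => aA /=; last by rewrite andbT setU1K// eqxx andbT.
        rewrite andbF; symmetry; apply/negbTE; rewrite negb_and; apply/orP; right.
        by apply/eqP => E; have := setD11 a (a |: A); rewrite E aA.
      apply: eq_bigr => A /andP[/andP[_ _] /eqP AE].
      apply: swap_perm_eq => //; apply: uniq_perm; rewrite /= ?enum_uniq ?mem_enum ?andbT//.
        by rewrite -AE setD11.
      by move=> b; rewrite inE !mem_enum in_setU1.
    by move=> /andP[_ aA]; apply: nu; rewrite /= mem_enum aA.
  - exact: (sw (a :: l1)).
  - by apply: nu; rewrite /= negb_and ns orbT.
rewrite -scaler_sumr (exchange_big_dep (fun A : {set 'I_N} => #|A| == k.+1)) /=; last first.
  by move=> a A _ /andP[].
rewrite factS mulnC natrM -scalerA; congr (_ *: _); rewrite scaler_sumr.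
apply: eq_bigr => A cA; rewrite (eq_bigl (mem A)) => [|a]; last by rewrite cA.
by rewrite sumr_const (eqP cA) scaler_nat.
Qed.

Lemma words_sum_mull k (w : Cl) g : w * words_sum k g = words_sum k (fun s => w * g s).
Proof.
elim: k g => //= k IH g; rewrite mulr_sumr; apply: eq_bigr => a _.
by rewrite IH.
Qed.

Lemma clifford_sum_words e k phi :
  clifford_sum e k phi = words_sum k (fun s => phi [seq e a | a <- s] *: cl_word Cl s).
Proof.
elim: k phi => [|k IH] phi /=; first by rewrite cl_word_nil.
apply: eq_bigr => a _; rewrite IH words_sum_mull; congr words_sum; apply/funext => s.
by rewrite cl_word_cons scalerAr.
Qed.

(** The values of the form and the products of distinct generators change sign together under
    transpositions, so their product is symmetric and [words_sum_sets] applies in each degree. *)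
Lemma quantization_sum e al :
  \sum_(A : {set 'I_N}) al [seq e a | a <- enum A] *: blade Cl A =
  \sum_(k < N.+1) (k`!%:R)^-1 *: clifford_sum e k al.
Proof.
rewrite (partition_big (fun A : {set 'I_N} => inord #|A| : 'I_N.+1) xpredT) //=.
apply: eq_bigr => k _; rewrite clifford_sum_words words_sum_sets.
- rewrite scalerA mulVf ?scale1r; last by rewrite pnatr_eq0 -lt0n fact_gt0.
  apply: eq_bigl => A; rewrite -val_eqE /= inordK// ltnS.
  by rewrite -[X in (_ <= X)%N](card_ord N) max_card.
- move=> s1 a b s2; have [->//|ab] := eqVneq a b.
  rewrite !map_cat /= form_swap !cl_word_cat !cl_word_cons.
  rewrite [cl_gen Cl a * _]mulrA (cl_genC Cl ab) mulNr mulrN scaleNr scalerN opprK.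
  by rewrite -(mulrA (cl_gen Cl b)).
- by move=> s ns; rewrite form_word_nonuniq ?scale0r.
Qed.

Lemma quantization_equivariant e al (A : 'M[C]_n) : A \is unitarymx ->
  cl_lift Cl (realify A) (\sum_(B : {set 'I_N}) al [seq frame_act e A a | a <- enum B] *: blade Cl B) =
  \sum_(B : {set 'I_N}) al [seq e a | a <- enum B] *: blade Cl B.
Proof.
move=> uA; rewrite !quantization_sum linear_sum; apply: eq_bigr => k _.
by rewrite linearZ /= clifford_sum_equivariant//; exact: form_multilinear.
Qed.

Lemma cl_formE e al : uframe H e ->
  (cl_form H Cl al : assoc H (cl_rep Cl) x) e =
    \sum_(A : {set 'I_N}) al [seq e a | a <- enum A] *: blade Cl A.
Proof.
by move=> ue; rewrite /cl_form mk_assocE// => e' A ue' uA; exact: quantization_equivariant.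
Qed.

Lemma kahler_form_axiom : form_axiom (kahler_form H (x := x)).
Proof.
split=> [l1 l2 a u v|l1 l2 l3 u].
  case: l1 => [|w1 [|w2 l1]]; case: l2 => [|w3 [|w4 l2]] //=;
    rewrite ?mulr0 ?addr0//; try by case: l1 => [|? ?]; rewrite ?mulr0 ?addr0.
  - by rewrite cplxP metricPl rmorphD rmorphM.
  - by rewrite metricDr metricZr rmorphD rmorphM.
case: l1 => [|w1 [|w2 l1]]; case: l2 => [|w3 [|w4 l2]]; case: l3 => [|w5 l3] //=.
  by rewrite cplx_orth.
all: by case: l1.
Qed.

Definition kahler_extform : extform x := ExtForm (asboolT kahler_form_axiom).

Lemma clifford_sum0 e k : clifford_sum e k (fun=> 0) = 0.
Proof.
elim: k => [|k IH] /=; first by rewrite scale0r.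
by rewrite big1// => a _; rewrite IH mulr0.
Qed.

(** Only the pairs of [even_ord j] and [odd_ord j] contribute, each in both orders; the resulting 2
    is cancelled by the factorial in [quantization_sum]. *)
Lemma clifford_sum_kahler e k : uframe H e ->
  clifford_sum e k (kahler_form H (x := x)) = if k == 2 then 2%:R *: omega_elt Cl else 0.
Proof.
move=> ue; have [oe _] := ue.
case: k => [|[|[|k]]] /=; first by rewrite scale0r.
- by rewrite big1// => a _; rewrite scale0r mulr0.
- have eo j : cplx H (e (odd_ord j)) = - e (even_ord j) by rewrite (uframe_odd _ ue) cplxK.
  have ee j : cplx H (e (even_ord j)) = e (odd_ord j) by rewrite (uframe_odd _ ue).
  rewrite sum_parity /omega_elt scaler_sumr; apply: eq_bigr => j _.
  rewrite (bigD1 (odd_ord j) isT) /= ee oe eqxx scale1r mulr1 [X in _ * (_ + X)]big1; last first.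
    by move=> a aj; rewrite oe eq_sym (negPf aj) scale0r mulr0.
  rewrite addr0 (bigD1 (even_ord j) isT) /= eo metricNl oe eqxx [X in _ * (_ + X)]big1; last first.
    by move=> a aj; rewrite metricNl oe eq_sym (negPf aj) oppr0 scale0r mulr0.
  rewrite addr0 rmorphN rmorph1 scaleN1r mulrN mulr1 mulrN.
  rewrite -(cl_genC Cl (a := even_ord j)); last by rewrite eq_even_odd.
  by rewrite -mulr2n scaler_nat.
- rewrite big1// => a _; rewrite big1 ?mulr0// => b _; rewrite big1 ?mulr0// => c _.
  by rewrite clifford_sum0 mulr0.
Qed.

Lemma cl_form_kahler e : uframe H e ->
  (cl_form H Cl (kahler_form H (x := x)) : assoc H (cl_rep Cl) x) e = omega_elt Cl.
Proof.
move=> ue; rewrite -[kahler_form H (x := x)]/(form_fun kahler_extform) cl_formE//.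
rewrite quantization_sum.
(* For [n = 0] the degree 2 is not among the indices of the sum, and both sides vanish. *)
have [n0|n0] := posnP n.
  rewrite /omega_elt big1 => [|k _]; last first.
    rewrite (clifford_sum_kahler k ue); case: eqP => [k2|_]; last by rewrite scaler0.
    by exfalso; have := ltn_ord k; rewrite k2 n0.
  by rewrite big1// => j; exfalso; case: (j) => j0; rewrite n0.
have n2 : (2 < N.+1)%N by rewrite ltnS (leq_double 1).
rewrite (bigD1 (Ordinal n2) isT) (clifford_sum_kahler (Ordinal n2) ue) /=.
rewrite scalerA mulVf ?scale1r; last by rewrite pnatr_eq0.
rewrite big1 ?addr0// => k k2; rewrite (clifford_sum_kahler k ue).
by case: eqP => [k2'|_]; [case/eqP: k2; exact: val_inj|rewrite scaler0].
Qed.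

End CliffordForm.

End ExteriorForms.

(** * The covariant derivative of forms in a parallel frame *)

Section FormDerivative.
Context {R : realType} {n : nat} {M : manifold R n.*2}.
Context (H : hermitian_structure M) (D : conn (M := M)) (hD : is_chern H D).
Local Notation C := R[i].
Local Notation N := n.*2.
Context (x : M) (v : tangent x) (e : local_frame (M := M)).
Hypothesis ue : uframe_near H x e.
Hypothesis pe : forall (u : tangent x) a, D u (e a) = 0.
Context (al : forall y, extformB M y).
Hypothesis sal : sec_smooth x al.

Let word (s : seq 'I_N) : seq (vfield M) := [seq e a | a <- s].

Lemma at_pt_cat (y : M) (Us Vs : seq (vfield M)) : at_pt y (Us ++ Vs) = at_pt y Us ++ at_pt y Vs.
Proof. by rewrite /at_pt map_cat. Qed.

Lemma at_pt_word y s : at_pt y (word s) = [seq frame_at e y a | a <- s].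
Proof. by rewrite /at_pt -map_comp. Qed.

Lemma all_smooth_cat s Us : all_smooth_at x Us -> all_smooth_at x (word s ++ Us).
Proof.
move=> sU i; rewrite size_cat nth_cat => iU; case: ltnP => [ils|sli].
  rewrite size_map in ils.
  have [a0 _] : exists a : 'I_N, true by case: (s) ils => // a; exists a.
  by rewrite (nth_map a0)//; exact: ue.1.
by apply: sU; rewrite -(ltn_add2l (size (word s))) subnKC.
Qed.

Lemma form_word_smooth s Us : all_smooth_at x Us ->
  csmooth_at x (fun y => al y (at_pt y (word s ++ Us))).
Proof. by move=> sU; apply: sal; exact: all_smooth_cat. Qed.

Lemma form_coef_smooth s : csmooth_at x (fun y => al y [seq frame_at e y a | a <- s]).
Proof.
have := form_word_smooth s (Us := [::]) (fun i => ltac:(by [])).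
by apply: csmooth_ext; apply: nearW => y; rewrite cats0 at_pt_word.
Qed.

Definition frame_derivative : extform x :=
  \sum_(A : {set 'I_N}) cder v (fun y => al y [seq frame_at e y a | a <- enum A]) *:
    det_form H (frame_at e x) A.

Lemma det_form_word A s y : uframe H (frame_at e y) ->
  det_form H (frame_at e y) A [seq frame_at e y a | a <- s] =
  det_form H (frame_at e x) A [seq frame_at e x a | a <- s].
Proof.
have ux := uframe_near_at ue; move=> uy.
rewrite /= /det_form_fun !size_map; case: eqP => // sA.
congr (\det _); apply/matrixP => i j; rewrite !mxE; congr (_%:C).
have [a0 _] : exists a : 'I_N, true by exists (enum_val i).
by rewrite !(nth_map a0) ?sA// uy.1 ux.1.
Qed.

Lemma frame_derivative_word s :
  cder v (fun y => al y [seq frame_at e y a | a <- s]) =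
  frame_derivative [seq frame_at e x a | a <- s].
Proof.
rewrite /frame_derivative form_sumE.
have sw A := form_coef_smooth (enum A).
pose c A := det_form H (frame_at e x) A [seq frame_at e x a | a <- s].
transitivity (cder v (fun y => \sum_A c A * al y [seq frame_at e y a | a <- enum A])).
  symmetry; apply: cder_ext; first by apply: csmooth_sum => A _; exact: csmoothZ.
  apply: filterS ue.2 => y uy; rewrite {2}(form_expand (al y) uy) form_sumE.
  by apply: eq_bigr => A _; rewrite mulrC /c -(det_form_word A s uy).
rewrite cder_sum => [|A _]; last exact: csmoothZ.
by apply: eq_bigr => A _; rewrite cderZ// mulrC.
Qed.

(** The fields of [Us] are expanded one by one in the frame, [s] recording those already replaced.
    Differentiating the coefficients [metric H (U y) (e a y)] produces the term with [D v U]; the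
    frame fields give no such term, being parallel at [x]. *)
Lemma frame_derivativeE Us s : all_smooth_at x Us ->
  frame_derivative (at_pt x (word s ++ Us)) =
    cder v (fun y => al y (at_pt y (word s ++ Us))) -
    \sum_(i < size Us) al x (at_pt x (word s) ++
       set_nth 0 (at_pt x Us) i (D v (nth (fun=> 0) Us i))).
Proof.
elim: Us s => [|U Us IH] s sU.
  rewrite big_ord0 subr0 cats0 at_pt_word -frame_derivative_word.
  by apply: eq_cder => y; rewrite at_pt_word.
have sU0 : vf_smooth_at x U := sU 0 isT.
have sUs : all_smooth_at x Us := fun i => sU i.+1.
have split y (be : extform y) : uframe H (frame_at e y) ->
    be (at_pt y (word s ++ U :: Us)) =
    \sum_a (metric H (U y) (e a y))%:C * be (at_pt y (word (rcons s a) ++ Us)).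
  move=> uy; rewrite at_pt_cat /= {1}(orthonormal_expand uy.1 (U y)).
  rewrite (multilinear_sum _ _ _ _ _ (form_multilinear be)).
  by apply: eq_bigr => a _; rewrite /word map_rcons !at_pt_cat /at_pt map_rcons cat_rcons.
have sg a : smooth_at x (fun y => metric H (U y) (e a y)) by apply: metric_smooth; [|exact: ue.1].
have sw a := form_word_smooth (rcons s a) sUs.
have ux := uframe_near_at ue.
rewrite split//; transitivity (\sum_a ((metric H (U x) (e a x))%:C *
    cder v (fun y => al y (at_pt y (word (rcons s a) ++ Us)))) -
    \sum_(i < size Us) al x (at_pt x (word s) ++ U x ::
       set_nth 0 (at_pt x Us) i (D v (nth (fun=> 0) Us i)))).
  under eq_bigr do rewrite (IH _ sUs) mulrBr; rewrite sumrB; congr (_ - _).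
  under eq_bigr do rewrite mulr_sumr; rewrite exchange_big /=; apply: eq_bigr => i _.
  rewrite [in RHS](orthonormal_expand ux.1 (U x)).
  rewrite (multilinear_sum _ _ _ _ _ (form_multilinear (al x))); apply: eq_bigr => a _.
  by rewrite /word map_rcons /at_pt map_rcons cat_rcons.
rewrite big_ord_recl /= opprD addrA; congr (_ - _).
apply/eqP; rewrite eq_sym subr_eq; apply/eqP.
transitivity (cder v (fun y => \sum_a (metric H (U y) (e a y))%:C *
    al y (at_pt y (word (rcons s a) ++ Us)))).
  symmetry; apply: cder_ext.
    by apply: csmooth_sum => a _; apply: csmoothM => //; exact: csmooth_real.
  by apply: filterS ue.2 => y uy; rewrite split.
rewrite cder_sum => [|a _]; last by apply: csmoothM => //; exact: csmooth_real.
rewrite addrC [X in _ = X + _](_ : _ = \sum_a (metric H (D v U) (e a x))%:C *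
    al x (at_pt x (word (rcons s a) ++ Us))).
  rewrite -big_split; apply: eq_bigr => a _ /=.
  rewrite cderM//; last exact: csmooth_real.
  by rewrite cder_real (chern_metric hD v sU0 (ue.1 a)) pe metric0r addr0.
rewrite {1}(orthonormal_expand ux.1 (D v U)) (multilinear_sum _ _ _ _ _ (form_multilinear (al x))).
by apply: eq_bigr => a _; rewrite /word map_rcons at_pt_cat /at_pt map_rcons cat_rcons.
Qed.

(** The condition defining [form_cov] fixes the values on frame vectors, so every solution equals
    [frame_derivative], which is one. *)
Lemma form_cov_frame : form_cov D v al = frame_derivative.
Proof.
pose P := [set be : extform x | forall Us, all_smooth_at x Us ->
      be (at_pt x Us) = cder v (fun y => al y (at_pt y Us))
        - \sum_(i < size Us)
            al x (set_nth 0 (at_pt x Us) i (D v (nth (fun=> 0) Us i)))].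
have Pf : P frame_derivative by move=> Us sU; rewrite -(frame_derivativeE [::] sU).
apply: (form_frame_ext (uframe_near_at ue)) => A.
have sA : all_smooth_at x (word (enum A)).
  have := all_smooth_cat (s := enum A) (Us := [::]) (fun i => ltac:(by [])).
  by rewrite cats0.
have := xgetPex (0 : extform x) (ex_intro P _ Pf); move=> /(_ _ sA) E.
by rewrite -at_pt_word [LHS]E -(Pf _ sA).
Qed.

End FormDerivative.

(** * V-spinors *)

Section CliffordValues.
Context {R : realType} {n : nat} {M : manifold R n.*2}.
Context (H : hermitian_structure M) (Cl : clifford R n.*2).
Local Notation N := n.*2.
Implicit Types (x : M) (A : 'M[R[i]]_n).

Lemma cl_oneE x (e : frame x) : uframe H e -> (cl_one H Cl x) e = 1.
Proof. by apply: mk_assocE => e' A _ _; exact: rmorph1. Qed.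

Lemma cl_mulE x (w w' : clB H Cl x) (e : frame x) : uframe H e ->
  (cl_mul w w') e = (w e : Cl) * w' e.
Proof.
by apply: mk_assocE => e' A ue uA; rewrite /= rmorphM; congr (_ * _); [exact: (assoc_act w ue uA)|exact: (assoc_act w' ue uA)].
Qed.

Lemma cl_tangentE x (v : tangent x) (e : frame x) : uframe H e ->
  (cl_tangent H Cl v) e = cl_vec Cl (\row_a metric H v (e a)).
Proof.
apply: mk_assocE => e' A ue uA; rewrite [LHS]cl_lift_vec; last exact: unitary_realify_tr.
have [oe _] := frame_act_uframe ue uA.
congr cl_vec; apply/rowP => a; rewrite !mxE {2}(orthonormal_expand oe v) metric_suml.
by apply: eq_bigr => c _; rewrite metricZl metric_frame_act// !mxE.
Qed.

Lemma dotv_tangent x (v : tangent x) (e : frame x) : uframe H e ->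
  dotv (\row_a metric H v (e a)) (\row_a metric H v (e a)) = metric H v v.
Proof.
move=> ue; rewrite /dotv mxE.
transitivity (metric H (\sum_a metric H v (e a) *: e a) v).
  by rewrite metric_suml; apply: eq_bigr => a _; rewrite !mxE metricZl (metricC H (e a)).
by rewrite -(orthonormal_expand ue.1).
Qed.

Section SpinorValues.
Context (kappa : spin_module Cl) (b : bool) (F : 'M[R[i]]_n -> Cl * R[i]).
Hypothesis hF : is_spinc_lift b F.

Lemma cl_spinorE x (w : clB H Cl x) (s : spinorB H kappa F x) (e : frame x) :
  uframe H e -> (cl_spinor w s) e = kappa (w e) *m s e.
Proof.
apply: mk_assocE => e' A ue uA /=; rewrite mulmxA (spinc_mx_kappa kappa hF _ uA) -mulmxA.
by congr (kappa _ *m _); [exact: (assoc_act w ue uA)|exact: (assoc_act s ue uA)].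
Qed.

Lemma spinor_gradeP k x (s : spinorB H kappa F x) (e : frame x) : uframe H e ->
  spinor_grade k s <-> kappa (omega_elt Cl) *m s e = grade_value n k *: s e.
Proof.
move=> ue; rewrite -(cl_form_kahler Cl ue) -[_ *: s e]assocZ -cl_spinorE//.
split=> [->//|E]; apply: (assoc_ext (V := spinor_rep kappa F) ue); exact: E.
Qed.

End SpinorValues.
End CliffordValues.

Section HermitianMetrics.
Context {R : realType} {m : nat} {M : manifold R m} {E : bundle M}.
Context (h : forall x, E x -> E x -> R[i]) (hh : is_hmetric h).
Context (x : M).
Implicit Types (u v w : E x).

Lemma hmetricDl u v w : h (u + v) w = h u w + h v w.
Proof. by have := hmetricPl hh 1 u v w; rewrite scale1r mul1r. Qed.

Lemma hmetric0l w : h 0 w = 0.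
Proof. by rewrite -[RHS](addNr (h 0 w)) -mulN1r -(hmetricPl hh) scaler0 addr0. Qed.

Lemma hmetricZl a u w : h (a *: u) w = a * h u w.
Proof. by have := hmetricPl hh a u 0 w; rewrite addr0 hmetric0l addr0. Qed.

Lemma hmetric_suml (I : Type) (r : seq I) (P : pred I) (F : I -> E x) w :
  h (\sum_(i <- r | P i) F i) w = \sum_(i <- r | P i) h (F i) w.
Proof. exact: (big_morph (fun u => h u w) (fun u v => hmetricDl u v w) (hmetric0l w)). Qed.

Lemma hmetricDr u v w : h w (u + v) = h w u + h w v.
Proof. by rewrite !(hmetricC hh w) hmetricDl rmorphD. Qed.

Lemma hmetricZr a u w : h w (a *: u) = a^* * h w u.
Proof. by rewrite !(hmetricC hh w) hmetricZl rmorphM. Qed.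

Lemma hmetric0r w : h w 0 = 0.
Proof. by rewrite (hmetricC hh w) hmetric0l rmorph0. Qed.

Lemma hmetric_sumr (I : Type) (r : seq I) (P : pred I) (F : I -> E x) w :
  h w (\sum_(i <- r | P i) F i) = \sum_(i <- r | P i) h w (F i).
Proof. exact: (big_morph (h w) (fun u v => hmetricDr u v w) (hmetric0r w)). Qed.

End HermitianMetrics.

Lemma uframe_exists (R : realType) (n : nat) (M : manifold R n.*2)
    (H : hermitian_structure M) (D : conn (M := M)) (hD : is_chern H D) (x : M) :
  exists e : frame x, uframe H e.
Proof.
by have [e [ue _]] := parallel_uframe_exists hD x; exists (frame_at e x); exact: uframe_near_at.
Qed.

Section TensorSpinors.
Context {R : realType} {n : nat} {M : manifold R n.*2}.
Context (H : hermitian_structure M) (D : conn (M := M)) (hD : is_chern H D).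
Context (Cl : clifford R n.*2) (kappa : spin_module Cl).
Local Notation C := R[i].
Local Notation Mat := 'M[R[i]]_(2 ^ n).
Local Notation N := n.*2.
Local Notation fS := (@mx_findim R (2 ^ n) 1).
Local Notation fV := (@mx_findim R (2 ^ n) (2 ^ n)).
Context (Fp Fm : 'M[C]_n -> Cl * C).
Context (hFp : is_spinc_lift true Fp) (hFm : is_spinc_lift false Fm).
Context (sP : smooth_urep (M := M) (V := spinor_rep kappa Fp) fS).
Context (sM : smooth_urep (M := M) (V := spinor_rep kappa Fm) fS).
Context (sV : smooth_urep (M := M) (V := vspinor_rep kappa Fp Fm) fV).
Local Notation SM := (spinorB H kappa Fm).
Local Notation SP := (spinorB H kappa Fp).
Local Notation VM := (vspinorB H kappa Fp Fm).
Implicit Types (x : M).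

Lemma vtenE x (s : SM x) (t : SP x) (e : frame x) : uframe H e ->
  (vten s t) e = s e *m (t e)^T.
Proof.
apply: mk_assocE => e' A ue uA; rewrite /= -(assoc_act s ue uA) -(assoc_act t ue uA) /=.
by rewrite trmx_mul !mulmxA.
Qed.

Lemma vten_sumE x (r : nat) (f : 'I_r -> SM x) (g : 'I_r -> SP x) (e : frame x) : uframe H e ->
  (\sum_i vten (f i) (g i) : VM x) e = \sum_i f i e *m (g i e)^T.
Proof. by move=> ue; rewrite assoc_sum; apply: eq_bigr => i _; rewrite vtenE. Qed.

Lemma matrix_rank1_sum (X Y t : Mat) : X *m t *m Y^T =
  \sum_i \sum_j (t i j *: (X *m (delta_mx i 0 : 'cV_(2 ^ n)))) *m
    (Y *m (delta_mx j 0 : 'cV_(2 ^ n)))^T.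
Proof.
rewrite {1}(matrix_sum_delta t) mulmx_sumr mulmx_suml; apply: eq_bigr => i _.
rewrite mulmx_sumr mulmx_suml; apply: eq_bigr => j _.
rewrite trmx_mul trmx_delta -!scalemxAr -!scalemxAl; congr (_ *: _).
by rewrite -[delta_mx i j](mul_delta_mx (0 : 'I_1)) !mulmxA.
Qed.

Lemma sum_enum_val (J : finType) (V : nmodType) (F : J -> V) :
  \sum_(i < #|{: J}|) F (enum_val i) = \sum_j F j.
Proof. by rewrite -big_enum_val. Qed.

(** Insert the identity as the sum of the graded projections on both sides of the matrix of [t],
    then split into matrices of rank one. The first factor has grade [k] exactly for [p = n - k]. *)
Lemma vhom_decomposition x (t : VM x) : exists r (p q : 'I_r -> nat)
    (f : 'I_r -> SM x) (g : 'I_r -> SP x),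
  (forall i, vhom (p i) (q i) (f i) (g i)) /\ t = \sum_i vten (f i) (g i).
Proof.
have [e ue] := uframe_exists hD x.
have [E [E1 Eo _ _]] := spinor_grading kappa.
pose J := (('I_n.+1 * 'I_n.+1) * ('I_(2 ^ n) * 'I_(2 ^ n)))%type.
pose f (a : J) : SM x := at_frame H (V := spinor_rep kappa Fm) e
  (t e a.2.1 a.2.2 *: (E a.1.1 *m delta_mx a.2.1 0)).
pose g (a : J) : SP x := at_frame H (V := spinor_rep kappa Fp) e
  (E a.1.2 *m delta_mx a.2.2 0).
pose nu (i : 'I_#|{: J}|) : J := enum_val i.
exists #|{: J}|, (fun i => n - (nu i).1.1)%N, (fun i => (nu i).1.2 : nat),
  (fun i => f (nu i)), (fun i => g (nu i)); split=> [i|].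
  case: (nu i) => -[k q] [a b]; split => /=.
  - exact: leq_subr.
  - by rewrite -ltnS.
  - rewrite subKn; last by rewrite -ltnS.
    apply/(spinor_gradeP hFm _ _ ue); rewrite (at_frame_id sM _ ue) -scalemxAr mulmxA Eo.
    by rewrite -scalemxAl scalerA mulrC -scalerA.
  - by apply/(spinor_gradeP hFp _ _ ue); rewrite (at_frame_id sP _ ue) mulmxA Eo -scalemxAl.
apply: (assoc_ext (V := vspinor_rep kappa Fp Fm) ue).
rewrite (vten_sumE _ _ ue) (sum_enum_val (fun a : J => (f a e : 'cV_(2 ^ n)) *m (g a e : 'cV_(2 ^ n))^T)).
rewrite (eq_bigr (fun a : J => (t e a.2.1 a.2.2 *: (E a.1.1 *m (delta_mx a.2.1 0 : 'cV_(2 ^ n)))) *m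
    (E a.1.2 *m (delta_mx a.2.2 0 : 'cV_(2 ^ n)))^T)); last first.
  by move=> a _; rewrite (at_frame_id sM _ ue) (at_frame_id sP _ ue).
rewrite -(pair_bigA _ (fun (c : 'I_n.+1 * 'I_n.+1) (a : 'I_(2 ^ n) * 'I_(2 ^ n)) =>
  (t e a.1 a.2 *: (E c.1 *m (delta_mx a.1 0 : 'cV_(2 ^ n)))) *m
    (E c.2 *m (delta_mx a.2 0 : 'cV_(2 ^ n)))^T)) /=.
transitivity (\sum_(c : 'I_n.+1 * 'I_n.+1) E c.1 *m (t e : Mat) *m (E c.2)^T); last first.
  by apply: eq_bigr => c _; rewrite matrix_rank1_sum pair_bigA.
rewrite -(pair_bigA _ (fun k l : 'I_n.+1 => E k *m (t e : Mat) *m (E l)^T)) /=.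
under eq_bigr do rewrite -mulmx_sumr -raddf_sum /= E1 trmx1 mulmx1.
by rewrite -mulmx_suml E1 mul1mx.
Qed.

Section Metric.
Context (hdn : forall x, SM x -> SM x -> C) (hup : forall x, SP x -> SP x -> C).
Context (hmd : is_hmetric hdn) (hmu : is_hmetric hup).
Local Notation hV := (vspinor_metric hdn hup).

Lemma spinor_frame_expand F (sF : smooth_urep (M := M) (V := spinor_rep kappa F) fS)
    x (e : frame x) (s : spinorB H kappa F x) : uframe H e ->
  s = \sum_i (s e : 'cV_(2 ^ n)) i 0 *:
    (at_frame H (V := spinor_rep kappa F) e (delta_mx i 0) : spinorB H kappa F x).
Proof.
move=> ue; apply: (assoc_ext (V := spinor_rep kappa F) ue); rewrite assoc_sum.
rewrite [LHS]matrix_sum_delta; apply: eq_bigr => i _.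
by rewrite big_ord1 assocZ (at_frame_id sF _ ue).
Qed.

(** For fixed [u] and [w] the expression is linear in the matrix of the tensor at [e], hence does
    not see the decomposition: the universal property of the tensor product in coordinates. *)
Lemma tensor_metric_coord x (e : frame x) (u : SM x) (w : SP x) : uframe H e ->
  exists m : 'I_(2 ^ n) -> 'I_(2 ^ n) -> C,
  forall (r : nat) (f : 'I_r -> SM x) (g : 'I_r -> SP x),
  \sum_i hdn (f i) u * hup (g i) w =
  \sum_a \sum_b ((\sum_i vten (f i) (g i) : VM x) e : Mat) a b * m a b.
Proof.
move=> ue; pose bm i : SM x := at_frame H (V := spinor_rep kappa Fm) e (delta_mx i 0).
pose bp i : SP x := at_frame H (V := spinor_rep kappa Fp) e (delta_mx i 0).
exists (fun a b => hdn (bm a) u * hup (bp b) w) => r f g; rewrite (vten_sumE _ _ ue).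
transitivity (\sum_i \sum_a \sum_b ((f i e : 'cV_(2 ^ n)) a 0 * (g i e : 'cV_(2 ^ n)) b 0) *
    (hdn (bm a) u * hup (bp b) w)).
  apply: eq_bigr => i _.
  rewrite {1}(spinor_frame_expand sM (f i) ue) {1}(spinor_frame_expand sP (g i) ue).
  rewrite !hmetric_suml// mulr_suml; apply: eq_bigr => a _; rewrite mulr_sumr.
  by apply: eq_bigr => b _; rewrite !hmetricZl// mulrACA.
rewrite exchange_big /=; apply: eq_bigr => a _; rewrite exchange_big /=; apply: eq_bigr => b _.
rewrite -mulr_suml summxE; congr (_ * _); apply: eq_bigr => i _.
by rewrite mxE big_ord1 mxE.
Qed.

Lemma tensor_metric_dec x (r r' : nat) (f : 'I_r -> SM x) (g : 'I_r -> SP x)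
    (f' : 'I_r' -> SM x) (g' : 'I_r' -> SP x) (u : SM x) (w : SP x) :
  \sum_i vten (f i) (g i) = \sum_i vten (f' i) (g' i) ->
  \sum_i hdn (f i) u * hup (g i) w = \sum_i hdn (f' i) u * hup (g' i) w.
Proof.
have [e ue] := uframe_exists hD x; have [m mE] := tensor_metric_coord u w ue.
by move=> E; rewrite !mE E.
Qed.

(** Independence of the decomposition in the first argument is [tensor_metric_dec]; in the second it
    follows by Hermitian symmetry. So the condition defining [vspinor_metric] is satisfiable and
    gives this value. *)
Lemma vmetric_dec x (r r' : nat) (f : 'I_r -> SM x) (g : 'I_r -> SP x)
    (f' : 'I_r' -> SM x) (g' : 'I_r' -> SP x) :
  hV (\sum_i vten (f i) (g i)) (\sum_j vten (f' j) (g' j)) =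
  \sum_i \sum_j hdn (f i) (f' j) * hup (g i) (g' j).
Proof.
set t := \sum_i vten (f i) (g i); set t' := \sum_j vten (f' j) (g' j).
pose P := [set c : R[i] | forall r r'
    (f : 'I_r -> spinorB H kappa Fm x) (p : 'I_r -> spinorB H kappa Fp x)
    (f' : 'I_r' -> spinorB H kappa Fm x) (p' : 'I_r' -> spinorB H kappa Fp x),
    t = \sum_i vten (f i) (p i) -> t' = \sum_j vten (f' j) (p' j) ->
    c = \sum_i \sum_j hdn (f i) (f' j) * hup (p i) (p' j)].
suff Pc : P (\sum_i \sum_j hdn (f i) (f' j) * hup (g i) (g' j)).
  exact: (xgetPex 0 (ex_intro P _ Pc)).
move=> r1 r1' f1 g1 f1' g1' E E'.
transitivity (\sum_i \sum_j hdn (f1 i) (f' j) * hup (g1 i) (g' j)).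
  rewrite exchange_big [RHS]exchange_big /=; apply: eq_bigr => j _.
  exact: tensor_metric_dec.
apply: eq_bigr => i _.
have C' (s s' : SM x) (q q' : SP x) : hdn s s' * hup q q' = (hdn s' s * hup q' q)^*.
  by rewrite (hmetricC hmd s) (hmetricC hmu q) rmorphM.
under eq_bigr do rewrite C'; under [RHS]eq_bigr do rewrite C'.
by rewrite -!rmorph_sum; congr (_^*); exact: tensor_metric_dec.
Qed.

Lemma vmetricC x (t t' : VM x) : hV t t' = (hV t' t)^*.
Proof.
have [r [_ [_ [f [g [_ ->]]]]]] := vhom_decomposition t.
have [r' [_ [_ [f' [g' [_ ->]]]]]] := vhom_decomposition t'.
rewrite !vmetric_dec rmorph_sum exchange_big /=; apply: eq_bigr => j _.
rewrite rmorph_sum; apply: eq_bigr => i _.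
by rewrite (hmetricC hmd (f i)) (hmetricC hmu (g i)) -rmorphM.
Qed.

Lemma vmetricPl x a (t1 t2 t' : VM x) : hV (a *: t1 + t2) t' = a * hV t1 t' + hV t2 t'.
Proof.
have [e ue] := uframe_exists hD x.
have [r' [_ [_ [f' [g' [_ ->]]]]]] := vhom_decomposition t'.
have [m mE] := choice (fun j => tensor_metric_coord (f' j) (g' j) ue).
have hE (t : VM x) : hV t (\sum_j vten (f' j) (g' j)) =
    \sum_j \sum_a \sum_b (t e : Mat) a b * m j a b.
  have [r [_ [_ [f [g [_ ->]]]]]] := vhom_decomposition t.
  by rewrite vmetric_dec exchange_big /=; apply: eq_bigr => j _; exact: mE.
rewrite !hE mulr_sumr -big_split; apply: eq_bigr => j _ /=.
rewrite mulr_sumr -big_split; apply: eq_bigr => b _ /=.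
rewrite mulr_sumr -big_split; apply: eq_bigr => c _ /=.
rewrite mulrA -mulrDl; congr (_ * _).
transitivity ((a *: (t1 e : Mat) + (t2 e : Mat)) b c); first by [].
by rewrite mxE mxE.
Qed.

End Metric.

End TensorSpinors.

Section SpinorDerivative.
Context {R : realType} {n : nat} {M : manifold R n.*2}.
Context (H : hermitian_structure M) (D : conn (M := M)) (hD : is_chern H D).
Context (Cl : clifford R n.*2) (kappa : spin_module Cl).
Local Notation C := R[i].
Local Notation Mat := 'M[R[i]]_(2 ^ n).
Local Notation N := n.*2.
Local Notation fS := (@mx_findim R (2 ^ n) 1).
Local Notation fV := (@mx_findim R (2 ^ n) (2 ^ n)).
Context (Fp Fm : 'M[C]_n -> Cl * C).
Context (hFp : is_spinc_lift true Fp) (hFm : is_spinc_lift false Fm).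
Context (sP : smooth_urep (M := M) (V := spinor_rep kappa Fp) fS).
Context (sM : smooth_urep (M := M) (V := spinor_rep kappa Fm) fS).
Context (sV : smooth_urep (M := M) (V := vspinor_rep kappa Fp Fm) fV).
Local Notation SM := (spinorB H kappa Fm).
Local Notation SP := (spinorB H kappa Fp).
Local Notation VM := (vspinorB H kappa Fp Fm).
Local Notation DV := (@vspinor_cov R n M H D Cl kappa Fp Fm).
Implicit Types (x : M).

Lemma tensor_linear_l (s : 'cV[C]_(2 ^ n)) : linear (fun u : 'cV[C]_(2 ^ n) => u *m s^T).
Proof. exact: mulmx_bilin_l. Qed.

Lemma tensor_linear_r (s : 'cV[C]_(2 ^ n)) : linear (fun u : 'cV[C]_(2 ^ n) => s *m u^T).
Proof. by move=> k u w; rewrite linearP /= mulmxDr -scalemxAr. Qed.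

(** By the Leibniz rule for the matrix product, every smooth decomposition yields the derivative of
    the component matrix in [e]. One exists: the components of [t] times the elementary tensors of
    the frame. *)
Lemma vspinor_covE x (v : tangent x) (t : forall y, VM y) (e : local_frame (M := M)) :
  sec_smooth x t -> uframe_near H x e -> (forall u a, D (x := x) u (e a) = 0) ->
  (DV v t) (frame_at e x) = vder fV v (fun y => t y (frame_at e y)).
Proof.
move=> st ue pe; have ux := uframe_near_at ue.
pose P := [set u : VM x | forall r
    (f : 'I_r -> forall y, SM y) (p : 'I_r -> forall y, SP y),
    (forall i, sec_smooth x (f i)) -> (forall i, sec_smooth x (p i)) ->
    (\forall y \near x, t y = \sum_i vten (f i y) (p i y)) ->
    u = \sum_i (vten (spinor_cov D v (f i)) (p i x) +
                vten (f i x) (spinor_cov D v (p i)))].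
have val r (f : 'I_r -> forall y, SM y) (p : 'I_r -> forall y, SP y) :
    (forall i, sec_smooth x (f i)) -> (forall i, sec_smooth x (p i)) ->
    (\forall y \near x, t y = \sum_i vten (f i y) (p i y)) ->
    (\sum_i (vten (spinor_cov D v (f i)) (p i x) + vten (f i x) (spinor_cov D v (p i))) : VM x)
      (frame_at e x) = vder fV v (fun y => t y (frame_at e y)).
  move=> sf sp tE; rewrite assoc_sum.
  transitivity (vder fV v (fun y => \sum_i (f i y (frame_at e y) : 'cV_(2 ^ n)) *m
      (p i y (frame_at e y) : 'cV_(2 ^ n))^T)); last first.
    symmetry; apply: vder_ext; first exact: st.
    by apply: filterS2 tE ue.2 => y -> uy; rewrite (vten_sumE _ _ uy).
  have bs i : vsmooth_at x (fun y => (f i y (frame_at e y) : 'cV_(2 ^ n)) *m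
      (p i y (frame_at e y) : 'cV_(2 ^ n))^T).
    by apply: (vsmooth_bilin fS fS tensor_linear_l tensor_linear_r); [exact: sf|exact: sp].
  rewrite vder_sum => [|i _]; last exact: bs.
  apply: eq_bigr => i _; rewrite assocD (vtenE _ _ ux) (vtenE _ _ ux).
  rewrite (vder_bilin fS fS fV tensor_linear_l tensor_linear_r v (sf i e ue) (sp i e ue)).
  rewrite -(assoc_covE hD sM v (sf i) ue pe) -(assoc_covE hD sP v (sp i) ue pe).
  by [].
pose J := ('I_(2 ^ n) * 'I_(2 ^ n))%type.
pose nu (i : 'I_#|{: J}|) : J := enum_val i.
pose f (i : 'I_#|{: J}|) y : SM y := at_frame H (V := spinor_rep kappa Fm) (frame_at e y)
  ((t y (frame_at e y) : Mat) (nu i).1 (nu i).2 *: delta_mx (nu i).1 0).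
pose p (i : 'I_#|{: J}|) y : SP y := at_frame H (V := spinor_rep kappa Fp) (frame_at e y)
  (delta_mx (nu i).2 0).
have sf i : sec_smooth x (f i).
  apply: (at_frame_smooth sM ue); apply: vsmoothZ; last exact: vsmooth_cst.
  by have /vsmooth_mxP := st e ue; apply.
have sp i : sec_smooth x (p i) by apply: (at_frame_smooth sP ue); exact: vsmooth_cst.
have tE : \forall y \near x, t y = \sum_i vten (f i y) (p i y).
  apply: filterS ue.2 => y uy; apply: (assoc_ext (V := vspinor_rep kappa Fp Fm) uy).
  rewrite (vten_sumE _ _ uy).
  rewrite (eq_bigr (fun i => (t y (frame_at e y) : Mat) (nu i).1 (nu i).2 *:
      delta_mx (nu i).1 (nu i).2)); last first.
    move=> i _; rewrite (at_frame_id sM _ uy) (at_frame_id sP _ uy) trmx_delta -scalemxAl.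
    by rewrite mul_delta_mx.
  rewrite (sum_enum_val (fun a : J => (t y (frame_at e y) : Mat) a.1 a.2 *: delta_mx a.1 a.2)).
  by rewrite {1}[t y _]matrix_sum_delta pair_bigA.
have Pu : P (\sum_i (vten (spinor_cov D v (f i)) (p i x) + vten (f i x) (spinor_cov D v (p i)))).
  move=> r f1 p1 sf1 sp1 tE1; apply: (assoc_ext (V := vspinor_rep kappa Fp Fm) ux).
  by rewrite (val _ f p) ?(val _ f1 p1).
have -> : DV v t = \sum_i (vten (spinor_cov D v (f i)) (p i x) +
    vten (f i x) (spinor_cov D v (p i))).
  exact: (xgetPex (0 : VM x) (ex_intro P _ Pu)).
exact: val.
Qed.

Lemma vspinor_vbundle : is_vbundle VM.
Proof.
pose J := ('I_(2 ^ n) * 'I_(2 ^ n))%type.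
pose nu (i : 'I_#|{: J}|) : J := enum_val i.
exists #|{: J}| => x; have [e [ue _]] := parallel_uframe_exists hD x.
exists (fun i y => at_frame H (V := vspinor_rep kappa Fp Fm) (frame_at e y)
  (delta_mx (nu i).1 (nu i).2)).
have sumE y (c : 'I_#|{: J}| -> C) : uframe H (frame_at e y) ->
    (\sum_i c i *: at_frame H (V := vspinor_rep kappa Fp Fm) (frame_at e y)
      (delta_mx (nu i).1 (nu i).2)) (frame_at e y) =
    \matrix_(a, b) c (enum_rank ((a, b) : J)).
  move=> uy; rewrite assoc_sum.
  rewrite (eq_bigr (fun i => c i *: delta_mx (nu i).1 (nu i).2)) => [|i _]; last first.
    by rewrite assocZ (at_frame_id sV _ uy).
  transitivity (\sum_(a : J) c (enum_rank a) *: delta_mx a.1 a.2 : Mat).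
    rewrite -(sum_enum_val (fun a : J => c (enum_rank a) *: (delta_mx a.1 a.2 : Mat))).
    by apply: eq_bigr => i _; rewrite enum_valK.
  rewrite [RHS]matrix_sum_delta pair_bigA; apply: eq_bigr => -[a b] _ /=.
  by rewrite mxE.
have := uframe_near_near ue; apply: filterS => y ue'; have uy := uframe_near_at ue'; split.
  move=> t; exists [ffun i => (t (frame_at e y) : Mat) (nu i).1 (nu i).2]; split.
    apply: (assoc_ext (V := vspinor_rep kappa Fp Fm) uy); rewrite (sumE _ _ uy).
    by apply/matrixP => a b; rewrite mxE ffunE /nu enum_rankK.
  move=> c tE; apply/ffunP => i; rewrite ffunE tE (sumE _ _ uy) mxE; congr (c _).
  by rewrite -surjective_pairing enum_valK.
move=> s; split=> [ss|[c [sc sE]]].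
  exists (fun i z => (s z (frame_at e z) : Mat) (nu i).1 (nu i).2); split.
    by move=> i; have /vsmooth_mxP := ss e ue'; apply.
  apply: filterS ue'.2 => z uz; apply: (assoc_ext (V := vspinor_rep kappa Fp Fm) uz).
  rewrite (sumE _ _ uz); by apply/matrixP => a b; rewrite mxE /nu enum_rankK.
apply/(assoc_smoothP sV s ue')/vsmooth_mxP => a b.
apply: csmooth_ext (sc (enum_rank ((a, b) : J))); apply: filterS2 sE ue'.2 => z -> uz.
by rewrite (sumE _ _ uz) mxE.
Qed.

End SpinorDerivative.

Section SpinorConnection.
Context {R : realType} {n : nat} {M : manifold R n.*2}.
Context (H : hermitian_structure M) (D : conn (M := M)) (hD : is_chern H D).
Context (Cl : clifford R n.*2) (kappa : spin_module Cl).
Local Notation C := R[i].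
Local Notation Mat := 'M[R[i]]_(2 ^ n).
Local Notation N := n.*2.
Local Notation fS := (@mx_findim R (2 ^ n) 1).
Local Notation fV := (@mx_findim R (2 ^ n) (2 ^ n)).
Context (Fp Fm : 'M[C]_n -> Cl * C).
Context (hFp : is_spinc_lift true Fp) (hFm : is_spinc_lift false Fm).
Context (T : Mat) (uT : T \in unitmx)
  (hT : forall v, kappa (cl_vec Cl v) *m T = T *m (kappa (cl_vec Cl v))^T).
Context (sP : smooth_urep (M := M) (V := spinor_rep kappa Fp) fS).
Context (sM : smooth_urep (M := M) (V := spinor_rep kappa Fm) fS).
Local Notation sV := (vspinor_smooth_urep (M := M) uT hT hFp hFm).
Local Notation VM := (vspinorB H kappa Fp Fm).
Local Notation DV := (@vspinor_cov R n M H D Cl kappa Fp Fm).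
Local Notation act := (vspinor_act kappa Fp Fm).
Implicit Types (x : M).

(** Gives a frame parallel at [x] with any prescribed unitary value at [x]. *)
Lemma constant_frame_act x (f : local_frame (M := M)) (A : 'M[C]_n) :
  uframe_near H x f -> A \is unitarymx -> (forall u a, D (x := x) u (f a) = 0) ->
  let f' := (fun a y => frame_act (frame_at f y) A a) : local_frame in
  uframe_near H x f' /\ forall u a, D (x := x) u (f' a) = 0.
Proof.
move=> [sf uf] uA pf f'.
have s b a : vf_smooth_at x (fun y => realify A a b *: f a y).
  by apply: (vf_smoothZ (smooth_at_cst x (realify A a b))); exact: sf.
split; first split=> [b|].
- by apply: vf_smooth_sum => a _; exact: s.
- by apply: filterS uf => y uy; exact: frame_act_uframe.
move=> u b; suff ps : parallel_at D x (fun y => \sum_a realify A a b *: f a y) by exact: ps.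
apply: (parallel_sum hD _ (s b)) => a.
apply: (parallelZ hD (smooth_at_cst x _) (sf a)) => [w|w]; first exact: der_cst.
exact: pf.
Qed.

Let P (i : 'I_(2 ^ n) * 'I_(2 ^ n)) : 'I_N -> 'I_N -> Mat :=
  sval (cid (vspinor_der1 (M := M) uT hT hFp hFm (fd_vec fV i))).

Lemma vder_act1 y (v : tangent y) (A : M -> 'M[C]_n) (t : Mat) :
  (forall j k, csmooth_at y (fun z => A z j k)) ->
  (\forall z \near y, A z \is unitarymx) -> A y = 1%:M ->
  vder fV v (fun z => act (A z) t) =
    \sum_i fd_dual fV i t *: \sum_a \sum_b (der v (fun z => realify (A z) a b))%:C *: P i a b.
Proof.
move=> sA uA A1.
transitivity (vder fV v (fun z => \sum_i fd_dual fV i t *: act (A z) (fd_vec fV i))).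
  apply: vder_ext; first exact: (urep_smooth sV sA uA).
  by apply: nearW => z; exact: (uact_expand (V := vspinor_rep kappa Fp Fm) fV).
have s i : vsmooth_at y (fun z => act (A z) (fd_vec fV i)) := urep_smooth sV sA uA _.
rewrite vder_sum => [|i _]; last by apply: vsmoothZ => //; exact: csmooth_cst.
apply: eq_bigr => i _; rewrite (vderZ _ _ (csmooth_cst _ _) (s i)) cder_cst scale0r add0r.
by congr (_ *: _); exact: (svalP (cid (vspinor_der1 (M := M) uT hT hFp hFm (fd_vec fV i)))).
Qed.

(** The formula with connection form, for a frame that need not be parallel at [y]. Comparison is
    with a frame parallel at [y] that equals [e] at [y]: the transition matrix is then the identity
    at [y], and only its derivative, given by the [D v (e b)], contributes. *)
Lemma vspinor_cov_frame y (v : tangent y) (s : forall z, VM z) (e : local_frame (M := M)) :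
  sec_smooth y s -> uframe_near H y e ->
  (DV v s) (frame_at e y) = vder fV v (fun z => s z (frame_at e z)) +
    \sum_i fd_dual fV i (s y (frame_at e y)) *:
      \sum_a \sum_b (metric H (D v (e b)) (e a y))%:C *: P i a b.
Proof.
move=> ss ue; have [f [uf pf]] := parallel_uframe_exists hD y.
have uy := uframe_near_at ue; have uy' := uframe_near_at uf.
pose A0 := trans H (frame_at f y) (frame_at e y).
have [uf' pf'] := constant_frame_act uf (trans_unitary uy' uy) pf.
set f' := fun a z => _ in uf' pf'.
have f'y : frame_at f' y = frame_at e y := trans_act uy' uy.
pose A z := trans H (frame_at f' z) (frame_at e z).
have sA j k : csmooth_at y (fun z => A z j k) := trans_smooth j k uf' ue.
have uA : \forall z \near y, A z \is unitarymx := trans_unitary_near uf' ue.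
have A1 : A y = 1%:M by rewrite /A f'y trans_id.
have sse : vsmooth_at y (fun z => s z (frame_at e z)) := ss e ue.
rewrite -f'y (vspinor_covE hD sP sM v ss uf' pf') f'y.
transitivity (vder fV v (fun z => act (A z) (s z (frame_at e z)))).
  apply: vder_ext; first exact: (ss f' uf').
  apply: filterS2 uf'.2 ue.2 => z uz uz'.
  exact: (assoc_trans (V := vspinor_rep kappa Fp Fm) (s z) uz uz').
rewrite [LHS](vder_uact sV v sA uA sse) A1 [X in X + _ = _](urep1 sV); congr (_ + _).
rewrite [LHS](vder_act1 v _ sA uA A1); apply: eq_bigr => i _; congr (_ *: _).
apply: eq_bigr => a _; apply: eq_bigr => b _; congr (_%:C *: _).
transitivity (der v (fun z => metric H (e b z) (f' a z))).
  apply: der_ext; first exact: realify_smooth.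
  by apply: filterS2 uf'.2 ue.2 => z uz uz'; exact: realify_trans.
rewrite (chern_metric hD v (ue.1 b) (uf'.1 a)) pf' metric0r addr0.
by congr (metric H _ _); exact: (congr1 (fun g : frame y => g a) f'y).
Qed.

Lemma vspinor_smoothD x (s t : forall y, VM y) : sec_smooth x s -> sec_smooth x t ->
  sec_smooth x (fun y => s y + t y : VM y).
Proof. by move=> ss st e ue; exact: (vsmoothD (ss e ue) (st e ue)). Qed.

Lemma vspinor_smoothZ x (f : M -> C) (s : forall y, VM y) : csmooth_at x f ->
  sec_smooth x s -> sec_smooth x (fun y => f y *: s y : VM y).
Proof. by move=> sf ss e ue; exact: (vsmoothZ sf (ss e ue)). Qed.

Lemma vspinor_is_cov : is_cov DV.
Proof.
pose VE x (e : frame x) (s t : VM x) := @assoc_ext _ _ _ H (vspinor_rep kappa Fp Fm) x e s t.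
split.
- move=> x a u v s ss; have [e [ue pe]] := parallel_uframe_exists hD x.
  have val w := vspinor_covE hD sP sM w ss ue pe.
  apply: (VE _ _ _ _ (uframe_near_at ue)).
  apply: (etrans (val _)); rewrite vder_linear; symmetry.
  exact: (congr2 (fun A B : Mat => a%:C *: A + B) (val u) (val v)).
- move=> x v s t ss st; have [e [ue pe]] := parallel_uframe_exists hD x.
  apply: (VE _ _ _ _ (uframe_near_at ue)).
  apply: (etrans (vspinor_covE hD sP sM v (vspinor_smoothD ss st) ue pe)).
  apply: (etrans (vderD fV v (ss e ue) (st e ue))); symmetry.
  exact: (congr2 (fun A B : Mat => A + B) (vspinor_covE hD sP sM v ss ue pe)
    (vspinor_covE hD sP sM v st ue pe)).
- move=> x v f s sf ss; have [e [ue pe]] := parallel_uframe_exists hD x.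
  apply: (VE _ _ _ _ (uframe_near_at ue)).
  apply: (etrans (vspinor_covE hD sP sM v (vspinor_smoothZ sf ss) ue pe)).
  apply: (etrans (vderZ fV v sf (ss e ue))); symmetry.
  exact: (congr1 (fun A : Mat => cder v f *: (s x (frame_at e x) : Mat) + f x *: A)
    (vspinor_covE hD sP sM v ss ue pe)).
- move=> x v s t ss st st'; have [e [ue pe]] := parallel_uframe_exists hD x.
  apply: (VE _ _ _ _ (uframe_near_at ue)).
  rewrite (vspinor_covE hD sP sM v ss ue pe) (vspinor_covE hD sP sM v st ue pe).
  by apply: vder_ext; [exact: (ss e ue)|apply: filterS st' => y ->].
(* Smoothness involves the points near [x], where [e] is no longer parallel, hence the formula with
   connection form. *)
move=> x X s sX ss; have [e [ue _]] := parallel_uframe_exists hD x.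
apply/(assoc_smoothP sV _ ue).
have sse : vsmooth_at x (fun z => s z (frame_at e z)) := ss e ue.
apply: (vsmooth_ext (f := fun y => vder fV (X y) (fun z => s z (frame_at e z)) +
    \sum_i fd_dual fV i (s y (frame_at e y)) *:
      \sum_a \sum_b (metric H (D (X y) (e b)) (e a y))%:C *: P i a b)).
  apply: filterS2 (uframe_near_near ue) (assoc_smooth_near hD sV ss) => y uy sy.
  by rewrite (vspinor_cov_frame (X y) sy uy).
apply: vsmoothD; first exact: vder_near.
apply: vsmooth_sum => i _; apply: vsmoothZ; first exact: sse.
apply: vsmooth_sum => a _; apply: vsmooth_sum => b _; apply: vsmoothZ; last exact: vsmooth_cst.
apply: csmooth_real; apply: metric_smooth; last exact: ue.1.
by apply: (conn_smooth (chern_connection hD)) => //; exact: ue.1.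
Qed.

End SpinorConnection.

Section SpinorMetric.
Context {R : realType} {n : nat} {M : manifold R n.*2}.
Context (H : hermitian_structure M) (D : conn (M := M)).
Context (Cl : clifford R n.*2) (kappa : spin_module Cl).
Context (b : bool) (F : 'M[R[i]]_n -> Cl * R[i]) (hF : is_spinc_lift b F).
Context (k : nat) (s0 : forall x : M, spinorB H kappa F x).
Context (h : forall x : M, spinorB H kappa F x -> spinorB H kappa F x -> R[i]).
Hypothesis sm : is_spinor_metric D k s0 h.
Context (x : M).
Implicit Types (v : tangent x) (s t : spinorB H kappa F x).
Local Notation cliff v s := (cl_spinor (cl_tangent H Cl v) s).

Let hh := sm_hmetric sm.

Lemma cl_spinor_tangentE v s (e : frame x) : uframe H e ->
  (cliff v s) e = kappa (cl_vec Cl (\row_a metric H v (e a))) *m s e.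
Proof. by move=> ue; rewrite (cl_spinorE hF _ _ ue) cl_tangentE. Qed.

(** An isometry of square -1 is skew. *)
Lemma unit_tangent_skew (e : frame x) v s t : uframe H e -> metric H v v = 1 ->
  h (cliff v s) t = - h s (cliff v t).
Proof.
move=> ue v1; rewrite -(sm_invariant sm (cliff v s) t v1).
have -> : cliff v (cliff v s) = (-1) *: s.
  apply: (assoc_ext (V := spinor_rep kappa F) ue).
  rewrite assocZ !(cl_spinor_tangentE _ _ ue) mulmxA -kappaM cl_vec_sqr ?dotv_tangent//.
  by rewrite kappaN kappa1 mulNmx mul1mx scaleN1r.
by rewrite (hmetricZl hh) mulN1r.
Qed.

Lemma tangent_skew (e : frame x) v s t : uframe H e ->
  h (cliff v s) t = - h s (cliff v t).
Proof.
move=> ue; have cZ (a : R) u (r : spinorB H kappa F x) : cliff (a *: u) r = a%:C *: cliff u r.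
  apply: (assoc_ext (V := spinor_rep kappa F) ue).
  rewrite (cl_spinor_tangentE _ _ ue).
  apply: (etrans _ (esym (congr1 (fun X : 'cV_(2 ^ n) => a%:C *: X) (cl_spinor_tangentE u r ue)))).
  rewrite scalemxAl -kappaZ -cl_vecZ.
  by congr (kappa (cl_vec _ _) *m _); apply/rowP => c; rewrite !mxE metricZl.
have [->|v0] := eqVneq v 0.
  rewrite -(scale0r (0 : tangent x)) !cZ (hmetricZl hh) (hmetricZr hh).
  by rewrite conjC0 !mul0r oppr0.
have g0 := metric_gt0 H v0; set a := Num.sqrt (metric H v v).
have a0 : a != 0 by rewrite gt_eqF// sqrtr_gt0.
have [u [-> u1]] : exists u, v = a *: u /\ metric H u u = 1.
  exists (a^-1 *: v); split; first by rewrite scalerA mulfV// scale1r.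
  by rewrite metricZl metricZr mulrA -invfM -expr2 sqr_sqrtr ?ltW// mulVf ?gt_eqF.
rewrite !cZ (hmetricZl hh) (hmetricZr hh) (unit_tangent_skew _ _ ue u1) mulrN.
by congr (- (_ * _)); apply: complex_ext; rewrite ?cReJ ?cImJ /= ?oppr0.
Qed.

End SpinorMetric.

(** * The metric of V-spinors *)

Section TensorMetric.
Context {R : realType} {n : nat} {M : manifold R n.*2}.
Context (H : hermitian_structure M) (D : conn (M := M)) (hD : is_chern H D).
Context (Cl : clifford R n.*2) (kappa : spin_module Cl).
Local Notation C := R[i].
Local Notation Mat := 'M[R[i]]_(2 ^ n).
Local Notation N := n.*2.
Local Notation fS := (@mx_findim R (2 ^ n) 1).
Local Notation fV := (@mx_findim R (2 ^ n) (2 ^ n)).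
Context (Fp Fm : 'M[C]_n -> Cl * C).
Context (hFp : is_spinc_lift true Fp) (hFm : is_spinc_lift false Fm).
Context (T : Mat) (uT : T \in unitmx)
  (hT : forall v, kappa (cl_vec Cl v) *m T = T *m (kappa (cl_vec Cl v))^T).
Context (sP : smooth_urep (M := M) (V := spinor_rep kappa Fp) fS).
Context (sM : smooth_urep (M := M) (V := spinor_rep kappa Fm) fS).
Local Notation sV := (vspinor_smooth_urep (M := M) uT hT hFp hFm).
Local Notation SM := (spinorB H kappa Fm).
Local Notation SP := (spinorB H kappa Fp).
Local Notation VM := (vspinorB H kappa Fp Fm).
Local Notation DV := (@vspinor_cov R n M H D Cl kappa Fp Fm).
Context (psi0 : forall x : M, SP x) (phi0 : forall x : M, SM x).
Context (hup : forall x : M, SP x -> SP x -> C) (hdn : forall x : M, SM x -> SM x -> C).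
Context (hhup : is_spinor_metric D 0 psi0 hup) (hhdn : is_spinor_metric D n phi0 hdn).
Local Notation hV := (vspinor_metric hdn hup).
Implicit Types (x : M).

Let hmu := sm_hmetric hhup.
Let hmd := sm_hmetric hhdn.

Let hVdec x r r' f g f' g' := vmetric_dec hD sP sM hmd hmu (x := x) (r := r) (r' := r') f g f' g'.
Let hdec x (t : VM x) := vhom_decomposition hD hFp hFm sP sM t.
Let hVC x (t t' : VM x) := vmetricC hD hFp hFm sP sM hmd hmu t t'.
Let hVPl x a (t1 t2 t' : VM x) := vmetricPl hD hFp hFm sP sM hmd hmu a t1 t2 t'.

Section AtFrame.
Context (x : M) (e : frame x) (ue : uframe H e).

Let at_e (X : Mat) : VM x := at_frame H (V := vspinor_rep kappa Fp Fm) e X.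
(** The metric read on Clifford elements. Left multiplication of [w] by a vector is its action on
    the factor of [Fp], through the transpose; right multiplication is, by [hT], its action on the
    factor of [Fm]. So [beta] is invariant under both. *)
Let beta (w w' : Cl) : C := hV (at_e (T *m (kappa w)^T)) (at_e (T *m (kappa w')^T)).

Lemma frame_gen a : metric H (e a) (e a) = 1.
Proof. by rewrite ue.1 eqxx. Qed.

Lemma frame_gen_row a : \row_c metric H (e a) (e c) = delta_mx 0 a.
Proof. by apply/rowP => c; rewrite !mxE ue.1 eq_sym. Qed.

Lemma vmetric_gen_l a (X Y : Mat) :
  hV (at_e (kappa (cl_gen Cl a) *m X)) (at_e (kappa (cl_gen Cl a) *m Y)) = hV (at_e X) (at_e Y).
Proof.
have E (Z : Mat) r (f : 'I_r -> SM x) (g : 'I_r -> SP x) : at_e Z = \sum_i vten (f i) (g i) ->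
    at_e (kappa (cl_gen Cl a) *m Z) = \sum_i vten (cl_spinor (cl_tangent H Cl (e a)) (f i)) (g i).
  move=> ZE; apply: (assoc_ext (V := vspinor_rep kappa Fp Fm) ue).
  rewrite (at_frame_id sV _ ue) (vten_sumE _ _ ue).
  have := congr1 (fun t : VM x => t e) ZE.
  rewrite (at_frame_id sV _ ue) (vten_sumE _ _ ue) => ->.
  rewrite mulmx_sumr; apply: eq_bigr => i _.
  by rewrite (cl_spinor_tangentE hFm _ _ ue) frame_gen_row mulmxA.
have [r [_ [_ [f [g [_ XE]]]]]] := hdec (at_e X).
have [r' [_ [_ [f' [g' [_ YE]]]]]] := hdec (at_e Y).
rewrite (E _ _ _ _ XE) (E _ _ _ _ YE) XE YE !hVdec.
apply: eq_bigr => i _; apply: eq_bigr => j _.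
by rewrite (sm_invariant hhdn _ _ (frame_gen a)).
Qed.

Lemma vmetric_gen_r a (X Y : Mat) :
  hV (at_e (X *m (kappa (cl_gen Cl a))^T)) (at_e (Y *m (kappa (cl_gen Cl a))^T)) =
  hV (at_e X) (at_e Y).
Proof.
have E (Z : Mat) r (f : 'I_r -> SM x) (g : 'I_r -> SP x) : at_e Z = \sum_i vten (f i) (g i) ->
    at_e (Z *m (kappa (cl_gen Cl a))^T) =
      \sum_i vten (f i) (cl_spinor (cl_tangent H Cl (e a)) (g i)).
  move=> ZE; apply: (assoc_ext (V := vspinor_rep kappa Fp Fm) ue).
  rewrite (at_frame_id sV _ ue) (vten_sumE _ _ ue).
  have := congr1 (fun t : VM x => t e) ZE.
  rewrite (at_frame_id sV _ ue) (vten_sumE _ _ ue) => ->.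
  rewrite mulmx_suml; apply: eq_bigr => i _.
  by rewrite (cl_spinor_tangentE hFp _ _ ue) frame_gen_row trmx_mul mulmxA.
have [r [_ [_ [f [g [_ XE]]]]]] := hdec (at_e X).
have [r' [_ [_ [f' [g' [_ YE]]]]]] := hdec (at_e Y).
rewrite (E _ _ _ _ XE) (E _ _ _ _ YE) XE YE !hVdec.
apply: eq_bigr => i _; apply: eq_bigr => j _.
by rewrite (sm_invariant hhup _ _ (frame_gen a)).
Qed.

Lemma beta_gen_l a w w' : beta (cl_gen Cl a * w) (cl_gen Cl a * w') = beta w w'.
Proof.
have E u : T *m (kappa (cl_gen Cl a * u))^T = T *m (kappa u)^T *m (kappa (cl_gen Cl a))^T.
  by rewrite kappaM trmx_mul mulmxA.
by rewrite /beta (E w) (E w'); exact: vmetric_gen_r.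
Qed.

Lemma beta_gen_r a w w' : beta (w * cl_gen Cl a) (w' * cl_gen Cl a) = beta w w'.
Proof.
have E u : T *m (kappa (u * cl_gen Cl a))^T = kappa (cl_gen Cl a) *m (T *m (kappa u)^T).
  by rewrite kappaM trmx_mul !mulmxA -hT.
by rewrite /beta (E w) (E w'); exact: vmetric_gen_l.
Qed.

Lemma at_eZ a X : at_e (a *: X) = a *: at_e X.
Proof.
apply: (assoc_ext (V := vspinor_rep kappa Fp Fm) ue).
by rewrite assocZ !(at_frame_id sV _ ue).
Qed.

Lemma vmetricZl a (t t' : VM x) : hV (a *: t) t' = a * hV t t'.
Proof.
have h0 : hV 0 t' = 0.
  by rewrite -[RHS](addNr (hV 0 t')) -mulN1r -hVPl scaler0 addr0.
by rewrite -[a *: t]addr0 hVPl h0 addr0.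
Qed.

Lemma vmetric_suml (I : Type) (r : seq I) (G : I -> VM x) t' :
  hV (\sum_(i <- r) G i) t' = \sum_(i <- r) hV (G i) t'.
Proof.
elim: r => [|i r IH]; first by rewrite !big_nil -(scale0r (0 : VM x)) vmetricZl mul0r.
by rewrite !big_cons -IH -[hV (G i) t']mul1r -hVPl scale1r.
Qed.

Lemma beta_Zl c w w' : beta (c *: w) w' = c * beta w w'.
Proof. by rewrite /beta kappaZ linearZ /= -scalemxAr at_eZ vmetricZl. Qed.

Lemma betaC w w' : beta w w' = (beta w' w)^*.
Proof. exact: hVC. Qed.

Lemma beta_Zr c w w' : beta w (c *: w') = c^* * beta w w'.
Proof. by rewrite betaC beta_Zl rmorphM (betaC w w'). Qed.

Lemma beta_word l w w' : beta (cl_word Cl l * w) (cl_word Cl l * w') = beta w w'.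
Proof.
elim: l => [|a l IH]; first by rewrite cl_word_nil !mul1r.
by rewrite !cl_word_cons -!mulrA beta_gen_l.
Qed.

(* Conjugation by a generator that separates A and B changes the sign.        *)
Lemma beta_blade A B : beta (blade Cl A) (blade Cl B) = beta 1 1 * (A == B)%:R.
Proof.
have [<-|AB] := eqVneq A B.
  by rewrite mulr1 -[RHS](beta_word (enum A)) !mulr1.
rewrite mulr0; have [a] := blade_separate AB; rewrite count_cat count_rev => od.
have : beta (blade Cl A) (blade Cl B) = - beta (blade Cl A) (blade Cl B).
  rewrite -{1}(beta_gen_l a) !cl_gen_word beta_Zl beta_Zr beta_gen_r.
  rewrite rmorphXn rmorphN1.
  by rewrite mulrA -exprD -signr_odd od mulN1r.
by move/eqP; rewrite -subr_eq0 opprK -mulr2n mulrn_eq0 => /eqP.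
Qed.

Lemma xi_exists (A : {set 'I_N}) : exists l : {scalar Mat},
  forall X, l X = cl_dual kappa A (vspinor_symbol kappa T X).
Proof.
apply: (@scalar_exists R Mat (fun X => cl_dual kappa A (vspinor_symbol kappa T X))) => c X Y.
rewrite /vspinor_symbol -[(invmx T *m _)]/(mulmx (invmx T) _) linearP [X in kappa_inv _ X]linearP.
by rewrite (kappa_inv_linear kappa) linearP.
Qed.

End AtFrame.

(** The coordinate of a V-spinor value along [T kappa(e_A)^T], where [e_A] is the blade of [A]. *)
Definition xi (A : {set 'I_N}) : {scalar Mat} := sval (cid (xi_exists A)).

Lemma xiE A X : xi A X = cl_dual kappa A (vspinor_symbol kappa T X).
Proof. exact: (svalP (cid (xi_exists A))). Qed.

Lemma xi_sum X : T *m (kappa (\sum_A xi A X *: blade Cl A))^T = X.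
Proof.
under eq_bigr do rewrite xiE.
by rewrite -cl_findim_sum vspinor_symbolK.
Qed.

End TensorMetric.

Section TensorMetricProperties.
Context {R : realType} {n : nat} {M : manifold R n.*2}.
Context (H : hermitian_structure M) (D : conn (M := M)) (hD : is_chern H D).
Context (Cl : clifford R n.*2) (kappa : spin_module Cl).
Local Notation C := R[i].
Local Notation Mat := 'M[R[i]]_(2 ^ n).
Local Notation N := n.*2.
Local Notation fS := (@mx_findim R (2 ^ n) 1).
Local Notation fV := (@mx_findim R (2 ^ n) (2 ^ n)).
Context (Fp Fm : 'M[C]_n -> Cl * C).
Context (hFp : is_spinc_lift true Fp) (hFm : is_spinc_lift false Fm).
Context (T : Mat) (uT : T \in unitmx)
  (hT : forall v, kappa (cl_vec Cl v) *m T = T *m (kappa (cl_vec Cl v))^T).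
Local Notation SM := (spinorB H kappa Fm).
Local Notation SP := (spinorB H kappa Fp).
Local Notation VM := (vspinorB H kappa Fp Fm).
Local Notation DV := (@vspinor_cov R n M H D Cl kappa Fp Fm).
Context (psi0 : forall x : M, SP x) (phi0 : forall x : M, SM x).
Context (hup : forall x : M, SP x -> SP x -> C) (hdn : forall x : M, SM x -> SM x -> C).
Context (hhup : is_spinor_metric D 0 psi0 hup) (hhdn : is_spinor_metric D n phi0 hdn).
Local Notation hV := (vspinor_metric hdn hup).
Local Notation xi := (xi kappa T).
Implicit Types (x : M).

Let sP := spinor_smooth_urep hD uT hT hFp (s0_smooth hhup) (s0_neq0 hhup).
Let sM := spinor_smooth_urep hD uT hT hFm (s0_smooth hhdn) (s0_neq0 hhdn).
Local Notation sV := (vspinor_smooth_urep (M := M) uT hT hFp hFm).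
Let hmu := sm_hmetric hhup.
Let hmd := sm_hmetric hhdn.
Let hVC x (t t' : VM x) := vmetricC hD hFp hFm sP sM hmd hmu t t'.
Let hVPl x a (t1 t2 t' : VM x) := vmetricPl hD hFp hFm sP sM hmd hmu a t1 t2 t'.

(* The V-spinor with value T in all frames corresponds to the constant form 1. *)
Definition charge_section x : VM x := mk_assoc H (vspinor_rep kappa Fp Fm) (fun _ : frame x => T).

Lemma charge_sectionE x (e : frame x) : uframe H e -> charge_section x e = T.
Proof.
apply: mk_assocE => e' A ue uA.
have := vspinor_act_charge uT hT hFp hFm 1 uA; rewrite (rmorph1 (cl_lift Cl (realify A))) kappa1 trmx1 mulmx1; exact.
Qed.

Definition norm_factor x : C := hV (charge_section x) (charge_section x).

(** Expand both arguments along the images of the blades, which [beta_blade] makes orthogonal with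
    common squared length [norm_factor x]. *)
Lemma vmetric_xi x (e : frame x) (t t' : VM x) : uframe H e ->
  hV t t' = norm_factor x * \sum_A xi A (t e) * (xi A (t' e))^*.
Proof.
move=> ue; pose at_e (X : Mat) : VM x := at_frame H (V := vspinor_rep kappa Fp Fm) e X.
pose bl A := at_e (T *m (kappa (blade Cl A))^T).
have expand (s : VM x) : s = \sum_A xi A (s e) *: bl A.
  apply: (assoc_ext (V := vspinor_rep kappa Fp Fm) ue); rewrite assoc_sum.
  rewrite -{1}[s e](xi_sum kappa uT) kappa_sum linear_sum mulmx_sumr; apply: eq_bigr => A _.
  apply: (etrans _ (esym (congr1 (fun X : Mat => xi A (s e) *: X)
    (at_frame_id sV (T *m (kappa (blade Cl A))^T) ue)))).
  by rewrite kappaZ linearZ scalemxAr.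
have blE A B : hV (bl A) (bl B) = norm_factor x * (A == B)%:R.
  rewrite [LHS](beta_blade hD hFp hFm uT hT sP sM hhup hhdn ue); congr (_ * _).
  have E : at_e (T *m (kappa (1 : Cl))^T) = charge_section x.
    apply: (assoc_ext (V := vspinor_rep kappa Fp Fm) ue).
    by rewrite (charge_sectionE ue) /at_e (at_frame_id sV _ ue) kappa1 trmx1 mulmx1.
  by rewrite /norm_factor -E.
have suml := vmetric_suml hD hFp hFm sP sM hhup hhdn.
have Zl := vmetricZl hD hFp hFm sP sM hhup hhdn.
rewrite {1}(expand t) suml mulr_sumr; apply: eq_bigr => A _.
have nfJ : Num.conj (norm_factor x) = norm_factor x by rewrite {2}/norm_factor hVC.
have h2 : hV t' (bl A) = xi A (t' e) * norm_factor x.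
  rewrite {1}(expand t') suml (bigD1 A isT) /= big1 => [|B BA]; first by rewrite addr0 Zl blE eqxx mulr1.
  by rewrite Zl blE (negPf BA) mulr0 mulr0.
have cM (a b : C) : (a * b)^* = a^* * b^* := rmorphM Num.conj a b.
by rewrite Zl hVC h2 cM nfJ mulrA [LHS]mulrC -[LHS]mulrA [LHS]mulrC.
Qed.

Definition unit_value x (e : frame x) : Mat :=
  (phi0 x e : 'cV_(2 ^ n)) *m (psi0 x e : 'cV_(2 ^ n))^T.

Definition xi_norm (X : Mat) : C := \sum_A xi A X * (xi A X)^*.

(** Since [phi0 x] and [psi0 x] have norm 1, their tensor product calibrates the factor. Its
    positivity, smoothness and derivative are all obtained from this formula. *)
Lemma norm_factor_unit x (e : frame x) : uframe H e ->
  norm_factor x * xi_norm (unit_value e) = 1.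
Proof.
move=> ue; have := vmetric_dec hD sP sM hmd hmu (fun _ : 'I_1 => phi0 x) (fun _ : 'I_1 => psi0 x)
  (fun _ : 'I_1 => phi0 x) (fun _ : 'I_1 => psi0 x).
rewrite !big_ord1 (sm_norm hhdn) (sm_norm hhup) mulr1 (vmetric_xi _ _ ue) (vtenE _ _ ue).
exact.
Qed.

Lemma xi_norm_ge0 X : 0 <= xi_norm X.
Proof. by apply: sumr_ge0 => A _; exact: mul_conjC_ge0. Qed.

Lemma norm_factor_gt0 x : 0 < norm_factor x.
Proof.
have [e ue] := uframe_exists hD x; have := norm_factor_unit ue.
have := xi_norm_ge0 (unit_value e); rewrite le_eqVlt => /predU1P[<-|n0 E].
  by rewrite mulr0 => /eqP; rewrite eq_sym oner_eq0.
by rewrite -(pmulr_lgt0 _ n0) E ltr01.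
Qed.

Section NearPoint.
Context (x : M) (e : local_frame (M := M)) (ue : uframe_near H x e).

Lemma xi_smooth A (f : M -> Mat) : vsmooth_at x f -> csmooth_at x (fun y => xi A (f y)).
Proof. by move=> sf; exact: sf. Qed.

Lemma xi_norm_smooth (f : M -> Mat) : vsmooth_at x f -> csmooth_at x (fun y => xi_norm (f y)).
Proof.
by move=> sf; apply: csmooth_sum => A _; apply: csmoothM; [|apply: csmooth_conj]; exact: sf.
Qed.

Lemma unit_value_smooth : vsmooth_at x (fun y => unit_value (frame_at e y)).
Proof.
by apply: (vsmooth_bilin fS fS (tensor_linear_l (n := n)) (tensor_linear_r (n := n)));
  [exact: (s0_smooth hhdn ue)|exact: (s0_smooth hhup ue)].
Qed.

Lemma norm_factorE : \forall y \near x,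
  norm_factor y = (xi_norm (unit_value (frame_at e y)))^-1.
Proof.
apply: filterS ue.2 => y uy; have E := norm_factor_unit uy.
by apply: (mulIf (x := xi_norm (unit_value (frame_at e y)))); rewrite ?E ?mulVf//;
  apply: contra_eq_neq E => ->; rewrite mulr0 eq_sym oner_neq0.
Qed.

Lemma xi_norm_unit_neq0 : xi_norm (unit_value (frame_at e x)) != 0.
Proof.
by apply: contra_eq_neq (norm_factor_unit (uframe_near_at ue)) => ->;
  rewrite mulr0 eq_sym oner_neq0.
Qed.

Lemma norm_factor_smooth : csmooth_at x norm_factor.
Proof.
apply: (csmooth_ext _ (csmoothV (xi_norm_smooth unit_value_smooth) xi_norm_unit_neq0)).
by apply: filterS norm_factorE => y ->.
Qed.

(* phi0 (x) psi0 is a parallel section of norm 1.                             *)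
Lemma cder_norm_factor (v : tangent x) : (forall u a, D (x := x) u (e a) = 0) ->
  cder v norm_factor = 0.
Proof.
move=> pe; have sN := xi_norm_smooth unit_value_smooth.
transitivity (cder v (fun y => (xi_norm (unit_value (frame_at e y)))^-1)).
  exact: (cder_ext v norm_factor_smooth norm_factorE).
apply: (cderV0 sN xi_norm_unit_neq0).
have dP : vder fS v (fun y => psi0 y (frame_at e y)) = 0.
  rewrite -(assoc_covE hD sP v (s0_smooth hhup (x := x)) ue pe).
  by rewrite -[assoc_cov _ _ _ _ _ _]/(spinor_cov D v psi0) (s0_parallel hhup).
have dM : vder fS v (fun y => phi0 y (frame_at e y)) = 0.
  rewrite -(assoc_covE hD sM v (s0_smooth hhdn (x := x)) ue pe).
  by rewrite -[assoc_cov _ _ _ _ _ _]/(spinor_cov D v phi0) (s0_parallel hhdn).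
have dU : vder fV v (fun y => unit_value (frame_at e y)) = 0.
  rewrite [LHS](vder_bilin fS fS fV (tensor_linear_l (n := n)) (tensor_linear_r (n := n)) v
    (s0_smooth hhdn ue) (s0_smooth hhup ue)).
  by rewrite dM dP mul0mx trmx0 mulmx0 addr0.
have dxi A : cder v (fun y => xi A (unit_value (frame_at e y))) = 0.
  by rewrite -(vderP fV v (xi A) unit_value_smooth) dU linear0.
have sxi A := xi_smooth A unit_value_smooth.
rewrite /xi_norm cder_sum => [|A _]; last by apply: csmoothM => //; exact: csmooth_conj.
rewrite big1// => A _; rewrite cderM//; last exact: csmooth_conj.
by rewrite cder_conj// dxi rmorph0 mul0r mulr0 addr0.
Qed.

End NearPoint.

Lemma vmetric_is_hmetric : is_hmetric (E := VM) hV.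
Proof.
split=> [x a u v w|x u v|x u u0|x s t ss st].
- exact: hVPl.
- exact: hVC.
- have [e ue] := uframe_exists hD x.
  rewrite (vmetric_xi _ _ ue) pmulr_rgt0 ?norm_factor_gt0// lt_def xi_norm_ge0 andbT.
  apply: contra_neq u0 => /eqP; rewrite psumr_eq0 => [/allP x0|A _]; last exact: mul_conjC_ge0.
  apply: (assoc_ext (V := vspinor_rep kappa Fp Fm) ue).
  rewrite -[LHS](xi_sum kappa uT) big1 => [|A _].
    by rewrite kappa0 trmx0 mulmx0.
  have := x0 A (mem_index_enum _); rewrite mul_conjC_eq0 => /eqP->.
  by rewrite scale0r.
- have [e [ue _]] := parallel_uframe_exists hD x.
  apply: (csmooth_ext (f := fun y => norm_factor y *
    \sum_A xi A (s y (frame_at e y)) * (xi A (t y (frame_at e y)))^*)).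
    by apply: filterS ue.2 => y uy; rewrite [RHS](vmetric_xi _ _ uy).
  apply: csmoothM; first exact: (norm_factor_smooth ue).
  apply: csmooth_sum => A _; apply: csmoothM; first exact: (ss e ue).
  by apply: csmooth_conj; exact: (st e ue).
Qed.

Lemma vmetric_preserved : preserves DV hV.
Proof.
move=> x v s t ss st; have [e [ue pe]] := parallel_uframe_exists hD x.
have ux := uframe_near_at ue.
have xs A : csmooth_at x (fun y => xi A (s y (frame_at e y))) := ss e ue (xi A).
have xt A : csmooth_at x (fun y => (xi A (t y (frame_at e y)))^*).
  by apply: csmooth_conj; exact: (st e ue (xi A)).
have xst A := csmoothM (xs A) (xt A).
transitivity (cder v (fun y => norm_factor y *
    \sum_A xi A (s y (frame_at e y)) * (xi A (t y (frame_at e y)))^*)).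
  symmetry; apply: cder_ext.
    by apply: (csmoothM (norm_factor_smooth ue)); apply: csmooth_sum => A _; exact: xst.
  by apply: filterS ue.2 => y uy; rewrite [RHS](vmetric_xi _ _ uy).
rewrite (cderM v (norm_factor_smooth ue)); last by apply: csmooth_sum => A _; exact: xst.
rewrite (cder_norm_factor ue v pe) mul0r add0r !(vmetric_xi _ _ ux) -mulrDr; congr (_ * _).
rewrite cder_sum => [|A _]; last exact: xst.
rewrite -big_split; apply: eq_bigr => A _ /=; rewrite (cderM v (xs A) (xt A)).
rewrite (cder_conj v (st e ue (xi A))).
have dxi (r : forall y, VM y) (sr : sec_smooth x r) :
    xi A ((DV v r) (frame_at e x)) = cder v (fun y => xi A (r y (frame_at e y))).
  by rewrite (vspinor_covE hD sP sM v sr ue pe); exact: (vderP fV v (xi A) (sr e ue)).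
by rewrite (dxi s ss) (dxi t st).
Qed.

End TensorMetricProperties.

Section GradingOrthogonality.
Context {R : realType} {n : nat} {M : manifold R n.*2}.
Context (H : hermitian_structure M) (D : conn (M := M)).
Context (Cl : clifford R n.*2) (kappa : spin_module Cl).
Context (b : bool) (F : 'M[R[i]]_n -> Cl * R[i]) (hF : is_spinc_lift b F).
Context (k0 : nat) (s0 : forall x : M, spinorB H kappa F x).
Context (h : forall x : M, spinorB H kappa F x -> spinorB H kappa F x -> R[i]).
Hypothesis sm : is_spinor_metric D k0 s0 h.
Context (x : M) (e : frame x) (ue : uframe H e).
Implicit Types (s t : spinorB H kappa F x).
Local Notation cliff v s := (cl_spinor (cl_tangent H Cl v) s).
Local Notation ci := (0 +i* 1 : R[i]).

Let hh := sm_hmetric sm.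

Lemma complex_tangent_skew (u u' : tangent x) s t :
  h (cl_spinor (cl_tangent H Cl u + ci *: cl_tangent H Cl u') s) t +
  h s (cl_spinor (cl_tangent H Cl u - ci *: cl_tangent H Cl u') t) = 0.
Proof.
have E (c : R[i]) r : cl_spinor (cl_tangent H Cl u + c *: cl_tangent H Cl u') r =
    cliff u r + c *: (cliff u' r : spinorB H kappa F x).
  apply: (assoc_ext (V := spinor_rep kappa F) ue).
  apply: (etrans (cl_spinorE hF _ _ ue)).
  apply: (etrans _ (esym (congr2 (fun X Y : 'cV_(2 ^ n) => X + c *: Y)
    (cl_spinorE hF (cl_tangent H Cl u) r ue) (cl_spinorE hF (cl_tangent H Cl u') r ue)))).
  by rewrite scalemxAl -mulmxDl -kappaZ -kappaD.
rewrite -scaleNr !E (hmetricDl hh) (hmetricDr hh) (hmetricZl hh) (hmetricZr hh).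
rewrite !(tangent_skew hF sm _ _ _ ue).
have -> : Num.conj (- ci) = ci by apply: complex_ext; rewrite /= ?oppr0 ?opprK.
by rewrite mulrN addrACA !addNr addr0.
Qed.

(** The Kähler form acts as the sum of products of two orthogonal unit vectors; such a product of
    anticommuting skew operators is skew. *)
Lemma kahler_skew s t :
  h (cl_spinor (cl_form H Cl (kahler_form H (x := x))) s) t =
  - h s (cl_spinor (cl_form H Cl (kahler_form H (x := x))) t).
Proof.
have G a c (r : spinorB H kappa F x) : (cliff (e a) (cliff (e c) r)) e = kappa (cl_gen Cl a * cl_gen Cl c) *m r e.
  rewrite kappaM -mulmxA (cl_spinor_tangentE hF (e a) (cliff (e c) r) ue).
  rewrite (cl_spinor_tangentE hF (e c) r ue).
  by rewrite (frame_gen_row ue a) (frame_gen_row ue c).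
have E r : cl_spinor (cl_form H Cl (kahler_form H (x := x))) r =
    \sum_j cliff (e (even_ord j)) (cliff (e (odd_ord j)) r) :> spinorB H kappa F x.
  apply: (assoc_ext (V := spinor_rep kappa F) ue); rewrite assoc_sum.
  rewrite (cl_spinorE hF _ _ ue) (cl_form_kahler Cl ue) kappa_sum mulmx_suml.
  by apply: eq_bigr => j _; rewrite G.
have A j r : cliff (e (odd_ord j)) (cliff (e (even_ord j)) r) =
    (-1) *: (cliff (e (even_ord j)) (cliff (e (odd_ord j)) r) : spinorB H kappa F x).
  apply: (assoc_ext (V := spinor_rep kappa F) ue); rewrite G.
  apply: (etrans _ (esym (congr1 (fun X : 'cV_(2 ^ n) => -1 *: X) (G _ _ r)))).
  by rewrite cl_genC ?kappaN ?mulNmx ?scaleN1r// eq_sym eq_even_odd.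
rewrite !E (hmetric_suml hh) (hmetric_sumr hh) -sumrN; apply: eq_bigr => j _.
rewrite !(tangent_skew hF sm _ _ _ ue) opprK A (hmetricZr hh).
by rewrite rmorphN1 mulN1r.
Qed.

Lemma grade_value_conj m k : Num.conj (@grade_value R m k) = - grade_value m k.
Proof.
rewrite /grade_value rmorphM rmorphB !rmorph_nat -mulrN; congr (_ * _).
by apply: complex_ext; rewrite /= ?oppr0.
Qed.

(** Eigenvectors of a skew operator for distinct imaginary eigenvalues. This makes the sign (-1)^p
    of [opR] compatible with the metric. *)
Lemma spinor_grade_orthogonal k k' s t : spinor_grade k s -> spinor_grade k' t ->
  k != k' -> h s t = 0.
Proof.
move=> ks kt kk; have := kahler_skew s t; rewrite ks kt (hmetricZl hh) (hmetricZr hh).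
rewrite -!/(grade_value n _) [X in - (X * _)]grade_value_conj mulNr opprK => /eqP.
rewrite -subr_eq0 -mulrBl mulf_eq0 subr_eq0 => /orP[/eqP/grade_value_inj kk'|/eqP//].
by rewrite kk' eqxx in kk.
Qed.

End GradingOrthogonality.

Section CliffordParity.
Context {R : realType} {n : nat} (Cl : clifford R n.*2) (kappa : spin_module Cl).
Local Notation N := n.*2.
Implicit Types (w : Cl) (v : 'rV[R]_N).

Definition parity_map : {lrmorphism Cl -> Cl} := cl_lift Cl (- 1%:M).
Definition cl_even w : Cl := 2^-1 *: (w + parity_map w).
Definition cl_odd w : Cl := 2^-1 *: (w - parity_map w).

Lemma opp1_tr : (- 1%:M : 'M[R]_N)^T = - 1%:M.
Proof. by apply/matrixP => a b; rewrite !mxE eq_sym. Qed.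

Lemma opp1_orthogonal : (- 1%:M : 'M[R]_N)^T *m (- 1%:M) = 1%:M.
Proof. by rewrite opp1_tr mulNmx mul1mx opprK. Qed.

Lemma parity_map_lift (Q : 'M[R]_N) w : Q^T *m Q = 1%:M ->
  parity_map (cl_lift Cl Q w) = cl_lift Cl Q (parity_map w).
Proof.
move=> oQ; rewrite /parity_map -(cl_liftM kappa w opp1_orthogonal oQ).
rewrite -(cl_liftM kappa w oQ opp1_orthogonal).
by rewrite mulNmx mul1mx mulmxN mulmx1.
Qed.

Lemma parity_mapK w : parity_map (parity_map w) = w.
Proof.
rewrite /parity_map -(cl_liftM kappa w opp1_orthogonal opp1_orthogonal).
by rewrite mulNmx mul1mx opprK (cl_lift1 kappa).
Qed.

Lemma parity_map_vec v : parity_map (cl_vec Cl v) = - cl_vec Cl v.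
Proof.
rewrite /parity_map (cl_lift_vec _ _ opp1_orthogonal) opp1_tr mulmxN mulmx1.
by rewrite -scaleN1r cl_vecZ rmorphN1 scaleN1r.
Qed.

Lemma half_double (V : lmodType R[i]) (w : V) : 2^-1 *: (w + w) = w.
Proof. by rewrite -mulr2n -[w *+ 2]scaler_nat scalerA mulVf ?scale1r// pnatr_eq0. Qed.

Lemma cl_even_odd w : w = cl_even w + cl_odd w.
Proof. by rewrite /cl_even /cl_odd -scalerDr addrACA subrr addr0 half_double. Qed.

Lemma parity_even w : parity_map (cl_even w) = cl_even w.
Proof. by rewrite /cl_even linearZ linearD /= parity_mapK addrC. Qed.

Lemma parity_odd w : parity_map (cl_odd w) = - cl_odd w.
Proof. by rewrite /cl_odd linearZ linearB /= parity_mapK -scalerN opprB. Qed.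

Lemma cl_even_eq w w0 w1 : w = w0 + w1 -> parity_map w0 = w0 -> parity_map w1 = - w1 ->
  cl_even w = w0 /\ cl_odd w = w1.
Proof.
move=> -> p0 p1; have pD : parity_map (w0 + w1) = w0 - w1 by rewrite rmorphD /= p0 p1.
rewrite /cl_even /cl_odd pD.
by rewrite addrACA subrr addr0 half_double opprD opprK addrACA subrr add0r half_double.
Qed.

Lemma cl_even_linear : linear cl_even.
Proof.
move=> c u w; rewrite /cl_even linearP /= scalerA [c * _]mulrC -scalerA -scalerDr; congr (_ *: _).
by rewrite scalerDr addrACA.
Qed.

Lemma cl_odd_linear : linear cl_odd.
Proof.
move=> c u w; rewrite /cl_odd linearP /= scalerA [c * _]mulrC -scalerA -scalerDr; congr (_ *: _).
by rewrite scalerBr opprD addrACA.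
Qed.

Lemma cl_even1 : cl_even 1 = 1.
Proof. by rewrite /cl_even rmorph1 half_double. Qed.

Lemma cl_odd1 : cl_odd 1 = 0.
Proof. by rewrite /cl_odd rmorph1 subrr scaler0. Qed.

Lemma cl_even_oddM w w' :
  cl_even (w * w') = cl_even w * cl_even w' + cl_odd w * cl_odd w' /\
  cl_odd (w * w') = cl_even w * cl_odd w' + cl_odd w * cl_even w'.
Proof.
apply: cl_even_eq; last 2 first.
- by rewrite linearD !rmorphM /= !parity_even !parity_odd mulrNN.
- by rewrite linearD !rmorphM /= !parity_even !parity_odd mulrN mulNr opprD.
rewrite {1}(cl_even_odd w) {1}(cl_even_odd w') mulrDl !mulrDr -!addrA; congr (_ + _).
by rewrite [RHS]addrC -addrA.
Qed.

End CliffordParity.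

(** * The two Clifford module structures *)

Section Operations.
Context {R : realType} {n : nat} {M : manifold R n.*2}.
Context (H : hermitian_structure M) (D : conn (M := M)) (hD : is_chern H D).
Context (Cl : clifford R n.*2) (kappa : spin_module Cl).
Local Notation C := R[i].
Local Notation Mat := 'M[R[i]]_(2 ^ n).
Local Notation N := n.*2.
Local Notation fS := (@mx_findim R (2 ^ n) 1).
Local Notation fV := (@mx_findim R (2 ^ n) (2 ^ n)).
Context (Fp Fm : 'M[C]_n -> Cl * C).
Context (hFp : is_spinc_lift true Fp) (hFm : is_spinc_lift false Fm).
Context (T : Mat) (uT : T \in unitmx)
  (hT : forall v, kappa (cl_vec Cl v) *m T = T *m (kappa (cl_vec Cl v))^T).
Local Notation SM := (spinorB H kappa Fm).
Local Notation SP := (spinorB H kappa Fp).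
Local Notation VM := (vspinorB H kappa Fp Fm).
Local Notation DV := (@vspinor_cov R n M H D Cl kappa Fp Fm).
Context (psi0 : forall x : M, SP x) (phi0 : forall x : M, SM x).
Context (hup : forall x : M, SP x -> SP x -> C) (hdn : forall x : M, SM x -> SM x -> C).
Context (hhup : is_spinor_metric D 0 psi0 hup) (hhdn : is_spinor_metric D n phi0 hdn).
Local Notation hV := (vspinor_metric hdn hup).
Local Notation ci := (0 +i* 1 : R[i]).
Implicit Types (x : M).

Let sP := spinor_smooth_urep hD uT hT hFp (s0_smooth hhup) (s0_neq0 hhup).
Let sM := spinor_smooth_urep hD uT hT hFm (s0_smooth hhdn) (s0_neq0 hhdn).
Local Notation sV := (vspinor_smooth_urep (M := M) uT hT hFp hFm).
Let hmu := sm_hmetric hhup.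
Let hmd := sm_hmetric hhdn.
Let hdec x (t : VM x) := vhom_decomposition hD hFp hFm sP sM t.

(** What both operations share: in every unitary frame they are one constant module structure [B] on
    matrices. The module axioms hold framewise, and the Leibniz rule is the product rule in a
    parallel frame; only skewness is particular to each. *)
Lemma chern_dirac_of_bilinear (c : forall x, clB H Cl x -> VM x -> VM x)
    (B : Cl -> Mat -> Mat) :
  (forall t, linear (B^~ t)) -> (forall w, linear (B w)) ->
  (forall t, B 1 t = t) -> (forall w w' t, B (w * w') t = B w (B w' t)) ->
  (forall x (e : frame x) (w : clB H Cl x) (t : VM x), uframe H e -> (c x w t) e = B (w e) (t e)) ->
  (forall x (u u' : tangent x) (s t : VM x),
    hV (c x (cl_tangent H Cl u + ci *: cl_tangent H Cl u') s) t +
    hV s (c x (cl_tangent H Cl u - ci *: cl_tangent H Cl u') t) = 0) ->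
  is_chern_dirac (E := VM) D hV DV c.
Proof.
move=> Bl Br B1 BM cE skew.
have VE x (e : frame x) (s t : VM x) := @assoc_ext _ _ _ H (vspinor_rep kappa Fp Fm) x e s t.
have csm x (w : forall y, clB H Cl y) (s : forall y, VM y) : sec_smooth x w -> sec_smooth x s ->
    sec_smooth x (fun y => c y (w y) (s y)).
  move=> sw ss; have [e [ue _]] := parallel_uframe_exists hD x.
  apply/(assoc_smoothP sV _ ue).
  apply: (vsmooth_ext (f := fun y => B (w y (frame_at e y)) (s y (frame_at e y)))).
    by apply: filterS ue.2 => y uy; rewrite [RHS](cE _ _ _ _ uy).
  exact: (vsmooth_bilin (cl_findim kappa) fV Bl Br (sw e ue) (ss e ue)).
split.
- exact: (vspinor_vbundle hD sV).
- exact: (vmetric_is_hmetric hD hFp hFm uT hT hhup hhdn).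
- exact: (vspinor_is_cov hD hFp hFm uT hT sP sM).
- exact: (vmetric_preserved hD hFp hFm uT hT hhup hhdn).
- move=> x a w w' s; have [e ue] := uframe_exists hD x; apply: (VE _ _ _ _ ue).
  apply: (etrans (cE _ _ _ _ ue)); apply: (etrans (Bl (s e) a (w e) (w' e))).
  exact: (esym (congr2 (fun X Y : Mat => a *: X + Y) (cE _ _ w s ue) (cE _ _ w' s ue))).
- move=> x a w s t; have [e ue] := uframe_exists hD x; apply: (VE _ _ _ _ ue).
  apply: (etrans (cE _ _ _ _ ue)); apply: (etrans (Br (w e) a (s e) (t e))).
  exact: (esym (congr2 (fun X Y : Mat => a *: X + Y) (cE _ _ w s ue) (cE _ _ w t ue))).
- move=> x s; have [e ue] := uframe_exists hD x; apply: (VE _ _ _ _ ue).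
  by apply: (etrans (cE _ _ _ _ ue)); rewrite (cl_oneE Cl ue) B1.
- move=> x w w' s; have [e ue] := uframe_exists hD x; apply: (VE _ _ _ _ ue).
  apply: (etrans (cE _ _ _ _ ue)); rewrite (cl_mulE w w' ue) BM.
  by rewrite (cE _ _ _ _ ue) (cE _ _ _ _ ue).
- exact: csm.
- exact: skew.
move=> x v w s sw ss; have [e [ue pe]] := parallel_uframe_exists hD x.
have ux := uframe_near_at ue; apply: (VE _ _ _ _ ux).
apply: (etrans (vspinor_covE hD sP sM v (csm _ _ _ sw ss) ue pe)).
transitivity (vder fV v (fun y => B (w y (frame_at e y)) (s y (frame_at e y)))).
  symmetry; apply: vder_ext.
    exact: (vsmooth_bilin (cl_findim kappa) fV Bl Br (sw e ue) (ss e ue)).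
  by apply: filterS ue.2 => y uy; rewrite [RHS](cE _ _ _ _ uy).
rewrite (vder_bilin (cl_findim kappa) fV fV Bl Br v (sw e ue) (ss e ue)).
have cw := assoc_covE hD (cl_smooth_urep (M := M) kappa) v sw ue pe.
have cs := vspinor_covE hD sP sM v ss ue pe.
apply: (etrans _ (esym (congr2 (fun X Y : Mat => X + Y)
  (cE _ _ (assoc_cov H D (cl_rep Cl) x v w) (s x) ux) (cE _ _ (w x) (DV v s) ux)))).
by rewrite cw cs.
Qed.

Lemma opLE x (e : frame x) (w : clB H Cl x) (t : VM x) : uframe H e ->
  (opL w t) e = kappa (w e) *m t e.
Proof.
move=> ue; have val r (f : 'I_r -> SM x) (g : 'I_r -> SP x) : t = \sum_i vten (f i) (g i) ->
    (\sum_i vten (cl_spinor w (f i)) (g i) : VM x) e = kappa (w e) *m t e.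
  move=> ->; rewrite !(vten_sumE _ _ ue) mulmx_sumr; apply: eq_bigr => i _.
  by rewrite (cl_spinorE hFm _ _ ue) mulmxA.
have [r [p [q [f [g [fg tE]]]]]] := hdec t.
pose P := [set u : VM x | forall r (p q : 'I_r -> nat) (f : 'I_r -> SM x) (g : 'I_r -> SP x),
    (forall i, vhom (p i) (q i) (f i) (g i)) ->
    t = \sum_i vten (f i) (g i) ->
    u = \sum_i vten (cl_spinor w (f i)) (g i)].
have Pu : P (\sum_i vten (cl_spinor w (f i)) (g i)).
  move=> r1 p1 q1 f1 g1 _ tE1; apply: (assoc_ext (V := vspinor_rep kappa Fp Fm) ue).
  by apply: (etrans (val _ _ _ tE)); rewrite (val _ _ _ tE1).
have /(_ _ _ _ _ _ fg tE) E := xgetPex (0 : VM x) (ex_intro P _ Pu).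
by rewrite -(val _ _ _ tE) -E.
Qed.

Lemma opL_dec x (w : clB H Cl x) r (f : 'I_r -> SM x) (g : 'I_r -> SP x) :
  opL w (\sum_i vten (f i) (g i)) = \sum_i vten (cl_spinor w (f i)) (g i).
Proof.
have [e ue] := uframe_exists hD x; apply: (assoc_ext (V := vspinor_rep kappa Fp Fm) ue).
rewrite (opLE _ _ ue) !(vten_sumE _ _ ue) mulmx_sumr; apply: eq_bigr => i _.
by rewrite (cl_spinorE hFm _ _ ue) mulmxA.
Qed.

Lemma opL_chern_dirac : is_chern_dirac (E := VM) D hV DV (@opL R n M H Cl kappa Fp Fm).
Proof.
apply: (@chern_dirac_of_bilinear _ (fun w t => kappa w *m t)) => [t|w|t|w w' t|x e w t|x u u' s t].
- by move=> a w w'; rewrite linearP mulmxDl -scalemxAl.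
- exact: mulmx_bilin_r.
- by rewrite kappa1 mul1mx.
- by rewrite kappaM mulmxA.
- exact: opLE.
have [e ue] := uframe_exists hD x.
have [r [_ [_ [f [g [_ ->]]]]]] := hdec s; have [r' [_ [_ [f' [g' [_ ->]]]]]] := hdec t.
rewrite !opL_dec !(vmetric_dec hD sP sM hmd hmu) -big_split big1// => i _ /=.
rewrite -big_split big1// => j _ /=; rewrite -mulrDl.
by rewrite (complex_tangent_skew hFm hhdn ue) mul0r.
Qed.

Definition right_op (w : Cl) (t : Mat) : Mat :=
  t *m (kappa (cl_even w))^T + chirality kappa *m t *m (kappa (cl_odd w))^T.

Lemma right_op_linear_l t : linear (right_op^~ t).
Proof.
move=> a w w'; rewrite /right_op cl_even_linear cl_odd_linear !kappaD !kappaZ.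
by rewrite !linearP /= addrACA -scalerDr.
Qed.

Lemma right_op_linear_r w : linear (right_op w).
Proof.
move=> a t t'; rewrite /right_op mulmxDr !mulmxDl -scalemxAr -!scalemxAl addrACA.
by rewrite -scalerDr.
Qed.

Lemma right_op1 t : right_op 1 t = t.
Proof. by rewrite /right_op cl_even1 cl_odd1 kappa1 kappa0 !trmx0 trmx1 mulmx1 mulmx0 addr0. Qed.

(** Transposition turns right multiplication into a left action. Two odd parts bring the chirality
    element twice, and its square is 1, so they contribute to the even part of the product as they
    should. *)
Lemma right_opM w w' t : right_op (w * w') t = right_op w (right_op w' t).
Proof.
rewrite /right_op; have [-> ->] := cl_even_oddM kappa w w'.
have cM (X : Mat) : chirality kappa *m (chirality kappa *m X) = X.
  by rewrite mulmxA (chirality_sqr kappa) mul1mx.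
have trD (X Y : Mat) : (X + Y)^T = X^T + Y^T by rewrite linearD.
rewrite !kappaD !trD !kappaM !trmx_mul !mulmxDl !mulmxDr !mulmxDl -!mulmxA cM.
rewrite -!addrA; congr (_ + _); rewrite [RHS]addrA [RHS]addrC; congr (_ + _).
Qed.

Lemma parity_section x (e : frame x) (b : bool) (w : Cl) : uframe H e ->
  parity_map Cl w = (-1) ^+ b *: w ->
  cl_bundle_parity b (at_frame H (V := cl_rep Cl) e w : clB H Cl x).
Proof.
move=> ue pw e' ue'; rewrite /cl_parity.
rewrite (at_frameE (cl_smooth_urep (M := M) kappa) _ ue ue') /=.
rewrite -[cl_lift Cl (- 1%:M)]/(parity_map Cl) (parity_map_lift kappa); last first.
  exact: unitary_realify_tr (trans_unitary ue' ue).
by rewrite pw linearZ.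
Qed.

(** In bidegree [(p, q)] the first factor has grade [n - p], so the sign from [chirality_eigen] is
    the one of [opR]. *)
Lemma sign_degree p : (p <= n)%N -> (-1) ^+ (n + (n - p)) = (-1) ^+ p :> C.
Proof.
by move=> pn; rewrite -[LHS]signr_odd -[RHS]signr_odd oddD oddB// addbA addbb.
Qed.

(** On each homogeneous summand the chirality element acts on the first factor as (-1)^p, so all
    admissible decompositions of [w] and [t] give the same value, and at least one exists. *)
Lemma opRE x (e : frame x) (w : clB H Cl x) (t : VM x) : uframe H e ->
  (opR w t) e = right_op (w e) (t e).
Proof.
move=> ue; have val (w0 w1 : clB H Cl x) r (p q : 'I_r -> nat) (f : 'I_r -> SM x) (g : 'I_r -> SP x) :
    cl_bundle_parity false w0 -> cl_bundle_parity true w1 -> w = w0 + w1 ->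
    (forall i, vhom (p i) (q i) (f i) (g i)) -> t = \sum_i vten (f i) (g i) ->
    (\sum_i (vten (f i) (cl_spinor w0 (g i)) + (-1) ^+ p i *: vten (f i) (cl_spinor w1 (g i))) : VM x) e
    = right_op (w e) (t e).
  move=> p0 p1 wE fg ->; have [] := @cl_even_eq _ _ Cl (w e) (w0 e) (w1 e).
  - by rewrite wE.
  - by have := p0 _ ue; rewrite /cl_parity expr0 scale1r.
  - by have := p1 _ ue; rewrite /cl_parity expr1 scaleN1r.
  rewrite /right_op => -> ->; rewrite (vten_sumE _ _ ue) assoc_sum mulmx_suml mulmx_sumr.
  rewrite mulmx_suml -big_split; apply: eq_bigr => i _ /=.
  apply: (etrans (congr2 (fun X Y : Mat => X + (-1) ^+ p i *: Y)
    (vtenE (f i) (cl_spinor w0 (g i)) ue) (vtenE (f i) (cl_spinor w1 (g i)) ue))).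
  rewrite (cl_spinorE hFp w0 (g i) ue) (cl_spinorE hFp w1 (g i) ue).
  rewrite (trmx_mul (kappa (w0 e))) (trmx_mul (kappa (w1 e))) -!mulmxA; congr (_ + _).
  have [pn _ /(spinor_gradeP hFm _ _ ue) /chirality_eigen cf _] := fg i.
  rewrite mulmxA cf -scalemxAl; congr (_ *: _).
  exact: (esym (sign_degree pn)).
have [r [p [q [f [g [fg tE]]]]]] := hdec t.
pose w0 : clB H Cl x := at_frame H (V := cl_rep Cl) e (cl_even (w e)).
pose w1 : clB H Cl x := at_frame H (V := cl_rep Cl) e (cl_odd (w e)).
have p0 : cl_bundle_parity false w0.
  by apply: (parity_section ue); rewrite (parity_even kappa) expr0 scale1r.
have p1 : cl_bundle_parity true w1.
  by apply: (parity_section ue); rewrite (parity_odd kappa) expr1 scaleN1r.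
have wE : w = w0 + w1.
  apply: (assoc_ext (V := cl_rep Cl) ue); rewrite assocD /w0 /w1.
  rewrite !(at_frame_id (cl_smooth_urep (M := M) kappa) _ ue); exact: cl_even_odd.
pose P := [set u : VM x | forall (w0 w1 : clB H Cl x) r (p q : 'I_r -> nat)
    (f : 'I_r -> SM x) (g : 'I_r -> SP x),
    cl_bundle_parity false w0 -> cl_bundle_parity true w1 -> w = w0 + w1 ->
    (forall i, vhom (p i) (q i) (f i) (g i)) ->
    t = \sum_i vten (f i) (g i) ->
    u = \sum_i (vten (f i) (cl_spinor w0 (g i)) +
                (-1) ^+ p i *: vten (f i) (cl_spinor w1 (g i)))].
have Pu : P (\sum_i (vten (f i) (cl_spinor w0 (g i)) +
                (-1) ^+ p i *: vten (f i) (cl_spinor w1 (g i)))).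
  move=> v0 v1 r1 p' q1 f1 g1 q0 q1' vE fg1 tE1.
  apply: (assoc_ext (V := vspinor_rep kappa Fp Fm) ue).
  by apply: (etrans (val _ _ _ _ _ _ _ p0 p1 wE fg tE)); rewrite (val _ _ _ _ _ _ _ q0 q1' vE fg1 tE1).
have /(_ _ _ _ _ _ _ _ p0 p1 wE fg tE) E := xgetPex (0 : VM x) (ex_intro P _ Pu).
by rewrite -(val _ _ _ _ _ _ _ p0 p1 wE fg tE) -E.
Qed.

Lemma opR_odd_dec x (w : clB H Cl x) r (p q : 'I_r -> nat) (f : 'I_r -> SM x) (g : 'I_r -> SP x) :
  (forall e : frame x, uframe H e -> parity_map Cl (w e) = - w e) ->
  (forall i, vhom (p i) (q i) (f i) (g i)) ->
  opR w (\sum_i vten (f i) (g i)) = \sum_i (-1) ^+ p i *: (vten (f i) (cl_spinor w (g i)) : VM x).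
Proof.
move=> pw fg; have [e ue] := uframe_exists hD x.
apply: (assoc_ext (V := vspinor_rep kappa Fp Fm) ue).
rewrite (opRE _ _ ue) /right_op; have [] := @cl_even_eq _ _ Cl (w e) 0 (w e).
- by rewrite add0r.
- exact: raddf0.
- exact: pw.
move=> -> ->; rewrite kappa0 trmx0 mulmx0 add0r (vten_sumE _ _ ue) assoc_sum.
rewrite mulmx_sumr mulmx_suml; apply: eq_bigr => i _.
apply: (etrans _ (esym (congr1 (fun X : Mat => (-1) ^+ p i *: X)
    (vtenE (f i) (cl_spinor w (g i)) ue)))).
rewrite (cl_spinorE hFp _ _ ue) trmx_mul !mulmxA.
have [pn _ /(spinor_gradeP hFm _ _ ue) /chirality_eigen cf _] := fg i.
rewrite cf -!scalemxAl; congr (_ *: _).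
exact: (sign_degree pn).
Qed.

Lemma opR_chern_dirac : is_chern_dirac (E := VM) D hV DV (@opR R n M H Cl kappa Fp Fm).
Proof.
apply: (@chern_dirac_of_bilinear _ right_op) => [||||x e w t|x u u' s t].
- exact: right_op_linear_l.
- exact: right_op_linear_r.
- exact: right_op1.
- exact: right_opM.
- exact: opRE.
have [e ue] := uframe_exists hD x.
have pt (c : C) (e' : frame x) : uframe H e' ->
    parity_map Cl ((cl_tangent H Cl u + c *: cl_tangent H Cl u') e') =
    - ((cl_tangent H Cl u + c *: cl_tangent H Cl u') e' : Cl).
  move=> ue'; have E : (cl_tangent H Cl u + c *: cl_tangent H Cl u') e' =
     cl_vec Cl (\row_a metric H u (e' a)) + c *: cl_vec Cl (\row_a metric H u' (e' a)).
    exact: (congr2 (fun X Y : Cl => X + c *: Y) (cl_tangentE Cl u ue') (cl_tangentE Cl u' ue')).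
  by rewrite E linearD linearZ /= !parity_map_vec scalerN opprD.
have [r [p [q [f [g [fg ->]]]]]] := hdec s; have [r' [p' [q' [f' [g' [fg' ->]]]]]] := hdec t.
rewrite (opR_odd_dec (pt ci) fg) -scaleNr (opR_odd_dec (pt (- ci)) fg') scaleNr.
have hh := vmetric_is_hmetric hD hFp hFm uT hT hhup hhdn.
have vm (a : SM x) (b : SP x) (a' : SM x) (b' : SP x) : hV (vten a b) (vten a' b') = hdn a a' * hup b b'.
  have := vmetric_dec hD sP sM hmd hmu (fun _ : 'I_1 => a) (fun _ : 'I_1 => b)
    (fun _ : 'I_1 => a') (fun _ : 'I_1 => b').
  by rewrite !big_ord1.
rewrite !(hmetric_suml hh) -big_split big1// => i _ /=.
rewrite !(hmetric_sumr hh) -big_split big1// => j _ /=.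
rewrite (hmetricZl hh) (hmetricZr hh) !vm.
have [pn _ gi _] := fg i; have [pn' _ gj _] := fg' j.
(* For equal degrees the two signs agree and skewness on the second factor applies; otherwise the
   first factors are orthogonal. *)
have [pp|pp] := eqVneq (p i) (p' j).
  rewrite pp rmorphXn rmorphN1 -mulrDr -mulrDr.
  by rewrite (complex_tangent_skew hFp hhup ue) !mulr0.
rewrite (spinor_grade_orthogonal hFm hhdn ue gi gj) ?mul0r ?mulr0 ?addr0//.
by apply: contraNneq pp => E; rewrite -(subKn pn) E subKn.
Qed.

End Operations.

(** * The isometry between forms and V-spinors *)

Section FormsAsSpinors.
Context {R : realType} {n : nat} {M : manifold R n.*2}.
Context (H : hermitian_structure M) (D : conn (M := M)) (hD : is_chern H D).
Context (Cl : clifford R n.*2) (kappa : spin_module Cl).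
Local Notation C := R[i].
Local Notation Mat := 'M[R[i]]_(2 ^ n).
Local Notation N := n.*2.
Local Notation fV := (@mx_findim R (2 ^ n) (2 ^ n)).
Context (Fp Fm : 'M[C]_n -> Cl * C).
Context (hFp : is_spinc_lift true Fp) (hFm : is_spinc_lift false Fm).
Context (T : Mat) (uT : T \in unitmx)
  (hT : forall v, kappa (cl_vec Cl v) *m T = T *m (kappa (cl_vec Cl v))^T).
Local Notation SM := (spinorB H kappa Fm).
Local Notation SP := (spinorB H kappa Fp).
Local Notation VM := (vspinorB H kappa Fp Fm).
Local Notation DV := (@vspinor_cov R n M H D Cl kappa Fp Fm).
Context (psi0 : forall x : M, SP x) (phi0 : forall x : M, SM x).
Context (hup : forall x : M, SP x -> SP x -> C) (hdn : forall x : M, SM x -> SM x -> C).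
Context (hhup : is_spinor_metric D 0 psi0 hup) (hhdn : is_spinor_metric D n phi0 hdn).
Local Notation hV := (vspinor_metric hdn hup).
Local Notation xi := (xi kappa T).
Implicit Types (x : M) (A B : {set 'I_N}).

Let sP := spinor_smooth_urep hD uT hT hFp (s0_smooth hhup) (s0_neq0 hhup).
Let sM := spinor_smooth_urep hD uT hT hFm (s0_smooth hhdn) (s0_neq0 hhdn).
Local Notation sV := (vspinor_smooth_urep (M := M) uT hT hFp hFm).
Local Notation nf := (norm_factor T hup hdn).

(** The inverse square root of [norm_factor], a complex number that is real and positive. *)
Definition norm_scale x : C := ((Num.sqrt (complex.Re (nf x)))^-1)%:C.

Lemma norm_factor_real x : 0 < complex.Re (nf x) /\ nf x = (complex.Re (nf x))%:C.
Proof.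
have := norm_factor_gt0 hD hFp hFm uT hT hhup hhdn x; rewrite ltcE /= => /andP[/eqP i0 r0].
by split=> //; apply: complex_ext.
Qed.

Lemma norm_scale_neq0 x : norm_scale x != 0.
Proof.
have [r0 _] := norm_factor_real x.
by rewrite /norm_scale fmorph_eq0 invr_eq0 gt_eqF// sqrtr_gt0.
Qed.

Lemma norm_scale_sqr x : nf x * (norm_scale x * norm_scale x) = 1.
Proof.
have [r0 ->] := norm_factor_real x.
rewrite /norm_scale -!rmorphM -invfM -expr2 sqr_sqrtr ?ltW// divff ?rmorph1//.
by rewrite gt_eqF.
Qed.

Lemma norm_scale_smooth x : csmooth_at x norm_scale.
Proof.
have [e [ue _]] := parallel_uframe_exists hD x; have [r0 _] := norm_factor_real x.
apply: csmooth_real; apply: smooth_at_invsqrt => //.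
by have [] := norm_factor_smooth hD hFp hFm uT hT hhup hhdn ue.
Qed.

Lemma cder_norm_scale x (v : tangent x) : cder v norm_scale = 0.
Proof.
have [e [ue pe]] := parallel_uframe_exists hD x; have [r0 _] := norm_factor_real x.
have [sr _] := norm_factor_smooth hD hFp hFm uT hT hhup hhdn ue.
rewrite /norm_scale cder_real der_invsqrt0//.
have := cder_norm_factor hD hFp hFm uT hT hhup hhdn ue v pe.
by move/(congr1 (@complex.Re R)).
Qed.

Definition charge_blade A : Mat := T *m (kappa (blade Cl A))^T.

Lemma charge_blade_sum (y : {set 'I_N} -> C) :
  \sum_A y A *: charge_blade A = T *m (kappa (\sum_A y A *: blade Cl A))^T.
Proof.
rewrite kappa_sum linear_sum mulmx_sumr; apply: eq_bigr => A _.
by rewrite kappaZ linearZ scalemxAr.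
Qed.

Lemma xi_charge_blade (y : {set 'I_N} -> C) A : xi A (\sum_B y B *: charge_blade B) = y A.
Proof.
rewrite xiE charge_blade_sum cl_dualE /vspinor_symbol mulKmx// trmxK kappa_invK.
rewrite kappa_sum; under eq_bigr do rewrite kappaZ; exact: blade_coef.
Qed.

(** Forms to Clifford elements, then [w |-> T kappa(w)^T], then the normalisation that turns the
    orthogonal images of the blades into unit vectors. *)
Definition spinor_of_form x (al : extform x) : VM x := mk_assoc H (vspinor_rep kappa Fp Fm)
  (fun e => norm_scale x *: \sum_(A : {set 'I_N}) al [seq e a | a <- enum A] *: charge_blade A).

Lemma spinor_of_formE x (al : extform x) (e : frame x) : uframe H e ->
  (spinor_of_form al) e = norm_scale x *: \sum_(A : {set 'I_N}) al [seq e a | a <- enum A] *: charge_blade A.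
Proof.
apply: mk_assocE => e' A ue uA; rewrite linearZ; congr (_ *: _).
rewrite !charge_blade_sum; apply: (etrans (vspinor_act_charge uT hT hFp hFm _ uA)).
by rewrite quantization_equivariant.
Qed.

Lemma xi_spinor_of_form x (al : extform x) (e : frame x) A : uframe H e ->
  xi A ((spinor_of_form al) e) = norm_scale x * al [seq e a | a <- enum A].
Proof. by move=> ue; rewrite (spinor_of_formE _ ue) linearZ xi_charge_blade. Qed.

Lemma spinor_of_form_linear x a (al be : extform x) :
  spinor_of_form (a *: al + be) = a *: spinor_of_form al + spinor_of_form be.
Proof.
have [e ue] := uframe_exists hD x; apply: (assoc_ext (V := vspinor_rep kappa Fp Fm) ue).
apply: (etrans (spinor_of_formE _ ue)).
apply: (etrans _ (esym (congr2 (fun X Y : Mat => a *: X + Y)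
  (spinor_of_formE al ue) (spinor_of_formE be ue)))).
rewrite scalerA [a * _]mulrC -scalerA -scalerDr; congr (_ *: _).
rewrite scaler_sumr -big_split; apply: eq_bigr => A _ /=.
by rewrite scalerA -scalerDl.
Qed.

Lemma spinor_of_form_bij x : bijective (@spinor_of_form x).
Proof.
have [e ue] := uframe_exists hD x.
exists (fun t : VM x => \sum_A ((norm_scale x)^-1 * xi A (t e)) *: det_form H e A) => [al|t].
  rewrite [RHS](form_expand al ue); apply: eq_bigr => A _; congr (_ *: _).
  by rewrite xi_spinor_of_form// mulKf// norm_scale_neq0.
apply: (assoc_ext (V := vspinor_rep kappa Fp Fm) ue).
rewrite (spinor_of_formE _ ue) scaler_sumr -[RHS](xi_sum kappa uT) -charge_blade_sum.
apply: eq_bigr => A _; rewrite form_sumE scalerA; congr (_ *: _).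
under eq_bigr do rewrite (det_form_frame _ _ ue).
rewrite (bigD1 A isT) /= big1 => [|B BA]; last by rewrite (negPf BA) mulr0.
by rewrite addr0 eqxx mulr1 mulVKf// norm_scale_neq0.
Qed.

Lemma spinor_of_form_smooth x (al : forall y, extformB M y) : sec_smooth x al ->
  sec_smooth x (fun y => spinor_of_form (al y) : VM y).
Proof.
move=> sal; have [e [ue _]] := parallel_uframe_exists hD x.
apply/(assoc_smoothP sV _ ue).
apply: (vsmooth_ext (f := fun y => norm_scale y *:
  \sum_(A : {set 'I_N}) al y [seq frame_at e y a | a <- enum A] *: charge_blade A)).
  by apply: filterS ue.2 => y uy; rewrite [RHS](spinor_of_formE _ uy).
apply: (vsmoothZ (norm_scale_smooth x)); apply: vsmooth_sum => A _.
by apply: vsmoothZ; [exact: (form_coef_smooth ue sal)|exact: vsmooth_cst].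
Qed.

Lemma spinor_of_form_isometric x (e : frame x) (al be : extform x) : uframe H e ->
  hV (spinor_of_form al) (spinor_of_form be) = form_inner e al be.
Proof.
move=> ue; rewrite (vmetric_xi hD hFp hFm uT hT hhup hhdn _ _ ue) /form_inner mulr_sumr.
apply: eq_bigr => A _.
apply: (etrans (congr2 (fun a c : C => nf x * (a * Num.conj c))
  (xi_spinor_of_form al A ue) (xi_spinor_of_form be A ue))).
have kJ : Num.conj (norm_scale x) = norm_scale x by apply: complex_ext; rewrite /= ?oppr0.
have cM (a c : C) : Num.conj (a * c) = Num.conj a * Num.conj c := rmorphM _ a c.
by rewrite cM kJ mulrACA [LHS]mulrA norm_scale_sqr mul1r.
Qed.

(** In a frame parallel at [x] both sides differentiate the same components: the [charge_blade A]
    are constant matrices and [norm_scale] has derivative zero. *)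
Lemma spinor_of_form_parallel x (v : tangent x) (al : forall y, extformB M y) :
  sec_smooth x al ->
  DV v (fun y => spinor_of_form (al y)) = spinor_of_form (form_cov D v al).
Proof.
move=> sal; have [e [ue pe]] := parallel_uframe_exists hD x; have ux := uframe_near_at ue.
apply: (assoc_ext (V := vspinor_rep kappa Fp Fm) ux).
have sc A := form_coef_smooth ue sal (enum A).
have sA A : vsmooth_at x (fun y => al y [seq frame_at e y a | a <- enum A] *: charge_blade A).
  by apply: vsmoothZ; [exact: sc|exact: vsmooth_cst].
apply: (etrans (vspinor_covE hD sP sM v (spinor_of_form_smooth sal) ue pe)).
have sS : vsmooth_at x (fun y => \sum_(A : {set 'I_N}) al y [seq frame_at e y a | a <- enum A] *: charge_blade A).
  by apply: vsmooth_sum => A _; exact: sA.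
transitivity (vder fV v (fun y => norm_scale y *:
  \sum_(A : {set 'I_N}) al y [seq frame_at e y a | a <- enum A] *: charge_blade A)).
  symmetry; apply: vder_ext; first exact: (vsmoothZ (norm_scale_smooth x) sS).
  by apply: filterS ue.2 => y uy; rewrite [RHS](spinor_of_formE _ uy).
rewrite (vderZ fV v (norm_scale_smooth x) sS) cder_norm_scale scale0r add0r.
rewrite (spinor_of_formE _ ux); congr (_ *: _).
rewrite vder_sum => [|A _]; last exact: sA.
apply: eq_bigr => A _; rewrite (form_cov_frame hD v ue pe sal).
rewrite -(frame_derivative_word v ue sal).
by rewrite (vderZ fV v (sc A) (vsmooth_cst x (charge_blade A))) vder_cst scaler0 addr0.
Qed.

End FormsAsSpinors.

Theorem proposition4p3 (R : realType) (n : nat) (M : manifold R n.*2)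
  (H : hermitian_structure M) (D : conn (M := M)) (hD : is_chern H D)
  (Cl : clifford R n.*2) (kappa : spin_module Cl)
  (Fp Fm : 'M[R[i]]_n -> Cl * R[i])
  (hFp : is_spinc_lift true Fp) (hFm : is_spinc_lift false Fm)
  (psi0 : forall x : M, spinorB H kappa Fp x)
  (phi0 : forall x : M, spinorB H kappa Fm x)
  (hup : forall x : M, spinorB H kappa Fp x -> spinorB H kappa Fp x -> R[i])
  (hdn : forall x : M, spinorB H kappa Fm x -> spinorB H kappa Fm x -> R[i])
  (hhup : is_spinor_metric D 0 psi0 hup)
  (hhdn : is_spinor_metric D n phi0 hdn) :
  let VM := vspinorB H kappa Fp Fm in
  let hV := vspinor_metric hdn hup in
  let DV := @vspinor_cov R n M H D Cl kappa Fp Fm in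
  (is_chern_dirac (E := VM) D hV DV (@opL R n M H Cl kappa Fp Fm) /\
   is_chern_dirac (E := VM) D hV DV (@opR R n M H Cl kappa Fp Fm)) /\
  exists sg : forall x : M, extformB M x -> VM x,
    [/\ (forall x a (al be : extformB M x),
           sg x (a *: al + be) = a *: sg x al + sg x be),
        (forall x, bijective (sg x)),
        (forall x (al : forall y, extformB M y),
           sec_smooth x al -> sec_smooth x (fun y => sg y (al y))),
        (forall x (e : frame x) (al be : extformB M x), uframe H e ->
           hV x (sg x al) (sg x be) = form_inner e al be) &
        (forall x (v : tangent x) (al : forall y, extformB M y),
           sec_smooth x al ->
           DV x v (fun y => sg y (al y)) = sg x (form_cov D v al))].
Proof.
have [T [uT hT]] := charge_conjugation kappa; split.
  split; first exact: (opL_chern_dirac hD hFp hFm uT hT hhup hhdn).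
  exact: (opR_chern_dirac hD hFp hFm uT hT hhup hhdn).
exists (@spinor_of_form _ _ _ H _ kappa Fp Fm T hup hdn); split.
- exact: (spinor_of_form_linear hD hFp hFm uT hT).
- exact: (spinor_of_form_bij hD hFp hFm uT hT hhup hhdn).
- exact: (spinor_of_form_smooth hD hFp hFm uT hT hhup hhdn).
- exact: (spinor_of_form_isometric hD hFp hFm uT hT hhup hhdn).
- exact: (spinor_of_form_parallel hD hFp hFm uT hT hhup hhdn).
Qed.
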